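(* Let $\Delta$ be a rational pointed fan in $N_{\mathbb R}$, let $X\subset Y_\Delta$ be a closed subscheme, and let $T$ be the dense torus in $Y_\Delta$. Assume that $X\cap T$ is equidimensional of dimension $d$. Let $(\xi_i)_{i\in\mathbb N}$ be a sequence in $S_{\mathrm{Trop}}(X)$ which is contained in $(X\cap T)^{\mathrm{an}}$ and which converges to a point $\xi\in(X\cap O(\sigma))^{\mathrm{an}}$ for some torus orbit $O(\sigma)\subset Y_\Delta$. Put $\omega_i=\mathrm{trop}(\xi_i)\in N_{\mathbb R}$ and $\omega=\mathrm{trop}(\xi)\in N_{\mathbb R}(\sigma)$. If there exists a polyhedron $P\subset\mathrm{Trop}(X)\cap N_{\mathbb R}$ of dimension $d$ which contains all $\omega_i$ and is relevant for all $\xi_i$, and such that $\pi_\sigma(P)$ is $d$-maximal at $\omega$, then $\xi\in S_{\mathrm{Trop}}(X)$ and $\dim_\xi(X_\omega)=d(\omega)$.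
   Context: $K$ is a field complete with respect to a (possibly trivial) non-Archimedean valuation $v\colon K\to\mathbb R\cup\{\infty\}$, with $|\cdot|=\exp(-v(\cdot))$, value group $\Gamma=v(K^\times)$ and residue field $\widetilde K$. A valued extension field $K'\supset K$ is a complete non-Archimedean field whose valuation restricts to that of $K$. $M\cong\mathbb Z^n$, $N=\mathrm{Hom}(M,\mathbb Z)$, $N_{\mathbb R}=N\otimes\mathbb R$, $T=\mathrm{Spec}(K[M])$ with characters $\chi^u$, $u\in M$. A pointed rational fan $\Delta$ in $N_{\mathbb R}$ defines the toric variety $Y_\Delta$ over $K$ with dense torus $T$; as a set $Y_\Delta=\bigsqcup_{\sigma\in\Delta}O(\sigma)$ with torus orbits $O(\sigma)=\mathrm{Spec}(K[\sigma^\perp\cap M])$. Put $N(\sigma)=N/(\langle\sigma\rangle\cap N)$ and $N_{\mathbb R}(\sigma)=N_{\mathbb R}/\langle\sigma\rangle$, where $\langle\sigma\rangle$ is the linear span; $\pi_\sigma\colon N_{\mathbb R}\to N_{\mathbb R}(\sigma)$ is the projection. Tropicalization: $\overline N{}^\Delta_{\mathbb R}=\bigsqcup_{\sigma\in\Delta}N_{\mathbb R}(\sigma)$ is the Kajiwara--Payne partial compactification of $N_{\mathbb R}$, glued from the open pieces $\mathrm{Hom}(\sigma^\vee\cap M,\mathbb R\cup\{\infty\})$ (monoid homomorphisms, topology of pointwise convergence), where for a face $\tau\prec\sigma$ a point $\omega\in N_{\mathbb R}(\tau)$ is the homomorphism $u\mapsto\langle u,\omega\rangle$ if $u\in\tau^\perp$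 and $u\mapsto\infty$ otherwise. $Y^{\mathrm{an}}$ denotes Berkovich analytification. The continuous map $\mathrm{trop}\colon Y_\Delta^{\mathrm{an}}\to\overline N{}^\Delta_{\mathbb R}$ is given by $\langle u,\mathrm{trop}(\xi)\rangle=-\log|\chi^u(\xi)|$. For a closed subscheme $X\subset Y_\Delta$, $\mathrm{Trop}(X)=\mathrm{trop}(X^{\mathrm{an}})$, and for $\omega\in\mathrm{Trop}(X)\cap N_{\mathbb R}(\sigma)$, $X_\omega=\mathrm{trop}^{-1}(\omega)\cap X^{\mathrm{an}}$, an affinoid domain in $(X\cap O(\sigma))^{\mathrm{an}}$. The Shilov boundary $B(\mathscr M(\mathcal A))$ of an affinoid space is the (finite) smallest subset on which every $|f|$, $f\in\mathcal A$, attains its maximum. The tropical skeleton is $S_{\mathrm{Trop}}(X)=\{\xi\in X^{\mathrm{an}}\mid\xi\in B(X_{\mathrm{trop}(\xi)})\}$. $\dim_\xi$ denotes the local dimension of an analytic space at $\xi$. Local dimension and $d$-maximality: for $\omega\in\mathrm{Trop}(X)\cap N_{\mathbb R}(\sigma)$, $d(\omega)$ is the dimension of the local cone $\mathrm{LC}_\omega(\mathrm{Trop}(X))=\{\eta\in N_{\mathbb R}(\sigma)\mid\omega+t\eta\in\mathrm{Trop}(X)\text{ for all sufficiently small }t\ge0\}$. A polyhedron $P\subset\mathrm{Trop}(X)\cap N_{\mathbb R}(\sigma)$ is $d$-maximal at $\omega$ if $\omega\in P$ and $\dim(P)=d(\omega)$. Relevance. (1) Suppose first that $v$ is non-trivial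 and that $\omega\in N(\sigma)\otimes\Gamma$. Let $U_\omega=\mathrm{trop}^{-1}(\omega)\subset O(\sigma)^{\mathrm{an}}$, with affinoid algebra $K\langle U_\omega\rangle=\{\sum_u a_u\chi^u\mid v(a_u)+\langle u,\omega\rangle\to\infty\}$ ($u\in\sigma^\perp\cap M$), let $K\langle U_\omega\rangle^\circ$ be the subring of series with all $v(a_u)+\langle u,\omega\rangle\ge0$, and let $\mathfrak a_\omega$ be the ideal of $X_\omega$ in $K\langle U_\omega\rangle$. The initial degeneration $\mathrm{in}_\omega(X)$ is the special fiber over $\widetilde K$ of $\mathrm{Spf}\big(K\langle U_\omega\rangle^\circ/(\mathfrak a_\omega\cap K\langle U_\omega\rangle^\circ)\big)$; it is a closed subscheme of $\mathrm{Spec}$ of the special fiber of $K\langle U_\omega\rangle^\circ$, a torus over $\widetilde K$ with cocharacter lattice $N(\sigma)$. For a strictly affinoid algebra $\mathcal A$, let $\mathcal A^\circ$ be the power-bounded elements, $\mathcal A^{\circ\circ}$ the topologically nilpotent ones, and $\widetilde{\mathscr M(\mathcal A)}=\mathrm{Spec}(\mathcal A^\circ/\mathcal A^{\circ\circ})$ the canonical reduction, with reduction map $\mathrm{red}$; Shilov boundary points are exactly the points reducing to generic points of the canonical reduction. There is a canonical finite surjective morphism $\iota\colon\widetilde X_\omega\to\mathrm{in}_\omega(X)$. For a Shilov boundary point $\xi$ of $X_\omega$, $\iota(\mathrm{red}(\xi))$ is the generic point of an irreducible component $Z$ of $\mathrm{in}_\omega(X)$. A polyhedron $P\subset\mathrm{Trop}(X)\cap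 N_{\mathbb R}(\sigma)$ is relevant for $\xi$ if $\omega\in P$ and $P\subset\mathrm{Trop}(Z)+\omega$, where $\mathrm{Trop}(Z)\subset N_{\mathbb R}(\sigma)$ is formed with respect to the trivial valuation on $\widetilde K$. (2) In general, choose a valued extension field $K'\supset K$ with non-trivial value group $\Gamma'$ such that $\omega\in N(\sigma)\otimes\Gamma'$, put $X'=X_{K'}$; then $P$ is relevant for $\xi\in B(X_\omega)$ if there is $\xi'\in B(X'_\omega)$ mapping to $\xi$ under the structural map such that $P$ is relevant for $\xi'$ in the sense of (1). This does not depend on the choice of $K'$. *)

(* Defs.v *)
From HB Require Import structures.
From mathcomp Require Import all_boot all_order all_algebra.
From mathcomp Require Import finmap generic_quotient ring_quotient.
From mathcomp Require Import all_classical all_reals topology function_spaces.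
From mathcomp Require Import ereal sequences exp.

Set Implicit Arguments.
Unset Strict Implicit.
Unset Printing Implicit Defensive.

Import Order.TTheory GRing.Theory Num.Theory numFieldTopology.Exports.

Local Open Scope classical_set_scope.
Local Open Scope quotient_scope.
Local Open Scope ring_scope.

(* Complete valuations with values in R and infinity. *)
Record valuation (R : realType) (K : fieldType) := Valuation {
  val_fun :> K -> \bar R;
  val_neqNy : forall x, (val_fun x != -oo)%E;
  val_eqy : forall x, (val_fun x == +oo%E) = (x == 0);
  valM : forall x y, val_fun (x * y) = (val_fun x + val_fun y)%E;
  valD : forall x y, (Order.min (val_fun x) (val_fun y) <= val_fun (x + y)%R)%E;
  val_complete : forall s : nat -> K,
    (forall C : R, exists N : nat, forall i j : nat, (N <= i)%N -> (N <= j)%N ->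
      (C%:E <= val_fun (s i - s j)%R)%E) ->
    exists l : K, forall C : R, exists N : nat, forall i : nat, (N <= i)%N ->
      (C%:E <= val_fun (s i - l)%R)%E }.

Section Valuation.
Context {R : realType} {K : fieldType} (v : valuation R K).
Implicit Types (x y : K) (C : R).

Definition absv x : R := fine (expeR (- v x))%E.

Definition value_group : set R := [set r | exists2 x, x != 0 & v x = r%:E].

Definition nontrivially_valued : Prop := exists2 x, x != 0 & v x != 0%E.

Lemma val0 : v 0 = +oo%E.
Proof. by apply/eqP; rewrite val_eqy. Qed.

Lemma val_fin x : x != 0 -> exists r, v x = r%:E.
Proof.
rewrite -(val_eqy v); have := val_neqNy v x.
by case: (v x) => [r _ _|//|//]; exists r.
Qed.

Lemma val1 : v 1 = 0%E.
Proof.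
have [r vr] := val_fin (oner_neq0 K).
have := valM v 1 1; rewrite mulr1 vr -EFinD => -[/eqP].
by rewrite -subr_eq subrr => /eqP <-.
Qed.

Lemma valN x : v (- x) = v x.
Proof.
have n1 : (-1 : K) != 0 by rewrite oppr_eq0 oner_eq0.
have [r vr] := val_fin n1.
have := valM v (-1) (-1); rewrite mulrNN mulr1 val1 vr -EFinD => -[/esym/eqP].
rewrite -mulr2n mulrn_eq0 /= => /eqP r0.
by rewrite -mulN1r valM vr r0 add0e.
Qed.

Lemma valD_ge C x y : (C%:E <= v x)%E -> (C%:E <= v y)%E -> (C%:E <= v (x + y)%R)%E.
Proof.
by move=> Cx Cy; apply: le_trans (valD v x y); rewrite le_min Cx Cy.
Qed.

Lemma valB_ge C x y : (C%:E <= v x)%E -> (C%:E <= v y)%E -> (C%:E <= v (x - y)%R)%E.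
Proof. by move=> Cx Cy; apply: valD_ge => //; rewrite valN. Qed.

Lemma val_sum_ge (I : Type) (s : seq I) (P : pred I) (F : I -> K) C :
  (forall i, P i -> (C%:E <= v (F i))%E) -> (C%:E <= v (\sum_(i <- s | P i) F i)%R)%E.
Proof.
move=> CF; elim/big_ind: _ => //; first by rewrite val0 leey.
exact: valD_ge.
Qed.

Lemma val_all x : (forall C, (C%:E <= v x)%E) -> x = 0.
Proof.
move=> h; apply/eqP; rewrite -(val_eqy v); have := h; have := val_neqNy v x.
case: (v x) => // r _ /(_ (r + 1)); rewrite lee_fin.
by rewrite gerDl ler10.
Qed.

Lemma val_eq x y : (forall C, (C%:E <= v (x - y)%R)%E) -> x = y.
Proof. by move=> /val_all/eqP; rewrite subr_eq0 => /eqP. Qed.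

(* Null families, i.e. families tending to 0 along the cofinite filter, and
   their unconditional sums. *)
Definition null_family (I : Type) (F : I -> K) : Prop :=
  forall C, finite_set [set i | (v (F i) < C%:E)%E].

Definition family_sum (I : choiceType) (F : I -> K) : K :=
  xget 0 [set l | forall C, exists S0 : {fset I},
    forall S : {fset I}, fsubset S0 S -> (C%:E <= v (l - \sum_(i <- S) F i)%R)%E].

Section Sum.
Context {I : choiceType}.
Implicit Types (F G : I -> K) (S : {fset I}).

Definition big_part F C : {fset I} := fset_set [set i | (v (F i) < C%:E)%E].

Lemma in_big_part F C i : null_family F -> (i \in big_part F C) = (v (F i) < C%:E)%E.
Proof. by move=> nF; rewrite in_fset_set ?mem_setE //; exact: nF. Qed.

Lemma sum_incl F C S S' : null_family F -> fsubset (big_part F C) S -> fsubset S S' ->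
  (C%:E <= v (\sum_(i <- S') F i - \sum_(i <- S) F i)%R)%E.
Proof.
move=> nF /fsubsetP ES /fsubsetP SS'.
rewrite (big_fsetID _ (mem S)) /=.
have -> : [fset x in S' | x \in S]%fset = S.
  by apply/fsetP => x; rewrite !inE; case: (boolP (x \in S)) => [/SS' ->|]; rewrite ?andbF.
rewrite addrAC subrr add0r big_seq; apply: val_sum_ge => i; rewrite !inE => /andP[_ iS].
by rewrite leNgt -in_big_part //; apply: contra iS => /ES.
Qed.

Lemma sum_incl2 F C S S' : null_family F ->
  fsubset (big_part F C) S -> fsubset (big_part F C) S' ->
  (C%:E <= v (\sum_(i <- S') F i - \sum_(i <- S) F i)%R)%E.
Proof.
move=> nF ES ES'.
rewrite -[X in v X](subrKA (\sum_(i <- big_part F C) F i)).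
apply: valD_ge; first exact: sum_incl.
by rewrite -opprB valN; apply: sum_incl.
Qed.

Lemma family_sumP F C S : null_family F -> fsubset (big_part F C) S ->
  (C%:E <= v (family_sum F - \sum_(i <- S) F i)%R)%E.
Proof.
move=> nF ES; rewrite /family_sum; case: xgetP => [l _ /(_ C)[S0 hS0]|].
  rewrite -[X in v X](subrKA (\sum_(i <- (S0 `|` S)%fset) F i)).
  by apply: valD_ge; [exact: hS0 (fsubsetUl _ _)|exact: sum_incl (fsubsetUr _ _)].
pose s m := \sum_(i <- big_part F m%:R) F i.
have mono C1 C2 : C1 <= C2 -> fsubset (big_part F C1) (big_part F C2).
  move=> CC; apply/fsubsetP => i; rewrite !in_big_part // => /lt_le_trans; apply.
  by rewrite lee_fin.
have [C1|l hl] := @val_complete _ _ v s.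
  exists (Num.truncn C1).+1 => i j Ni Nj; apply: (@le_trans _ _ (((Num.truncn C1).+1)%:R : R)%:E).
    by rewrite lee_fin ltW // Num.Theory.truncnS_gt.
  by apply: sum_incl2 => //; apply: mono; rewrite ler_nat.
move=> /(_ l); case => C1; have [N hN] := hl C1.
pose m := maxn N (Num.truncn C1).+1.
exists (big_part F m%:R) => S' mS'; rewrite -[X in v X](subrKA (s m)).
apply: valD_ge; first by rewrite -opprB valN; apply: hN; exact: leq_maxl.
rewrite -opprB valN; apply: (@le_trans _ _ (m%:R : R)%:E); last exact: sum_incl.
rewrite lee_fin (le_trans (ltW (Num.Theory.truncnS_gt _))) // ler_nat; exact: leq_maxr.
Qed.

Lemma family_sum_uniq F l : null_family F ->
  (forall C, exists2 S, fsubset (big_part F C) S & (C%:E <= v (l - \sum_(i <- S) F i)%R)%E) ->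
  family_sum F = l.
Proof.
move=> nF h; apply: val_eq => C; have [S ES lS] := h C.
rewrite -[X in v X](subrKA (\sum_(i <- S) F i)); apply: valD_ge.
  exact: family_sumP.
by rewrite -opprB valN.
Qed.

Lemma null_familyD F G : null_family F -> null_family G -> null_family (fun i => F i + G i).
Proof.
move=> nF nG C; have : finite_set ([set i | (v (F i) < C%:E)%E] `|` [set i | (v (G i) < C%:E)%E]).
  by rewrite finite_setU; split.
apply: sub_finite_set => i /= FG.
have [Ci|] := leP C%:E (v (F i)); last by left.
have [Di|] := leP C%:E (v (G i)); last by right.
by move: FG; rewrite ltNge (valD_ge Ci Di).
Qed.

Lemma family_sumD F G : null_family F -> null_family G ->
  family_sum (fun i => F i + G i) = family_sum F + family_sum G.
Proof.
move=> nF nG; apply: family_sum_uniq; first exact: null_familyD.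
move=> C; exists (big_part F C `|` big_part G C)%fset.
  apply/fsubsetP => i; rewrite inE !in_big_part //; last exact: null_familyD.
  by move=> FG; apply: contraLR FG; rewrite negb_or -!leNgt => /andP[]; exact: valD_ge.
rewrite big_split /= opprD addrACA; apply: valD_ge; apply: family_sumP => //.
  exact: fsubsetUl.
exact: fsubsetUr.
Qed.

Lemma val_mul_ge C r x y : v x = r%:E -> ((C - r)%:E <= v y)%E -> (C%:E <= v (x * y)%R)%E.
Proof. by move=> vx; rewrite valM vx EFinB leeBlDr // addeC. Qed.

Lemma null_familyZ c F : null_family F -> null_family (fun i => c * F i).
Proof.
move=> nF C; have [->|/val_fin[r vc]] := eqVneq c 0.
  rewrite [X in finite_set X](_ : _ = set0) //; apply/seteqP; split => // i /=.
  by rewrite mul0r val0.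
apply: sub_finite_set (nF (C - r)) => i /=; rewrite !ltNge; apply: contra.
exact: val_mul_ge.
Qed.

Lemma family_sumZ c F : null_family F -> family_sum (fun i => c * F i) = c * family_sum F.
Proof.
move=> nF; apply: family_sum_uniq; first exact: null_familyZ.
move=> C; have [c0|/val_fin[r vc]] := eqVneq c 0.
  exists (big_part (fun i => c * F i) C) => //.
  by rewrite big1 ?c0 ?mul0r ?subr0 ?val0 ?leey // => i _; rewrite mul0r.
exists (big_part F (C - r)).
  apply/fsubsetP => i; rewrite !in_big_part //; last exact: null_familyZ.
  by rewrite !ltNge; apply: contra; exact: val_mul_ge.
rewrite -mulr_sumr -mulrBr; apply: (val_mul_ge vc); exact: family_sumP.
Qed.

Lemma family_sum_ge F C : (forall i, (C%:E <= v (F i))%E) -> null_family F ->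
  (C%:E <= v (family_sum F))%E.
Proof.
move=> CF nF; have := @family_sumP F C fset0 nF; rewrite big_seq_fset0 subr0; apply.
by apply/fsubsetP => i; rewrite in_big_part // ltNge CF.
Qed.

Lemma null_single F i0 : (forall i, i != i0 -> F i = 0) -> null_family F.
Proof.
move=> F0 C; apply: sub_finite_set (finite_set1 i0) => i /=.
by apply: contraPP => /eqP/F0 ->; rewrite val0.
Qed.

Lemma family_sum1 F i0 : (forall i, i != i0 -> F i = 0) -> family_sum F = F i0.
Proof.
move=> F0; apply: family_sum_uniq; first exact: null_single F0.
move=> C; exists [fset i0]%fset; last by rewrite big_seq_fset1 subrr val0 leey.
apply/fsubsetP => i; rewrite in_big_part ?inE; last exact: null_single F0.
by apply: contraTT => /F0 ->; rewrite val0.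
Qed.

End Sum.

Lemma null_comp (I J : Type) (e : I -> J) (F : J -> K) : injective e ->
  null_family F -> null_family (F \o e).
Proof. by move=> ei nF C; apply: finite_preimage (nF C) => ? ? _ _ /ei. Qed.

Lemma family_sum_inj (I J : choiceType) (e : I -> J) (F : J -> K) : injective e ->
  null_family F -> (forall j, ~ range e j -> F j = 0) ->
  family_sum F = family_sum (F \o e).
Proof.
move=> ei nF F0; have nFe := null_comp ei nF; apply: family_sum_uniq => // C.
exists (e @` big_part (F \o e) C)%fset; last first.
  rewrite big_imfset /=; last by move=> ? ? _ _ /ei.
  exact: family_sumP.
apply/fsubsetP => j; rewrite in_big_part // => Fj.
have [[i _ eij]|nj] := pselect (range e j); last by move: Fj; rewrite F0 // val0.
by rewrite -eij; apply: in_imfset; rewrite /= in_big_part //= eij.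
Qed.

Definition push (I J : choiceType) (h : I -> J) (F : I -> K) (j : J) : K :=
  family_sum (fun i => if h i == j then F i else 0).

Lemma null_if (I : Type) (P : pred I) (F : I -> K) :
  null_family F -> null_family (fun i => if P i then F i else 0).
Proof.
move=> nF C; apply: sub_finite_set (nF C) => i /=.
by case: ifP => // _; rewrite val0.
Qed.

Lemma null_push (I J : choiceType) (h : I -> J) (F : I -> K) :
  null_family F -> null_family (push h F).
Proof.
move=> nF C; apply: sub_finite_set (finite_image h (nF C)) => j /= pj.
apply: contrapT => nj; move: pj; rewrite ltNge => /negP; apply; apply: family_sum_ge.
  move=> i; case: eqP => [hij|_]; last by rewrite val0 leey.
  by rewrite leNgt; apply/negP => Fi; apply: nj; exists i.
exact: null_if.
Qed.

Lemma family_sum_push (I J : choiceType) (h : I -> J) (F : I -> K) :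
  null_family F -> family_sum (push h F) = family_sum F.
Proof.
move=> nF; apply: family_sum_uniq; first exact: null_push.
move=> C; pose E := big_part F C.
exists (h @` E)%fset.
  apply/fsubsetP => j; rewrite in_big_part; last exact: null_push.
  apply: contraTT => nj; rewrite -leNgt; apply: family_sum_ge; last exact: null_if.
  move=> i; case: eqP => [hij|_]; last by rewrite val0 leey.
  rewrite leNgt -in_big_part //; apply: contra nj => iE; rewrite -hij.
  exact: in_imfset.
have -> : \sum_(j <- (h @` E)%fset) push h F j =
   \sum_(i <- E) F i + \sum_(j <- (h @` E)%fset)
     (push h F j - \sum_(i <- E) (if h i == j then F i else 0)).
  rewrite sumrB [X in _ - X]exchange_big /= addrC -addrA -[LHS]addr0; congr (_ + _).
  apply/esym/eqP; rewrite addrC subr_eq0; apply/eqP/eq_big_seq => i iE.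
  rewrite (big_fsetD1 (h i)) /=; last exact: in_imfset.
  by rewrite eqxx big_seq big1 ?addr0 // => j; rewrite !inE eq_sym => /andP[/negPf ->].
rewrite opprD addrA; apply: valB_ge; first exact: family_sumP.
apply: val_sum_ge => j _; apply: family_sumP; first exact: null_if.
apply/fsubsetP => i; rewrite !in_big_part //; last exact: null_if.
by case: ifP => // _; rewrite val0.
Qed.

End Valuation.

Section WeightedFamilies.
Context {R : realType} {K : fieldType} (v : valuation R K).

Definition wnull (I : Type) (W : I -> R) (F : I -> K) : Prop :=
  forall C : R, finite_set [set i | (v (F i) + (W i)%:E < C%:E)%E].

Lemma wnull_bounded (I : choiceType) (W : I -> R) (F : I -> K) : wnull W F ->
  exists B : R, forall i, (B%:E <= v (F i) + (W i)%:E)%E.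
Proof.
move=> nF; pose E := fset_set [set i | (v (F i) + (W i)%:E < 0%:E)%E].
exists (- \sum_(i <- E) `|fine (v (F i) + (W i)%:E)%E|) => i.
have s0 P : 0 <= \sum_(i <- E | P i) `|fine (v (F i) + (W i)%:E)%E| by exact: sumr_ge0.
have [p0|n0] := leP 0%:E (v (F i) + (W i)%:E)%E.
  by apply: le_trans p0; rewrite lee_fin oppr_le0; exact: s0 xpredT.
have iE : i \in E by rewrite in_fset_set; [exact: mem_set|exact: nF].
rewrite (big_fsetD1 i) //=; move: n0; have := val_neqNy v (F i).
case: (v (F i)) => //= r _ _; rewrite -EFinD lee_fin.
rewrite opprD -[X in _ <= X]addr0 lerD //; first by rewrite lerNl -normrN ler_norm.
by rewrite oppr_le0 sumr_ge0.
Qed.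

Lemma wnull_tensor (I J : choiceType) (W : I -> R) (W' : J -> R) F G :
  wnull W F -> wnull W' G ->
  wnull (fun p : I * J => W p.1 + W' p.2) (fun p => F p.1 * G p.2).
Proof.
move=> nF nG C; have [B hB] := wnull_bounded nF; have [B' hB'] := wnull_bounded nG.
apply: sub_finite_set (finite_setX (nF (C - B')) (nG (C - B))) => -[i j] /= hC.
have E : (v (F i * G j)%R + (W i + W' j)%:E =
          (v (F i) + (W i)%:E) + (v (G j) + (W' j)%:E))%E.
  by rewrite valM EFinD addeACA.
rewrite E in hC; split; rewrite ltNge; apply/negP => h; move: hC; apply/negP; rewrite -leNgt.
  by have := leeD h (hB' j); rewrite -EFinD subrK.
by have := leeD (hB i) h; rewrite -EFinD addrC subrK.
Qed.

Lemma wnull_fiber (I : Type) (W : I -> R) F (P : pred I) (c : R) : wnull W F ->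
  (forall i, P i -> W i = c) -> null_family v (fun i => if P i then F i else 0).
Proof.
move=> nF Wc C; apply: sub_finite_set (nF (C + c)) => i /=.
by case: ifP => [/Wc -> h|_]; [rewrite EFinD lteD2rE|rewrite val0].
Qed.

Lemma wnull_push (I J : choiceType) (h : I -> J) (W : J -> R) F :
  wnull (fun i => W (h i)) F -> wnull W (push v h F).
Proof.
move=> nF C; apply: sub_finite_set (finite_image h (nF C)) => j /= pj.
apply: contrapT => nj; move: pj; rewrite ltNge => /negP; apply.
rewrite -leeBlDr // -EFinB; apply: family_sum_ge.
  move=> i; case: eqP => [hij|_]; last by rewrite val0 leey.
  rewrite leNgt; apply/negP => Fi; apply: nj; exists i => //=.
  by rewrite hij -lteBrDr.
by apply: (wnull_fiber (c := W j) nF) => i /eqP ->.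
Qed.

End WeightedFamilies.

Section Restricted.
Context {R : realType} {K : fieldType} (v : valuation R K).
Context {A : nmodType} (S : addrClosed A) (w : {additive A -> R}).

(* K<S, w>: the series of terms f u * chi^u, u in S, with v (f u) + w u tending to
   infinity. *)
Record restr := Restr {
  coef :> A -> K;
  coef_supp : forall u, u \notin S -> coef u = 0;
  coef_null : forall C : R, finite_set [set u | (v (coef u) + (w u)%:E < C%:E)%E] }.

HB.instance Definition _ := gen_eqMixin restr.
HB.instance Definition _ := gen_choiceMixin restr.

Implicit Types f g h : restr.

Lemma restr_eq f g : coef f =1 coef g -> f = g.
Proof.
case: f g => [f f1 f2] [g g1 g2] /= /funext fg; case: _ / fg in g1 g2 *.
by congr Restr; exact: Prop_irrelevance.
Qed.

Fact restr0_supp u : u \notin S -> 0 = 0 :> K. Proof. by []. Qed.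
Fact restr0_null : wnull v w (fun=> 0).
Proof.
by move=> C; rewrite [X in finite_set X](_ : _ = set0) //; apply/seteqP; split => // i /=; rewrite val0.
Qed.
Definition restr0 := Restr restr0_supp restr0_null.

Fact restr1_supp u : u \notin S -> (u == 0)%:R = 0 :> K.
Proof. by case: eqP => // -> /negP[]; exact: rpred0. Qed.
Fact wnull1 u0 (F : A -> K) : (forall u, u != u0 -> F u = 0) -> wnull v w F.
Proof.
move=> F0 C; apply: sub_finite_set (finite_set1 u0) => u /=.
by apply: contraPP => /eqP/F0 ->; rewrite val0.
Qed.
Fact restr1_null : wnull v w (fun u => (u == 0)%:R).
Proof. by apply: (wnull1 (u0 := 0)) => u /negPf ->. Qed.
Definition restr1 := Restr restr1_supp restr1_null.

Fact restrN_supp f u : u \notin S -> - f u = 0.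
Proof. by move=> /coef_supp ->; rewrite oppr0. Qed.
Fact restrN_null f : wnull v w (fun u => - f u).
Proof. by move=> C; under eq_set do rewrite valN; exact: coef_null. Qed.
Definition restrN f := Restr (@restrN_supp f) (@restrN_null f).

Fact restrD_supp f g u : u \notin S -> f u + g u = 0.
Proof. by move=> uS; rewrite !coef_supp ?addr0. Qed.
Fact restrD_null f g : wnull v w (fun u => f u + g u).
Proof.
move=> C; have : finite_set ([set u | (v (f u) + (w u)%:E < C%:E)%E] `|`
    [set u | (v (g u) + (w u)%:E < C%:E)%E]).
  by rewrite finite_setU; split; exact: coef_null.
apply: sub_finite_set => u /= fg.
have [fC|] := leP C%:E (v (f u) + (w u)%:E)%E; last by left.
have [gC|] := leP C%:E (v (g u) + (w u)%:E)%E; last by right.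
by move: fg; rewrite ltNge -leeBlDr // -EFinB valD_ge // EFinB leeBlDr.
Qed.
Definition restrD f g := Restr (@restrD_supp f g) (@restrD_null f g).

Definition tensor f g (p : A * A) : K := f p.1 * g p.2.

Lemma tensor_null f g : wnull v (fun p : A * A => w (p.1 + p.2)) (tensor f g).
Proof.
move=> C; under eq_set do rewrite raddfD.
exact: wnull_tensor (@coef_null f) (@coef_null g) C.
Qed.

Lemma tensor_fiber f g c :
  null_family v (fun p => if p.1 + p.2 == c then tensor f g p else 0).
Proof. by apply: (wnull_fiber (c := w c) (@tensor_null f g)) => p /eqP ->. Qed.

(* The coefficient of f * g at c is the sum of f a * g b over a + b = c. *)
Definition mul_coef f g : A -> K := push v (fun p : A * A => p.1 + p.2) (tensor f g).

Fact restrM_supp f g u : u \notin S -> mul_coef f g u = 0.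
Proof.
move=> uS; rewrite /mul_coef /push.
rewrite (family_sum1 v (i0 := (0, 0))); last first.
  move=> [a b] _; case: eqP => //= abu; rewrite /tensor /=.
  have [aS|/coef_supp ->] := boolP (a \in S); last by rewrite mul0r.
  have [bS|/coef_supp ->] := boolP (b \in S); last by rewrite mulr0.
  by move: uS; rewrite -abu rpredD.
by case: eqP => //= u0; move: uS; rewrite -u0 addr0 rpred0.
Qed.
Fact restrM_null f g : wnull v w (mul_coef f g).
Proof. exact: wnull_push (@tensor_null f g). Qed.
Definition restrM f g := Restr (@restrM_supp f g) (@restrM_null f g).

Fact restrDA : associative restrD.
Proof. by move=> f g h; apply: restr_eq => u; rewrite /= addrA. Qed.
Fact restrDC : commutative restrD.
Proof. by move=> f g; apply: restr_eq => u; rewrite /= addrC. Qed.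
Fact restr0D : left_id restr0 restrD.
Proof. by move=> f; apply: restr_eq => u; rewrite /= add0r. Qed.
Fact restrND : left_inverse restr0 restrN restrD.
Proof. by move=> f; apply: restr_eq => u; rewrite /= addNr. Qed.

HB.instance Definition _ := GRing.isZmodule.Build restr restrDA restrDC restr0D restrND.

Fact restrMC : commutative restrM.
Proof.
move=> f g; apply: restr_eq => c; rewrite /= /mul_coef /push.
rewrite (family_sum_inj (v := v) (e := fun p : A * A => (p.2, p.1))).
- by congr (family_sum _ _); apply/funext => p /=; rewrite addrC /tensor mulrC.
- by move=> [a b] [c' d] [-> ->].
- exact: tensor_fiber.
- by move=> [a b] []; exists (b, a).
Qed.

Fact restr1M : left_id restr1 restrM.
Proof.
move=> f; apply: restr_eq => c; rewrite /= /mul_coef /push.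
rewrite (family_sum1 v (i0 := (0, c))) /= /tensor /= ?add0r ?eqxx ?mul1r //.
move=> [a b]; rewrite xpair_eqE /=; have [->|a0] := eqVneq a 0.
  by rewrite add0r /= => /negPf ->.
by rewrite mul0r if_same.
Qed.

Fact restrMDl : left_distributive restrM restrD.
Proof.
move=> f g h; apply: restr_eq => c; rewrite /= /mul_coef /push.
rewrite -family_sumD; try exact: tensor_fiber.
congr (family_sum _ _); apply/funext => p; case: eqP => _; last by rewrite addr0.
by rewrite /tensor mulrDl.
Qed.

Definition tensor3 f g h (t : A * A * A) : K := f t.1.1 * g t.1.2 * h t.2.

Lemma tensor3_null f g h d :
  null_family v (fun t => if t.1.1 + t.1.2 + t.2 == d then tensor3 f g h t else 0).
Proof.
pose W (t : A * A * A) := w t.1.1 + w t.1.2 + w t.2.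
have n3 : wnull v W (tensor3 f g h).
  apply: (@wnull_tensor _ _ v _ _ (fun p : A * A => w p.1 + w p.2) w (tensor f g) h).
    exact: wnull_tensor (@coef_null f) (@coef_null g).
  exact: coef_null.
by apply: (wnull_fiber (c := w d) n3) => t /eqP <-; rewrite !raddfD.
Qed.

Lemma restrM3 f g h d : mul_coef (restrM f g) h d =
  family_sum v (fun t => if t.1.1 + t.1.2 + t.2 == d then tensor3 f g h t else 0).
Proof.
rewrite -(family_sum_push (fun t => (t.1.1 + t.1.2, t.2)) (@tensor3_null f g h d)).
rewrite {1}/mul_coef {1}/push; congr (family_sum _ _); apply/funext => -[x z] /=.
have [xz|xz] := eqVneq (x + z) d; last first.
  rewrite /push (family_sum1 v (i0 := (0, 0, 0))) /=.
    case: eqP => // -[x0 z0]; case: eqP => // h0; move: xz.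
    by rewrite -x0 -z0 h0 eqxx.
  move=> t _; case: eqP => // -[x0 z0]; case: eqP => // h0; move: xz.
  by rewrite -x0 -z0 h0 eqxx.
rewrite [LHS]/tensor /= mulrC /mul_coef {1}/push -family_sumZ; last exact: tensor_fiber.
rewrite /push [RHS](family_sum_inj (v := v) (e := fun p : A * A => (p, z))); first last.
- move=> [[a b] c] /= nr; case: eqP => // -[_ cz]; exfalso; apply: nr.
  by exists (a, b); rewrite // cz.
- exact: null_if (@tensor3_null f g h d).
- by move=> p q [].
congr (family_sum _ _); apply/funext => -[a b] /=.
rewrite xpair_eqE eqxx andbT; case: eqP => [->|_]; last by rewrite mulr0.
by rewrite xz eqxx /tensor /tensor3 /= mulrC.
Qed.

Fact restrMA : associative restrM.
Proof.
move=> f g h; rewrite [restrM f _]restrMC [restrM g h]restrMC.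
apply: restr_eq => d; rewrite /= !restrM3.
rewrite (family_sum_inj (v := v) (e := fun t : A * A * A => (t.2, t.1.2, t.1.1))).
- congr (family_sum _ _); apply/funext => t /=.
  have -> : t.2 + t.1.2 + t.1.1 = t.1.1 + t.1.2 + t.2 by rewrite addrC addrA addrAC.
  by case: ifP => // _; rewrite /tensor3 /= mulrC mulrA mulrAC.
- by move=> [[a b] c] [[a' b'] c'] /= [-> -> ->].
- exact: tensor3_null.
- by move=> [[a b] c] []; exists (c, b, a).
Qed.

Fact restr1_neq0 : restr1 != 0.
Proof.
apply/eqP => /(congr1 (fun f : restr => f 0)) /eqP.
by rewrite /= eqxx oner_eq0.
Qed.

HB.instance Definition _ :=
  GRing.Zmodule_isComNzRing.Build restr restrMA restrMC restr1M restrMDl restr1_neq0.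

End Restricted.

Section TrivialValuation.
Context (R : realType) (K : fieldType).

Definition trivial_val (x : K) : \bar R := if x == 0 then +oo%E else 0%E.

Fact trivial_neqNy x : (trivial_val x != -oo)%E.
Proof. by rewrite /trivial_val; case: (x == 0). Qed.
Fact trivial_eqy x : (trivial_val x == +oo%E) = (x == 0).
Proof. by rewrite /trivial_val; case: (x == 0). Qed.
Fact trivialM x y : trivial_val (x * y) = (trivial_val x + trivial_val y)%E.
Proof.
rewrite /trivial_val mulf_eq0.
by case: (x == 0); case: (y == 0); rewrite /= ?adde0 ?add0e.
Qed.
Fact trivialD x y :
  (Order.min (trivial_val x) (trivial_val y) <= trivial_val (x + y)%R)%E.
Proof.
rewrite {3}/trivial_val; case: eqP => [_|/eqP xy]; first exact: leey.
rewrite ge_min /trivial_val; have [x0|_] := eqVneq x 0; last by rewrite lexx.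
by move: xy; rewrite x0 add0r => /negPf ->; rewrite lexx orbT.
Qed.
Fact trivial_complete (s : nat -> K) :
  (forall C : R, exists N : nat, forall i j : nat, (N <= i)%N -> (N <= j)%N ->
    (C%:E <= trivial_val (s i - s j)%R)%E) ->
  exists l : K, forall C : R, exists N : nat, forall i : nat, (N <= i)%N ->
    (C%:E <= trivial_val (s i - l)%R)%E.
Proof.
move=> /(_ 1)[N hN]; exists (s N) => C; exists N => i Ni.
have := hN i N Ni (leqnn N); rewrite /trivial_val; case: ifP => _ => [_|]; first by rewrite leey.
by rewrite lee_fin ler10.
Qed.

Definition trivial_valuation : valuation R K :=
  Valuation trivial_neqNy trivial_eqy trivialM trivialD trivial_complete.

End TrivialValuation.

(* The monoid algebra K[S]: for the trivial valuation the null families are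
   the finitely supported ones, see laurent_finite. *)
Definition laurent (R : realType) (K : fieldType) (A : nmodType) (S : addrClosed A) :=
  restr (trivial_valuation R K) S (\0 : A -> R).

Lemma laurent_finite (R : realType) (K : fieldType) (A : nmodType) (S : addrClosed A)
    (f : laurent R K S) : finite_set [set u | f u != 0].
Proof.
apply: sub_finite_set (coef_null f 1) => u /= fu.
by rewrite /trivial_val (negPf fu) adde0 lte_fin ltr01.
Qed.

Section Maps.
Context {R : realType} {K : fieldType} (v : valuation R K).
Context {A : nmodType} (S : addrClosed A) (w : {additive A -> R}).

(* The monomial c * chi^u, or 0 when u is not in S. *)
Definition mono_coef (c : K) (u x : A) : K := if (x == u) && (x \in S) then c else 0.
Fact mono_supp c u x : x \notin S -> mono_coef c u x = 0.
Proof. by rewrite /mono_coef andbC => /negPf ->. Qed.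
Fact mono_null c u : wnull v w (mono_coef c u).
Proof. by apply: (wnull1 v w (u0 := u)) => x; rewrite /mono_coef => /negPf ->. Qed.
Definition mono c u : restr v S w := Restr (@mono_supp c u) (@mono_null c u).

Definition gauss_norm (f : restr v S w) : R :=
  sup (range (fun u => absv v (f u) * expR (- w u))).

End Maps.

Section Truncation.
Context {R : realType} {K : fieldType} {A : nmodType} (S S' : addrClosed A).

Definition trunc_coef (f : laurent R K S) (u : A) : K := if u \in S' then f u else 0.
Fact trunc_supp f u : u \notin S' -> trunc_coef f u = 0.
Proof. by rewrite /trunc_coef => /negPf ->. Qed.
Fact trunc_null f : wnull (trivial_valuation R K) (\0 : A -> R) (trunc_coef f).
Proof.
move=> C; apply: sub_finite_set (coef_null f C) => u /=; rewrite /trunc_coef.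
by case: ifP => // _; rewrite {1}/trivial_val eqxx.
Qed.

(* Keep the terms with exponent in S'. For S contained in S' this is the
   inclusion of K[S] in K[S']. *)
Definition trunc (f : laurent R K S) : laurent R K S' :=
  Restr (@trunc_supp f) (@trunc_null f).

End Truncation.

Section CommutativeAlgebra.
Context {R : realType} {B : comNzRingType}.
Implicit Types I P Q : set B.

Record is_ideal I : Prop := IsIdeal {
  ideal0 : I 0;
  idealD : forall x y, I x -> I y -> I (x + y);
  idealM : forall x y, I y -> I (x * y) }.

Definition gen_ideal (G : set B) : set B :=
  [set x | forall I, is_ideal I -> G `<=` I -> I x].

Record is_prime P : Prop := IsPrime {
  prime_ideal : is_ideal P;
  prime_proper : ~ P 1;
  primeM : forall x y, P (x * y) -> P x \/ P y }.

Record minimal_prime I P : Prop := MinimalPrime {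
  minimal_prime_prime : is_prime P;
  minimal_prime_sub : I `<=` P;
  minimal_prime_min : forall Q, is_prime Q -> I `<=` Q -> Q `<=` P -> Q = P }.

(* The Krull dimension of B / I, equal to -oo when I is the unit ideal. *)
Definition krull_dim I : \bar R :=
  ereal_sup [set (k%:R)%:E | k in [set k : nat | exists P_ : nat -> set B,
    (forall i, (i <= k)%N -> is_prime (P_ i) /\ I `<=` P_ i) /\
    (forall i, (i < k)%N -> P_ i `<` P_ i.+1)]].

Definition equidimensional I (d : nat) : Prop :=
  forall P, minimal_prime I P -> krull_dim P = (d%:R)%:E.

Record mult_seminorm (p : B -> R) : Prop := MultSeminorm {
  seminorm_ge0 : forall x, 0 <= p x;
  seminorm0 : p 0 = 0;
  seminorm1 : p 1 = 1;
  seminormM : forall x y, p (x * y) = p x * p y;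
  seminormD : forall x y, p (x + y) <= p x + p y }.

End CommutativeAlgebra.

Arguments equidimensional R {B} I d.

(* The image of J under the map induced by iota on coefficients, wherever it
   makes sense: K[S] -> K<S, w>, K[S] -> K'<S, w> and K<S, w> -> K'<S, w>. *)
Definition coef_image (R : realType) (K K' : fieldType) (iota : K -> K')
    (v : valuation R K) (v' : valuation R K') (A : nmodType) (S : addrClosed A)
    (w w' : {additive A -> R}) (J : set (restr v S w)) : set (restr v' S w') :=
  [set g : restr v' S w' | exists2 f, J f & forall u, g u = iota (f u)].
Arguments coef_image {R K K'} iota {v} v' {A S w} w' J _.

(* q is the composite of p with the map induced by iota on coefficients. *)
Definition restricts_to (R : realType) (K K' : fieldType) (iota : K -> K')
    (v : valuation R K) (v' : valuation R K') (A : nmodType) (S : addrClosed A)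
    (w w' : {additive A -> R}) (p : restr v' S w' -> R) (q : restr v S w -> R) : Prop :=
  forall (f : restr v S w) (g : restr v' S w'), (forall u, g u = iota (f u)) -> p g = q f.

Section Affinoid.
Context {R : realType} {K : fieldType} (v : valuation R K).
Context {A : nmodType} (S : addrClosed A) (w : {additive A -> R}).
Local Notation KU := (restr v S w).
Implicit Types (a J : set KU) (p : KU -> R).

(* The Berkovich spectrum of KU / a, as a subspace of KU -> R with the topology
   of pointwise convergence. *)
Definition spectrum a : set (KU -> R) :=
  [set p | mult_seminorm p /\ (exists C, forall f, p f <= C * gauss_norm f) /\
           forall f, a f -> p f = 0].

(* Closedness is essential: the points at which the |f| attain their maximum may
   be avoided by a boundary which is not closed. *)
Definition closed_boundary a (B : set (KU -> R)) : Prop :=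
  [/\ B `<=` spectrum a,
      exists2 C : set {ptws KU -> R}, closed C & B = spectrum a `&` C &
      forall f, exists2 p, B p & forall q, spectrum a q -> q f <= p f].

(* The smallest closed boundary. *)
Definition shilov_boundary a : set (KU -> R) :=
  [set p | forall B, closed_boundary a B -> B p].

(* The dimension of a K-affinoid algebra is the Krull dimension after a valued
   extension of scalars which makes it strictly affinoid. *)
Definition affinoid_dim a (e : \bar R) : Prop :=
  exists (L : fieldType) (vL : valuation R L) (iota : {rmorphism K -> L}),
    [/\ forall x, vL (iota x) = v x,
        nontrivially_valued vL,
        forall u, u \in S -> value_group vL (w u) &
        krull_dim (gen_ideal (coef_image iota vL w a)) = e].

(* The local dimension at p is the largest dimension of an irreducible
   component through p. *)
Definition local_dim a p (e : \bar R) : Prop :=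
  (exists P, [/\ minimal_prime a P, spectrum P p & affinoid_dim P e]) /\
  (forall P e', minimal_prime a P -> spectrum P p -> affinoid_dim P e' -> (e' <= e)%E).

Definition unit_ball_pred : {pred KU} := fun f => `[< forall u, (0 <= v (f u) + (w u)%:E)%E >].

Fact unit_ballP : subring_closed unit_ball_pred.
Proof.
have vge (f : KU) u : (0 <= v (f u) + (w u)%:E)%E = ((- w u)%:E <= v (f u))%E.
  by rewrite -leeBlDr // sub0e.
split.
- apply/asboolP => u; rewrite /=; case: eqP => [->|_].
    by rewrite val1 raddf0 adde0.
  by rewrite val0 leey.
- move=> f g /asboolP hf /asboolP hg; apply/asboolP => u; rewrite vge /=.
  by apply: valB_ge; rewrite -vge.
- move=> f g /asboolP hf /asboolP hg; apply/asboolP => u; rewrite vge /=.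
  apply: family_sum_ge; last exact: tensor_fiber.
  move=> -[x y] /=; case: eqP => [<-|_]; last by rewrite val0 leey.
  rewrite /tensor /= valM raddfD opprD EFinD.
  by apply: leeD; rewrite -vge.
Qed.
HB.instance Definition _ := GRing.isSubringClosed.Build KU unit_ball_pred unit_ballP.

Record unit_ball := UnitBall { ball_val : KU; ball_valP : ball_val \in unit_ball_pred }.
HB.instance Definition _ := [isSub for ball_val].
HB.instance Definition _ := [Choice of unit_ball by <:].
HB.instance Definition _ := [SubChoice_isSubComNzRing of unit_ball by <:].

(* The ideal of in_omega(X) = Spec((KU^0 / (a \cap KU^0)) \otimes residue field):
   closed subschemes of the special fiber of KU^0 are represented by ideals of KU^0
   containing the maximal ideal of K^0. *)
Definition init_ideal a : set unit_ball :=
  gen_ideal ([set b | a (val b)] `|`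
             [set b | exists2 c, (0 < v c)%E & val b = mono v S w c 0]).

(* The prime ideal of iota(red(p)): the inverse image under KU^0 -> (KU / a)^0 of
   the kernel of (KU / a)^0 -> (residue field of H(p)). *)
Definition iota_red p : set unit_ball := [set b | p (val b) < 1].

(* The tropicalization of the closed subscheme Z of the special fiber, with
   respect to the trivial valuation of the residue field. When
   v c + w u = 0, the class of c * chi^u is a character of weight u. *)
Definition trop_special (Z : set unit_ball) : set (A -> R) :=
  [set eta | exists q : unit_ball -> R,
    [/\ mult_seminorm q,
        forall b, Z b -> q b = 0,
        forall b c, v c = 0%E -> val b = mono v S w c 0 -> q b = 1 &
        forall b c u, u \in S -> (v c + (w u)%:E = 0)%E -> val b = mono v S w c u ->
          q b = expR (- eta u)]].

End Affinoid.

Section Polyhedra.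
Context {R : realType} {V : lmodType R}.
Implicit Types C P T : set V.

Definition polyhedron P : Prop :=
  exists (m : nat) (l : 'I_m -> {scalar V}) (c : 'I_m -> R),
    P = [set x | forall i, l i x <= c i].

Definition affinely_independent (k : nat) (x : 'I_k -> V) : Prop :=
  forall c : 'I_k -> R, \sum_i c i = 0 -> \sum_i c i *: x i = 0 -> forall i, c i = 0.

(* The dimension of the affine hull. *)
Definition aff_dim P : \bar R :=
  ereal_sup [set (k%:R)%:E | k in [set k : nat |
    exists2 x : 'I_k.+1 -> V, forall i, P (x i) & affinely_independent x]].

(* The dimension of a finite union of polyhedra. *)
Definition set_dim C : \bar R :=
  ereal_sup [set aff_dim P | P in [set P | polyhedron P /\ P `<=` C]].

Definition local_cone T (omega : V) : set V :=
  [set eta | exists2 eps : R, 0 < eps &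
    forall t, 0 <= t <= eps -> T (omega + t *: eta)].

Definition local_trop_dim T omega : \bar R := set_dim (local_cone T omega).

Definition d_maximal T P omega : Prop :=
  [/\ polyhedron P, P `<=` T, P omega & aff_dim P = local_trop_dim T omega].

Definition linear_span (s : set V) : {pred V} := fun x =>
  `[< forall U : set V, U 0 -> (forall a y z, U y -> U z -> U (a *: y + z)) ->
      s `<=` U -> U x >].

Fact linear_spanZD s a x y :
  x \in linear_span s -> y \in linear_span s -> a *: x + y \in linear_span s.
Proof.
move=> /asboolP hx /asboolP hy; apply/asboolP => U U0 Ul sU.
exact: Ul (hx U U0 Ul sU) (hy U U0 Ul sU).
Qed.
Fact linear_span0 s : 0 \in linear_span s.
Proof. by apply/asboolP => U. Qed.
Fact linear_span_zmod s : zmod_closed (linear_span s).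
Proof.
split; first exact: linear_span0.
move=> x y xs ys; rewrite addrC -scaleN1r; exact: linear_spanZD.
Qed.
HB.instance Definition _ s := GRing.isZmodClosed.Build V (linear_span s) (linear_span_zmod s).

(* The quotient of V by the linear span of s. *)
Definition quotient (s : set V) := Quotient.quot (linear_span s).
HB.instance Definition _ s := Choice.on (quotient s).
HB.instance Definition _ s := GRing.Zmodule.on (quotient s).
HB.instance Definition _ s := EqQuotient.on (quotient s).

Section Quotient.
Variable s : set V.

Definition quotient_proj (x : V) : quotient s := \pi_(quotient s) x.

Definition quotient_scale (a : R) (x : quotient s) : quotient s :=
  quotient_proj (a *: repr x).

Fact quotient_projE x y : (quotient_proj x == quotient_proj y) = (x - y \in linear_span s).
Proof. by rewrite Quotient.idealrBE. Qed.

Fact quotient_projK x : quotient_proj (repr x) = x.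
Proof. exact: reprK. Qed.

Fact repr_proj x : repr (quotient_proj x) - x \in linear_span s.
Proof. by rewrite -quotient_projE quotient_projK. Qed.

Fact quotient_projD x y : quotient_proj (x + y) = quotient_proj x + quotient_proj y.
Proof. by rewrite /quotient_proj !piE. Qed.

Fact quotient_projZ a x : quotient_proj (a *: x) = quotient_scale a (quotient_proj x).
Proof.
apply/esym/eqP; rewrite quotient_projE -scalerBr -[_ *: _]addr0.
by apply: linear_spanZD; [exact: repr_proj|exact: linear_span0].
Qed.

Fact quotient_scaleA a b x :
  quotient_scale a (quotient_scale b x) = quotient_scale (a * b) x.
Proof. by rewrite -(quotient_projK x) -!quotient_projZ scalerA. Qed.
Fact quotient_scale1 : left_id 1 quotient_scale.
Proof. by move=> x; rewrite -(quotient_projK x) -quotient_projZ scale1r. Qed.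
Fact quotient_scaleDr : right_distributive quotient_scale +%R.
Proof.
move=> a x y; rewrite -(quotient_projK x) -(quotient_projK y).
by rewrite -quotient_projD -!quotient_projZ -quotient_projD scalerDr.
Qed.
Fact quotient_scaleDl x : {morph quotient_scale^~ x : a b / a + b}.
Proof.
by move=> a b; rewrite -(quotient_projK x) -!quotient_projZ -quotient_projD scalerDl.
Qed.
HB.instance Definition _ := GRing.Zmodule_isLmodule.Build R (quotient s)
  quotient_scaleA quotient_scale1 quotient_scaleDr quotient_scaleDl.

End Quotient.
End Polyhedra.

Section Toric.
Context {R : realType} {n : nat}.
Local Notation NR := 'rV[R]_n.
Local Notation M := 'rV[int]_n.
Implicit Types (s t : set NR) (x : NR) (u : M).

(* The pairing of M_R with N_R, for M and N both identified with Z^n. *)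
Definition dot (y x : NR) : R := \sum_i y 0 i * x 0 i.

Definition pairing x u : R := dot (map_mx intr u) x.

Fact pairing_nmod x : nmod_morphism (pairing x).
Proof.
split; first by rewrite /pairing /dot big1 // => i _; rewrite !mxE mul0r.
move=> u u'; rewrite /pairing /dot -big_split /=; apply: eq_bigr => i _.
by rewrite !mxE rmorphD mulrDl.
Qed.
HB.instance Definition _ x := GRing.isNmodMorphism.Build M R (pairing x) (pairing_nmod x).

Definition rational_cone s : Prop :=
  exists (k : nat) (g : 'I_k -> M), s = [set x | exists2 c : 'I_k -> R,
    forall i, 0 <= c i & x = \sum_i c i *: map_mx intr (g i)].

Definition pointed s : Prop := forall x, s x -> s (- x) -> x = 0.

Definition face t s : Prop :=
  exists2 y : NR, forall x, s x -> 0 <= dot y x & t = [set x | s x /\ dot y x = 0].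

Fact pairing0 x : pairing x 0 = 0. Proof. exact: raddf0. Qed.
Fact pairingD x u u' : pairing x (u + u') = pairing x u + pairing x u'.
Proof. exact: raddfD. Qed.

(* sigma^perp \cap M *)
Definition perp s : {pred M} := fun u => `[< forall x, s x -> pairing x u = 0 >].
Fact perp_add s : GRing.addumagma_closed (perp s).
Proof.
split; first by apply/asboolP => x _; rewrite pairing0.
move=> u u' /asboolP hu /asboolP hu'; apply/asboolP => x sx.
by rewrite pairingD hu // hu' // addr0.
Qed.
HB.instance Definition _ s := GRing.isAddClosed.Build M (perp s) (perp_add s).

(* sigma^vee \cap M *)
Definition dual s : {pred M} := fun u => `[< forall x, s x -> 0 <= pairing x u >].
Fact dual_add s : GRing.addumagma_closed (dual s).
Proof.
split; first by apply/asboolP => x _; rewrite pairing0.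
move=> u u' /asboolP hu /asboolP hu'; apply/asboolP => x sx.
by rewrite pairingD addr_ge0 ?hu ?hu'.
Qed.
HB.instance Definition _ s := GRing.isAddClosed.Build M (dual s) (dual_add s).

(* The point x of N_R(sigma) = N_R / <sigma> as a weight on M. Only its values on
   sigma^perp matter, and they do not depend on the representative. *)
Definition weight s (x : quotient s) : M -> R := pairing (repr x).
HB.instance Definition _ s (x : quotient s) := GRing.Additive.on (weight x).

End Toric.

Record fan (R : realType) (n : nat) := Fan {
  cones : set (set 'rV[R]_n);
  fan_neq0 : cones !=set0;
  fan_finite : finite_set cones;
  fan_cone : forall s, cones s -> rational_cone s /\ pointed s;
  fan_face : forall s t, cones s -> face t s -> cones t;
  fan_cap : forall s t, cones s -> cones t -> face (s `&` t) s }.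

Section ToricVariety.
Context {R : realType} {K : fieldType} (v : valuation R K) {n : nat} (Delta : fan R n).
Local Notation NR := 'rV[R]_n.
Implicit Types (s t : set NR).

(* The points of the analytification of Y_Delta: multiplicative seminorms on the
   coordinate ring of some torus orbit, extending the absolute value of K. *)
Record toric_an := ToricAn {
  torus_orbit : set NR;
  orbit_cone : cones Delta torus_orbit;
  pt : laurent R K (perp torus_orbit) -> R;
  pt_seminorm : mult_seminorm pt;
  pt_abs : forall c, pt (mono _ _ _ c 0) = absv v c }.

Arguments pt _ _ : clear implicits.

HB.instance Definition _ := gen_eqMixin toric_an.
HB.instance Definition _ := gen_choiceMixin toric_an.

(* A point of U_sigma^an, i.e. a point of an orbit O(tau) with tau a face of sigma,
   as a seminorm on K[sigma^vee \cap M]. *)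
Definition chart s (xi : toric_an) (f : laurent R K (dual s)) : R :=
  pt xi (trunc (perp (torus_orbit xi)) f).

Arguments chart s xi f : clear implicits.

(* The topology glued from the topologies of pointwise convergence of the charts
   U_sigma^an. *)
Definition toric_open (W : set toric_an) : Prop :=
  forall s, cones Delta s -> exists2 O : set {ptws laurent R K (dual s) -> R}, open O &
    forall xi, face (torus_orbit xi) s -> W xi <-> O (chart s xi).

Fact toric_openT : toric_open setT.
Proof. by move=> s _; exists setT => //; exact: openT. Qed.

Fact toric_openI : setI_closed toric_open.
Proof.
move=> W W' oW oW' s Ds; have [O oO hO] := oW s Ds; have [O' oO' hO'] := oW' s Ds.
exists (O `&` O'); first exact: openI.
by move=> xi fxi; split=> -[]; [move=> /hO ? /hO' ?|move=> /hO ? /hO' ?]; split; auto.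
Qed.

Fact toric_open_bigU (I : Type) (W : I -> set toric_an) :
  (forall i, toric_open (W i)) -> toric_open (\bigcup_i W i).
Proof.
move=> oW s Ds.
have /choice[O hO] : forall i, exists O : set {ptws laurent R K (dual s) -> R},
  open O /\ forall xi, face (torus_orbit xi) s -> W i xi <-> O (chart s xi).
  by move=> i; have [O oO hO] := oW i s Ds; exists O.
exists (\bigcup_i O i); first by apply: bigcup_open => i _; have [] := hO i.
move=> xi fxi; split=> -[i _ hi]; exists i => //; have [_ /(_ xi fxi)[]] := hO i; auto.
Qed.

HB.instance Definition _ :=
  isOpenTopological.Build toric_an toric_openT toric_openI toric_open_bigU.

(* A closed subscheme of Y_Delta: ideals of the K[sigma^vee \cap M], sigma in
   Delta, which agree on the overlaps. *)
Record closed_subscheme := ClosedSubscheme {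
  ideal_of : forall s, set (laurent R K (dual s));
  ideal_ofP : forall s, cones Delta s -> is_ideal (@ideal_of s);
  ideal_of_face : forall s t, cones Delta s -> cones Delta t -> face t s ->
    @ideal_of t = gen_ideal (@trunc R K _ (dual s) (dual t) @` @ideal_of s) }.
Arguments ideal_of _ _ _ : clear implicits.

(* The Kajiwara-Payne space, stratified by the N_R(sigma). *)
Definition trop_space := {s : set NR & quotient s}.

Definition trop_pt (xi : toric_an) : quotient (torus_orbit xi) :=
  xget 0 [set x | forall u, u \in perp (torus_orbit xi) -> pt xi (mono _ _ _ 1 u) = expR (- weight x u)].

Definition trop (xi : toric_an) : trop_space := existT _ (torus_orbit xi) (trop_pt xi).

Variable X : closed_subscheme.

(* The ideal of X \cap O(sigma) in K[sigma^perp \cap M]. *)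
Definition orbit_ideal s : set (laurent R K (perp s)) :=
  @trunc R K _ (dual s) (perp s) @` ideal_of X s.
Arguments orbit_ideal s _ : clear implicits.

Definition an : set toric_an :=
  [set xi | forall f, orbit_ideal (torus_orbit xi) f -> pt xi f = 0].

Definition orbit_an s : set toric_an := [set xi | an xi /\ torus_orbit xi = s].

Definition trop_X : set trop_space := trop @` an.

(* Trop(X) \cap N_R(sigma) *)
Definition trop_X_at s : set (quotient s) := [set x | trop_X (existT _ s x)].
Arguments trop_X_at s _ : clear implicits.

(* The ideal of X'_omega in K'<U_omega>, for a field K' over K and omega in
   N_R(sigma). *)
Definition affinoid_ideal (K' : fieldType) (v' : valuation R K') (iota : K -> K')
    s (x : quotient s) : set (restr v' (perp s) (weight x)) :=
  gen_ideal (coef_image iota v' (weight x) (orbit_ideal s)).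
Arguments affinoid_ideal {K'} v' iota {s} x _.

(* A point p of the affinoid space X_omega is identified with a point xi of
   Y_Delta^an by restriction from K<U_omega> to K[sigma^perp \cap M]. *)
Definition trop_skeleton : set toric_an :=
  [set xi | an xi /\ exists2 p, shilov_boundary (affinoid_ideal v id (trop_pt xi)) p &
    restricts_to id p (pt xi)].

(* dim_xi(X_omega) = e with omega = trop(xi) *)
Definition fiber_dim (xi : toric_an) (e : \bar R) : Prop :=
  exists p, [/\ spectrum (affinoid_ideal v id (trop_pt xi)) p,
    restricts_to id p (pt xi) & local_dim (affinoid_ideal v id (trop_pt xi)) p e].

(* x lies in N(sigma) \otimes Gamma *)
Definition rational_point (K' : fieldType) (v' : valuation R K') s (x : quotient s) : Prop :=
  exists2 y : NR, forall i, value_group v' (y 0 i) & x = quotient_proj s y.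

(* Relevance for a non-trivially valued field K' and omega in N(sigma) \otimes Gamma'.
   Here Z is the prime ideal of the irreducible component of in_omega(X'). *)
Definition relevant_rational (K' : fieldType) (v' : valuation R K') (iota : K -> K')
    s (omega : quotient s) (p : restr v' (perp s) (weight omega) -> R)
    (P : set (quotient s)) : Prop :=
  P omega /\ exists2 Z, minimal_prime (init_ideal (affinoid_ideal v' iota omega)) Z &
    Z = iota_red p /\
    forall x, P x -> exists2 y, trop_special Z (weight y) & x = y + omega.

Definition relevant (xi : toric_an) (P : set (quotient (torus_orbit xi))) : Prop :=
  exists (K' : fieldType) (v' : valuation R K') (iota : {rmorphism K -> K'}),
    [/\ forall c, v' (iota c) = v c,
        nontrivially_valued v',
        rational_point v' (trop_pt xi) &
        exists p, [/\ shilov_boundary (affinoid_ideal v' iota (trop_pt xi)) p,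
          restricts_to iota p (pt xi) & relevant_rational iota p P]].

End ToricVariety.

Arguments closed_subscheme {R} K {n} Delta.
Arguments trop_X_at {R K} v {n Delta} X s _.
Arguments relevant {R K v n Delta} X xi P.
Arguments orbit_ideal {R K n Delta} X s _.

(* Main.v *)
Require Import Defs.
From HB Require Import structures.
From mathcomp Require Import all_boot all_order all_algebra.
From mathcomp Require Import finmap generic_quotient ring_quotient.
From mathcomp Require Import all_classical all_reals topology function_spaces.
From mathcomp Require Import ereal normedtype sequences exp.
From mathcomp Require derive.
From mathcomp Require Import zify ring lra.

Set Implicit Arguments.
Unset Strict Implicit.
Unset Printing Implicit Defensive.

Import Order.TTheory GRing.Theory Num.Theory numFieldTopology.Exports numFieldNormedType.Exports.

Local Open Scope classical_set_scope.
Local Open Scope ring_scope.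

(* Let T be a subgroup of M_sigma = sigma^perp \cap M with basis e, omega = trop(xi) and a the
   ideal of X_omega in K<U_omega>.

   Relevance makes xi_i a Gauss point on K[T] as soon as the forms in T are linearly independent
   on P: an f in K[T] losing norm at xi_i vanishes on the relevant component Z, so that, at every
   point of P, two of finitely many exponents of f have the same weight, which fails at a generic
   point of P. Letting i tend to infinity, xi is a Gauss point on K[T] as well.

   Start with T = M_sigma. A relation in K<T> modulo a becomes, after a change of basis, monic in
   one variable, so that Weierstrass division makes K<U_omega>/a finite over K<T'> with T' of rank
   one less; the directions of pi_sigma(P) remain independent on T' as long as
   rank T > dim pi_sigma(P). So T can be chosen with K<U_omega>/a finite over K<T>, no small
   relation in K<T> modulo a, and rank T >= dim pi_sigma(P) = d(omega).

   Conversely, absence of relations provides a point of X_omega which is a Gauss point on K[T].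
   Over it the ring is algebraic over K[T], so that moving the weight on T in all directions lifts
   to points of X \cap O(sigma), whose tropicalizations depend on the weight in a piecewise linear
   way: Trop(X) contains a polyhedron of dimension rank T at omega. Hence rank T = d(omega), and
   xi is a Gauss point on K[T].

   The points of X_omega over the Gauss point of K<T> are finitely many and pairwise incomparable.
   Weak approximation gives functions separating one of them from the others, and multiplying by
   elements of K<T> gives functions whose maximum is attained only near that point: they all lie
   in the Shilov boundary. The local dimension at them is rank T: chains of primes over an
   extension of K have length at most rank T, as each step costs one variable of K<T>, and a
   component through xi meets K<T> in 0. *)

(** * Multiplicative seminorms *)

(** The valuation may be trivial and [omega] need not be rational over the value group, so X_omega
    has no canonical reduction to argue with over K. Reductions enter only through the definition of
    relevance; everything else is done with Gauss norms and with multiplicative seminorms obtained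
    from Zorn's lemma.

    Weierstrass division of Laurent series needs units at both ends. The change of basis must
    therefore separate the dominant exponents in one variable, so that every coefficient is a single
    monomial, and it must do so without destroying the independence of the directions of P.

    Integral equations of characters have coefficients in K<T>, not in K[T]. That characters are
    algebraic over K[T] modulo the kernel of the point is a separate argument, [free_algebraic].

    Values of algebraic elements are slopes of Newton polygons, and slopes have to be chosen
    compatibly for all characters. One auxiliary monomial, whose value determines the others, does
    this in [germ_lift].

    For dimensions after extension of K, flatness of completed tensor products is replaced by
    approximation in orthogonal bases. *)

Section Berkovich.
Context {R : realType}.

Lemma geometric_lt (q e : R) : 0 <= q -> q < 1 -> 0 < e -> exists n, q ^+ n < e.
Proof.
move=> q0 q1 e0.
have h : q ^+ n @[n --> \oo] --> (0 : R) by apply: cvg_expr; rewrite ger0_norm.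
have [n _ hn] := proj1 (cvgrPdist_lt _ _) h e e0.
exists n; have := hn n (leqnn n); rewrite /= sub0r normrN ger0_norm //.
exact: exprn_ge0.
Qed.

Definition ultrametric (B : comNzRingType) (p : B -> R) : Prop :=
  forall x y, p (x + y) <= Num.max (p x) (p y).

Record submult (B : comNzRingType) (N : B -> R) : Prop := Submult {
  submult_ge0 : forall x, 0 <= N x;
  submult0 : N 0 = 0;
  submultN : forall x, N (- x) = N x;
  submultD : ultrametric N;
  submultM : forall x y, N (x * y) <= N x * N y }.

Lemma ultrametric_sum (B : comNzRingType) (N : B -> R) (I : Type) (s : seq I) (P : pred I) F c :
  N 0 = 0 -> ultrametric N -> 0 <= c -> (forall i, P i -> N (F i) <= c) ->
  N (\sum_(i <- s | P i) F i) <= c.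
Proof.
move=> N0 NU c0 Fc; elim/big_ind: _ => //; first by rewrite N0.
by move=> x y xc yc; rewrite (le_trans (NU _ _)) // ge_max xc yc.
Qed.

Lemma ultrametricMn (B : comNzRingType) (N : B -> R) x k :
  0 <= N x -> N 0 = 0 -> ultrametric N -> N (x *+ k) <= N x.
Proof.
move=> x0 N0 NU; elim: k => [|k IH]; first by rewrite mulr0n N0.
by rewrite mulrS (le_trans (NU _ _)) // ge_max lexx.
Qed.

Variables (B : comNzRingType) (S : set B) (c : B -> R).
Hypotheses (S1 : S 1) (SM : forall s t, S s -> S t -> S (s * t)).
Hypotheses (c_gt0 : forall s, S s -> 0 < c s) (cM : forall s t, S s -> S t -> c (s * t) = c s * c t).

Let SX s n : S s -> S (s ^+ n).
Proof. by move=> Ss; elim: n => [|n IH]; rewrite ?expr0 // exprS; exact: SM. Qed.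
Let c1 : c 1 = 1.
Proof.
have := cM S1 S1; rewrite mulr1 => /eqP; rewrite -{1}[c 1]mulr1.
by rewrite (inj_eq (mulfI (lt0r_neq0 (c_gt0 S1)))) => /eqP.
Qed.
Let cX s n : S s -> c (s ^+ n) = c s ^+ n.
Proof. by move=> Ss; elim: n => [|n IH]; rewrite ?expr0 // !exprS cM ?IH //; exact: SX. Qed.

(** These are the submultiplicative norms below [N] that come from the localization of [B] at [S]
    and give each [s] the absolute value [c s]. *)
Record localized (N M : B -> R) : Prop := Localized {
  loc_sub : submult M;
  loc_le : forall x, M x <= N x;
  loc1 : M 1 = 1;
  locS : forall s x, S s -> M (s * x) = c s * M x }.

(** Spectral seminorm of the localization at [S]: a number is admissible for [x] if it bounds all
    powers of [x], up to a constant, once a denominator [t] from [S] is cleared. The lower bound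
    [c0] prevents [M 1] from dropping below 1. The last clause, about squares, is what makes a
    minimal seminorm power-multiplicative. *)
Lemma localize (N : B -> R) (c0 C0 : R) : submult N -> 0 < c0 ->
  (forall s, S s -> c0 * c s <= N s) -> (forall s, S s -> N s <= C0 * c s) ->
  exists2 M, localized N M &
    forall x (al : R), 0 < al -> N (x ^+ 2) <= al ^+ 2 -> M x <= al.
Proof.
move=> Nsub c0_gt0 cN NC; have [N0 NN0 NN NU NM] := Nsub.
pose adm x : set R := [set al | 0 <= al /\ exists C t, [/\ 0 <= C, S t &
  forall n, N ((t * x) ^+ n) <= C * (al * c t) ^+ n]].
have C00 : 0 <= C0 by have := le_trans (N0 1) (NC _ S1); rewrite c1 mulr1.
have adm_ge0 x al : adm x al -> 0 <= al by case.
have C0_ge1 : 0 <= Num.max C0 1 by rewrite le_max C00.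
have NX x n : N (x ^+ n) <= Num.max C0 1 * N x ^+ n.
  elim: n => [|n IH].
    by rewrite !expr0 mulr1 (le_trans (NC _ S1)) // c1 mulr1 le_max lexx.
  by rewrite !exprS mulrCA (le_trans (NM _ _)) // ler_wpM2l.
have admN x : adm x (N x).
  split=> //; exists (Num.max C0 1), 1; split=> // n.
  by rewrite mul1r c1 mulr1.
have hlb x : has_lbound (adm x) by exists 0 => al /adm_ge0.
have hinf x : has_inf (adm x) by split; [exists (N x)|].
pose M x := inf (adm x).
have Mle x al : adm x al -> M x <= al by move=> h; apply: ge_inf.
have Mge x b : (forall al, adm x al -> b <= al) -> b <= M x.
  by move=> h; apply: lb_le_inf; [exists (N x)|].
have Madm x e : M x < e -> exists2 al, adm x al & al < e.
  by move=> /(inf_lt (proj1 (hinf x))).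
have NtX t n : S t -> N (t ^+ n) <= C0 * c t ^+ n.
  by move=> St; rewrite (le_trans (NC _ (SX _ St))) // cX.
exists M; last first.
  move=> x al al0 hx; apply: Mle; split; first exact: ltW.
  exists (Num.max C0 1 * (1 + N x / al)), 1; split => //.
    by rewrite mulr_ge0 // addr_ge0 // divr_ge0 // ltW.
  move=> n; rewrite mul1r c1 mulr1 -{1}(odd_double_half n) exprD -muln2 mulnC exprM.
  have h1 : N ((x ^+ 2) ^+ n./2) <= Num.max C0 1 * (al ^+ 2) ^+ n./2.
    apply: le_trans (NX _ _) _; rewrite ler_wpM2l //.
    by rewrite lerXn2r // nnegrE ?N0 // exprn_ge0 // ltW.
  have a0 : 0 <= (al ^+ 2) ^+ n./2 by rewrite !exprn_ge0 // ltW.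
  case: (odd n) (odd_double_half n) => /= En.
    rewrite expr1 (le_trans (NM _ _)) // (le_trans (ler_wpM2l (N0 _) h1)) //.
    rewrite -{2}En -muln2 mulnC exprD exprM expr1; set a := (_ ^+ _ ^+ _) in a0 *.
    set K := Num.max C0 1 in C0_ge1 *.
    have -> : K * (1 + N x / al) * (al * a) = N x * (K * a) + K * al * a.
      by field; rewrite lt0r_neq0.
    by rewrite lerDl !mulr_ge0 // ltW.
  rewrite expr0 mul1r (le_trans h1) // -mulrA ler_wpM2l // -{2}En -muln2 add0n mulnC exprM.
  by rewrite mulrDl mul1r lerDl mulr_ge0 // divr_ge0 // ltW.
have Mge0 x : 0 <= M x by apply: Mge => al /adm_ge0.
have admM x y al be : adm x al -> adm y be -> adm (x * y) (al * be).
  move=> [al0 [C [t [hC St ht]]]] [be0 [C' [t' [hC' St' ht']]]]; split; first exact: mulr_ge0.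
  exists (C * C'), (t * t'); split; [exact: mulr_ge0|exact: SM|] => n.
  rewrite mulrACA exprMn (le_trans (NM _ _)) // (le_trans (ler_pM (N0 _) (N0 _) (ht _) (ht' _))) //.
  by rewrite cM // mulrACA -exprMn mulrACA.
have admD x y al be : adm x al -> adm y be -> adm (x + y) (Num.max al be).
  move=> [al0 [C [t [hC St ht]]]] [be0 [C' [t' [hC' St' ht']]]].
  have mx0 : 0 <= Num.max al be by rewrite le_max al0.
  split=> //; exists (C * C0 * (C' * C0)), (t * t'); split; [by rewrite !mulr_ge0|exact: SM|] => n.
  rewrite mulrDr exprDn; apply: ultrametric_sum => //.
    by rewrite !mulr_ge0 // exprn_ge0 // mulr_ge0 // ltW // c_gt0 //; exact: SM.
  move=> k _; apply: le_trans (ultrametricMn _ _ _ _) _ => //.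
  apply: le_trans (NM _ _) _.
  have -> : t * t' * x = t * x * t' by rewrite mulrAC.
  have -> : t * t' * y = t' * y * t by rewrite mulrC mulrA mulrAC [y * t']mulrC.
  rewrite (exprMn _ (t * x)) (exprMn _ (t' * y)).
  have tn0 := ltW (c_gt0 St); have t'n0 := ltW (c_gt0 St').
  have h1 : N ((t * x) ^+ (n - k) * t' ^+ (n - k)) <= C * C0 * (Num.max al be * c t * c t') ^+ (n - k).
    apply: le_trans (NM _ _) _; apply: le_trans (ler_pM (N0 _) (N0 _) (ht _) (NtX _ _ St')) _.
    rewrite mulrACA -exprMn ler_wpM2l ?mulr_ge0 // lerXn2r ?nnegrE ?mulr_ge0 //.
    by rewrite !ler_wpM2r // le_max lexx.
  have h2 : N ((t' * y) ^+ k * t ^+ k) <= C' * C0 * (Num.max al be * c t * c t') ^+ k.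
    apply: le_trans (NM _ _) _; apply: le_trans (ler_pM (N0 _) (N0 _) (ht' _) (NtX _ _ St)) _.
    rewrite mulrACA -exprMn ler_wpM2l ?mulr_ge0 // lerXn2r ?nnegrE ?mulr_ge0 //.
    by rewrite mulrAC !ler_wpM2r // le_max lexx orbT.
  have := ler_pM (N0 _) (N0 _) h1 h2; rewrite -!exprMn => /le_trans; apply.
  rewrite mulrACA -exprD subnK -1?ltnS // cM // !mulrA lexx //.
have MN x : M (- x) = M x.
  suff h y : M (- y) <= M y by apply/eqP; rewrite eq_le h -{1}(opprK x) h.
  apply: Mge => al [al0 [C [t [hC St ht]]]]; apply: Mle; split => //.
  exists C, t; split=> // n; rewrite mulrN exprNn -signr_odd; case: odd; rewrite /= ?mul1r //.
  by rewrite expr1 mulN1r NN.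
have M1 : M 1 = 1.
  apply/eqP; rewrite eq_le; apply/andP; split.
    apply: Mle; split => //; exists C0, 1; split => // n.
    by rewrite mul1r !expr1n c1 mulr1 expr1n mulr1 (le_trans (NC _ S1)) // c1 mulr1.
  apply: Mge => al [al0 [C [t [hC St ht]]]]; rewrite leNgt; apply/negP => al1.
  have h n : c0 <= C * al ^+ n.
    have cn : 0 < c t ^+ n by rewrite exprn_gt0 // c_gt0.
    rewrite -(ler_pM2r cn) -mulrA -exprMn -(cX _ St).
    by apply: le_trans (cN _ (SX _ St)) _; have := ht n; rewrite mulr1.
  have C1 : 0 < C + 1 by rewrite ltr_wpDl.
  have [n hn] : exists n, al ^+ n < c0 / (C + 1).
    by apply: geometric_lt => //; rewrite divr_gt0.
  have := h n; rewrite leNgt => /negP; apply.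
  apply: (@le_lt_trans _ _ ((C + 1) * al ^+ n)).
    by rewrite ler_wpM2r ?exprn_ge0 // lerDl.
  by rewrite mulrC -ltr_pdivlMr.
have MS s x : S s -> M (s * x) = c s * M x.
  move=> Ss; have cs := c_gt0 Ss; apply/eqP; rewrite eq_le; apply/andP; split.
    rewrite -ler_pdivrMl //; apply: Mge => al [al0 [C [t [hC St ht]]]].
    rewrite ler_pdivrMl //; apply: Mle; split; first by rewrite mulr_ge0 // ltW.
    exists (C * C0), t; split; [exact: mulr_ge0|exact: St|] => n.
    rewrite mulrCA mulrC [in leLHS]exprMn (le_trans (NM _ _)) //.
    apply: le_trans (ler_pM (N0 _) (N0 _) (ht _) (NtX _ _ Ss)) _.
    rewrite mulrACA -exprMn ler_wpM2l ?mulr_ge0 // le_eqVlt; apply/orP; left.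
    by apply/eqP; congr (_ ^+ _); rewrite mulrC mulrA.
  apply: Mge => al [al0 [C [t [hC St ht]]]]; rewrite -ler_pdivlMl //.
  apply: Mle; split; first by rewrite mulr_ge0 // invr_ge0 ltW.
  exists C, (t * s); split; [exact: hC|exact: SM|] => n.
  rewrite cM // -mulrA; apply: le_trans (ht n) _.
  have -> // : (c s)^-1 * al * (c t * c s) = al * c t by field; rewrite lt0r_neq0.
split => //.
split => //.
- by apply/eqP; rewrite eq_le Mge0 andbT -NN0; apply: Mle.
- move=> x y; rewrite leNgt; apply/negP; rewrite gt_max => /andP[].
  move=> /Madm[al hal xl] /Madm[be hbe yl].
  have := Mle _ _ (admD _ _ _ _ hal hbe); rewrite leNgt => /negP; apply.
  by rewrite gt_max xl yl.
- move=> x y; rewrite leNgt; apply/negP => h.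
  have [e e0 he] : exists2 e, 0 < e & (M x + e) * (M y + e) < M (x * y).
    pose d := M (x * y) - M x * M y; have d0 : 0 < d by rewrite subr_gt0.
    pose k := M x + M y + 1; have k0 : 0 < k by rewrite ltr_wpDl // addr_ge0.
    have := Mge0 x; have := Mge0 y => my mx.
    exists (Num.min 1 (d / (2 * k))); first by rewrite lt_min ltr01 divr_gt0 // mulr_gt0.
    set e := Num.min _ _; have e1 : e <= 1 by rewrite ge_min lexx.
    have e0 : 0 < e by rewrite lt_min ltr01 divr_gt0 // mulr_gt0.
    have ek : e * k <= d / 2.
      by rewrite -ler_pdivlMr // -mulrA -invfM ge_min lexx orbT.
    have -> : (M x + e) * (M y + e) = M x * M y + e * (M x + M y + e) by ring.
    have : e * (M x + M y + e) <= e * k by rewrite ler_pM2l // lerD2l.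
    by rewrite /d in d0 ek *; lra.
  have [|al [hal1 hal] hal2] := @Madm x (M x + e); first by rewrite ltrDl.
  have [|be [hbe1 hbe] hbe2] := @Madm y (M y + e); first by rewrite ltrDl.
  have := Mle _ _ (admM _ _ _ _ (conj hal1 hal) (conj hbe1 hbe)); rewrite leNgt => /negP; apply.
  by apply: le_lt_trans he; rewrite ler_pM // ltW.
- by move=> x; apply: Mle.
Qed.

End Berkovich.

Lemma localized_trans (R : realType) (B : comNzRingType) (S S' : set B) (c c' N M M' : B -> R) :
  localized S c N M -> localized S' c' M M' -> S `<=` S' -> (forall s, S s -> c' s = c s) ->
  localized S c N M'.
Proof.
move=> [sM MN M1 MS] [sM' MN' M1' MS'] SS cc; split => //.
  by move=> x; rewrite (le_trans (MN' _)).
by move=> s x Ss; rewrite MS' ?cc //; exact: SS.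
Qed.

(* A minimal M is power-multiplicative; localizing it along the powers of an element f shows
   that it is multiplicative at f. *)
Lemma localized_minimal (R : realType) (B : comNzRingType) (S : set B) (c N M0 : B -> R) :
  localized S c N M0 -> exists2 M, localized S c N M &
    forall M', localized S c N M' -> (forall x, M' x <= M x) -> M' = M.
Proof.
move=> LM0; pose T := {M | localized S c N M}.
pose r (M M' : T) := `[< forall x, sval M' x <= sval M x >].
have [| | |[M LM] Mmin] := @ZL_preorder T (exist _ M0 LM0) r.
- by move=> M; apply/asboolP => x.
- move=> M1 M2 M3 /asboolP h1 /asboolP h2; apply/asboolP => x.
  exact: le_trans (h2 x) (h1 x).
- move=> A totA; have [[M1 AM1]|/forallNP A0] := pselect (exists M, A M); last first.
    by exists (exist _ M0 LM0) => M /A0.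
  pose vals x : set R := [set sval M x | M in A].
  have hlb x : has_lbound (vals x).
    by exists 0 => _ [M AM <-]; case: (svalP M) => -[].
  have hinf x : has_inf (vals x) by split => //; exists (sval M1 x); exists M1.
  pose M x := inf (vals x).
  have Mle x M' : A M' -> M x <= sval M' x by move=> AM'; apply: ge_inf => //; exists M'.
  have Mge x b : (forall M', A M' -> b <= sval M' x) -> b <= M x.
    by move=> h; apply: lb_le_inf; [exists (sval M1 x), M1|move=> _ [M' AM' <-]; exact: h].
  have Mlt x e : M x < e -> exists2 M', A M' & sval M' x < e.
    by move=> /(inf_lt (proj1 (hinf x)))[_ [M' AM' <-]]; exists M'.
  have dir M' M'' : A M' -> A M'' -> exists M3 : T, [/\ A M3, forall x, sval M3 x <= sval M' x &
      forall x, sval M3 x <= sval M'' x].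
    by move=> a1 a2; have [/asboolP h|/asboolP h] := totA _ _ a1 a2; [exists M''|exists M'].
  have M_ge0 x : 0 <= M x by apply: Mge => M' _; case: (svalP M') => -[].
  have LM : localized S c N M.
    split; first split.
    + exact: M_ge0.
    + apply/eqP; rewrite eq_le M_ge0 andbT; apply: le_trans (Mle _ _ AM1) _.
      by case: (svalP M1) => -[_ ->].
    + by move=> x; congr (inf _); apply/seteqP; split => _ [M' AM' <-]; exists M' => //;
        case: (svalP M') => -[_ _ ->].
    + move=> x y; rewrite leNgt; apply/negP; rewrite gt_max => /andP[/Mlt[M' h1 h2] /Mlt[M'' h3 h4]].
      have [M3 [h5 h6 h7]] := dir _ _ h1 h3.
      have := Mle (x + y) _ h5; rewrite leNgt => /negP; apply.
      case: (svalP M3) => -[_ _ _ U _] _ _ _; apply: le_lt_trans (U _ _) _.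
      by rewrite gt_max (le_lt_trans (h6 _) h2) (le_lt_trans (h7 _) h4).
    + move=> x y; rewrite leNgt; apply/negP => h.
      have [u [v [xu yv uv]]] : exists u v, [/\ M x < u, M y < v & u * v <= M (x * y)].
        pose d := M (x * y) - M x * M y; have d0 : 0 < d by rewrite subr_gt0.
        pose k := M x + M y + 1; have k0 : 0 < k by rewrite ltr_wpDl // addr_ge0.
        pose e := Num.min 1 (d / k).
        have e0 : 0 < e by rewrite lt_min ltr01 divr_gt0.
        have e1 : e <= 1 by rewrite ge_min lexx.
        have ek : e * k <= d by rewrite -ler_pdivlMr // ge_min lexx orbT.
        exists (M x + e), (M y + e); rewrite !ltrDl; split => //.
        have -> : (M x + e) * (M y + e) = M x * M y + e * (M x + M y + e) by ring.
        have : e * (M x + M y + e) <= e * k by rewrite ler_pM2l // lerD2l.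
        by rewrite /d in d0 ek *; lra.
      have [M' h1 h2] := Mlt _ _ xu; have [M'' h3 h4] := Mlt _ _ yv.
      have [M3 [h5 h6 h7]] := dir _ _ h1 h3.
      have := le_lt_trans uv; have := Mle (x * y) _ h5 => h8 _.
      have := le_trans uv h8; rewrite leNgt => /negP; apply.
      case: (svalP M3) => -[p0 _ _ _ pM] _ _ _; apply: le_lt_trans (pM _ _) _.
      by rewrite ltr_pM ?p0 // ?(le_lt_trans (h6 _) h2) // (le_lt_trans (h7 _) h4).
    + by move=> x; apply: le_trans (Mle _ _ AM1) _; case: (svalP M1).
    + apply/eqP; rewrite eq_le; apply/andP; split.
        by apply: le_trans (Mle _ _ AM1) _; case: (svalP M1) => _ _ ->.
      by apply: Mge => M' _; case: (svalP M') => _ _ ->.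
    + move=> s x Ss; have cs : 0 <= c s.
        by case: (svalP M1) => -[p0 _ _ _ _] _ p1 pS; rewrite -[c s]mulr1 -p1 -pS.
      apply/eqP; rewrite eq_le; apply/andP; split.
        have [E|cs0] := eqVneq (c s) 0.
          rewrite E mul0r; apply: le_trans (Mle _ _ AM1) _.
          by case: (svalP M1) => _ _ _ -> //; rewrite E mul0r.
        have {}cs0 : 0 < c s by rewrite lt_def cs0.
        rewrite -ler_pdivrMl //; apply: Mge => M' AM'; rewrite ler_pdivrMl //.
        by apply: le_trans (Mle _ _ AM') _; case: (svalP M') => _ _ _ ->.
      apply: Mge => M' AM'; case: (svalP M') => _ _ _ -> //.
      by rewrite ler_wpM2l // Mle.
  exists (exist _ M LM) => M' AM'; apply/asboolP => x; exact: Mle.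
exists M => // M' LM' le; apply/funext => x; apply/eqP; rewrite eq_le le /=.
by have /asboolP := Mmin (exist _ M' LM') (asboolT le); exact.
Qed.

(** Berkovich's theorem that the spectrum is not empty, in a form that prescribes the values on a
    multiplicative set; [N] has to agree with [c] on [S] only up to bounded factors. *)
Theorem berkovich (R : realType) (B : comNzRingType) (S : set B) (c N : B -> R) (c0 C0 : R) :
  S 1 -> (forall s t, S s -> S t -> S (s * t)) ->
  (forall s, S s -> 0 < c s) -> (forall s t, S s -> S t -> c (s * t) = c s * c t) ->
  submult N -> 0 < c0 ->
  (forall s, S s -> c0 * c s <= N s) -> (forall s, S s -> N s <= C0 * c s) ->
  exists q, [/\ mult_seminorm q, ultrametric q, forall x, q x <= N x &
    forall s, S s -> q s = c s].
Proof.
move=> S1 SM c_gt0 cM Nsub c0_gt0 cN NC.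
have [M0 LM0 _] := localize S1 SM c_gt0 cM Nsub c0_gt0 cN NC.
have [M LM Mmin] := localized_minimal LM0.
have [[M_ge0 MZ MN MU MM] M_le M1 MS] := LM.
have Mc s : S s -> M s = c s by move=> Ss; rewrite -{1}[s]mulr1 MS // M1 mulr1.
(* Localizing [M] along the same [S] gives [M] back by minimality, so the clause of [localize] on
   squares applies to [M] itself. *)
have Msq x : M x ^+ 2 <= M (x ^+ 2).
  have [|||M' LM' hM'] := @localize R B S c S1 SM c_gt0 cM M 1 1 _ ltr01.
  - by [].
  - by move=> s Ss; rewrite mul1r Mc.
  - by move=> s Ss; rewrite mul1r Mc.
  have EM : M' = M.
    by apply: Mmin; [exact: localized_trans LM LM' _ _|case: LM'].
  rewrite leNgt; apply/negP => h; rewrite {}EM in hM'.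
  set al := (Num.sqrt (M (x ^+ 2)) + M x) / 2.
  have sq : Num.sqrt (M (x ^+ 2)) < M x.
    by rewrite -(ltr_pXn2r (n := 2)) ?nnegrE ?sqrtr_ge0 // sqr_sqrtr.
  have s0 := sqrtr_ge0 (M (x ^+ 2)).
  have al0 : 0 < al by rewrite /al; lra.
  have al1 : al < M x by rewrite /al; lra.
  suff /hM'-/(_ al0) : M (x ^+ 2) <= al ^+ 2 by rewrite leNgt al1.
  rewrite -[leLHS]sqr_sqrtr // lerXn2r ?nnegrE // ?ltW //; rewrite /al; lra.
have MX x n : M (x ^+ n) = M x ^+ n.
  have le k : M (x ^+ k) <= M x ^+ k.
    elim: k => [|k IH]; first by rewrite !expr0 M1.
    by rewrite !exprS (le_trans (MM _ _)) // ler_wpM2l.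
  have ge2 j : M x ^+ (2 ^ j) <= M (x ^+ (2 ^ j)).
    elim: j => [|j IH]; first by rewrite expn0 !expr1.
    rewrite expnSr !exprM (le_trans _ (Msq _)) // lerXn2r // nnegrE // exprn_ge0 //.
  apply/eqP; rewrite eq_le le /=.
  have [x0|x0] := eqVneq (M x) 0.
    by rewrite x0; case: n => [|n]; rewrite ?expr0 ?M1 // expr0n.
  have {}x0 : 0 < M x by rewrite lt_def x0 M_ge0.
  have nj : (n <= 2 ^ n)%N by rewrite ltnW // ltn_expl.
  have := ge2 n; rewrite -{1 2}(subnK nj) !exprD => h.
  have := le_trans h (MM _ _) => h2.
  have := le_trans h2 (ler_wpM2r (M_ge0 _) (le _)).
  by rewrite ler_pM2l // exprn_gt0.
exists M; split => //; split => //; last first.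
  by move=> x y; rewrite (le_trans (MU _ _)) // ge_max lerDl lerDr !M_ge0.
move=> f x; have [f0|f0] := eqVneq (M f) 0.
  by rewrite f0 mul0r; apply/eqP; rewrite eq_le M_ge0 andbT; have := MM f x; rewrite f0 mul0r.
have {}f0 : 0 < M f by rewrite lt_def f0 M_ge0.
pose S' : set B := [set y | exists2 s, S s & exists n, y = s * f ^+ n].
have MS' s n : S s -> M (s * f ^+ n) = c s * M f ^+ n by move=> Ss; rewrite MS // MX.
have [|||||||M' LM' _] := @localize R B S' M _ _ _ _ M 1 1 _ ltr01.
- by exists 1 => //; exists 0; rewrite mul1r.
- move=> _ _ [s Ss [n ->]] [t St [m ->]]; exists (s * t); first exact: SM.
  by exists (n + m)%N; rewrite exprD mulrACA.
- by move=> _ [s Ss [n ->]]; rewrite MS' // mulr_gt0 ?exprn_gt0 // c_gt0.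
- move=> _ _ [s Ss [n ->]] [t St [m ->]]; rewrite mulrACA -exprD !MS' //; last exact: SM.
  by rewrite cM // exprD mulrACA.
- by [].
- by move=> s _; rewrite mul1r.
- by move=> s _; rewrite mul1r.
have EM : M' = M.
  apply: Mmin; last by case: LM'.
  apply: localized_trans LM LM' _ _ => // s Ss.
  by exists s => //; exists 0%N; rewrite expr0 mulr1.
case: LM' => _ _ _ /(_ f x); rewrite EM; apply.
by exists 1 => //; exists 1%N; rewrite mul1r.
Qed.

Section Seminorms.
Context {R : realType} {B : comNzRingType}.
Implicit Types (p q : B -> R) (K : set B).

Definition ums p : Prop := mult_seminorm p /\ ultrametric p.

Lemma mult_seminormN p : mult_seminorm p -> forall x, p (- x) = p x.
Proof.
move=> [p0 _ p1 pM _] x; rewrite -mulN1r pM.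
suff -> : p (-1) = 1 by rewrite mul1r.
have := pM (-1) (-1); rewrite mulrNN mulr1 p1 => /esym/eqP.
by rewrite -expr2 sqrf_eq1 => /orP[/eqP //|/eqP h]; have := p0 (-1); rewrite h ler0N1.
Qed.

Lemma mult_seminormX p : mult_seminorm p -> forall x n, p (x ^+ n) = p x ^+ n.
Proof.
by move=> [_ _ p1 pM _] x; elim=> [|n IH]; rewrite ?expr0 ?p1 // !exprS pM IH.
Qed.

Lemma ums_submult p : ums p -> submult p.
Proof.
move=> [[p0 pz p1 pM pD] pU]; split => //; last by move=> x y; rewrite pM.
by apply: mult_seminormN.
Qed.

Lemma ultra_eq p x y : (forall x, p (- x) = p x) -> ultrametric p -> p y < p x -> p (x + y) = p x.
Proof.
move=> pN pU yx; apply/eqP; rewrite eq_le; apply/andP; split.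
  by apply: le_trans (pU _ _) _; rewrite ge_max lexx ltW.
have := pU (x + y) (- y); rewrite addrK pN le_max => /orP[//|].
by rewrite leNgt yx.
Qed.

Lemma berkovich_quot (K S : set B) (c N : B -> R) :
  is_ideal K -> S 1 -> (forall s t, S s -> S t -> S (s * t)) ->
  (forall s, S s -> 0 < c s) -> (forall s t, S s -> S t -> c (s * t) = c s * c t) ->
  submult N -> (forall s, S s -> N s <= c s) ->
  (forall s h, S s -> K (s - h) -> c s <= N h) ->
  exists q, [/\ ums q, forall x, q x <= N x, forall x, K x -> q x = 0 &
    forall s, S s -> q s = c s].
Proof.
move=> [K0 KD KM] S1 SM c_gt0 cM [N0 NZ NN NU NM] Nc key.
have KN x : K x -> K (- x) by move=> Kx; rewrite -mulN1r; exact: KM.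
have c1 : c 1 = 1.
  have := cM _ _ S1 S1; rewrite mulr1 => /eqP; rewrite -{1}[c 1]mulr1.
  by rewrite (inj_eq (mulfI (lt0r_neq0 (c_gt0 _ S1)))) => /eqP.
pose V x : set R := [set al | exists s h, [/\ S s, K (s * x - h) & al = N h / c s]].
have V0 x : V x (N x) by exists 1, x; rewrite mul1r subrr c1 divr1.
have Vge0 x al : V x al -> 0 <= al.
  by move=> [s [h [Ss _ ->]]]; rewrite divr_ge0 // ltW // c_gt0.
have hlb x : has_lbound (V x) by exists 0 => al /Vge0.
have hne x : V x !=set0 by exists (N x).
pose M x := inf (V x).
have Mle x al : V x al -> M x <= al by move=> h; apply: ge_inf.
have Mge x b : (forall al, V x al -> b <= al) -> b <= M x by move=> h; apply: lb_le_inf.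
have Mlt x e : M x < e -> exists s h, [/\ S s, K (s * x - h) & N h < e * c s].
  move=> /(inf_lt (hne x))[_ [s [h [Ss Kh ->]]] lt].
  by exists s, h; split => //; rewrite -ltr_pdivrMr // c_gt0.
have M0 x : 0 <= M x by apply: Mge => al /Vge0.
have MleN x : M x <= N x by apply: Mle.
have MK x : K x -> M x = 0.
  move=> Kx; apply/eqP; rewrite eq_le M0 andbT; apply: Mle.
  by exists 1, 0; rewrite mul1r subr0 NZ mul0r.
have [|||q [q1 q2 q3 q4]] := @berkovich R B S c M 1 1 S1 SM c_gt0 cM _ ltr01.
- split => //.
  + by apply: MK.
  + move=> x; suff h y : M (- y) <= M y by apply/eqP; rewrite eq_le h -{1}(opprK x) h.
    apply: Mge => al [s [h [Ss Kh ->]]]; apply: Mle; exists s, (- h); rewrite NN; split => //.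
    by rewrite mulrN -opprD; exact: KN.
  + move=> x y; rewrite leNgt; apply/negP; rewrite gt_max => /andP[/Mlt[s [h [Ss Kh hs]]]].
    move=> /Mlt[t [k [St Kk kt]]].
    have cs := c_gt0 _ Ss; have ct := c_gt0 _ St.
    suff : M (x + y) < M (x + y) by rewrite ltxx.
    apply: (@le_lt_trans _ _ (N (t * h + s * k) / c (s * t))).
      apply: Mle; exists (s * t), (t * h + s * k); split => //; first exact: SM.
      have -> : s * t * (x + y) - (t * h + s * k) = t * (s * x - h) + s * (t * y - k) by ring.
      by apply: KD; apply: KM.
    rewrite cM // ltr_pdivrMr ?mulr_gt0 //; apply: le_lt_trans (NU _ _) _.
    rewrite gt_max; apply/andP; split; apply: le_lt_trans (NM _ _) _.
      apply: (@le_lt_trans _ _ (c t * N h)); first by rewrite ler_wpM2r ?Nc.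
      by rewrite mulrA [ltRHS]mulrC ltr_pM2l.
    apply: (@le_lt_trans _ _ (c s * N k)); first by rewrite ler_wpM2r ?Nc.
    by rewrite mulrCA ltr_pM2l.
  + move=> x y; rewrite leNgt; apply/negP => h.
    have [u [v [xu yv uv]]] : exists u v, [/\ M x < u, M y < v & u * v <= M (x * y)].
      pose d := M (x * y) - M x * M y; have d0 : 0 < d by rewrite subr_gt0.
      pose k := M x + M y + 1; have k0 : 0 < k by rewrite ltr_wpDl // addr_ge0.
      pose e := Num.min 1 (d / k).
      have e0 : 0 < e by rewrite lt_min ltr01 divr_gt0.
      have e1 : e <= 1 by rewrite ge_min lexx.
      have ek : e * k <= d by rewrite -ler_pdivlMr // ge_min lexx orbT.
      exists (M x + e), (M y + e); rewrite !ltrDl; split => //.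
      have -> : (M x + e) * (M y + e) = M x * M y + e * (M x + M y + e) by ring.
      have : e * (M x + M y + e) <= e * k by rewrite ler_pM2l // lerD2l.
      by rewrite /d in d0 ek *; lra.
    have [s [a [Ss Ka hs]]] := Mlt _ _ xu; have [t [b [St Kb kt]]] := Mlt _ _ yv.
    have cs := c_gt0 _ Ss; have ct := c_gt0 _ St.
    suff : M (x * y) < u * v by rewrite ltNge uv.
    apply: (@le_lt_trans _ _ (N (a * b) / c (s * t))).
      apply: Mle; exists (s * t), (a * b); split => //; first exact: SM.
      have -> : s * t * (x * y) - a * b = (t * y) * (s * x - a) + a * (t * y - b) by ring.
      by apply: KD; apply: KM.
    rewrite cM // ltr_pdivrMr ?mulr_gt0 //; apply: le_lt_trans (NM _ _) _.
    by rewrite mulrACA ltr_pM.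
- move=> s Ss; rewrite mul1r; apply: Mge => al [t [h [St Kh ->]]].
  by rewrite ler_pdivlMr ?c_gt0 // mulrC -cM //; apply: key Kh; exact: SM.
- by move=> s Ss; rewrite mul1r (le_trans (MleN _)) // Nc.
exists q; split => // [x|x Kx]; first exact: le_trans (q3 _) (MleN _).
by apply/eqP; rewrite eq_le; case: q1 => -> *; rewrite andbT -(MK x Kx).
Qed.

End Seminorms.

(** * Gauss norms on polynomial rings and Newton polygons *)

Section PolyNorm.
Context {R : realType} {B : comNzRingType} (q : B -> R) (rho : R).
Hypotheses (hq : ums q) (rho0 : 0 < rho).
Implicit Types (f g h : {poly B}).

Definition term f i : R := q f`_i * rho ^+ i.
Definition pnorm f : R := \big[Num.max/0]_(i < size f) term f i.

Let q_ge0 x : 0 <= q x. Proof. by case: hq => -[]. Qed.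
Let q_0 : q 0 = 0. Proof. by case: hq => -[]. Qed.
Let qM x y : q (x * y) = q x * q y. Proof. by case: hq => -[]. Qed.
Let qN x : q (- x) = q x. Proof. by case: hq => h _; exact: mult_seminormN. Qed.
Let qU : ultrametric q. Proof. by case: hq. Qed.

Lemma term_ge0 f i : 0 <= term f i.
Proof. by rewrite mulr_ge0 // exprn_ge0 // ltW. Qed.

Lemma le_pnorm f i : term f i <= pnorm f.
Proof.
have [fi|fi] := ltnP i (size f).
  exact: (le_bigmax 0 (fun i : 'I_(size f) => term f i) (Ordinal fi)).
rewrite /term nth_default // q_0 mul0r; apply: bigmax_ge_id.
Qed.

Lemma pnorm_le f c : 0 <= c -> (forall i, term f i <= c) -> pnorm f <= c.
Proof. by move=> c0 fc; apply/bigmax_leP. Qed.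

Lemma pnorm_ge0 f : 0 <= pnorm f.
Proof. exact: le_trans (term_ge0 f 0) (le_pnorm f 0). Qed.

Lemma pnorm_attained f : exists i, term f i = pnorm f.
Proof.
have [//|/forallNP h] := pselect (exists i, term f i = pnorm f).
have lt i : term f i < pnorm f by rewrite lt_def le_pnorm andbT eq_sym; apply/eqP/h.
have [n0|n0] := eqVneq (pnorm f) 0.
  by have := lt 0; rewrite n0 ltNge term_ge0.
have {}n0 : 0 < pnorm f by rewrite lt_def n0 pnorm_ge0.
have : pnorm f < pnorm f by rewrite {1}/pnorm; apply/bigmax_ltP; split.
by rewrite ltxx.
Qed.

Lemma pnorm_submult0 : pnorm 0 = 0.
Proof. by rewrite /pnorm size_poly0 big_ord0. Qed.

Lemma pnormD f g : pnorm (f + g) <= Num.max (pnorm f) (pnorm g).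
Proof.
apply: pnorm_le => [|i]; first by rewrite le_max pnorm_ge0.
have r0 : 0 <= rho ^+ i by rewrite exprn_ge0 // ltW.
rewrite /term coefD; apply: le_trans (ler_wpM2r r0 (qU _ _)) _.
rewrite maxr_pMl // ge_max !le_max; apply/andP; split; first by rewrite le_pnorm.
by apply/orP; right; exact: le_pnorm.
Qed.

Lemma pnormN f : pnorm (- f) = pnorm f.
Proof. by rewrite /pnorm size_polyN; apply: eq_bigr => i _; rewrite /term coefN qN. Qed.

Lemma pnormM_le f g : pnorm (f * g) <= pnorm f * pnorm g.
Proof.
have fg0 : 0 <= pnorm f * pnorm g by rewrite mulr_ge0 ?pnorm_ge0.
have r0 n : 0 < rho ^+ n by rewrite exprn_gt0.
apply: pnorm_le => // i; rewrite /term coefM -ler_pdivlMr //.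
apply: ultrametric_sum => //; first by rewrite divr_ge0 // ltW.
move=> j _; have ij : (j <= i)%N by rewrite -ltnS.
rewrite qM (ler_pdivlMr _ _ (r0 i)) -[X in _ * rho ^+ X](subnKC ij) exprD mulrACA.
exact: (ler_pM (term_ge0 f j) (term_ge0 g (i - j)) (le_pnorm f j) (le_pnorm g (i - j))).
Qed.

Lemma term_dom f g i0 j0 :
  (forall i j, (i + j = i0 + j0)%N -> i != i0 -> term f i * term g j < term f i0 * term g j0) ->
  term (f * g) (i0 + j0) = term f i0 * term g j0.
Proof.
have r0 n : 0 < rho ^+ n by rewrite exprn_gt0.
move=> dom; rewrite /term coefM.
have hi : (i0 < (i0 + j0).+1)%N by rewrite ltnS leq_addr.
rewrite (bigD1 (Ordinal hi)) //= addKn.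
rewrite (_ : q (_ + _) = q (f`_i0 * g`_j0)); first by rewrite qM exprD mulrACA.
set T := \sum_(_ | _) _; have [t0|Tn0] := eqVneq (q T) 0.
  have [m0|m0] := eqVneq (q (f`_i0 * g`_j0)) 0.
    by apply/eqP; rewrite m0 eq_le q_ge0 andbT (le_trans (qU _ _)) // m0 t0 maxxx.
  by apply: ultra_eq => //; rewrite t0 lt_def m0 q_ge0.
apply: ultra_eq => //.
have [i [iP hle]] : exists i : 'I_(i0 + j0).+1, i != Ordinal hi /\ q T <= q (f`_i * g`_(i0 + j0 - i)).
  apply: contrapT => /forallNP h.
  suff : q T < q T by rewrite ltxx.
  have {}h i : i != Ordinal hi -> q (f`_i * g`_(i0 + j0 - i)) < q T.
    by move=> iP; rewrite ltNge; apply/negP => ?; apply: (h i).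
  rewrite {1}/T; have : 0 < q T by rewrite lt_def Tn0 q_ge0.
  elim/big_ind: _ => [|x y hx hy t0|i iP _]; [by rewrite q_0| |exact: h].
  by apply: le_lt_trans (qU _ _) _; rewrite gt_max hx ?hy.
apply: le_lt_trans hle _.
have ij : (i + (i0 + j0 - i) = i0 + j0)%N by rewrite subnKC // -ltnS.
have := dom _ _ ij iP; rewrite !qM /term mulrACA -exprD ij [ltRHS]mulrACA -exprD.
by rewrite (ltr_pM2r (r0 _)).
Qed.

Definition dominant f i := term f i == pnorm f.

Lemma min_dominant f : exists2 i, dominant f i & forall j, dominant f j -> (i <= j)%N.
Proof.
have h : exists i, dominant f i by have [i /eqP hi] := pnorm_attained f; exists i.
by exists (ex_minn h); case: ex_minnP.
Qed.

Lemma max_dominant f : 0 < pnorm f ->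
  exists2 i, dominant f i & forall j, dominant f j -> (j <= i)%N.
Proof.
move=> f0; have h : exists i, dominant f i by have [i /eqP hi] := pnorm_attained f; exists i.
have b i : dominant f i -> (i <= size f)%N.
  move=> /eqP fi; rewrite leqNgt; apply/negP => /ltnW si.
  by move: f0; rewrite -fi /term nth_default // q_0 mul0r ltxx.
by exists (ex_maxn h b); case: ex_maxnP.
Qed.

Lemma dominant_term f i : dominant f i = false -> term f i < pnorm f.
Proof. by move=> h; rewrite lt_def le_pnorm andbT eq_sym -/(dominant f i) h. Qed.

Lemma term_lt f g i j i0 j0 : 0 < pnorm f -> 0 < pnorm g -> dominant f i0 -> dominant g j0 ->
  ~~ dominant f i \/ ~~ dominant g j -> term f i * term g j < term f i0 * term g j0.
Proof.
move=> f0 g0 /eqP -> /eqP -> [/negbTE/dominant_term h|/negbTE/dominant_term h].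
  by apply: le_lt_trans (ler_wpM2l (term_ge0 _ _) (le_pnorm g j)) _; rewrite ltr_pM2r.
by apply: le_lt_trans (ler_wpM2r (term_ge0 _ _) (le_pnorm f i)) _; rewrite ltr_pM2l.
Qed.

(** Gauss's lemma: at the sum of the two lowest dominant indices only one product has maximal size,
    so nothing cancels. With the analogue for the highest indices, the dominant range of a product
    has the sum of the two lengths; [real_step] depends on this. *)
Lemma dominant_min_mul f g i0 j0 : 0 < pnorm f -> 0 < pnorm g -> dominant f i0 -> dominant g j0 ->
  (forall j, dominant f j -> (i0 <= j)%N) -> (forall j, dominant g j -> (j0 <= j)%N) ->
  term (f * g) (i0 + j0) = pnorm f * pnorm g.
Proof.
move=> f0 g0 df dg mf mg; rewrite term_dom; first by rewrite (eqP df) (eqP dg).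
move=> i j ij ii0; apply: term_lt => //.
have [di|_] := boolP (dominant f i); last by left.
have [dj|_] := boolP (dominant g j); last by right.
by have := mf _ di; have := mg _ dj; move: ii0 ij; lia.
Qed.

Lemma dominant_max_mul f g i0 j0 : 0 < pnorm f -> 0 < pnorm g -> dominant f i0 -> dominant g j0 ->
  (forall j, dominant f j -> (j <= i0)%N) -> (forall j, dominant g j -> (j <= j0)%N) ->
  term (f * g) (i0 + j0) = pnorm f * pnorm g.
Proof.
move=> f0 g0 df dg mf mg; rewrite term_dom; first by rewrite (eqP df) (eqP dg).
move=> i j ij ii0; apply: term_lt => //.
have [di|_] := boolP (dominant f i); last by left.
have [dj|_] := boolP (dominant g j); last by right.
by have := mf _ di; have := mg _ dj; move: ii0 ij; lia.
Qed.

Lemma pnormM f g : pnorm (f * g) = pnorm f * pnorm g.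
Proof.
have [f0|f0] := eqVneq (pnorm f) 0.
  apply/eqP; rewrite f0 mul0r eq_le pnorm_ge0 andbT (le_trans (pnormM_le _ _)) //.
  by rewrite f0 mul0r.
have [g0|g0] := eqVneq (pnorm g) 0.
  apply/eqP; rewrite g0 mulr0 eq_le pnorm_ge0 andbT (le_trans (pnormM_le _ _)) //.
  by rewrite g0 mulr0.
apply/eqP; rewrite eq_le pnormM_le /=.
have [i0 h1 h2] := min_dominant f; have [j0 h3 h4] := min_dominant g.
rewrite -(dominant_min_mul _ _ h1 h3 h2 h4) ?le_pnorm // lt_def ?f0 ?g0 pnorm_ge0 //.
Qed.

Lemma pnormC b : pnorm b%:P = q b.
Proof.
apply/eqP; rewrite eq_le; apply/andP; split.
  apply: pnorm_le => // i; rewrite /term coefC; case: eqP => [->|_]; first by rewrite mulr1.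
  by rewrite q_0 mul0r.
by have := le_pnorm b%:P 0; rewrite /term coefC mulr1.
Qed.

Lemma pnormX : pnorm 'X = rho.
Proof.
have q1 : q 1 = 1 by case: hq => -[].
apply/eqP; rewrite eq_le; apply/andP; split.
  apply: pnorm_le => [|i]; first exact: ltW.
  rewrite /term coefX; case: eqP => [->|_]; first by rewrite q1 mul1r.
  by rewrite q_0 mul0r ltW.
by have := le_pnorm 'X 1; rewrite /term coefX q1 mul1r.
Qed.

Lemma pnorm_ums : ums pnorm.
Proof.
have U : ultrametric pnorm by exact: pnormD.
split=> //; split.
- exact: pnorm_ge0.
- exact: pnorm_submult0.
- by rewrite pnormC; case: hq => -[].
- exact: pnormM.
- by move=> x y; rewrite (le_trans (U _ _)) // ge_max lerDl lerDr !pnorm_ge0.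
Qed.

(** The Newton polygon of [f] has an edge of slope given by [rho], so that [rho] is a possible
    absolute value of a root of [f]. *)
Definition two_dominant f : Prop :=
  0 < pnorm f /\ exists i j, [/\ (i < j)%N, dominant f i & dominant f j].

End PolyNorm.

Lemma ultra_sum_lt (R : realType) (B : comNzRingType) (p : B -> R) (I : Type) (s : seq I) (P : pred I) F c :
  ums p -> 0 < c -> (forall i, P i -> p (F i) < c) -> p (\sum_(i <- s | P i) F i) < c.
Proof.
move=> [[_ p0 _ _ _] pU] c0 Fc; elim/big_ind: _ => //; first by rewrite p0.
by move=> x y xc yc; rewrite (le_lt_trans (pU _ _)) // gt_max xc yc.
Qed.

(** * Extension of seminorms to algebraic elements *)

Section AlgebraicStep.
Context {R : realType} {A B : comNzRingType} (J : set A) (phi : {rmorphism B -> A}) (q0 : B -> R).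
Hypotheses (PJ : is_prime J) (hq0 : ums q0) (kerq0 : forall b, q0 b = 0 <-> J (phi b)).
Implicit Types (f g h : {poly B}) (x : A).

Definition vanishing x : set {poly B} := [set g | J (map_poly phi g).[x]].

Definition algebraic_mod x : Prop := exists2 f, vanishing x f & exists i, ~ J (phi f`_i).

(** A minimal polynomial of [x] over the fraction field of the image of [B] modulo [J], with
    denominators cleared. A coefficient counts as zero when [phi] sends it into [J]. *)
Definition min_relation x f : Prop :=
  [/\ vanishing x f, ~ J (phi (lead_coef f)) &
    forall g, vanishing x g -> (size g < size f)%N -> forall i, J (phi g`_i)].

Let J0 : J 0. Proof. by case: PJ => -[]. Qed.
Let JD x y : J x -> J y -> J (x + y). Proof. by case: PJ => -[_ + _] _ _; apply. Qed.
Let JM x y : J y -> J (x * y). Proof. by case: PJ => -[_ _ +] _ _; apply. Qed.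
Let JMr x y : J y -> J (y * x). Proof. by rewrite mulrC; exact: JM. Qed.
Let JN x : J x -> J (- x). Proof. by rewrite -mulN1r; exact: JM. Qed.
Let J1 : ~ J 1. Proof. by case: PJ. Qed.
Let Jprime x y : J (x * y) -> J x \/ J y. Proof. by case: PJ => _ _; apply. Qed.
Let JX x n : ~ J x -> ~ J (x ^+ n).
Proof. by move=> Jx; elim: n => [|n IH]; rewrite ?expr0 // exprS => /Jprime[]. Qed.

Lemma vanishing_ideal x : is_ideal (vanishing x).
Proof.
rewrite /vanishing; split => [|f g|f g] /=; first by rewrite rmorph0 horner0.
  by rewrite rmorphD hornerD; exact: JD.
by rewrite rmorphM hornerM; exact: JM.
Qed.

Lemma vanishing_coefs x f : (forall i, J (phi f`_i)) -> vanishing x f.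
Proof.
move=> hf; rewrite /vanishing /= horner_poly.
by elim/big_ind: _ => // i _; exact: JMr.
Qed.

Lemma vanishing_prime x f g : vanishing x (f * g) -> vanishing x f \/ vanishing x g.
Proof. by rewrite /vanishing /= rmorphM hornerM => /Jprime. Qed.

Lemma vanishingB x f g : vanishing x f -> vanishing x g -> vanishing x (f - g).
Proof. by have [_ D M] := vanishing_ideal x; move=> hf hg; apply: D => //; rewrite -mulN1r; apply: M. Qed.

(** A polynomial over [B] stands for its image modulo [J], whose degree may be smaller; cutting off
    the top terms that vanish there makes sizes meaningful. *)
Lemma strip_lead_coef f : (exists i, ~ J (phi f`_i)) ->
  exists f', [/\ ~ J (phi (lead_coef f')), forall i, J (phi (f - f')`_i) & (size f' <= size f)%N].
Proof.
have [n] := ubnP (size f); elim: n f => // n IH f; rewrite ltnS => sf [i hi].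
have [hl|hl] := pselect (J (phi (lead_coef f))); last first.
  by exists f; split => // j; rewrite subrr coef0 rmorph0.
have f0 : f != 0 by apply/eqP => f0; apply: hi; rewrite f0 coef0 rmorph0.
pose g := f - (lead_coef f)%:P * 'X^((size f).-1).
have cg j : g`_j = if j == (size f).-1 then 0 else f`_j.
  rewrite coefB coefCM coefXn; case: eqP => [->|_]; last by rewrite mulr0 subr0.
  by rewrite mulr1 lead_coefE subrr.
have sg : (size g < size f)%N.
  rewrite -[X in (_ < X)%N]prednK ?size_poly_gt0 // ltnS; apply/leq_sizeP => j; rewrite cg.
  case: eqP => // /eqP jn jge; rewrite nth_default //.
  by rewrite -[size f]prednK ?size_poly_gt0 // ltn_neqAle eq_sym jn.
have [|f' [h1 h2 h3]] := IH g (leq_trans sg sf).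
  exists i; rewrite cg; case: eqP => // ij; exfalso; apply: hi.
  by move: hl; rewrite lead_coefE -ij.
exists f'; split => //; last exact: leq_trans h3 (ltnW sg).
move=> j; have -> : f - f' = (g - f') + (lead_coef f)%:P * 'X^((size f).-1) by rewrite /g; ring.
by rewrite coefD rmorphD; apply: JD => //; rewrite coefCM rmorphM; exact: JMr.
Qed.

Lemma min_relation_exists x : algebraic_mod x -> exists f, min_relation x f.
Proof.
move=> [f Vf hf].
pose P n := `[< exists g, [/\ vanishing x g, ~ J (phi (lead_coef g)) & size g = n] >].
have exP : exists n, P n.
  have [f' [h1 h2 h3]] := strip_lead_coef hf; exists (size f'); apply/asboolP; exists f'; split => //.
  rewrite (_ : f' = f - (f - f')); last by rewrite opprB addrC subrK.
  by apply: vanishingB => //; exact: vanishing_coefs.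
case: (ex_minnP exP) => n /asboolP[g [Vg lg sg]] nmin.
exists g; split => // h Vh sh; apply: contrapT => /existsNP hi.
have [h' [h1 h2 h3]] := strip_lead_coef hi.
have : P (size h').
  apply/asboolP; exists h'; split => //.
  rewrite (_ : h' = h - (h - h')); last by rewrite opprB addrC subrK.
  by apply: vanishingB => //; exact: vanishing_coefs.
by move=> /nmin; rewrite -sg leqNgt (leq_ltn_trans h3 sh).
Qed.

Lemma pseudo_division f g : f != 0 ->
  exists k h r, (lead_coef f ^+ k) *: g = h * f + r /\ (size r < size f)%N.
Proof.
move=> f0; exists (Pdiv.Ring.rscalp g f), (Pdiv.Ring.rdivp g f), (Pdiv.Ring.rmodp g f).
by split; [exact: Pdiv.ComRing.rdivp_eq|rewrite Pdiv.Ring.ltn_rmodp].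
Qed.

Lemma min_relation_neq0 x f : min_relation x f -> f != 0.
Proof. by move=> [_ lf _]; apply/eqP => f0; apply: lf; rewrite f0 lead_coef0 rmorph0. Qed.

Lemma vanishingZ x f b : vanishing x f -> vanishing x (b *: f).
Proof. by rewrite -mul_polyC; case: (vanishing_ideal x) => _ _; apply. Qed.

Lemma min_relation_div x f g : min_relation x f -> vanishing x g ->
  exists k h, forall i, J (phi (lead_coef f ^+ k *: g - h * f)`_i).
Proof.
move=> mf Vg; have [Vf lf minf] := mf.
have [k [h [r [E sr]]]] := pseudo_division g (min_relation_neq0 mf).
exists k, h; rewrite E addrC addKr; apply: minf => //.
have -> : r = lead_coef f ^+ k *: g - h * f by rewrite E addrC addKr.
by apply: vanishingB; [exact: vanishingZ|case: (vanishing_ideal x) => _ _; apply].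
Qed.

(** Bezout's identity: the minimal relation is irreducible over the fraction field. [m] has least
    degree among the nonvanishing elements of the ideal generated by [g] and the relations; if it
    were not constant, pseudo-division of [f] by [m] would factor [f] modulo [J]. *)
Lemma vanishing_inverse x f g : min_relation x f -> ~ vanishing x g ->
  exists h b, vanishing x (h * g - b%:P) /\ ~ J (phi b).
Proof.
move=> mf Vg; have [Vf lf minf] := mf; have [V0 VD VM] := vanishing_ideal x.
pose I := [set r | exists u, vanishing x (r - u * g)].
pose P n := `[< exists m, [/\ I m, ~ vanishing x m, ~ J (phi (lead_coef m)) & size m = n] >].
have stripI r : I r -> ~ vanishing x r -> exists m, [/\ I m, ~ vanishing x m, ~ J (phi (lead_coef m))
    & (size m <= size r)%N].
  move=> [u Vu] Vr; have [|m [h1 h2 h3]] := @strip_lead_coef r.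
    by apply: contrapT => /forallNP h; apply: Vr; apply: vanishing_coefs => i; exact: contrapT (h i).
  have Vrm : vanishing x (r - m) by exact: vanishing_coefs.
  exists m; split => //; last by move=> Vm; apply: Vr; rewrite -(subrK m r); apply: VD.
  exists u; have -> : m - u * g = (r - u * g) - (r - m) by ring.
  exact: vanishingB.
have exP : exists n, P n.
  have [|m [h1 h2 h3 _]] := stripI g _ Vg; first by exists 1; rewrite mul1r subrr.
  by exists (size m); apply/asboolP; exists m.
case: (ex_minnP exP) => n /asboolP[m [[u Vu] Vm lm sm]] nmin.
have small r : I r -> (size r < size m)%N -> vanishing x r.
  move=> Ir sr; apply: contrapT => Vr; have [m' [h1 h2 h3 h4]] := stripI r Ir Vr.
  have /nmin : P (size m') by apply/asboolP; exists m'.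
  by rewrite -sm leqNgt (leq_ltn_trans h4 sr).
have m0 : m != 0 by apply/eqP => m0; apply: lm; rewrite m0 lead_coef0 rmorph0.
have [sm1|sm1] := leqP (size m) 1.
  exists u, (lead_coef m); split => //.
  have -> : u * g - (lead_coef m)%:P = - (m - u * g).
    by rewrite {2}(size1_polyC sm1) lead_coefE (_ : (size m).-1 = 0%N) ?opprB //; lia.
  by rewrite -mulN1r; apply: VM.
exfalso.
have mf_size : (size m < size f)%N.
  have [k [h [r [E sr]]]] := pseudo_division m (min_relation_neq0 mf).
  have Er : r = lead_coef f ^+ k *: m - h * f by rewrite E addrC addKr.
  have Vr : ~ vanishing x r.
    move=> Vr; have : vanishing x ((lead_coef f ^+ k)%:P * m).
      by rewrite mul_polyC E; apply: VD => //; exact: VM.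
    case/vanishing_prime => //; rewrite /vanishing /= map_polyC hornerC /= rmorphXn; exact: JX.
  have [|m' [h1 h2 h3 h4]] := stripI r _ Vr.
    exists ((lead_coef f ^+ k)%:P * u).
    have -> : r - (lead_coef f ^+ k)%:P * u * g = (lead_coef f ^+ k) *: (m - u * g) - h * f.
      by rewrite Er -!mul_polyC; ring.
    by apply: vanishingB; [exact: vanishingZ|exact: VM].
  have /nmin : P (size m') by apply/asboolP; exists m'.
  by rewrite -sm => h5; exact: leq_ltn_trans h5 (leq_ltn_trans h4 sr).
have [k [h [r [E sr]]]] := pseudo_division f m0.
have Er : r = lead_coef m ^+ k *: f - h * m by rewrite E addrC addKr.
have Vr : vanishing x r.
  apply: small => //; exists (- h * u).
  have -> : r - - h * u * g = lead_coef m ^+ k *: f - h * (m - u * g) by rewrite Er; ring.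
  by apply: vanishingB; [exact: vanishingZ|exact: VM].
have Jr i : J (phi r`_i) by apply: minf Vr _ i; exact: ltn_trans sr mf_size.
have Vh : vanishing x h.
  have : vanishing x (h * m).
    rewrite (_ : h * m = lead_coef m ^+ k *: f - r); last by rewrite E addrK.
    by apply: vanishingB => //; exact: vanishingZ.
  by case/vanishing_prime.
have Jmul (p p' : {poly B}) : (forall i, J (phi p`_i)) -> forall i, J (phi (p * p')`_i).
  move=> hp i; rewrite coefM rmorph_sum /=.
  by elim/big_ind: _ => // j _; rewrite rmorphM; exact: JMr.
have top : ~ J (phi (lead_coef m ^+ k *: f)`_((size f).-1)).
  rewrite coefZ -lead_coefE rmorphM rmorphXn => /Jprime[]; last exact: lf.
  exact: JX.
have [hh|/existsNP hh] := pselect (forall i, J (phi h`_i)).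
  by apply: top; rewrite E coefD rmorphD; apply: JD => //; exact: Jmul.
have [h' [h1 h2 h3]] := strip_lead_coef hh.
have Vh' : vanishing x h'.
  rewrite (_ : h' = h - (h - h')); last by rewrite opprB addrC subrK.
  by apply: vanishingB => //; exact: vanishing_coefs.
have sh' : (size f <= size h')%N.
  by rewrite leqNgt; apply/negP => sh; apply: h1; rewrite lead_coefE; exact: minf.
have : J (phi (h' * m)`_(size h' + size m).-2).
  rewrite (_ : h' * m = lead_coef m ^+ k *: f - (r + (h - h') * m)); last by rewrite E; ring.
  have hs : (size f <= (size h' + size m).-2)%N by move: sm1 sh'; clear; lia.
  rewrite coefB coefZ (nth_default _ hs) mulr0 sub0r rmorphN coefD rmorphD; apply: JN; apply: JD => //; exact: Jmul.
by rewrite -mul_lead_coef rmorphM => /Jprime[].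
Qed.

(** The Gauss norm of radius [rho] is prescribed on monomials and pushed to the quotient by the
    relations. If a monomial [s] were congruent to some [h] of smaller norm, then [s - h] would have
    exactly one dominant term, although up to a constant it agrees modulo [J] with a multiple of
    [f], which has at least two. The kernel is no larger than the relations because any other [g] is
    invertible up to a constant. *)
Lemma real_step x f rho : min_relation x f -> 0 < rho -> two_dominant q0 rho f ->
  exists q1 : {poly B} -> R, [/\ ums q1, forall g, q1 g = 0 <-> vanishing x g,
    forall b, q1 b%:P = q0 b & q1 'X = rho].
Proof.
move=> mf rho0 [f0 [j1 [j2 [j12 d1 d2]]]]; have [Vf lf minf] := mf.
have pnU := pnorm_ums hq0 rho0; have [[pn0 pnz pn1 pnM _] pnD] := pnU.
have pnC := pnormC rho hq0; have pnX := pnormX hq0 rho0.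
have qlt b : ~ J (phi b) -> 0 < q0 b.
  by case: hq0 => -[q00 _ _ _ _] _ Jb; rewrite lt_def q00 andbT; apply/eqP => /kerq0.
pose S : set {poly B} := [set s | exists a n, q0 a != 0 /\ s = a%:P * 'X^n].
have cS s : S s -> 0 < pnorm q0 rho s.
  move=> [a [n [a0 ->]]]; rewrite pnM pnC (mult_seminormX (proj1 pnU)) pnX.
  apply: mulr_gt0; last exact: exprn_gt0.
  by rewrite lt_def a0; case: hq0 => -[->].
have [|||||||q1 [hq1 q1le q1V q1S]] :=
  @berkovich_quot R _ (vanishing x) S (pnorm q0 rho) (pnorm q0 rho) (vanishing_ideal x).
- by exists 1, 0; case: hq0 => -[_ _ -> _ _] _; rewrite oner_neq0 mul1r.
- move=> _ _ [a [n [a0 ->]]] [b [m [b0 ->]]]; exists (a * b), (n + m)%N.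
  case: hq0 => -[_ _ _ -> _] _; rewrite mulf_neq0 //; split => //.
  by rewrite polyCM exprD mulrACA.
- exact: cS.
- by move=> s t _ _; exact: pnM.
- exact: ums_submult.
- by [].
- move=> s h Ss Vsh; rewrite leNgt; apply/negP => hs.
  have [k [u Ju]] := min_relation_div mf Vsh.
  have [a [n [a0 Es]]] := Ss; set g := s - h in Vsh Ju.
  have termn i : term q0 rho s i = if i == n then pnorm q0 rho s else 0.
    rewrite {1}/term Es coefCM coefXn; case: eqP => [->|_]; last first.
      by rewrite mulr0; case: hq0 => -[_ -> _ _ _] _; rewrite mul0r.
    by rewrite mulr1 pnM pnC (mult_seminormX (proj1 pnU)) pnX.
  have termg i : term q0 rho g i = pnorm q0 rho s <-> i = n.
    have hi : term q0 rho h i < pnorm q0 rho s.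
      exact: le_lt_trans (le_pnorm rho hq0 h i) hs.
    have qN := mult_seminormN (proj1 hq0); have ri : 0 < rho ^+ i by rewrite exprn_gt0.
    split => [E|->]; last first.
      have := termn n; rewrite eqxx => En.
      rewrite -En /term coefB; congr (_ * _); apply: ultra_eq => //; first by case: hq0.
      rewrite qN -(ltr_pM2r (exprn_gt0 n rho0)).
      by move: (le_lt_trans (le_pnorm rho hq0 h n) hs); rewrite -En.
    apply: contrapT => /eqP ni; have := termn i; rewrite (negPf ni) => Ei.
    have : term q0 rho g i <= Num.max (term q0 rho s i) (term q0 rho h i).
      by rewrite /term -(maxr_pMl _ _ (ltW ri)) ler_pM2r // coefB -(qN h`_i); case: hq0 => _ /(_ s`_i (- h`_i)).
    by rewrite E Ei le_max leNgt cS //= leNgt hi.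
  have gn : pnorm q0 rho g = pnorm q0 rho s.
    apply/eqP; rewrite eq_le; apply/andP; split.
      by apply: le_trans (pnD _ _) _; rewrite (pnormN rho hq0) ge_max lexx ltW.
    have /termg <- := erefl n; exact: (le_pnorm rho hq0).
  have lk : 0 < q0 (lead_coef f ^+ k).
    by apply: qlt; rewrite rmorphXn; exact: JX.
  have teq i : term q0 rho (u * f) i = q0 (lead_coef f ^+ k) * term q0 rho g i.
    rewrite /term mulrA; congr (_ * _).
    have qM (b c : B) : q0 (b * c) = q0 b * q0 c by case: hq0 => -[].
    rewrite -qM -coefZ; have /kerq0 := Ju i; rewrite coefB => E0.
    have qN := mult_seminormN (proj1 hq0); have [[q00 qz _ _ _] qU] := hq0.
    apply/eqP; rewrite eq_le; apply/andP; split.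
      have := qU (- ((lead_coef f ^+ k *: g)`_i - (u * f)`_i)) ((lead_coef f ^+ k *: g)`_i).
      by rewrite qN E0 opprB subrK (max_r (q00 _)).
    have := qU ((lead_coef f ^+ k *: g)`_i - (u * f)`_i) ((u * f)`_i).
    by rewrite E0 subrK (max_r (q00 _)).
  have guf : pnorm q0 rho (u * f) = q0 (lead_coef f ^+ k) * pnorm q0 rho g.
    apply/eqP; rewrite eq_le; apply/andP; split.
      apply: pnorm_le => // [|i]; first by rewrite mulr_ge0 // ltW.
      by rewrite teq ler_pM2l // (le_pnorm rho hq0).
    have /termg En := erefl n; rewrite gn -En -teq; exact: (le_pnorm rho hq0).
  have uf0 : 0 < pnorm q0 rho u * pnorm q0 rho f.
    by rewrite -pnM guf mulr_gt0 // gn cS.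
  have u0 : 0 < pnorm q0 rho u by rewrite lt_def pn0 andbT; apply/eqP => z; rewrite z mul0r ltxx in uf0.
  have only i : term q0 rho (u * f) i = pnorm q0 rho u * pnorm q0 rho f -> i = n.
    rewrite -pnM guf teq => /(mulfI (lt0r_neq0 lk)) h'; apply/termg; by rewrite h' gn.
  have [i1 di1 mi1] := min_dominant hq0 rho0 u.
  have [i2 di2 mi2] := max_dominant hq0 rho0 u0.
  have [l1 dl1 ml1] := min_dominant hq0 rho0 f.
  have [l2 dl2 ml2] := max_dominant hq0 rho0 f0.
  have e1 := only _ (dominant_min_mul hq0 rho0 u0 f0 di1 dl1 mi1 ml1).
  have e2 := only _ (dominant_max_mul hq0 rho0 u0 f0 di2 dl2 mi2 ml2).
  have := mi1 _ di2; have := ml1 _ d1; have := ml2 _ d2.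
  by move: e1 e2 j12; clear; lia.
have q1C b : q1 b%:P = q0 b.
  have [b0|b0] := eqVneq (q0 b) 0.
    rewrite b0; apply/eqP; rewrite eq_le -{1}b0 -pnC q1le /=.
    by case: hq1 => -[].
  by rewrite -pnC; apply: q1S; exists b, 0; rewrite mulr1.
exists q1; split => //; last first.
  by rewrite -pnX; apply: q1S; exists 1, 1; case: hq0 => -[_ _ -> _ _] _; rewrite oner_neq0 mul1r.
move=> g; split => [g0|]; last exact: q1V.
apply: contrapT => Vg; have [h [b [Vh Jb]]] := vanishing_inverse mf Vg.
have [[q10 q1z _ q1M _] q1U] := hq1.
have := q1U (h * g) (- (h * g - b%:P)); rewrite opprB addrC subrK q1C q1M g0 mulr0.
rewrite -opprB (mult_seminormN (proj1 hq1)) q1V // maxxx leNgt qlt //.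
Qed.

(** Were a single term of [f.[x]] strictly dominant, [q] could not vanish on [f.[x]], which lies in
    [J]: the value of a root is a slope. *)
Lemma newton_dominant (q : A -> R) x f : ums q -> (forall a, J a -> q a = 0) ->
  (forall b, q (phi b) = q0 b) -> 0 < q x -> vanishing x f -> ~ J (phi (lead_coef f)) ->
  two_dominant q0 (q x) f.
Proof.
move=> hq qJ qphi x0 Vf lf; have [[q00 qz _ qM _] qU] := hq.
have f0 : 0 < pnorm q0 (q x) f.
  apply: lt_le_trans (le_pnorm (q x) hq0 f ((size f).-1)).
  rewrite /term -lead_coefE mulr_gt0 ?exprn_gt0 // lt_def; case: hq0 => -[-> _ _ _ _] _.
  by rewrite andbT; apply/eqP => /kerq0.
split => //; have [i di mi] := min_dominant hq0 x0 f.
apply: contrapT => h; have uniq j : j != i -> term q0 (q x) f j < pnorm q0 (q x) f.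
  move=> ji; apply: dominant_term => //; apply/negbTE/negP => dj.
  by apply: h; exists i, j; split => //; rewrite ltn_neqAle eq_sym ji mi.
have ti j : q (phi f`_j * x ^+ j) = term q0 (q x) f j.
  by rewrite qM qphi (mult_seminormX (proj1 hq)).
have si : (i < size f)%N.
  rewrite ltnNge; apply/negP => si; move: f0; rewrite -(eqP di) /term nth_default //.
  by case: hq0 => -[_ -> _ _ _] _; rewrite mul0r ltxx.
have := qJ _ Vf; rewrite horner_poly (bigD1 (Ordinal si)) //=.
rewrite ultra_eq //.
- by rewrite ti (eqP di) => z; rewrite z ltxx in f0.
- exact: mult_seminormN (proj1 hq).
- rewrite ti (eqP di); apply: ultra_sum_lt => // j ji; rewrite ti; exact: uniq.
Qed.

(** [rho] is the slope of the last edge, the one that ends at the leading coefficient: the maximum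
    of the roots [r i]. It is positive because [x] is not in [J], so that some lower coefficient
    survives modulo [J]. *)
Lemma slope_exists x f : min_relation x f -> ~ J x -> exists2 rho, 0 < rho & two_dominant q0 rho f.
Proof.
move=> mf Jx; have [Vf lf minf] := mf; have f0 := min_relation_neq0 mf.
have [[q00 qz _ qM _] qU] := hq0.
have qlt b : ~ J (phi b) -> 0 < q0 b.
  by move=> Jb; rewrite lt_def q00 andbT; apply/eqP => /kerq0.
pose n := (size f).-1; have sn : size f = n.+1 by rewrite prednK // size_poly_gt0.
have ln : 0 < q0 f`_n by rewrite -lead_coefE; exact: qlt.
have [i0 hi0] : exists i : 'I_n, ~ J (phi f`_i).
  apply/not_existsP => h; have : J (phi f`_n * x ^+ n).
    have := Vf; rewrite /vanishing /= horner_poly sn big_ord_recr /= => h1.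
    have h2 : J (\sum_(i < n) phi f`_i * x ^+ i).
      by elim/big_ind: _ => // i _; apply: JMr; exact: contrapT (h i).
    by rewrite -[_ * _](addKr (\sum_(i < n) phi f`_i * x ^+ i)); apply: JD => //; exact: JN.
  by case/Jprime => //; exact: JX.
pose r (i : 'I_n) := (q0 f`_i / q0 f`_n) `^ ((n - i)%:R^-1).
have ri i : r i ^+ (n - i) = q0 f`_i / q0 f`_n.
  have a0 : 0 <= q0 f`_i / q0 f`_n by rewrite divr_ge0.
  rewrite -powR_mulrn ?powR_ge0 // -powRrM mulVf ?powRr1 // pnatr_eq0 subn_eq0 -ltnNge //.
have r0 i : 0 <= r i by exact: powR_ge0.
pose rho := \big[Num.max/0]_(i < n) r i.
have rrho i : r i <= rho by exact: le_bigmax.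
have rho0 : 0 < rho.
  by apply: lt_le_trans (rrho i0); rewrite powR_gt0 // divr_gt0 // qlt.
have [i1 hi1] : exists i : 'I_n, r i = rho.
  apply/not_existsP => h; have : rho < rho by apply/bigmax_ltP; split => // i _;
    rewrite lt_def rrho andbT eq_sym; apply/eqP/h.
  by rewrite ltxx.
have tn i : (i < n)%N -> rho ^+ n = rho ^+ (n - i) * rho ^+ i.
  by move=> /ltnW hi; rewrite -exprD subnK.
have rle i : (i <= n)%N -> term q0 rho f i <= term q0 rho f n.
  rewrite leq_eqVlt => /orP[/eqP -> //|hi].
  rewrite /term (tn i hi) mulrA ler_pM2r ?exprn_gt0 //.
  rewrite mulrC -ler_pdivrMr // -(ri (Ordinal hi)) lerXn2r ?nnegrE ?(ltW rho0) ?r0 //=.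
have pn : pnorm q0 rho f = term q0 rho f n.
  apply/eqP; rewrite eq_le (le_pnorm rho hq0) andbT; apply: pnorm_le => [|i].
    by rewrite mulr_ge0 // exprn_ge0 // ltW.
  have [hi|hi] := leqP i n; first exact: rle.
  by rewrite {1}/term nth_default ?sn // qz mul0r mulr_ge0 // exprn_ge0 // ltW.
exists rho => //; split; first by rewrite pn mulr_gt0 // exprn_gt0.
exists i1, n; split => //; rewrite /dominant pn //.
rewrite /term (tn _ (ltn_ord i1)) mulrA; apply/eqP; congr (_ * _).
by rewrite -hi1 ri mulrC divfK // lt0r_neq0.
Qed.

End AlgebraicStep.

(** Generation as a ring over the image of [phi], stated as an induction principle; this form passes
    from [B] to [{poly B}] without polynomials in several variables. *)
Definition gen_by (A B : comNzRingType) (phi : B -> A) (xs : seq A) (a : A) : Prop :=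
  forall P : set A, (forall b, P (phi b)) -> (forall x, x \in xs -> P x) ->
    (forall x y, P x -> P y -> P (x + y)) -> (forall x y, P x -> P y -> P (x * y)) -> P a.

Definition eval_at (A B : comNzRingType) (phi : {rmorphism B -> A}) (x : A) : {rmorphism {poly B} -> A} :=
  (horner_eval x \o map_poly phi).

Lemma eval_atC (A B : comNzRingType) (phi : {rmorphism B -> A}) x b : eval_at phi x b%:P = phi b.
Proof. by rewrite /= map_polyC /horner_eval hornerC. Qed.

Lemma eval_atX (A B : comNzRingType) (phi : {rmorphism B -> A}) x : eval_at phi x 'X = x.
Proof. by rewrite /= map_polyX /horner_eval hornerX. Qed.

Lemma gen_by_eval_at (A B : comNzRingType) (phi : {rmorphism B -> A}) x xs a :
  gen_by phi (x :: xs) a -> gen_by (eval_at phi x) xs a.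
Proof.
move=> h P P1 P2 P3 P4; apply: h => // [b|y]; first by rewrite -(eval_atC _ x).
by rewrite inE => /orP[/eqP ->|/P2 //]; rewrite -(eval_atX phi x).
Qed.

Lemma algebraic_eval_at (R : realType) (A B : comNzRingType) (J : set A) (phi : {rmorphism B -> A}) x y :
  algebraic_mod J phi y -> algebraic_mod J (eval_at phi x) y.
Proof.
move=> [f Vf [i hi]]; exists (map_poly polyC f); last first.
  by exists i; rewrite coef_map eval_atC.
rewrite /vanishing /= -map_poly_comp (_ : map_poly _ f = map_poly phi f) //.
by apply: eq_map_poly => b; exact: eval_atC.
Qed.

(** The generators are adjoined one at a time, the base growing from [B] to [{poly B}]. The exact
    description of the kernel is part of the induction, since the next step needs it. When no
    generator is left, [phi] is surjective and [q0] descends. *)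
Lemma extend_list (R : realType) (A : comNzRingType) (J : set A) (xs : seq A) : is_prime J ->
  forall (B : comNzRingType) (phi : {rmorphism B -> A}) (q0 : B -> R), ums q0 ->
  (forall b, q0 b = 0 <-> J (phi b)) ->
  (forall x, x \in xs -> algebraic_mod J phi x /\ ~ J x) -> (forall a, gen_by phi xs a) ->
  exists q : A -> R, [/\ ums q, forall a, q a = 0 <-> J a & forall b, q (phi b) = q0 b].
Proof.
move=> PJ; elim: xs => [|x xs IH] B phi q0 hq0 ker alg gen.
  have sur a : exists b, phi b = a.
    apply: (gen a (fun a => exists b, phi b = a)) => // [b|x y [b <-] [c <-]|x y [b <-] [c <-]].
    - by exists b.
    - by exists (b + c); rewrite rmorphD.
    - by exists (b * c); rewrite rmorphM.
  have [psi hpsi] := choice sur.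
  have qE b b' : phi b = phi b' -> q0 b = q0 b'.
    move=> E; have /ker : J (phi (b - b')).
      by rewrite rmorphB E subrr; case: PJ => -[].
    have [[q00 qz _ _ _] qU] := hq0; have qN := mult_seminormN (proj1 hq0).
    move=> z; apply/eqP; rewrite eq_le.
    have h1 := qU (b - b') b'; have h2 := qU (- (b - b')) b.
    rewrite subrK z (max_r (q00 _)) in h1; rewrite opprB subrK -opprB qN z (max_r (q00 _)) in h2.
    by rewrite h1 h2.
  have qphi b : q0 (psi (phi b)) = q0 b by apply: qE; rewrite hpsi.
  exists (fun a => q0 (psi a)); split => //; last first.
    by move=> a; rewrite ker hpsi.
  have [[q00 qz q1 qM qD] qU] := hq0.
  split; first split => //.
  - by rewrite -[X in psi X](rmorph0 phi) qphi.
  - by rewrite -[X in psi X](rmorph1 phi) qphi.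
  - by move=> a b; rewrite -qM; apply: qE; rewrite rmorphM !hpsi.
  - by move=> a b; apply: le_trans (qD _ _); rewrite le_eqVlt; apply/orP; left; apply/eqP;
      apply: qE; rewrite rmorphD !hpsi.
  - by move=> a b; apply: le_trans (qU _ _); rewrite le_eqVlt; apply/orP; left; apply/eqP;
      apply: qE; rewrite rmorphD !hpsi.
have [algx Jx] := alg x (mem_head _ _).
have [f mf] := min_relation_exists PJ algx.
have [rho rho0 tf] := slope_exists PJ hq0 ker mf Jx.
have [q1 [hq1 ker1 q1C q1X]] := real_step PJ hq0 ker mf rho0 tf.
have [|a||q [h1 h2 h3]] := IH _ (eval_at phi x) q1 hq1.
- by move=> g; rewrite ker1.
- by move=> h; have [|h1 h2] := alg a; [rewrite inE h orbT|split => //; exact: algebraic_eval_at].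
- by move=> a; apply: gen_by_eval_at; exact: gen.
by exists q; split => // b; rewrite -(eval_atC phi x) h3 q1C.
Qed.

(** The element [x] need not be one of the generators: adjoining it before them leaves its value
    free among the slopes of its relation. *)
Lemma extend_with_slope (R : realType) (A B : comNzRingType) (J : set A) (xs : seq A)
    (phi : {rmorphism B -> A}) (q0 : B -> R) x f rho : is_prime J -> ums q0 ->
  (forall b, q0 b = 0 <-> J (phi b)) ->
  (forall y, y \in xs -> algebraic_mod J phi y /\ ~ J y) -> (forall a, gen_by phi xs a) ->
  min_relation J phi x f -> 0 < rho -> two_dominant q0 rho f ->
  exists q : A -> R, [/\ ums q, forall a, q a = 0 <-> J a, forall b, q (phi b) = q0 b & q x = rho].
Proof.
move=> PJ hq0 ker alg gen mf rho0 tf.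
have [q1 [hq1 ker1 q1C q1X]] := real_step PJ hq0 ker mf rho0 tf.
have [|y hy|a|q [h1 h2 h3]] := @extend_list R A J xs PJ _ (eval_at phi x) q1 hq1.
- by move=> g; rewrite ker1.
- by have [h1 h2] := alg y hy; split => //; exact: algebraic_eval_at.
- by move=> P P1 P2; apply: gen => // b; rewrite -(eval_atC phi x).
exists q; split => // [b|]; first by rewrite -(eval_atC phi x) h3 q1C.
by rewrite -{1}(eval_atX phi x) h3 q1X.
Qed.

Lemma exists_min_seq (T : eqType) (le : T -> T -> Prop) (s : seq T) :
  (forall x y, le x y \/ le y x) -> (forall y x z, le x y -> le y z -> le x z) ->
  s != [::] -> exists2 x, x \in s & forall y, y \in s -> le x y.
Proof.
move=> tot tr; elim: s => // x [|y s] IH _.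
  exists x; rewrite ?mem_head // => z; rewrite inE => /eqP ->.
  by case: (tot x x).
have [//|m ms hm] := IH; have [h|h] := tot x m.
  exists x; rewrite ?mem_head // => z; rewrite inE => /orP[/eqP ->|/hm]; last exact: tr.
  by case: (tot x x).
exists m; first by rewrite inE ms orbT.
by move=> z; rewrite inE => /orP[/eqP -> //|/hm].
Qed.

(** Once the other exponents are chosen, each vector with nonzero first entry forbids at most one
    value of the first exponent, by torsion-freeness; [N] exceeds all the forbidden values. *)
Lemma separating_weights (W : zmodType) (r : nat) (I : finType) (d : I -> 'I_r -> W) :
  (forall (w : W) m, w *+ m = 0 -> w = 0 \/ m = 0%N) ->
  exists n : 'I_r -> nat, forall i, (exists j, d i j <> 0) -> \sum_j d i j *+ n j <> 0.
Proof.
move=> tf; elim: r d => [|r IH] d; first by exists (fun=> 0%N) => i [[]].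
have [n hn] := IH (fun i j => d i (lift ord0 j)).
pose tl i := \sum_(j < r) d i (lift ord0 j) *+ n j.
have uniqm i : d i ord0 <> 0 -> forall m m', d i ord0 *+ m + tl i = 0 -> d i ord0 *+ m' + tl i = 0 -> m = m'.
  move=> di m m' h h'; have E : d i ord0 *+ m = d i ord0 *+ m'.
    by apply: (addIr (tl i)); rewrite h h'.
  have [le|le] := leqP m m'.
    have /tf[//|/eqP] : d i ord0 *+ (m' - m) = 0 by rewrite mulrnBr // E subrr.
    by move=> ?; apply/eqP; rewrite eqn_leq le -subn_eq0.
  have /tf[//|/eqP] : d i ord0 *+ (m - m') = 0 by rewrite mulrnBr ?(ltnW le) // E subrr.
  by rewrite subn_eq0 leqNgt le.
have [bad hbad] : exists bad : I -> nat, forall i, d i ord0 <> 0 ->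
    forall m, d i ord0 *+ m + tl i = 0 -> m = bad i.
  have : forall i, exists b, d i ord0 <> 0 -> forall m, d i ord0 *+ m + tl i = 0 -> m = b.
    move=> i; have [[b hb]|nb] := pselect (exists b, d i ord0 *+ b + tl i = 0).
      by exists b => di m hm; exact: uniqm hm hb.
    by exists 0%N => di m hm; case: nb; exists m.
  by move=> /choice[bad hbad]; exists bad.
pose N := (\sum_(i : I) bad i).+1.
have badN i : bad i <> N.
  by rewrite /N (bigD1 i) //= => /eqP; rewrite -addSn eq_sym gtn_eqF // ltnS leq_addr.
exists (fun j => if unlift ord0 j is Some j' then n j' else N) => i [j dj].
rewrite big_ord_recl unlift_none; under eq_bigr do rewrite liftK.
have [d0|d0] := pselect (d i ord0 = 0); last by move=> /(hbad i d0)/esym; exact: badN.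
rewrite d0 mul0rn add0r; apply: hn; case: (unliftP ord0 j) dj => [j' ->|-> //].
by exists j'.
Qed.

(** * Families of seminorms over germs of polyhedra *)

Section Germs.
Context {R : realType} {k : nat} (x0 : 'rV[R]_k).

Definition rform (l : 'rV[rat]_k) (x : 'rV[R]_k) : R := \sum_i ratr (l 0 i) * x 0 i.

Lemma rformD l l' x : rform (l + l') x = rform l x + rform l' x.
Proof. by rewrite -big_split; apply: eq_bigr => i _; rewrite mxE rmorphD mulrDl. Qed.
Lemma rformZ c l x : rform (c *: l) x = ratr c * rform l x.
Proof. by rewrite mulr_sumr; apply: eq_bigr => i _; rewrite mxE rmorphM mulrA. Qed.
Lemma rformN l x : rform (- l) x = - rform l x.
Proof. by rewrite -scaleN1r rformZ rmorphN rmorph1 mulN1r. Qed.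
Lemma rform0 x : rform 0 x = 0.
Proof. by rewrite -(scale0r 0) rformZ rmorph0 mul0r. Qed.

Definition near0 (Q : R -> 'rV[R]_k -> Prop) : Prop :=
  exists2 e : R, 0 < e & forall (t : R) (x : 'rV[R]_k), 0 < t < e -> (forall i, `|x 0 i - x0 0 i| < e) -> Q t x.

Lemma near0T (Q : R -> 'rV[R]_k -> Prop) : (forall t x, Q t x) -> near0 Q.
Proof. by move=> h; exists 1. Qed.

Lemma near0_and Q1 Q2 : near0 Q1 -> near0 Q2 -> near0 (fun t x => Q1 t x /\ Q2 t x).
Proof.
move=> [e e0 h] [e' e0' h']; exists (Num.min e e'); first by rewrite lt_min e0.
move=> t x /andP[t0]; rewrite lt_min => /andP[te te'] hx; split; [apply: h|apply: h'];
  rewrite ?t0 // => i; have := hx i; rewrite lt_min => /andP[] //.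
Qed.

Lemma near0_impl (Q1 Q2 : R -> 'rV[R]_k -> Prop) : near0 Q1 -> (forall t x, Q1 t x -> Q2 t x) -> near0 Q2.
Proof. by move=> [e e0 h] h'; exists e => // t x t0 hx; apply: h'; exact: h. Qed.

Lemma near0_all (I : finType) (Q : I -> R -> 'rV[R]_k -> Prop) :
  (forall i, near0 (Q i)) -> near0 (fun t x => forall i, Q i t x).
Proof.
move=> h; suff : near0 (fun t x => forall i, i \in enum I -> Q i t x).
  by move/near0_impl; apply => t x hQ i; apply: hQ; rewrite mem_enum.
elim: (enum I) => [|i s IH]; first by exists 1.
apply: near0_impl (near0_and (h i) IH) _ => t x [h1 h2] j.
by rewrite inE => /orP[/eqP ->|/h2].
Qed.

Lemma near0_ex Q : near0 Q -> exists t x, Q t x.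
Proof.
move=> [e e0 h]; exists (e / 2), x0; apply: h => [|i]; last by rewrite subrr normr0.
by rewrite divr_gt0 //= ltr_pdivrMr // ltr_pMr // ltr1n.
Qed.

(* (c, l) is the germ of (t, x) |-> c + t l(x) for small t > 0 and x near x0. The order gle is
   total because the coordinates of x0 are linearly independent over the rationals. *)
Definition germ : Type := (R * 'rV[rat]_k)%type.
Implicit Types g : germ.
Definition gev g t x : R := g.1 + t * rform g.2 x.
Definition gpos g : Prop := 0 < g.1 \/ g.1 = 0 /\ 0 < rform g.2 x0.

Lemma gevD g g' t x : gev (g + g') t x = gev g t x + gev g' t x.
Proof. by rewrite /gev rformD mulrDr addrACA. Qed.
Lemma gevN g t x : gev (- g) t x = - gev g t x.
Proof. by rewrite /gev rformN mulrN -opprD. Qed.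
Lemma gevMn g m t x : gev (g *+ m) t x = gev g t x *+ m.
Proof. by elim: m => [|m IH]; rewrite ?mulrS ?gevD ?IH // /gev rform0 mulr0 addr0. Qed.
Lemma gev_sum (I : Type) (s : seq I) (P : pred I) (F : I -> germ) t x :
  gev (\sum_(i <- s | P i) F i) t x = \sum_(i <- s | P i) gev (F i) t x.
Proof.
elim/big_rec2: _ => [|i y z _ <-]; first by rewrite /gev rform0 mulr0 addr0.
by rewrite gevD.
Qed.

Lemma rform_bound (l : 'rV[rat]_k) (e : R) : 0 < e -> exists2 d : R, 0 < d &
  forall x : 'rV[R]_k, (forall i, `|x 0 i - x0 0 i| < d) -> `|rform l x - rform l x0| < e.
Proof.
move=> e0; pose C := \sum_i `|ratr (l 0 i) : R| + 1.
have C0 : 0 < C by rewrite ltr_wpDl // sumr_ge0.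
exists (e / C); first exact: divr_gt0.
move=> x hx; rewrite -sumrB.
apply: (@le_lt_trans _ _ (\sum_i `|ratr (l 0 i) : R| * (e / C))).
  apply: le_trans (ler_norm_sum _ _ _) _; apply: ler_sum => i _.
  by rewrite -mulrBr normrM ler_wpM2l // ltW.
by rewrite -mulr_suml mulrCA mulrC -ltr_pdivlMr // divff ?gt_eqF // ltr_pdivrMr // mul1r ltrDl.
Qed.

Lemma gpos_near g : gpos g -> near0 (fun t x => 0 < gev g t x).
Proof.
case: g => c l [/= c0|[/= c0 l0]].
  have [d d0 hd] := rform_bound l ltr01.
  pose C := `|rform l x0| + 1; have C0 : 0 < C by rewrite ltr_wpDl.
  exists (Num.min d (c / C)); first by rewrite lt_min d0 divr_gt0.
  move=> t x /andP[t0]; rewrite lt_min => /andP[_ tc] hx.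
  have {}hx : `|rform l x - rform l x0| < 1.
    by apply: hd => i; have := hx i; rewrite lt_min => /andP[].
  have hC : `|rform l x| < C.
    rewrite -(subrK (rform l x0) (rform l x)) addrC (le_lt_trans (ler_normD _ _)) //.
    by rewrite /C ltrD2l.
  have : `|t * rform l x| < c.
    rewrite normrM gtr0_norm //; apply: lt_trans (_ : t * C < _); first by rewrite ltr_pM2l.
    by rewrite -ltr_pdivlMr.
  by rewrite /gev /= ltr_norml => /andP[h _]; rewrite -(subrr c) ltrD2l.
have [d d0 hd] := rform_bound l l0; exists d => // t x /andP[t0 _] /hd.
rewrite /gev /= c0 add0r ltr_norml => /andP[h _]; rewrite pmulr_rgt0 //.
by rewrite -(ltrD2r (- rform l x0)) sub0r.
Qed.

Hypothesis x0_indep : forall l : 'rV[rat]_k, l != 0 -> rform l x0 != 0.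

Lemma gpos_total g : g = 0 \/ gpos g \/ gpos (- g).
Proof.
case: g => c l; have [c0|c0|c0] := ltgtP c 0.
- by right; right; left; rewrite /= oppr_gt0.
- by right; left; left.
have [->|l0] := eqVneq l 0; first by left; rewrite c0.
right; have := x0_indep l0; case: ltgtP => // h _; [right|left]; right => /=; rewrite c0 ?oppr0 //.
by rewrite rformN oppr_gt0.
Qed.

Lemma gneq0_near g : g <> 0 -> near0 (fun t x => gev g t x != 0).
Proof.
move=> g0; case: (gpos_total g) => [//|[]] /gpos_near /near0_impl; apply => t x.
  by move=> h; rewrite gt_eqF.
by rewrite gevN oppr_gt0 => h; rewrite lt_eqF.
Qed.

Definition gle g g' : Prop := g' - g = 0 \/ gpos (g' - g).

Lemma gposD g g' : gpos g -> gpos g' -> gpos (g + g').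
Proof.
case: g g' => c l [c' l'] [/= h|[/= h h1]] [/= h'|[/= h' h1']]; rewrite /gpos /=.
- by left; rewrite addr_gt0.
- by left; rewrite h' addr0.
- by left; rewrite h add0r.
- by right; rewrite h h' addr0 rformD addr_gt0.
Qed.

Lemma gle_total g g' : gle g g' \/ gle g' g.
Proof.
rewrite /gle -[g - g']opprB; case: (gpos_total (g' - g)) => [->|[]]; by [left; left|left; right|right; right].
Qed.

Lemma gle_trans g' g g'' : gle g g' -> gle g' g'' -> gle g g''.
Proof.
rewrite /gle -[g'' - g](subrKA g'); move=> [->|h] [->|h']; rewrite ?add0r ?addr0; auto.
by right; exact: gposD.
Qed.

Lemma gle_near g g' : gle g g' -> near0 (fun t x => gev g t x <= gev g' t x).
Proof.
move=> [/subr0_eq ->|/gpos_near /near0_impl]; first by exists 1.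
by apply => t x; rewrite gevD gevN subr_gt0 => /ltW.
Qed.

Lemma gle_fst g g' : gle g g' -> g.1 <= g'.1.
Proof.
case: g g' => c l [c' l'] [/subr0_eq [->]//|[/=|[/= /subr0_eq -> //]]].
by rewrite subr_gt0 => /ltW.
Qed.

Variables (A B : comNzRingType) (J : set A) (phi : {rmorphism B -> A}) (q : A -> R).
Variables (Gam : R -> 'rV[R]_k -> B -> R) (r : nat) (b : 'I_r -> A) (xs : seq A).
Hypotheses (PJ : is_prime J) (hq : ums q) (kerq : forall a, q a = 0 <-> J a).
Hypothesis hGam : near0 (fun t x => ums (Gam t x) /\ forall c, Gam t x c = 0 <-> J (phi c)).
Hypothesis Gam_germ : forall c, ~ J (phi c) -> exists l,
  near0 (fun t x => - ln (Gam t x c) = gev (- ln (q (phi c)), l) t x).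
Hypothesis alg : forall n : 'I_r -> nat, algebraic_mod J phi (\prod_i b i ^+ n i).
Hypothesis bJ : forall i, ~ J (b i).
Hypothesis xs_alg : forall y, y \in xs -> algebraic_mod J phi y /\ ~ J y.
Hypothesis xs_gen : forall a, gen_by phi xs a.

Let q0 c := q (phi c).
Let hq0 : ums q0.
Proof.
have [[q00 qz q1 qM qD] qU] := hq; split; first split; rewrite /q0.
- by move=> x.
- by rewrite rmorph0.
- by rewrite rmorph1.
- by move=> x y; rewrite rmorphM.
- by move=> x y; rewrite rmorphD.
- by move=> x y; rewrite rmorphD.
Qed.
Let ker0 c : q0 c = 0 <-> J (phi c). Proof. exact: kerq. Qed.

(** The value of [y] is one of finitely many expressions in the values of the coefficients of its
    relation. Through [h] the same formula can be used with numbers at the base point and with germs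
    nearby. *)
Lemma slope_formula (G : B -> R) (p : A -> R) (f : {poly B}) (y : A) (h : nat -> R) :
  ums G -> (forall c, G c = 0 <-> J (phi c)) -> ums p -> (forall a, J a -> p a = 0) ->
  (forall c, p (phi c) = G c) -> 0 < p y -> min_relation J phi y f ->
  (forall j, (j < size f)%N -> ~ J (phi f`_j) -> - ln (G f`_j) = h j) ->
  exists j l, [/\ (j < l)%N, (l < size f)%N, ~ J (phi f`_j), ~ J (phi f`_l) &
    - ln (p y) = (l - j)%:R^-1 * (h j - h l)].
Proof.
move=> hG kG hp pJ pG y0 [Vf lf mf] hh.
have [f0 [j [l [jl dj dl]]]] := newton_dominant hG kG hp pJ pG y0 Vf lf.
have [[G0 _ _ _ _] _] := hG.
have v i : dominant G (p y) f i -> ~ J (phi f`_i) /\ (i < size f)%N.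
  move=> /eqP di; split.
    by move=> /kG z; move: f0; rewrite -di /term z mul0r ltxx.
  rewrite ltnNge; apply/negP => si; move: f0; rewrite -di /term nth_default //.
  by case: hG => -[_ -> _ _ _] _; rewrite mul0r ltxx.
have [vj sj] := v _ dj; have [vl sl] := v _ dl.
exists j, l; split => //.
have Gp i : ~ J (phi f`_i) -> 0 < G f`_i by move=> h0; rewrite lt_def G0 andbT; apply/eqP => /kG.
have := eqP dj; rewrite -(eqP dl) /term => /(congr1 (@ln R)).
rewrite !lnM ?posrE ?exprn_gt0 ?Gp // !lnXn // -!hh //.
have jl' : (l - j)%:R != 0 :> R by rewrite pnatr_eq0 subn_eq0 -ltnNge.
rewrite natrB ?(ltnW jl) // in jl' *.
rewrite -![ln _ *+ _]mulr_natl => E; apply: (mulfI jl'); rewrite mulVKf //.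
by move: E; lra.
Qed.

(** Each [b i] has finitely many possible slopes, all given by germs; the difficulty is to choose
    them jointly. The exponents of the monomial [y] separate all combinations of slopes, so that
    prescribing the value of [y] alone, along a germ that starts at the value under [q], determines
    the germs of all the [b i], and does so independently of [(t, x)]. *)
Lemma germ_lift : exists L : 'I_r -> 'rV[rat]_k, near0 (fun t x => exists p : A -> R,
  [/\ ums p, forall a, p a = 0 <-> J a, forall c, p (phi c) = Gam t x c &
    forall i, - ln (p (b i)) = gev (- ln (q (b i)), L i) t x]).
Proof.
have [[q00 qz q1 qM qD] qU] := hq.
have /choice[lf hlf] : forall c, exists l : 'rV[rat]_k, ~ J (phi c) ->
    near0 (fun t x => - ln (Gam t x c) = gev (- ln (q0 c), l) t x).
  move=> c; have [Jc|Jc] := pselect (J (phi c)); first by exists 0.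
  by have [l hl] := Gam_germ Jc; exists l.
pose gm c : germ := (- ln (q0 c), lf c).
(* The germ of the slope of the segment between two indices of the Newton polygon. *)
pose sg (f : {poly B}) (jl : nat * nat) : germ :=
  ((jl.2 - jl.1)%:R^-1 * ((gm f`_jl.1).1 - (gm f`_jl.2).1),
   (jl.2 - jl.1)%:R^-1 *: ((gm f`_jl.1).2 - (gm f`_jl.2).2)).
have gev_sg f jl t x : gev (sg f jl) t x =
    (jl.2 - jl.1)%:R^-1 * (gev (gm f`_jl.1) t x - gev (gm f`_jl.2) t x).
  rewrite /gev /sg /= rformZ rformD rformN.
  have -> : ratr ((jl.2 - jl.1)%:R^-1 : rat) = (jl.2 - jl.1)%:R^-1 :> R by rewrite fmorphV rmorph_nat.
  set a := _%:R^-1; ring.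
have qb i : 0 < q (b i) by rewrite lt_def q00 andbT; apply/eqP => /kerq; exact: bJ.
have algb i : algebraic_mod J phi (b i).
  have := alg (fun j => (j == i)); rewrite (bigD1 i) //= eqxx expr1 big1 ?mulr1 // => j /negPf ->.
  by rewrite expr0.
have [fb hfb] := choice (fun i => min_relation_exists PJ (algb i)).
pose D := (\sum_i size (fb i))%N.
have szD i : (size (fb i) <= D)%N by rewrite /D (bigD1 i) //= leq_addr.
pose Phi : finType := {ffun 'I_r -> 'I_D * 'I_D}.
pose kap (ph : Phi) i : germ := sg (fb i) (nat_of_ord (ph i).1, nat_of_ord (ph i).2).
have fstMn (w : germ) m : (w *+ m).1 = w.1 *+ m by elim: m => // m IH; rewrite !mulrS -IH.
have sndMn (w : germ) m : (w *+ m).2 = w.2 *+ m by elim: m => // m IH; rewrite !mulrS -IH.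
have tfR (c : R) m : c *+ m = 0 -> c = 0 \/ m = 0%N.
  by move=> /eqP; rewrite mulrn_eq0 => /orP[/eqP ->|/eqP ->]; [right|left].
have tf (w : germ) m : w *+ m = 0 -> w = 0 \/ m = 0%N.
  move=> h; have h1 := congr1 fst h; have h2 := congr1 snd h.
  rewrite fstMn in h1; rewrite sndMn /= in h2.
  have [h3|->] := tfR _ _ h1; last by right.
  move: h2; rewrite -scaler_nat => /eqP; rewrite scaler_eq0 pnatr_eq0 => /orP[/eqP ->|/eqP h4]; first by right.
  by left; move: h3 h4; case: (w) => c l /= -> ->.
(* [inl] separates combinations of slopes as germs and gives uniqueness. [inr] separates their
   values at [t = 0], so that the combination found nearby can be compared with the one of [q]
   itself. *)
pose d (s : (Phi * Phi) + (Phi * Phi)) i : germ := match s with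
  | inl p => kap p.1 i - kap p.2 i
  | inr p => ((kap p.1 i).1 - (kap p.2 i).1, 0) end.
have [n hn] := separating_weights d tf.
pose y := \prod_i b i ^+ n i.
have lnp (p : A -> R) : ums p -> (forall i, 0 < p (b i)) ->
    0 < p y /\ - ln (p y) = \sum_i (- ln (p (b i))) *+ n i.
  move=> hp pb; have pX x m := mult_seminormX (proj1 hp) x m.
  have [[_ _ p1 pM _] _] := hp.
  suff : 0 < p y /\ ln (p y) = \sum_i ln (p (b i)) *+ n i.
    move=> [h1 ->]; split=> //; rewrite -sumrN; apply: eq_bigr => i _; by rewrite mulNrn.
  rewrite /y; elim/big_rec2: _ => [|i u v _ [v0 <-]]; first by rewrite p1 ln1.
  by rewrite pM pX mulr_gt0 ?exprn_gt0 // lnM ?posrE ?exprn_gt0 // lnXn.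
have [q_y lnq_y] := lnp q hq qb.
have [f mf] := min_relation_exists PJ (alg n).
have [Vf lf0 minf] := mf.
have qJ a : J a -> q a = 0 by move=> /kerq.
have [f0 [j1 [j2' [j12' d1 d2']]]] := newton_dominant hq0 ker0 hq qJ (fun=> erefl) q_y Vf lf0.
have [j2 d2 m2] := max_dominant hq0 q_y f0.
have j12 : (j1 < j2)%N by apply: leq_trans j12' (m2 _ d2').
have vdom i : dominant q0 (q y) f i -> ~ J (phi f`_i).
  by move=> /eqP di /ker0 z; move: f0; rewrite -di /term z mul0r ltxx.
have v2 := vdom _ d2; have v1 := vdom _ d1.
pose s0 := - ln (q y).
have lnterm (p : B -> R) rho j : ums p -> 0 < rho -> 0 < p f`_j -> - ln (term p rho f j) = - ln (p f`_j) - ln rho *+ j.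
  by move=> hp rho0 pj; rewrite /term lnM ?posrE ?exprn_gt0 // lnXn // opprD.
have q0p c : ~ J (phi c) -> 0 < q0 c by move=> Jc; rewrite lt_def /q0 q00 andbT; apply/eqP => /ker0.
(* j2 is the last dominant index at the base point *)
have base j : ~ J (phi f`_j) -> (gm f`_j2).1 + s0 *+ j2 <= (gm f`_j).1 + s0 *+ j.
  move=> vj; rewrite /gm /= /s0 !mulNrn -!lnterm ?q0p // lerN2 ler_ln ?posrE.
  - by rewrite (eqP d2) (le_pnorm (q y) hq0).
  - by rewrite /term mulr_gt0 ?exprn_gt0 ?q0p.
  - by rewrite /term mulr_gt0 ?exprn_gt0 ?q0p.
have base1 : (gm f`_j2).1 + s0 *+ j2 = (gm f`_j1).1 + s0 *+ j1.
  by rewrite /gm /= /s0 !mulNrn -!lnterm ?q0p // (eqP d2) (eqP d1).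
have base_lt j : ~ J (phi f`_j) -> (j2 < j)%N -> (gm f`_j2).1 + s0 *+ j2 < (gm f`_j).1 + s0 *+ j.
  move=> vj j2j; rewrite /gm /= /s0 !mulNrn -!lnterm ?q0p // ltrN2 ltr_ln ?posrE.
  - rewrite (eqP d2); apply: dominant_term => //; apply/negbTE/negP => /m2.
    by rewrite leqNgt j2j.
  - by rewrite /term mulr_gt0 ?exprn_gt0 ?q0p.
  - by rewrite /term mulr_gt0 ?exprn_gt0 ?q0p.
(* The smallest slope from the left into [j2] remains the slope of an edge for all small [t] and
   nearby [x]. It starts at the value of [y] under [q] because [j1] is a candidate. *)
pose cand := [seq l <- iota 0 j2 | `[< ~ J (phi f`_l) >]].
pose le' (l l' : nat) := gle (sg f (l, j2)) (sg f (l', j2)).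
have [|||l0 l0c l0min] := @exists_min_seq nat le' cand.
- by move=> l l'; exact: gle_total.
- by move=> l l' l''; exact: gle_trans.
- have : j1 \in cand by rewrite mem_filter mem_iota /= add0n j12 andbT; apply/asboolP.
  by case: cand.
move: l0c; rewrite mem_filter mem_iota /= add0n => /andP[/asboolP vl0 l0j2].
pose ss := sg f (l0, j2).
have natj2 l : (l < j2)%N -> 0 < (j2 - l)%:R :> R by move=> h; rewrite ltr0n subn_gt0.
have fst_sg l : (l < j2)%N -> (sg f (l, j2)).1 * (j2 - l)%:R = (gm f`_l).1 - (gm f`_j2).1.
  by move=> h; rewrite /sg /= mulrAC mulVf ?mul1r // gt_eqF ?natj2.
have ss1 : ss.1 = s0.
  apply/eqP; rewrite eq_le; apply/andP; split.
    have /gle_fst h : le' l0 j1.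
      by apply: l0min; rewrite mem_filter mem_iota /= add0n j12 andbT; apply/asboolP.
    apply: le_trans h _; rewrite -(ler_pM2r (natj2 _ j12)) fst_sg // mulr_natr mulrnBr ?(ltnW j12) //.
    by move: base1; lra.
  rewrite -(ler_pM2r (natj2 _ l0j2)) fst_sg // mulr_natr mulrnBr ?(ltnW l0j2) //.
  by move: (base _ vl0); lra.
pose coefOK (G : B -> R) t x (g : {poly B}) j := ~ J (phi g`_j) -> - ln (G g`_j) = gev (gm g`_j) t x.
have N1 : near0 (fun t x => forall i (j : 'I_D), coefOK (Gam t x) t x (fb i) j).
  apply: near0_all => i; apply: near0_all => j.
  have [vj|vj] := pselect (J (phi (fb i)`_j)); first by apply: near0T => t x h; case: h.
  by apply: near0_impl (hlf _ vj) _ => t x h _.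
have N2 : near0 (fun t x => forall j : 'I_(size f), coefOK (Gam t x) t x f j).
  apply: near0_all => j.
  have [vj|vj] := pselect (J (phi f`_j)); first by apply: near0T => t x h; case: h.
  by apply: near0_impl (hlf _ vj) _ => t x h _.
(* Below [j2] this is the minimality of [ss]; above [j2] the inequality is strict already at
   [t = 0], since [j2] is the last dominant index. *)
have N3 : near0 (fun t x => forall j : 'I_(size f), ~ J (phi f`_j) ->
    gev (gm f`_j2) t x + gev ss t x *+ j2 <= gev (gm f`_j) t x + gev ss t x *+ j).
  apply: near0_all => j.
  have [vj|vj] := pselect (J (phi f`_j)); first by apply: near0T => t x h; case: h.
  have [jj2|jj2|->] := ltngtP j j2; last by apply: near0T.
  - have : le' l0 j by apply: l0min; rewrite mem_filter mem_iota /= add0n jj2 andbT; apply/asboolP.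
    move=> /gle_near /near0_impl; apply => t x h _.
    have e : gev (sg f (nat_of_ord j, j2)) t x * (j2 - j)%:R = gev (gm f`_j) t x - gev (gm f`_j2) t x.
      by rewrite gev_sg /= mulrAC mulVf ?mul1r // gt_eqF ?natj2.
    move: h; rewrite -(ler_pM2r (natj2 _ jj2)) e mulr_natr -/ss mulrnBr ?(ltnW jj2) //.
    by lra.
  - have : gpos (gm f`_j + ss *+ j - (gm f`_j2 + ss *+ j2)).
      by left; rewrite /= !fstMn ss1 subr_gt0; exact: base_lt.
    move=> /gpos_near /near0_impl; apply => t x; rewrite gevD gevN !gevD !gevMn subr_gt0 => /ltW //.
(* A combination whose germ differs from [ss] also differs from it in value at every nearby point,
   so an equality of values will give an equality of germs. *)
have N4 : near0 (fun t x => forall ph : Phi, \sum_i kap ph i *+ n i - ss <> 0 ->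
    gev (\sum_i kap ph i *+ n i - ss) t x != 0).
  apply: near0_all => ph; have [z|nz] := pselect (\sum_i kap ph i *+ n i - ss = 0); first by apply: near0T => t x h; case: h.
  by apply: near0_impl (gneq0_near nz) _.
have phex (G : B -> R) (p : A -> R) (h : B -> R) : ums G -> (forall c, G c = 0 <-> J (phi c)) ->
    ums p -> (forall a, J a -> p a = 0) -> (forall c, p (phi c) = G c) -> (forall i, 0 < p (b i)) ->
    (forall i (j : 'I_D), ~ J (phi (fb i)`_j) -> - ln (G (fb i)`_j) = h (fb i)`_j) ->
    exists ph : Phi, forall i, - ln (p (b i)) =
     ((ph i).2 - (ph i).1)%:R^-1 * (h (fb i)`_(ph i).1 - h (fb i)`_(ph i).2).
  move=> hG kG hp pJ pG pb hh.
  have : forall i, exists jl : 'I_D * 'I_D, - ln (p (b i)) =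
     (jl.2 - jl.1)%:R^-1 * (h (fb i)`_jl.1 - h (fb i)`_jl.2).
    move=> i.
    have [|j [l [jl ls vj vl E]]] := @slope_formula G p (fb i) (b i) (fun j => h (fb i)`_j) hG kG hp pJ pG (pb i) (hfb i).
      by move=> j js vj; rewrite (hh i (Ordinal (leq_trans js (szD i)))).
    have lD := leq_trans ls (szD i).
    by exists (Ordinal (ltn_trans jl lD), Ordinal lD).
  move=> /choice[g hg]; exists [ffun i => g i] => i; rewrite ffunE; exact: hg.
have pos (p : A -> R) : ums p -> (forall a, p a = 0 <-> J a) -> forall i, 0 < p (b i).
  by move=> [[p0 _ _ _ _] _] kp i; rewrite lt_def p0 andbT; apply/eqP => /kp; exact: bJ.
have main : near0 (fun t x => exists p, exists ph : Phi, [/\ ums p, forall a, p a = 0 <-> J a,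
    forall c, p (phi c) = Gam t x c, forall i, - ln (p (b i)) = gev (kap ph i) t x &
    \sum_i kap ph i *+ n i = ss]).
  apply: near0_impl (near0_and hGam (near0_and N1 (near0_and N2 (near0_and N3 N4)))) _.
  move=> t x [[hG kG] [C1 [C2 [C3 C4]]]].
  have [[G0 Gz _ _ _] _] := hG.
  pose rho := expR (- gev ss t x); have rho0 : 0 < rho by exact: expR_gt0.
  have Gp c : ~ J (phi c) -> 0 < Gam t x c by move=> Jc; rewrite lt_def G0 andbT; apply/eqP => /kG.
  have szv j : ~ J (phi f`_j) -> (j < size f)%N.
    move=> vj; rewrite ltnNge; apply/negP => h; apply: vj; rewrite nth_default // rmorph0.
    by case: PJ => -[].
  have lnt j : ~ J (phi f`_j) -> - ln (term (Gam t x) rho f j) = gev (gm f`_j) t x + gev ss t x *+ j.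
    move=> vj; rewrite lnterm ?Gp // expRK (C2 (Ordinal (szv _ vj))) //=.
    by rewrite -mulNrn opprK.
  have tp j : ~ J (phi f`_j) -> 0 < term (Gam t x) rho f j.
    by move=> vj; rewrite /term mulr_gt0 ?exprn_gt0 ?Gp.
  have le2 j : term (Gam t x) rho f j <= term (Gam t x) rho f j2.
    have [vj|vj] := pselect (J (phi f`_j)).
      by rewrite {1}/term (proj2 (kG _) vj) mul0r ltW // tp.
    rewrite -ler_ln ?posrE ?tp // -lerN2 !lnt //.
    exact: (C3 (Ordinal (szv _ vj))).
  have pn : pnorm (Gam t x) rho f = term (Gam t x) rho f j2.
    apply/eqP; rewrite eq_le (le_pnorm rho hG) andbT; apply: pnorm_le => //.
    by rewrite ltW // tp.
  have e0 : term (Gam t x) rho f l0 = term (Gam t x) rho f j2.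
    apply: ln_inj; rewrite ?posrE ?tp //; apply: oppr_inj; rewrite !lnt //.
    have e : gev ss t x * (j2 - l0)%:R = gev (gm f`_l0) t x - gev (gm f`_j2) t x.
      by rewrite gev_sg /= mulrAC mulVf ?mul1r // gt_eqF ?natj2.
    by move: e; rewrite mulr_natr mulrnBr ?(ltnW l0j2) //; lra.
  have td : two_dominant (Gam t x) rho f.
    split; first by rewrite pn tp.
    by exists l0, j2; split => //; rewrite /dominant pn ?e0.
  have [p [hp kp pG py]] := extend_with_slope PJ hG kG xs_alg xs_gen mf rho0 td.
  have pb := pos p hp kp.
  have [|ph hph] := phex (Gam t x) p (fun c => gev (gm c) t x) hG kG hp _ pG pb C1.
    by move=> a /kp.
  have hph' i : - ln (p (b i)) = gev (kap ph i) t x by rewrite hph gev_sg.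
  exists p, ph; split => //.
  have [_ lnpy] := lnp p hp pb.
  apply: contrapT => h; have := C4 ph; rewrite gevD gevN gev_sum => /(_ _) C4'.
  have /C4' : \sum_i kap ph i *+ n i - ss <> 0 by move=> /subr0_eq.
  under eq_bigr do rewrite gevMn -hph'.
  by rewrite -lnpy py expRK opprK subrr eqxx.
have [t1 [x1 [p1 [ph1 [hp1 kp1 pG1 pb1 Sph1]]]]] := near0_ex main.
have uniq ph : \sum_i kap ph i *+ n i = ss -> forall i, kap ph i = kap ph1 i.
  move=> Sph i; apply: contrapT => ne.
  apply: (hn (inl (ph, ph1))); first by exists i => /= /subr0_eq.
  rewrite /d /=; under eq_bigr do rewrite mulrnBl.
  by rewrite sumrB Sph Sph1 subrr.
have [ph0 hph0] := phex q0 q (fun c => (gm c).1) hq0 ker0 hq qJ (fun=> erefl) qb (fun i j _ => erefl).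
have fst1 i : (kap ph1 i).1 = - ln (q (b i)).
  have -> : - ln (q (b i)) = (kap ph0 i).1 by rewrite hph0.
  apply: contrapT => ne; apply: (hn (inr (ph1, ph0))).
    by exists i => /= /(congr1 fst) /= /subr0_eq.
  rewrite /d /=.
  have sumE (F : 'I_r -> R) : \sum_j ((F j, 0) : germ) *+ n j = (\sum_j F j *+ n j, 0).
    elim/big_rec2: _ => // j u v _ ->; congr pair; rewrite /= ?fstMn //.
    by rewrite sndMn /= mul0rn addr0.
  rewrite sumE; congr pair.
  under eq_bigr do rewrite mulrnBl.
  have fstS ph : (\sum_i kap ph i *+ n i).1 = \sum_i (kap ph i).1 *+ n i.
    by elim/big_rec2: _ => // j u v _ <-; rewrite /= fstMn.
  rewrite sumrB -fstS Sph1 ss1 /s0 lnq_y.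
  by apply/eqP; rewrite subr_eq0; apply/eqP; apply: eq_bigr => j _; rewrite hph0.
exists (fun i => (kap ph1 i).2); apply: near0_impl main _ => t x [p [ph [hp kp pG pb Sph]]].
exists p; split => // i; rewrite pb (uniq _ Sph) -fst1.
by case: (kap ph1 i).
Qed.

End Germs.

(** * The Gauss norm *)

Section AbsoluteValue.
Context {R : realType} {K : fieldType} (v : valuation R K).
Implicit Types (x y : K).

Lemma absvE x r : v x = r%:E -> absv v x = expR (- r).
Proof. by rewrite /absv => ->; rewrite -EFinN. Qed.

Lemma absv0 : absv v 0 = 0.
Proof. by rewrite /absv val0. Qed.

Lemma absv_gt0 x : x != 0 -> 0 < absv v x.
Proof. by move=> /(val_fin v)[r /absvE ->]; exact: expR_gt0. Qed.

Lemma absv_ge0 x : 0 <= absv v x.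
Proof. by have [->|/absv_gt0/ltW//] := eqVneq x 0; rewrite absv0. Qed.

Lemma absv_eq0 x : absv v x = 0 -> x = 0.
Proof. by move=> h; apply/eqP; apply: contra_eqT h => /absv_gt0 /gt_eqF ->. Qed.

Lemma absvM x y : absv v (x * y) = absv v x * absv v y.
Proof.
have [->|x0] := eqVneq x 0; first by rewrite mul0r absv0 mul0r.
have [->|y0] := eqVneq y 0; first by rewrite mulr0 absv0 mulr0.
have [r hr] := val_fin v x0; have [s hs] := val_fin v y0.
have : v (x * y) = (r + s)%:E by rewrite Defs.valM hr hs.
by move=> /absvE ->; rewrite (absvE hr) (absvE hs) opprD expRD.
Qed.

Lemma absv1 : absv v 1 = 1.
Proof. by rewrite (@absvE 1 0) ?oppr0 ?expR0 // Defs.val1. Qed.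

Lemma absvN x : absv v (- x) = absv v x.
Proof. by rewrite /absv valN. Qed.

Lemma absv_le x (C : R) : (absv v x <= expR (- C)) = (C%:E <= v x)%E.
Proof.
have [->|/(val_fin v)[r hr]] := eqVneq x 0; first by rewrite absv0 expR_ge0 val0 leey.
by rewrite (absvE hr) hr ler_expR lerN2 lee_fin.
Qed.

Lemma absvD x y : absv v (x + y) <= Num.max (absv v x) (absv v y).
Proof.
have [->|x0] := eqVneq x 0; first by rewrite add0r le_max lexx orbT.
have m0 : 0 < Num.max (absv v x) (absv v y) by rewrite lt_max absv_gt0.
rewrite -[leRHS](lnK m0) -[ln _]opprK absv_le; apply: valD_ge; rewrite -absv_le opprK lnK //.
  by rewrite le_max lexx.
by rewrite le_max lexx orbT.
Qed.

Lemma absvV x : absv v x^-1 = (absv v x)^-1.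
Proof.
have [->|x0] := eqVneq x 0; first by rewrite invr0 absv0 invr0.
by apply: (mulfI (lt0r_neq0 (absv_gt0 x0))); rewrite -absvM !mulfV ?absv1 // lt0r_neq0 ?absv_gt0.
Qed.

Lemma absv_complete (s : nat -> K) (C th : R) : 0 <= th -> th < 1 -> 0 <= C ->
  (forall n, absv v (s n.+1 - s n) <= C * th ^+ n) ->
  exists l, forall n, absv v (l - s n) <= C * th ^+ n.
Proof.
move=> th0 th1 C0 hs.
have mono i j : (i <= j)%N -> C * th ^+ j <= C * th ^+ i.
  move=> ij; rewrite ler_wpM2l // -(subnK ij) exprD ler_piMl ?exprn_ge0 //.
  by rewrite exprn_ile1 // ltW.
have cauchy i j : (i <= j)%N -> absv v (s j - s i) <= C * th ^+ i.
  elim: j => [|j IH]; first by rewrite leqn0 => /eqP ->; rewrite subrr absv0 mulr_ge0 // exprn_ge0.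
  rewrite leq_eqVlt => /orP[/eqP ->|]; first by rewrite subrr absv0 mulr_ge0 // exprn_ge0.
  rewrite ltnS => ij; rewrite -[_ - s i](subrKA (s j)) (le_trans (absvD _ _)) // ge_max IH //.
  by rewrite andbT (le_trans (hs _)) // mono.
have small (e : R) : 0 < e -> exists N, C * th ^+ N <= e.
  move=> e0; have C1 : 0 < C + 1 by rewrite ltr_wpDl.
  have [N hN] := geometric_lt th0 th1 (divr_gt0 e0 C1); exists N.
  rewrite ltr_pdivlMr // in hN; apply: le_trans (ltW hN).
  by rewrite mulrC ler_wpM2l ?exprn_ge0 // lerDl.
have [C' |l hl] := @val_complete _ _ v s.
  have [N hN] := small _ (expR_gt0 (- C')); exists N => i j Ni Nj.
  rewrite -absv_le; have [ij|/ltnW ij] := leqP i j.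
    by rewrite -absvN opprB (le_trans (cauchy _ _ ij)) // (le_trans (mono _ _ Ni)).
  by rewrite (le_trans (cauchy _ _ ij)) // (le_trans (mono _ _ Nj)).
exists l => n; rewrite leNgt; apply/negP => h.
have h0 : 0 < absv v (l - s n) by apply: le_lt_trans h; rewrite mulr_ge0 // exprn_ge0.
have [N hN] := hl (- ln (absv v (l - s n) / 2)).
have := hN (maxn N n) (leq_maxl _ _); rewrite -absv_le opprK lnK ?posrE ?divr_gt0 // => h1.
have : absv v (l - s n) < absv v (l - s n); last by rewrite ltxx.
rewrite -{1}(subrKA (s (maxn N n)) l); apply: le_lt_trans (absvD _ _) _.
rewrite gt_max -absvN opprB (le_lt_trans h1) ?ltr_pdivrMr ?ltr_pMr ?ltr1n //=.
by rewrite (le_lt_trans (cauchy _ _ (leq_maxr _ _))).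
Qed.

End AbsoluteValue.

Section Restr.
Context {R : realType} {K : fieldType} (v : valuation R K).
Context {A : zmodType} (S : addrClosed A) (w : {additive A -> R}).
Local Notation KU := (restr v S w).
Local Notation nrm := (@gauss_norm R K v A S w).
Implicit Types (f g h : KU) (u x : A).

Definition tm f u : R := absv v (f u) * expR (- w u).

Lemma tm_ge0 f u : 0 <= tm f u.
Proof. by rewrite mulr_ge0 ?absv_ge0 ?expR_ge0. Qed.

Lemma tm_le_expR f u C : (tm f u <= expR (- C)) = (C%:E <= v (f u) + (w u)%:E)%E.
Proof.
rewrite /tm expRN -ler_pdivlMr ?invr_gt0 ?expR_gt0 // invrK -expRD.
by rewrite -[X in expR X]opprK absv_le opprD opprK EFinB leeBlDr.
Qed.

Lemma tm_finite f (e : R) : 0 < e -> finite_set [set u | e < tm f u].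
Proof.
move=> e0; apply: sub_finite_set (coef_null f (- ln e)) => u /= h.
by rewrite ltNge -tm_le_expR opprK lnK ?posrE // -ltNge.
Qed.

Lemma tm_bounded f : exists C : R, forall u, tm f u <= C.
Proof.
pose E := fset_set [set u | 1 < tm f u].
exists (1 + \sum_(u <- E) tm f u) => u.
have s0 P : 0 <= \sum_(u <- E | P u) tm f u by apply: sumr_ge0 => *; exact: tm_ge0.
have [h|h] := leP (tm f u) 1; first by rewrite (le_trans h) // lerDl (s0 xpredT).
have uE : u \in E by rewrite in_fset_set ?inE //; exact: tm_finite.
by rewrite (big_fsetD1 u) //= addrCA lerDl addr_ge0 // sumr_ge0 // => *; exact: tm_ge0.
Qed.

Lemma le_nrm f u : tm f u <= nrm f.
Proof.
have [C hC] := tm_bounded f; apply: ub_le_sup; last by exists u.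
by exists C => _ [u' _ <-]; exact: hC.
Qed.

Lemma nrm_le f c : (forall u, tm f u <= c) -> nrm f <= c.
Proof. by move=> h; apply: ge_sup; [exists (tm f 0), 0|move=> _ [u _ <-]; exact: h]. Qed.

Lemma nrm_ge0 f : 0 <= nrm f.
Proof. exact: le_trans (tm_ge0 f 0) (le_nrm f 0). Qed.

Lemma nrm_attained f : exists u, tm f u = nrm f.
Proof.
have [n0|n0] := eqVneq (nrm f) 0.
  by exists 0; apply/eqP; rewrite eq_le le_nrm n0 tm_ge0.
have {}n0 : 0 < nrm f by rewrite lt_def n0 nrm_ge0.
apply: contrapT => /forallNP h.
have lt u : tm f u < nrm f by rewrite lt_def le_nrm andbT eq_sym; apply/eqP/h.
pose E := fset_set [set u | nrm f / 2 < tm f u].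
pose m := \big[Num.max/nrm f / 2]_(u : E) tm f (val u).
have : nrm f <= m.
  apply: nrm_le => u; have [hu|hu] := leP (tm f u) (nrm f / 2).
    by apply: le_trans hu _; exact: bigmax_ge_id.
  have uE : u \in E by rewrite in_fset_set ?inE //; apply: tm_finite; rewrite divr_gt0.
  exact: (le_bigmax _ (fun u : E => tm f (val u)) [` uE]%fset).
rewrite leNgt => /negP; apply; apply/bigmax_ltP; split => //.
by rewrite ltr_pdivrMr // ltr_pMr // ltr1n.
Qed.

Lemma coefD f g u : (f + g) u = f u + g u. Proof. by []. Qed.
Lemma coefN f u : (- f) u = - f u. Proof. by []. Qed.
Lemma coefB f g u : (f - g) u = f u - g u. Proof. by []. Qed.
Lemma coef0 u : (0 : KU) u = 0. Proof. by []. Qed.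
Lemma coef1 u : (1 : KU) u = (u == 0)%:R. Proof. by []. Qed.
Lemma coef_sum (I : Type) (s : seq I) (P : pred I) (F : I -> KU) u :
  (\sum_(i <- s | P i) F i) u = \sum_(i <- s | P i) F i u.
Proof. by elim/big_rec2: _ => // i y z _ <-. Qed.

Lemma nrm0 : nrm 0 = 0.
Proof.
apply/eqP; rewrite eq_le nrm_ge0 andbT; apply: nrm_le => u.
by rewrite /tm absv0 mul0r.
Qed.

Lemma nrm_eq0 f : nrm f = 0 -> f = 0.
Proof.
move=> h; apply: restr_eq => u; apply: (@absv_eq0 _ _ v); apply/eqP.
have := le_nrm f u; rewrite h /tm pmulr_lle0 ?expR_gt0 // => h1.
by rewrite eq_le h1 absv_ge0.
Qed.

Lemma nrmN f : nrm (- f) = nrm f.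
Proof. by congr (sup _); apply/seteqP; split => _ [u _ <-]; exists u; rewrite //= absvN. Qed.

Lemma nrmD f g : nrm (f + g) <= Num.max (nrm f) (nrm g).
Proof.
apply: nrm_le => u; rewrite /tm coefD.
have e0 := ltW (expR_gt0 (- w u)).
apply: le_trans (ler_wpM2r e0 (absvD _ _ _)) _.
by rewrite maxr_pMl // ge_max !le_max !le_nrm /= orbT.
Qed.

Lemma coefM_le f g u c : 0 < c ->
  (forall x y, x + y = u -> absv v (f x) * absv v (g y) <= c) -> absv v ((f * g) u) <= c.
Proof.
move=> c0 h; rewrite -[c](lnK c0) -[ln c]opprK absv_le /= /mul_coef /push.
apply: family_sum_ge => [[x y] /=|]; last exact: tensor_fiber.
case: eqP => [xy|_]; last by rewrite val0 leey.
by rewrite -absv_le opprK lnK // /tensor absvM h.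
Qed.

Lemma nrmM_le f g : nrm (f * g) <= nrm f * nrm g.
Proof.
have [->|f0] := eqVneq f 0; first by rewrite mul0r nrm0 mul0r.
have [->|g0] := eqVneq g 0; first by rewrite mulr0 nrm0 mulr0.
have pos f' : f' != 0 -> 0 < nrm f'.
  by move=> h; rewrite lt_def nrm_ge0 andbT; apply: contra h => /eqP/nrm_eq0/eqP.
apply: nrm_le => u; rewrite /tm expRN -ler_pdivlMr ?invr_gt0 ?expR_gt0 // invrK.
apply: coefM_le => [|x y <-]; first by rewrite !mulr_gt0 ?pos ?expR_gt0.
rewrite raddfD expRD mulrACA; apply: ler_pM; rewrite ?absv_ge0 //.
  by have := le_nrm f x; rewrite /tm expRN ler_pdivrMr ?expR_gt0.
by have := le_nrm g y; rewrite /tm expRN ler_pdivrMr ?expR_gt0.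
Qed.

Lemma nrm_submult : submult nrm.
Proof. by split; [exact: nrm_ge0|exact: nrm0|exact: nrmN|exact: nrmD|exact: nrmM_le]. Qed.

Lemma nrm_sum_le (I : Type) (s : seq I) (P : pred I) (F : I -> KU) c : 0 <= c ->
  (forall i, P i -> nrm (F i) <= c) -> nrm (\sum_(i <- s | P i) F i) <= c.
Proof. by move=> c0; apply: ultrametric_sum => //; [exact: nrm0|exact: nrmD]. Qed.

Local Notation mon := (@mono R K v A S w).

Lemma coef_mono c u x : u \in S -> mon c u x = if x == u then c else 0.
Proof. by move=> uS; rewrite /= /mono_coef; case: eqP => //= ->; rewrite uS. Qed.

Lemma mono0 u : mon 0 u = 0.
Proof. by apply: restr_eq => x; rewrite /= /mono_coef if_same. Qed.

Lemma monoD c c' u : mon (c + c') u = mon c u + mon c' u.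
Proof. by apply: restr_eq => x; rewrite /= /mono_coef; case: ifP => // _; rewrite addr0. Qed.

Lemma monoN c u : mon (- c) u = - mon c u.
Proof. by apply: restr_eq => x; rewrite /= /mono_coef; case: ifP => // _; rewrite oppr0. Qed.

Lemma nrm_mono c u : u \in S -> nrm (mon c u) = absv v c * expR (- w u).
Proof.
move=> uS; apply/eqP; rewrite eq_le; apply/andP; split; last first.
  by have := le_nrm (mon c u) u; rewrite /tm coef_mono // eqxx.
apply: nrm_le => x; rewrite /tm coef_mono //; case: eqP => [->//|_].
by rewrite absv0 mul0r mulr_ge0 ?absv_ge0 ?expR_ge0.
Qed.

Lemma coef_monoM c u f x : u \in S -> (mon c u * f) x = c * f (x - u).
Proof.
move=> uS; rewrite /= /mul_coef /push (family_sum1 v (i0 := (u, x - u))) /=.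
  by rewrite addrC subrK eqxx /tensor coef_mono // eqxx.
move=> [a b]; rewrite xpair_eqE /tensor /= => ab; case: eqP => // abx.
rewrite /mono_coef; case: (eqVneq a u) ab => [au|] /=; last by rewrite mul0r.
by rewrite -abx au addrAC subrr add0r eqxx.
Qed.

Lemma monoM c c' u u' : u \in S -> u' \in S -> mon c u * mon c' u' = mon (c * c') (u + u').
Proof.
move=> uS u'S; apply: restr_eq => x; rewrite coef_monoM // !coef_mono ?rpredD //.
by rewrite subr_eq [u' + u]addrC; case: eqP => //; rewrite mulr0.
Qed.

Lemma mono1 : mon 1 0 = 1.
Proof. by apply: restr_eq => x; rewrite coef_mono ?rpred0 // coef1; case: eqP. Qed.

Lemma coefZ c f x : (mon c 0 * f) x = c * f x.
Proof. by rewrite coef_monoM ?rpred0 // subr0. Qed.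

Definition mpart (E : seq A) f : KU := \sum_(u <- E) mon (f u) u.

Lemma coef_mpart (E : seq A) f x : uniq E -> mpart E f x = if x \in E then f x else 0.
Proof.
move=> uE; rewrite coef_sum; have [xE|xE] := boolP (x \in E).
  rewrite (bigD1_seq x) //= big1_seq => [|u /andP[ux _]]; last first.
    by rewrite /mono_coef eq_sym (negPf ux).
  rewrite addr0 /mono_coef eqxx /=; have [//|xS] := boolP (x \in S).
  by rewrite coef_supp.
rewrite big1_seq // => u /andP[_ uE']; rewrite /= /mono_coef; case: eqP => // xu.
by rewrite xu uE' in xE.
Qed.

Lemma approx f (e : R) : 0 < e -> exists2 E : seq A, uniq E &
  (forall u, u \in E -> u \in S) /\ nrm (f - mpart E f) <= e.
Proof.
move=> e0; pose E := fset_set [set u | e < tm f u].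
exists E; first exact: fset_uniq.
have EP u : u \in (E : seq A) = (e < tm f u).
  by rewrite in_fset_set ?mem_setE //; exact: tm_finite.
split=> [u|].
  rewrite EP => h; apply: contraLR h => uS.
  by rewrite -leNgt /tm coef_supp // absv0 mul0r ltW.
apply: nrm_le => u; rewrite /tm coefB coef_mpart ?fset_uniq // EP.
case: ltP => h; first by rewrite subrr absv0 mul0r ltW.
by rewrite subr0.
Qed.

Lemma approx_finite f : (finite_set [set u | f u != 0]) -> exists2 E : seq A, uniq E &
  (forall u, u \in E -> u \in S) /\ f = mpart E f.
Proof.
move=> fin; pose E := fset_set [set u | f u != 0].
have EP u : u \in (E : seq A) = (f u != 0) by rewrite in_fset_set ?mem_setE.
exists E; first exact: fset_uniq.
split => [u|].
  by rewrite EP; apply: contraR => /(coef_supp f) ->.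
by apply: restr_eq => u; rewrite coef_mpart ?fset_uniq // EP; case: eqP => // ->.
Qed.

Definition supp_in (T : set A) f : Prop := forall u, f u != 0 -> T u.

Lemma supp_inD T f g : supp_in T f -> supp_in T g -> supp_in T (f + g).
Proof.
move=> hf hg u; rewrite coefD; have [->|/hf //] := eqVneq (f u) 0.
by rewrite add0r => /hg.
Qed.

Lemma supp_inN T f : supp_in T f -> supp_in T (- f).
Proof. by move=> hf u; rewrite coefN oppr_eq0 => /hf. Qed.

Lemma supp_in0 T : supp_in T 0.
Proof. by move=> u; rewrite coef0 eqxx. Qed.

Lemma supp_in_sum T (I : Type) (s : seq I) (P : pred I) (F : I -> KU) :
  (forall i, P i -> supp_in T (F i)) -> supp_in T (\sum_(i <- s | P i) F i).
Proof. by move=> h; elim/big_ind: _ => //; [exact: supp_in0|exact: supp_inD]. Qed.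

Lemma supp_in_mono T c u : T u -> supp_in T (mon c u).
Proof. by move=> Tu x; rewrite /= /mono_coef; case: (eqVneq x u) => [->//|_] /=; rewrite eqxx. Qed.

Lemma supp_inM T f g : (forall x y, T x -> T y -> T (x + y)) ->
  supp_in T f -> supp_in T g -> supp_in T (f * g).
Proof.
move=> TD hf hg u; apply: contraPP => nTu; apply/negP; rewrite negbK.
apply/eqP; rewrite /= /mul_coef /push (family_sum1 v (i0 := (0, 0))) => [|[x y] _].
  case: ifP => //= /eqP z; rewrite /tensor /=; have [->|/hf T0] := eqVneq (f 0) 0; first by rewrite mul0r.
  have [->|/hg T1] := eqVneq (g 0) 0; first by rewrite mulr0.
  by case: nTu; rewrite -z /=; exact: TD.
case: ifP => //= /eqP xy; rewrite /tensor /=; have [->|/hf Tx] := eqVneq (f x) 0; first by rewrite mul0r.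
have [->|/hg Ty] := eqVneq (g y) 0; first by rewrite mulr0.
by case: nTu; rewrite -xy; exact: TD.
Qed.

(** Coefficients converge one by one; the rate is uniform after weighting, which makes the limit a
    null family again. *)
Lemma nrm_complete (x : nat -> KU) (C th : R) T : 0 <= th -> th < 1 -> 0 <= C ->
  (forall n, nrm (x n) <= C * th ^+ n) -> (forall n, supp_in T (x n)) ->
  exists2 y, supp_in T y & forall N, nrm (y - \sum_(i < N) x i) <= C * th ^+ N.
Proof.
move=> th0 th1 C0 hx xT.
pose s u n := (\sum_(i < n) x i) u.
have /choice[y hy] : forall u, exists l, forall n, absv v (l - s u n) <= C * expR (w u) * th ^+ n.
  move=> u; apply: absv_complete => // [|n]; first by rewrite mulr_ge0 ?expR_ge0.
  rewrite /s big_ord_recr coefD /= addrC addKr.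
  have := le_trans (le_nrm (x n) u) (hx n).
  by rewrite /tm expRN ler_pdivrMr ?expR_gt0 // mulrAC.
have small (e : R) : 0 < e -> exists N, C * th ^+ N <= e.
  move=> e0; have C1 : 0 < C + 1 by rewrite ltr_wpDl.
  have [N hN] := geometric_lt th0 th1 (divr_gt0 e0 C1); exists N.
  rewrite ltr_pdivlMr // in hN; apply: le_trans (ltW hN).
  by rewrite mulrC ler_wpM2l ?exprn_ge0 // lerDl.
have limz u : (forall n, s u n = 0) -> y u = 0.
  move=> su0; apply: (@absv_eq0 _ _ v); apply: contrapT => /eqP yu.
  have yu0 : 0 < absv v (y u) by rewrite lt_def yu absv_ge0.
  have [N hN] := small (absv v (y u) / 2 / expR (w u)) (divr_gt0 (divr_gt0 yu0 (ltr0n _ 2)) (expR_gt0 _)).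
  have := hy u N; rewrite su0 subr0 mulrAC leNgt => /negP; apply.
  rewrite ler_pdivlMr ?expR_gt0 // in hN; apply: le_lt_trans hN _.
  by rewrite ltr_pdivrMr // ltr_pMr // ltr1n.
have ysupp u : u \notin S -> y u = 0 by move=> uS; apply: limz => n; rewrite /s coef_supp.
have close u n : absv v (y u - s u n) * expR (- w u) <= C * th ^+ n.
  by rewrite expRN ler_pdivrMr ?expR_gt0 // mulrAC hy.
have ynull : wnull v w y.
  move=> C'; have [N hN] := small _ (expR_gt0 (- C')).
  apply: sub_finite_set (tm_finite (\sum_(i < N) x i) (expR_gt0 (- C'))) => u /=.
  rewrite ltNge => /negP h; rewrite ltNge; apply/negP => h1; apply: h.
  have e0 := expR_gt0 (- w u).
  suff : absv v (y u) * expR (- w u) <= expR (- C').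
    rewrite expRN -ler_pdivlMr ?invr_gt0 ?expR_gt0 // invrK -expRD.
    by rewrite -[X in expR X]opprK absv_le opprD opprK EFinB leeBlDr.
  rewrite -(subrK (s u N) (y u)) (le_trans (ler_wpM2r (ltW e0) (absvD _ _ _))) //.
  by rewrite (maxr_pMl _ _ (ltW e0)) ge_max (le_trans (close u N)).
exists (Restr ysupp ynull) => [u /=|N].
  apply: contraPP => nTu; apply/negP; rewrite negbK; apply/eqP/limz => n.
  have h : supp_in T (\sum_(i < n) x i) by apply: supp_in_sum => i _; exact: xT.
  by have [//|/h] := eqVneq (s u n) 0.
by apply: nrm_le => u; rewrite /tm coefB /=; exact: close.
Qed.

End Restr.

#[global] Opaque restrM restrD restrN restr0 restr1 mul_coef family_sum mono.

Lemma bernoulli (R : realType) (d : R) n : 0 <= d -> 1 + n%:R * d <= (1 + d) ^+ n.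
Proof.
move=> d0; elim: n => [|n IH]; first by rewrite mul0r addr0 expr0.
rewrite exprS; apply: le_trans (ler_wpM2l (addr_ge0 ler01 d0) IH).
rewrite -natr1 -subr_ge0; have -> : (1 + d) * (1 + n%:R * d) - (1 + (n%:R + 1) * d) = n%:R * d ^+ 2 by ring.
by rewrite mulr_ge0 // exprn_ge0.
Qed.

Lemma exists_ge_nat (R : realType) (c : R) : exists n : nat, c <= n%:R.
Proof. by exists (Num.truncn c).+1; rewrite ltW // Num.Theory.truncnS_gt. Qed.

(** The binomial formula gives [p (x + y) ^+ n <= n.+1%:R * M ^+ n], and a ratio above 1 would grow
    exponentially. With exponent [2n] the square of Bernoulli's inequality already exceeds [2n + 1],
    so no roots need to be taken. *)
Lemma ultrametric_of_nat (R : realType) (B : comNzRingType) (p : B -> R) : mult_seminorm p ->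
  (forall n, p n%:R <= 1) -> ultrametric p.
Proof.
move=> hp pn x y; have [p0 pz p1 pM pD] := hp; have pX := mult_seminormX hp.
set M := Num.max _ _; have M0 : 0 <= M by rewrite le_max p0.
have psum (I : Type) (s : seq I) (F : I -> B) : p (\sum_(i <- s) F i) <= \sum_(i <- s) p (F i).
  elim/big_rec2: _ => [|i a b _ h]; first by rewrite pz.
  by rewrite (le_trans (pD _ _)) // lerD2l.
have key n : p (x + y) ^+ n <= n.+1%:R * M ^+ n.
  rewrite -pX exprDn (le_trans (psum _ _ _)) //.
  rewrite -[n.+1 in leRHS]card_ord mulr_natl -sumr_const; apply: ler_sum => i _.
  rewrite -mulr_natl !pM !pX -[leRHS]mul1r; apply: ler_pM; rewrite ?mulr_ge0 ?exprn_ge0 //.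
  have ile : (i <= n)%N by rewrite -ltnS.
  rewrite -[X in _ <= M ^+ X](subnK ile) exprD; apply: ler_pM; rewrite ?exprn_ge0 // lerXn2r ?nnegrE //.
    by rewrite le_max lexx.
  by rewrite le_max lexx orbT.
rewrite leNgt; apply/negP => lt.
have [M00|Mn0] := eqVneq M 0.
  by have := key 1; rewrite !expr1 M00 mulr0 leNgt -M00 lt.
have {}M0 : 0 < M by rewrite lt_def Mn0.
pose d := p (x + y) / M - 1; have d0 : 0 < d by rewrite subr_gt0 ltr_pdivlMr // mul1r.
have key2 n : (1 + d) ^+ n <= n.+1%:R.
  by rewrite /d addrCA subrr addr0 expr_div_n ler_pdivrMr ?exprn_gt0.
have [n hn] := exists_ge_nat (2 / d ^+ 2 + 1).
have d2 : 0 < d ^+ 2 by rewrite exprn_gt0.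
have n1 : 1 <= n%:R :> R by rewrite (le_trans _ hn) // lerDr divr_ge0 // ltW.
have hn2 : 2 < n%:R * d ^+ 2.
  by rewrite -ltr_pdivrMr // (lt_le_trans _ hn) // ltrDl.
have := key2 (n * 2)%N; rewrite exprM leNgt => /negP; apply.
apply: (@lt_le_trans _ _ ((1 + n%:R * d) ^+ 2)); last first.
  have b := bernoulli n (ltW d0).
  have b0 : 0 <= 1 + n%:R * d by rewrite addr_ge0 ?mulr_ge0 // ltW.
  by rewrite lerXn2r ?nnegrE // (le_trans b0).
rewrite -natr1 natrM -subr_gt0.
have -> : (1 + n%:R * d) ^+ 2 - (n%:R * 2%:R + 1) = n%:R * (n%:R * d ^+ 2 - 2) + 2 * n%:R * d by ring.
by rewrite ltr_pwDl ?mulr_gt0 ?mulr_ge0 // ?subr_gt0 // ?ltW // ?(lt_le_trans ltr01 n1).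
Qed.

Lemma absvD_eq (R : realType) (K : fieldType) (v : valuation R K) x y :
  absv v y < absv v x -> absv v (x + y) = absv v x.
Proof.
move=> yx; apply/eqP; rewrite eq_le; apply/andP; split.
  by apply: le_trans (absvD v _ _) _; rewrite ge_max lexx ltW.
have := absvD v (x + y) (- y); rewrite addrK absvN le_max => /orP[//|].
by rewrite leNgt yx.
Qed.

Section Gauss.
Context {R : realType} {K : fieldType} (v : valuation R K) {n : nat}.
Local Notation A := 'rV[int]_n.
Context (S : addrClosed A) (w : {additive A -> R}).
Local Notation KU := (restr v S w).
Local Notation nrm := (@gauss_norm R K v A S w).
Local Notation mon := (@mono R K v A S w).
Implicit Types (f g h : KU).

Lemma nrm_gt0 f : f != 0 -> 0 < nrm f.
Proof. by move=> f0; rewrite lt_def nrm_ge0 andbT; apply: contra f0 => /eqP/nrm_eq0/eqP. Qed.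

(** Takes the place of a monomial order on the finitely many exponents that matter. *)
Lemma separating_functional (E : seq A) : exists phi : {additive A -> int},
  forall u u', u \in E -> u' \in E -> phi u = phi u' -> u = u'.
Proof.
pose I := seq_sub E.
have [|m hm] := @separating_weights int n (I * I)%type (fun p j => ssval p.1 0 j - ssval p.2 0 j).
  by move=> z k /eqP; rewrite mulrn_eq0 => /orP[/eqP ->|/eqP ->]; [right|left].
pose phi (u : A) : int := \sum_j u 0 j *+ m j.
have phiP : nmod_morphism phi.
  split; first by rewrite /phi big1 // => j _; rewrite mxE mul0rn.
  by move=> u u'; rewrite /phi -big_split; apply: eq_bigr => j _; rewrite mxE mulrnDl.
pose phi' := GRing.isNmodMorphism.Build A int phi phiP.
pose Phi : {additive A -> int} := HB.pack phi phi'.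
exists Phi => u u' uE u'E E'; apply: contrapT => ne.
apply: (hm (SeqSub uE, SeqSub u'E)) => /=.
  apply: contrapT => /forallNP h; apply: ne; apply/rowP => j.
  by apply: subr0_eq; exact: contrapT (h j).
by under eq_bigr do rewrite mulrnBl; rewrite sumrB; apply/eqP; rewrite subr_eq0; apply/eqP.
Qed.

Lemma dominant_finite f : f != 0 -> exists2 X : seq A, forall u, (u \in X) = (tm f u == nrm f) &
  X != [::].
Proof.
move=> f0; have n0 := nrm_gt0 f0.
have fin : finite_set [set u | tm f u = nrm f].
  apply: sub_finite_set (tm_finite f (divr_gt0 n0 (ltr0n _ 2))) => u /= ->.
  by rewrite ltr_pdivrMr // ltr_pMr // ltr1n.
exists (fset_set [set u | tm f u = nrm f]) => [u|].
  by rewrite in_fset_set //; apply/idP/eqP => [/set_mem //|h]; exact: mem_set.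
have [u hu] := nrm_attained f.
have : u \in fset_set [set u | tm f u = nrm f] by rewrite in_fset_set //; exact: mem_set.
move=> h; have {h} : u \in (fset_set [set u | tm f u = nrm f] : seq A) by [].
by case: (enum_fset _).
Qed.

(** Gauss's lemma: [u0] and [v0] are the dominant exponents extreme for [phi], so that at [u0 + v0]
    only one product is maximal. The convolution is infinite, hence the other products must be
    bounded away from the maximum uniformly. *)
Lemma nrmM f g : nrm (f * g) = nrm f * nrm g.
Proof.
have [->|f0] := eqVneq f 0; first by rewrite mul0r nrm0 mul0r.
have [->|g0] := eqVneq g 0; first by rewrite mulr0 nrm0 mulr0.
apply/eqP; rewrite eq_le nrmM_le /=.
have F0 := nrm_gt0 f0; have G0 := nrm_gt0 g0.
have [X hX Xn0] := dominant_finite f0; have [Y hY Yn0] := dominant_finite g0.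
have [phi hphi] := separating_functional (X ++ Y).
pose le u u' := phi u' <= phi u.
have le_tot u u' : le u u' \/ le u' u by apply/orP; exact: le_total.
have le_tr u' u u'' : le u u' -> le u' u'' -> le u u'' by move=> h1 h2; exact: le_trans h2 h1.
have [u0 u0X u0max] := exists_min_seq le_tot le_tr Xn0.
have [v0 v0Y v0max] := exists_min_seq le_tot le_tr Yn0.
have u0n : tm f u0 = nrm f by apply/eqP; rewrite -hX.
have v0n : tm g v0 = nrm g by apply/eqP; rewrite -hY.
have suppS h u : tm h u != 0 -> u \in S.
  by apply: contraR => uS; rewrite /tm coef_supp // absv0 mul0r.
have u0S : u0 \in S by apply: (suppS f); rewrite u0n gt_eqF.
have v0S : v0 \in S by apply: (suppS g); rewrite v0n gt_eqF.
pose c := u0 + v0.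
have strict a b : a + b = c -> a != u0 -> tm f a * tm g b < nrm f * nrm g.
  move=> ab au.
  have [fa|fa] := eqVneq (tm f a) (nrm f); last first.
    apply: le_lt_trans (ler_wpM2l (tm_ge0 f a) (le_nrm g b)) _.
    by rewrite ltr_pM2r // lt_def le_nrm eq_sym fa.
  have [gb|gb] := eqVneq (tm g b) (nrm g); last first.
    apply: le_lt_trans (ler_wpM2r (tm_ge0 g b) (le_nrm f a)) _.
    by rewrite ltr_pM2l // lt_def le_nrm eq_sym gb.
  have aX : a \in X by rewrite hX fa.
  have bY : b \in Y by rewrite hY gb.
  have h1 := u0max _ aX; have h2 := v0max _ bY; rewrite /le in h1 h2.
  have e : phi a + phi b = phi u0 + phi v0 by rewrite -!raddfD ab.
  have : a = u0.
    by apply: hphi; rewrite ?mem_cat ?aX ?u0X //; move: h1 h2 e; clear; lia.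
  by move=> E; rewrite E eqxx in au.
pose f' := f - mon (f u0) u0.
have cE : (f * g) c = f u0 * g v0 + (f' * g) c.
  have cu : c - u0 = v0 by rewrite /c addrAC subrr add0r.
  have -> : f' * g = f * g - mon (f u0) u0 * g by exact: mulrBl.
  by rewrite (coefB (f * g) (mon (f u0) u0 * g)) [X in _ + (_ - X)]coef_monoM // cu addrC subrK.
have f'E a : f' a = if a == u0 then 0 else f a.
  by rewrite /f' coefB coef_mono //; case: eqP => [->|_]; rewrite ?subrr ?subr0.
pose e := expR (w c); have e0 : 0 < e by exact: expR_gt0.
pose E := fset_set [set u | nrm f / 2 < tm f u].
have EP a : a \in E = (nrm f / 2 < tm f a).
  by rewrite in_fset_set ?mem_setE //; apply: tm_finite; rewrite divr_gt0.
(* Outside the finite set [E] the first factor is at most half the norm, and on [E] there are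
   finitely many strict inequalities: [m] is a uniform strict bound. *)
pose m := \big[Num.max/nrm f / 2 * nrm g]_(a : E | val a != u0) (tm f (val a) * tm g (c - val a)).
have m_lt : m < nrm f * nrm g.
  apply/bigmax_ltP; split; first by rewrite ltr_pM2r // ltr_pdivrMr // ltr_pMr // ltr1n.
  by move=> a au; apply: strict => //; rewrite addrC subrK.
have m_gt0 : 0 < m by apply: lt_le_trans (bigmax_ge_id _ _ _ _); rewrite mulr_gt0 ?divr_gt0.
have bound a : a != u0 -> tm f a * tm g (c - a) <= m.
  move=> au; have [aE|aE] := boolP (a \in E).
    exact: (le_bigmax_cond _ (fun a : E => tm f (val a) * tm g (c - val a)) (j := [` aE]%fset)).
  apply: le_trans (bigmax_ge_id _ _ _ _); apply: ler_pM; rewrite ?tm_ge0 ?le_nrm //.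
  by move: aE; rewrite EP -leNgt.
have tmc (x y : K) a b : a + b = c -> absv v x * absv v y = absv v x * expR (- w a) * (absv v y * expR (- w b)) * e.
  by move=> ab; rewrite /e -ab raddfD expRD !expRN; field; rewrite !gt_eqF ?expR_gt0.
have small : absv v ((f' * g) c) <= m * e.
  apply: coefM_le => [|a b ab]; first by rewrite mulr_gt0.
  rewrite f'E; case: eqP => [_|/eqP au]; first by rewrite absv0 mul0r ltW // mulr_gt0.
  rewrite (tmc _ _ _ _ ab) ler_pM2r //.
  by have := bound a au; rewrite -ab addrC addKr.
have main : absv v (f u0 * g v0) = nrm f * nrm g * e.
  by rewrite absvM (tmc _ _ u0 v0) // -!/(tm _ _) u0n v0n.
apply: le_trans (le_nrm _ c); rewrite /tm cE absvD_eq ?main; last first.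
  by apply: le_lt_trans small _; rewrite ltr_pM2r.
by rewrite -mulrA -expRD subrr expR0 mulr1.
Qed.

Lemma restr_integral f g : f * g = 0 -> f = 0 \/ g = 0.
Proof.
move=> fg; have := nrmM f g; rewrite fg nrm0 => /esym/eqP; rewrite mulf_eq0.
by case/orP => /eqP/nrm_eq0; [left|right].
Qed.

Lemma nrm1 : nrm 1 = 1.
Proof. by rewrite -mono1 nrm_mono ?rpred0 // absv1 mul1r raddf0 oppr0 expR0. Qed.

Lemma nrm_ums : ums nrm.
Proof.
split; last exact: nrmD.
split; [exact: nrm_ge0|exact: nrm0|exact: nrm1|exact: nrmM|].
by move=> f g; rewrite (le_trans (nrmD _ _)) // ge_max lerDl lerDr !nrm_ge0.
Qed.

Lemma nrm_nat k : nrm k%:R <= 1.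
Proof. by rewrite -nrm1; apply: ultrametricMn; [exact: nrm_ge0|exact: nrm0|exact: nrmD]. Qed.

(** Both sides are multiplicative, so applying the bound to high powers of [f] removes the
    constant. *)
Lemma bounded_le_nrm (p : KU -> R) C : mult_seminorm p -> (forall f, p f <= C * nrm f) ->
  forall f, p f <= nrm f.
Proof.
move=> hp pC f; rewrite leNgt; apply/negP => lt.
have [p0 _ p1 _ _] := hp.
have C0 : 0 < C.
  by apply: lt_le_trans ltr01 _; have := pC 1; rewrite p1 nrm1 mulr1.
have pf : 0 < p f by apply: le_lt_trans lt; exact: nrm_ge0.
have [|||k hk] := @geometric_lt R (nrm f / p f) C^-1.
- by rewrite divr_ge0 ?nrm_ge0.
- by rewrite ltr_pdivrMr // mul1r.
- by rewrite invr_gt0.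
move: hk.
rewrite expr_div_n ltr_pdivrMr ?exprn_gt0 // mulrC ltr_pdivlMr // mulrC ltNge => /negP; apply.
by rewrite -(mult_seminormX hp) -(mult_seminormX (proj1 nrm_ums)).
Qed.

Lemma spectrum_ums a p : spectrum a p ->
  [/\ ums p, forall f, p f <= nrm f & forall f, a f -> p f = 0].
Proof.
move=> [hp [[C pC] pa]]; have le := bounded_le_nrm hp pC.
split => //; split => //; apply: ultrametric_of_nat => // k.
exact: le_trans (le _) (nrm_nat k).
Qed.

Lemma spectrumP a p : ums p -> (forall f, p f <= nrm f) -> (forall f, a f -> p f = 0) -> spectrum a p.
Proof. by move=> [hp _] le pa; split => //; split => //; exists 1 => f; rewrite mul1r. Qed.

(** A nonzero monomial and its inverse are both bounded by their norms, and the two norms have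
    product 1. *)
Lemma spectrum_mono a p c u : (forall u, u \in S -> - u \in S) -> u \in S -> spectrum a p ->
  p (mon c u) = absv v c * expR (- w u).
Proof.
move=> SN uS /spectrum_ums[[[p0 pz p1 pM _] _] le _].
have [->|c0] := eqVneq c 0; first by rewrite mono0 pz absv0 mul0r.
rewrite -(nrm_mono v w c uS); apply/eqP; rewrite eq_le le /=.
have E : mon c u * mon c^-1 (- u) = 1 by rewrite monoM ?SN // mulfV // subrr mono1.
have := congr1 p E; rewrite pM p1 => E1.
have := congr1 nrm E; rewrite nrmM nrm1 => E2.
have m0 : 0 < nrm (mon c^-1 (- u)) by rewrite nrm_mono ?SN // mulr_gt0 ?expR_gt0 ?absv_gt0 ?invr_eq0.
rewrite -(ler_pM2r m0) E2 -E1 ler_wpM2l //.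
Qed.

End Gauss.

(** * Noether normalization *)

Section FiniteOver.
Context {R : realType} {K : fieldType} (v : valuation R K) {n : nat}.
Local Notation A := 'rV[int]_n.
Context (S : addrClosed A) (w : {additive A -> R}).
Local Notation KU := (restr v S w).
Local Notation nrm := (@gauss_norm R K v A S w).
Local Notation mon := (@mono R K v A S w).
Implicit Types (f g h a b : KU) (T : set A) (P : set KU).
Hypothesis SN : forall u, u \in S -> - u \in S.

Let SMz u (z : int) : u \in S -> u *~ z \in S.
Proof.
move=> uS; case: z => z; first by rewrite -pmulrn rpredMn.
by rewrite NegzE mulrNz -pmulrn SN // rpredMn.
Qed.

Lemma nrm_mon_gt0 u : u \in S -> 0 < nrm (mon 1 u).
Proof. by move=> uS; rewrite nrm_mono // absv1 mul1r expR_gt0. Qed.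

(** The approximate decomposition is iterated on its own error, which shrinks by the factor [th];
    the successive coefficients form geometric series supported in [T i]. *)
Lemma approx_exact (I : finType) (G : I -> KU) (C : I -> R) (T : I -> set A) (th : R) :
  0 <= th -> th < 1 -> (forall i, 0 <= C i) ->
  (forall a, exists x a1, [/\ a = \sum_i x i * G i + a1, forall i, supp_in (T i) (x i),
     forall i, nrm (x i) <= C i * nrm a & nrm a1 <= th * nrm a]) ->
  forall a, exists x, [/\ a = \sum_i x i * G i, forall i, supp_in (T i) (x i) &
     forall i, nrm (x i) <= C i * nrm a].
Proof.
move=> th0 th1 C0 /choice[X hX] a.
have {hX} /choice[N hN] := hX.
pose s k := iter k N a.
have sle k : nrm (s k) <= nrm a * th ^+ k.
  elim: k => [|k IH]; first by rewrite expr0 mulr1.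
  have [_ _ _ h] := hN (s k); rewrite /s iterS -/(s k) (le_trans h) // exprS mulrCA.
  by rewrite ler_wpM2l.
have /choice[y hy] : forall i, exists y, supp_in (T i) y /\
    forall M, nrm (y - \sum_(k < M) X (s k) i) <= C i * nrm a * th ^+ M.
  move=> i; have [|||k|k|y y1 y2] := @nrm_complete _ _ v A S w (fun k => X (s k) i) (C i * nrm a) th (T i).
  - by [].
  - by [].
  - by rewrite mulr_ge0 ?nrm_ge0.
  - by have [_ _ h _] := hN (s k); rewrite (le_trans (h i)) // -mulrA ler_wpM2l.
  - by have [_ h _ _] := hN (s k); exact: h.
  - by exists y.
exists y; split => [|i|i]; [|by case: (hy i)|]; last first.
  by have [_ /(_ 0%N)] := hy i; rewrite big_ord0 subr0 expr0 mulr1.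
have tel M : a = \sum_i (\sum_(k < M) X (s k) i) * G i + s M.
  elim: M => [|M IH].
    by rewrite big1 ?add0r // => i _; rewrite big_ord0 mul0r.
  have [E _ _ _] := hN (s M).
  under eq_bigr do rewrite big_ord_recr /= mulrDl.
  rewrite big_split /= -addrA; apply: (etrans IH); congr (_ + _); exact: E.
pose B := nrm a * (1 + \sum_i C i * nrm (G i)).
have B0 : 0 <= B.
  rewrite mulr_ge0 ?nrm_ge0 // addr_ge0 // sumr_ge0 // => i _; rewrite mulr_ge0 ?nrm_ge0 //.
have close M : nrm (a - \sum_i y i * G i) <= B * th ^+ M.
  have -> : a - \sum_i y i * G i = s M - \sum_i (y i - \sum_(k < M) X (s k) i) * G i.
    rewrite {1}(tel M); under [X in _ = _ - X]eq_bigr do rewrite mulrBl.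
    by rewrite sumrB opprB addrA; congr (_ - _); exact: addrC.
  have thM : 0 <= th ^+ M by rewrite exprn_ge0.
  have s0 : 0 <= \sum_i C i * nrm (G i) by apply: sumr_ge0 => i _; rewrite mulr_ge0 ?nrm_ge0.
  apply: le_trans (nrmD _ _) _; rewrite nrmN ge_max; apply/andP; split.
    apply: le_trans (sle M) _; rewrite ler_wpM2r // /B ler_peMr ?nrm_ge0 // lerDl //.
  apply: nrm_sum_le => [|i _]; first by rewrite mulr_ge0.
  rewrite nrmM; have [_ /(_ M) h] := hy i.
  apply: le_trans (ler_wpM2r (nrm_ge0 _) h) _.
  rewrite mulrAC; apply: ler_wpM2r => //.
  rewrite /B mulrAC [nrm a * _]mulrC ler_wpM2r ?nrm_ge0 //.
  rewrite (bigD1 i) //= addrCA lerDl addr_ge0 // sumr_ge0 // => j _.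
  by rewrite mulr_ge0 ?nrm_ge0.
apply/eqP; rewrite -subr_eq0; apply/eqP/(@nrm_eq0 _ _ v); apply/eqP; rewrite eq_le nrm_ge0 andbT.
rewrite leNgt; apply/negP => d0.
have B1 : 0 < B + 1 by rewrite ltr_wpDl.
have [M hM] := geometric_lt th0 th1 (divr_gt0 d0 B1).
have := close M; rewrite leNgt => /negP; apply.
rewrite ltr_pdivlMr // in hM; apply: le_lt_trans hM.
by rewrite mulrC ler_wpM2l ?exprn_ge0 // lerDl.
Qed.

(* KU / P is finite over K<T>, with generators chi^m, and the error terms in P are controlled. *)
Definition finite_over T P : Prop :=
  exists (I J : finType) (m : I -> A) (h : J -> KU) (C : R),
  [/\ 0 <= C, forall i, m i \in S, forall j, P (h j) &
   forall a, exists (b : I -> KU) (c : J -> KU),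
     [/\ a = \sum_i b i * mon 1 (m i) + \sum_j c j * h j, forall i, supp_in T (b i),
       forall i, nrm (b i * mon 1 (m i)) <= nrm a & forall j, nrm (c j) <= C * nrm a]].

Lemma finite_over_approx T P (I J : finType) (m : I -> A) (h : J -> KU) (C th : R) :
  0 <= th -> th < 1 -> 0 <= C -> (forall i, m i \in S) -> (forall j, P (h j)) ->
  (forall a, exists (b : I -> KU) (c : J -> KU) a1,
     [/\ a = \sum_i b i * mon 1 (m i) + \sum_j c j * h j + a1, forall i, supp_in T (b i),
       forall i, nrm (b i * mon 1 (m i)) <= nrm a, forall j, nrm (c j) <= C * nrm a &
       nrm a1 <= th * nrm a]) ->
  finite_over T P.
Proof.
move=> th0 th1 C0 mS hP approx; exists I, J, m, h, C; split => // a.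
pose G (i : I + J) := match i with inl i => mon 1 (m i) | inr j => h j end.
pose CC (i : I + J) := match i with inl i => (nrm (mon 1 (m i)))^-1 | inr j => C end.
pose TT (i : I + J) := match i with inl i => T | inr j => setT end.
have [|{}a|x [E xT xn]] := @approx_exact _ G CC TT th th0 th1 _ _ a.
- by case=> [i|j] //=; rewrite invr_ge0 nrm_ge0.
- have [b [c [a1 [E bT bn cn a1n]]]] := approx a.
  exists (fun i => match i with inl i => b i | inr j => c j end), a1; split => //.
  + by rewrite big_sumType.
  + by case=> [i|j].
  + case=> [i|j] //=; rewrite mulrC ler_pdivlMr ?nrm_mon_gt0 // -nrmM; exact: bn.
exists (fun i => x (inl i)), (fun j => x (inr j)); split.
- by rewrite {1}E big_sumType.
- by move=> i; exact: (xT (inl i)).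
- by move=> i; have := xn (inl i); rewrite /= mulrC ler_pdivlMr ?nrm_mon_gt0 // -nrmM.
- by move=> j; exact: (xn (inr j)).
Qed.

Lemma finite_over_self P : finite_over [set u | u \in S] P.
Proof.
exists unit, void, (fun=> 0), (fun j : void => 0), 0.
split => [//|i|[]|a]; first exact: rpred0.
exists (fun=> a), (fun=> 0); split => [||_|[]].
- by rewrite big_const card_unit /= addr0 [X in _ + X]big1 ?addr0 ?mono1 ?mulr1 //; case.
- by move=> _ u; apply: contraR => /(coef_supp a) ->.
- by rewrite mono1 mulr1.
Qed.

Section Division.
Variables (T T' : set A) (e : A) (d : nat) (gc : 'I_d.+1 -> KU) (c0 cd : K) (t0 td : A).
Hypotheses (eS : e \in S) (T'S : forall t, T' t -> t \in S) (T'0 : T' 0).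
Hypotheses (T'D : forall t t', T' t -> T' t' -> T' (t + t')) (T'N : forall t, T' t -> T' (- t)).
Hypothesis TE : forall t, T t -> exists t' z, T' t' /\ t = t' + e *~ z.
Let g := \sum_(l < d.+1) gc l * mon 1 (e *~ (l : nat)).
Let r := nrm g.
Hypotheses (gT : forall l, supp_in T' (gc l)) (gn : forall l, nrm (gc l * mon 1 (e *~ (l : nat))) <= r).
Hypotheses (g0E : gc ord0 = mon c0 t0) (gdE : gc ord_max = mon cd td) (Tt0 : T' t0) (Ttd : T' td).
Hypotheses (r0 : 0 < r) (g0n : nrm (gc ord0) = r) (gdn : nrm (gc ord_max * mon 1 (e *~ d)) = r).

Let EZ (z : int) : e *~ z \in S. Proof. exact: SMz. Qed.

(** Division by [g] with remainder of degree below [d] in [chi^e]. The bound [rho] is carried along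
    because the division will be iterated on an error term. *)
Definition divides_up (rho : R) (a : KU) : Prop := exists (b : 'I_d -> KU) Q,
  [/\ a = \sum_l b l * mon 1 (e *~ (l : nat)) + Q * g, forall l, supp_in T' (b l),
    forall l, nrm (b l * mon 1 (e *~ (l : nat))) <= rho & nrm Q * r <= rho].

Lemma divides_up0 rho : 0 <= rho -> divides_up rho 0.
Proof.
move=> h; exists (fun=> 0), 0; split.
- by rewrite mul0r addr0 big1 // => l _; rewrite mul0r.
- by move=> l; exact: supp_in0.
- by move=> l; rewrite mul0r nrm0.
- by rewrite nrm0 mul0r.
Qed.

Lemma divides_upD rho a a' : divides_up rho a -> divides_up rho a' -> divides_up rho (a + a').
Proof.
move=> [b [Q [-> h1 h2 h3]]] [b' [Q' [-> h1' h2' h3']]].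
exists (fun l => b l + b' l), (Q + Q'); split.
- by under [in RHS]eq_bigr do rewrite mulrDl; rewrite big_split /= mulrDl addrACA.
- by move=> l; apply: supp_inD.
- move=> l; have -> : (b l + b' l) * mon 1 (e *~ (l : nat)) = b l * mon 1 (e *~ (l : nat)) + b' l * mon 1 (e *~ (l : nat)) by exact: mulrDl.
  apply: (le_trans (nrmD (b l * mon 1 (e *~ (l : nat))) (b' l * mon 1 (e *~ (l : nat))))).
  by rewrite ge_max; apply/andP; split; [exact: h2|exact: h2'].
- have := nrmD Q Q'; rewrite -(ler_pM2r r0) maxr_pMl ?(ltW r0) // => /le_trans; apply.
  by rewrite ge_max h3 h3'.
Qed.

Lemma divides_upM rho b a : supp_in T' b -> divides_up rho a -> divides_up (nrm b * rho) (b * a).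
Proof.
move=> bT [b' [Q [-> h1 h2 h3]]]; exists (fun l => b * b' l), (b * Q); split.
- by rewrite mulrDr mulr_sumr mulrA; congr (_ + _); apply: eq_bigr => l _; rewrite mulrA.
- by move=> l; exact: supp_inM.
- by move=> l; rewrite -mulrA nrmM ler_wpM2l ?nrm_ge0.
- by rewrite nrmM -mulrA ler_wpM2l ?nrm_ge0.
Qed.

Lemma divides_upG rho Q : nrm Q * r <= rho -> divides_up rho (Q * g).
Proof.
move=> h; have rho0 : 0 <= rho by apply: le_trans h; rewrite mulr_ge0 ?nrm_ge0 // ltW.
exists (fun=> 0), Q; split => //.
- by rewrite big1 ?add0r // => l _; rewrite mul0r.
- by move=> l; exact: supp_in0.
- by move=> l; rewrite mul0r nrm0.
Qed.

Lemma divides_upN rho a : divides_up rho a -> divides_up rho (- a).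
Proof.
move=> h; have -> : - a = mon (-1) 0 * a by rewrite monoN mono1 mulN1r.
have -> : rho = nrm (mon (-1) 0) * rho by rewrite monoN nrmN mono1 nrm1 mul1r.
by apply: divides_upM => //; exact: supp_in_mono.
Qed.

Lemma divides_up_le rho rho' a : rho <= rho' -> divides_up rho a -> divides_up rho' a.
Proof.
move=> le [b [Q [h0 h1 h2 h3]]]; exists b, Q; split => // [l|]; exact: le_trans le.
Qed.

Lemma divides_up_sum rho (I : Type) (s : seq I) (P : pred I) (F : I -> KU) : 0 <= rho ->
  (forall i, P i -> divides_up rho (F i)) -> divides_up rho (\sum_(i <- s | P i) F i).
Proof. by move=> h hF; elim/big_ind: _ => //; [exact: divides_up0|exact: divides_upD]. Qed.

Let me (z : int) := mon 1 (e *~ z).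
Let meD z z' : me (z + z') = me z * me z'.
Proof. by rewrite /me monoM // mulr1 mulrzDr. Qed.

(* The monomial e^z rewritten through the unit coefficient of g at l0. *)
Let step (l0 : 'I_d.+1) c t z : gc l0 = mon c t -> T' t -> nrm (gc l0 * me (l0 : nat)) = r ->
  (forall l, l != l0 -> divides_up (nrm (me (z - (l0 : nat)%:Z + (l : nat)%:Z))) (me (z - (l0 : nat)%:Z + (l : nat)%:Z))) ->
  divides_up (nrm (me z)) (me z).
Proof.
move=> glE Tt gln IH.
have tS := T'S Tt; have ntS := SN tS.
have c_neq0 : c != 0.
  apply/eqP => c00; move: gln r0; rewrite glE c00 mono0 mul0r nrm0 => <-.
  by rewrite ltxx.
pose X := mon c^-1 (- t).
have Xg : X * gc l0 = 1 by rewrite glE /X monoM // mulVf // addNr mono1.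
pose y := z - (l0 : nat)%:Z.
have Xn : nrm X * r = nrm (me (l0 : nat)) by rewrite -gln -nrmM mulrA Xg mul1r.
have E : me z = me y * X * g - \sum_(l < d.+1 | l != l0) X * gc l * me (y + (l : nat)%:Z).
  rewrite /g (bigD1 l0) //= mulrDr mulr_sumr -addrA -sumrB.
  rewrite [X in _ + X]big1 ?addr0 => [|l _].
    by rewrite -mulrA [X * _]mulrA Xg mul1r -/(me _) -meD subrK.
  apply/eqP; rewrite subr_eq0 (meD y) -/(me (l : nat)%:Z); apply/eqP.
  by rewrite -mulrA [in RHS]mulrCA -!mulrA; congr (_ * _).
rewrite [X in divides_up _ X]E; apply: divides_upD.
  apply: divides_upG; rewrite nrmM -mulrA Xn -nrmM -meD subrK //.
apply: divides_upN; apply: divides_up_sum => [|l ll0]; first exact: nrm_ge0.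
apply: divides_up_le (divides_upM _ (IH l ll0)); last first.
  by apply: supp_inM => //; apply: supp_in_mono; exact: T'N.
rewrite -/y nrmM meD nrmM mulrA mulrAC -mulrA -mulrA.
rewrite (_ : nrm (gc l) * (nrm (me (l : nat)) * _) = nrm (gc l * me (l : nat)) * nrm (me y)); last first.
  by rewrite nrmM mulrA.
rewrite mulrA; apply: le_trans (ler_wpM2r (nrm_ge0 _) (ler_wpM2l (nrm_ge0 _) (gn l))) _.
by rewrite Xn -nrmM -meD addrC subrK.
Qed.

(** Exponents [z >= d] are lowered through the top coefficient of [g], negative ones are raised
    through the bottom one. This is why both are assumed to be monomials carrying the full norm of
    [g]. *)
Lemma divides_up_mon (z : int) : divides_up (nrm (mon 1 (e *~ z))) (mon 1 (e *~ z)).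
Proof.
have pos (k : nat) : divides_up (nrm (me k)) (me k).
  elim/ltn_ind: k => k IH; have [kd|dk] := ltnP k d.
    exists (fun l => if l == Ordinal kd then 1 else 0), 0; split.
    - rewrite (bigD1 (Ordinal kd)) //= eqxx mul1r big1 ?addr0 ?mul0r ?addr0 // => l /negPf ->.
      by rewrite mul0r.
    - by move=> l; case: eqP => _; [rewrite -mono1; exact: supp_in_mono|exact: supp_in0].
    - by move=> l; case: eqP => [->|_]; [rewrite mul1r|rewrite mul0r nrm0 nrm_ge0].
    - by rewrite nrm0 mul0r nrm_ge0.
  apply: (step gdE Ttd) => // l ll.
  have {}ll : (l < d)%N by rewrite ltn_neqAle -ltnS ltn_ord andbT.
  rewrite /= (_ : k%:Z - d%:Z + (l : nat)%:Z = (k - d + l)%N%:Z); last by lia.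
  by apply: IH; lia.
have neg (k : nat) : divides_up (nrm (me (- k%:Z))) (me (- k%:Z)).
  elim/ltn_ind: k => k IH; case: k IH => [|k] IH; first by rewrite oppr0; exact: (pos 0%N).
  apply: (step g0E Tt0) => [|l l0].
    by rewrite /= /me mulr0z mono1 mulr1.
  rewrite /= subr0; have {}l0 : (0 < l)%N by rewrite lt0n; apply: contra l0 => /eqP h; apply/eqP/val_inj.
  have [kl|lk] := leqP k.+1 l.
    by rewrite (_ : - k.+1%:Z + (l : nat)%:Z = (l - k.+1)%N%:Z); [exact: pos|lia].
  rewrite (_ : - k.+1%:Z + (l : nat)%:Z = - (k.+1 - l)%N%:Z); last by lia.
  by apply: IH; lia.
case: z => k; first exact: pos.
by rewrite NegzE; exact: neg.
Qed.

Lemma divides_up_finite (E : seq A) b : supp_in T b -> divides_up (nrm b) (mpart E b).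
Proof.
move=> bT; apply: divides_up_sum => [|u _]; first exact: nrm_ge0.
have [->|bu] := eqVneq (b u) 0; first by rewrite mono0; apply: divides_up0; exact: nrm_ge0.
have [t' [z [Tt' uE]]] := TE (bT _ bu); have t'S := T'S Tt'.
have -> : mon (b u) u = mon (b u) t' * mon 1 (e *~ z) by rewrite monoM // mulr1 -uE.
apply: divides_up_le (divides_upM (supp_in_mono Tt') (divides_up_mon z)).
rewrite -nrmM monoM // mulr1 -uE nrm_mono; last by rewrite uE rpredD.
exact: le_nrm.
Qed.

(** Weierstrass division: each coefficient over [T] is divided by [g], and modulo [P] the quotient
    times [g] becomes the quotient times [f], an error smaller by the factor [nrm f / r]. The
    relation [g - f] joins the generators of [P]. *)
Lemma finite_over_step P f : is_ideal P -> finite_over T P -> P (g - f) -> nrm f < r ->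
  finite_over T' P.
Proof.
move=> Pid [I [J [m [h [C [C0 mS hP ex]]]]]] Pgf fr.
(* The bound [1 / 2] leaves room, even when [f] is 0, for truncating the coefficients to finite sums
   of monomials before dividing. *)
pose th := Num.max (nrm f / r) (1 / 2).
have th0 : 0 < th by rewrite lt_max [X in _ || X]divr_gt0 ?orbT.
have th1 : th < 1.
  rewrite gt_max; apply/andP; split; first by rewrite ltr_pdivrMr // mul1r; exact: fr.
  by rewrite ltr_pdivrMr // mul1r ltr1n.
pose h' (j : option J) := if j is Some j then h j else g - f.
have rV : 0 <= r^-1 by rewrite invr_ge0 ltW.
apply: (@finite_over_approx T' P (I * 'I_d)%type (option J) (fun p => m p.1 + e *~ (p.2 : nat)) h'
    (Num.max C r^-1) th) => //.
- exact: ltW.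
- by rewrite le_max C0.
- by move=> p; rewrite rpredD.
- by case.
move=> a; have [b [c [Ea bT bn cn]]] := ex a.
have /choice[D hD] : forall i, exists D : ('I_d -> KU) * KU * KU,
   [/\ b i = \sum_l D.1.1 l * mon 1 (e *~ (l : nat)) + D.1.2 * g + D.2, forall l, supp_in T' (D.1.1 l),
    forall l, nrm (D.1.1 l * mon 1 (e *~ (l : nat))) <= nrm (b i), nrm D.1.2 * r <= nrm (b i) &
    nrm D.2 <= th * nrm (b i)].
  move=> i; have [bi0|bi0] := eqVneq (nrm (b i)) 0.
    exists ((fun=> 0), 0, 0); split => /=.
    - by rewrite mul0r !addr0 big1 => [|l _]; rewrite ?mul0r //; exact: nrm_eq0.
    - by move=> l; exact: supp_in0.
    - by move=> l; rewrite mul0r nrm0 nrm_ge0.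
    - by rewrite nrm0 mul0r nrm_ge0.
    - by rewrite nrm0 mulr_ge0 ?nrm_ge0 // ltW.
  have [|E _ [_ hE]] := @approx _ _ v A S w (b i) (th * nrm (b i)).
    by rewrite mulr_gt0 // lt_def bi0 nrm_ge0.
  have [b' [Q [EQ h1 h2 h3]]] := divides_up_finite E (bT i).
  exists (b', Q, b i - mpart E (b i)); split => //=.
  by rewrite -EQ addrC subrK.
pose Qm i := (D i).1.2 * mon 1 (m i).
exists (fun p => (D p.1).1.1 p.2), (fun j => if j is Some j then c j else \sum_i Qm i),
  ((\sum_i Qm i) * f + \sum_i (D i).2 * mon 1 (m i)).
have monE i (l : 'I_d) : mon 1 (m i + e *~ (l : nat)) = mon 1 (e *~ (l : nat)) * mon 1 (m i).
  by rewrite monoM // mulr1 addrC.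
have Qn i : nrm (Qm i) <= r^-1 * nrm a.
  have [_ _ _ h4 _] := hD i; rewrite nrmM [leRHS]mulrC ler_pdivlMr // mulrAC.
  by apply: le_trans (ler_wpM2r (nrm_ge0 _) h4) _; rewrite -nrmM.
have ra : 0 <= r^-1 * nrm a by rewrite mulr_ge0 ?nrm_ge0.
split.
- rewrite {1}Ea; have -> : \sum_i b i * mon 1 (m i) =
      \sum_i \sum_l (D i).1.1 l * mon 1 (m i + e *~ (l : nat)) + (\sum_i Qm i) * g + \sum_i (D i).2 * mon 1 (m i).
    rewrite mulr_suml -!big_split; apply: eq_bigr => i _ /=; have [E _ _ _ _] := hD i.
    rewrite {1}E !mulrDl mulr_suml; congr (_ + _ + _); last by rewrite /Qm mulrAC.
    by apply: eq_bigr => l _; rewrite monE mulrA.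
  rewrite pair_bigA /= (bigD1 None) //= [in RHS](reindex_omap Some id) /=; last by case.
  under [X in _ = _ + (_ + X) + _]eq_bigl do rewrite eqxx.
  rewrite mulrBr; set X1 := \sum_ _ _; set X2 := \sum_(j : J) _; set X3 := \sum_i _ * _; set Y := \sum_i _.
  by ring.
- by move=> [i l] /=; have [_ h1 _ _ _] := hD i; exact: h1.
- move=> [i l] /=; have [_ _ h2 _ _] := hD i; rewrite monE mulrA nrmM.
  by apply: le_trans (ler_wpM2r (nrm_ge0 _) (h2 l)) _; rewrite -nrmM.
- move=> [j|]; first by rewrite (le_trans (cn j)) // ler_wpM2r ?nrm_ge0 // le_max lexx.
  apply: (@le_trans _ _ (r^-1 * nrm a)); last by rewrite ler_wpM2r ?nrm_ge0 // le_max lexx orbT.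
  exact: nrm_sum_le.
- have ta : 0 <= th * nrm a by rewrite mulr_ge0 ?nrm_ge0 // ltW.
  rewrite (le_trans (nrmD _ _)) // ge_max; apply/andP; split.
    rewrite nrmM; apply: (@le_trans _ _ (r^-1 * nrm a * nrm f)).
      by rewrite ler_wpM2r ?nrm_ge0 //; exact: nrm_sum_le.
    by rewrite mulrAC ler_wpM2r ?nrm_ge0 // le_max mulrC lexx.
  apply: nrm_sum_le => // i _; have [_ _ _ _ h5] := hD i; rewrite nrmM.
  by apply: le_trans (ler_wpM2r (nrm_ge0 _) h5) _; rewrite -mulrA -nrmM ler_wpM2l // ltW.
Qed.

End Division.
End FiniteOver.

(** * Integral equations and absence of relations *)

Section Integrality.
Context {R : realType} {K : fieldType} (v : valuation R K) {n : nat}.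
Local Notation A := 'rV[int]_n.
Context (S : addrClosed A) (w : {additive A -> R}).
Local Notation KU := (restr v S w).
Local Notation nrm := (@gauss_norm R K v A S w).
Local Notation mon := (@mono R K v A S w).
Implicit Types (f g h a b : KU) (T : set A) (P : set KU).

Lemma ideal_sum (B : comNzRingType) (J : set B) (I : Type) (s : seq I) (Q : pred I) (F : I -> B) :
  is_ideal J -> (forall i, Q i -> J (F i)) -> J (\sum_(i <- s | Q i) F i).
Proof. by move=> [J0 JD _] h; elim/big_ind: _. Qed.

Lemma idealN (B : comNzRingType) (J : set B) x : is_ideal J -> J x -> J (- x).
Proof. by move=> Jid Jx; rewrite -mulN1r; apply: idealM. Qed.

Lemma idealB (B : comNzRingType) (J : set B) x y : is_ideal J -> J x -> J y -> J (x - y).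
Proof. by move=> Jid Jx Jy; apply: idealD => //; exact: idealN. Qed.

Lemma ideal_mulr (B : comNzRingType) (J : set B) x y : is_ideal J -> J x -> J (x * y).
Proof. by move=> Jid Jx; rewrite mulrC; apply: idealM. Qed.

Definition supp_poly T (p : {poly KU}) := forall i, supp_in T p`_i.

Lemma supp_poly_char_poly T (k : nat) (M : 'M[KU]_k) : T 0 -> (forall x y, T x -> T y -> T (x + y)) ->
  (forall i j, supp_in T (M i j)) -> supp_poly T (char_poly M).
Proof.
move=> T0 TD TM.
have QC c : supp_in T c -> supp_poly T c%:P.
  by move=> cT i; rewrite coefC; case: ifP => // _; exact: supp_in0.
have Q1 : supp_in T (1 : KU) by rewrite -mono1; exact: supp_in_mono.
have QD p q : supp_poly T p -> supp_poly T q -> supp_poly T (p + q).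
  by move=> hp hq i; rewrite poly.coefD; apply: supp_inD.
have QN p : supp_poly T p -> supp_poly T (- p).
  by move=> hp i; rewrite poly.coefN; apply: supp_inN.
have QM p q : supp_poly T p -> supp_poly T q -> supp_poly T (p * q).
  by move=> hp hq i; rewrite coefM; apply: supp_in_sum => j _; apply: supp_inM.
have QX : supp_poly T 'X.
  by move=> i; rewrite coefX; case: eqP => _; [exact: Q1|exact: supp_in0].
have Q0 : supp_poly T 0 by move=> i; rewrite poly.coef0; exact: supp_in0.
rewrite /char_poly /determinant; elim/big_ind: _ => // s _.
apply: (QM).
  by case: (perm.odd_perm s); rewrite ?expr1 ?expr0; [apply: (QN); exact: QC|exact: QC].
elim/big_ind: _ => [||i _]; [exact: QC|exact: QM|].
rewrite !mxE; apply: QD; last by apply: QN; exact: QC.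
by case: eqP => _; rewrite ?mulr1n ?mulr0n.
Qed.

(** Determinant trick for multiplication by [h] on the generators. The adjugate kills every
    generator modulo [P], and since a generator is a monomial, hence a unit, the determinant itself
    lies in [P]. Without generators [P] is the whole ring. *)
Lemma finite_over_integral T P h : is_ideal P -> T 0 -> (forall x y, T x -> T y -> T (x + y)) ->
  (forall u, u \in S -> - u \in S) -> finite_over T P ->
  exists f : {poly KU}, [/\ f \is monic, supp_poly T f & P f.[h]].
Proof.
move=> Pid T0 TD SN [I [J [m [hs [C [C0 mS hP ex]]]]]].
pose k := #|I|; pose mk (i : 'I_k) := mon 1 (m (enum_val i)).
have sumE (F : I -> KU) : \sum_i F i = \sum_(i : 'I_k) F (enum_val i).
  rewrite [LHS](reindex (@enum_val I (mem I))) /=; last first.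
    by exists enum_rank => i _; [exact: enum_valK|exact: enum_rankK].
  by apply: eq_bigl => i; rewrite /= .
have /choice[b hb] : forall i : 'I_k, exists b : 'I_k -> KU, (forall j, supp_in T (b j)) /\
    P (h * mk i - \sum_j b j * mk j).
  move=> i; have [b [c [E bT _ _]]] := ex (h * mk i).
  exists (fun j => b (enum_val j)); split => // .
  rewrite {1}E sumE addrC addKr.
  by apply: ideal_sum => // j _; apply: idealM.
pose M := \matrix_(i, j) b i j.
have MT i j : supp_in T (M i j) by rewrite mxE; have [h1 _] := hb i; exact: h1.
exists (char_poly M); split; [exact: char_poly_monic|exact: supp_poly_char_poly|].
have detE : (char_poly M).[h] = \det (h%:M - M).
  rewrite -horner_evalE /char_poly -det_map_mx; congr (\det _).
  apply/matrixP => i j; rewrite !mxE /= /horner_eval.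
  by case: eqP => _; rewrite ?mulr1n ?mulr0n !hornerE.
pose N := h%:M - M.
have NP i : P (\sum_j N i j * mk j).
  have [_ h2] := hb i; rewrite (_ : \sum_j _ = h * mk i - \sum_j b i j * mk j) //.
  under eq_bigr => j _ do rewrite [N i j]mxE mulrDl [X in X * _ + _]mxE [in X in _ + X]mxE mulNr [M i j]mxE.
  rewrite big_split /= sumrN; congr (_ - _).
  rewrite (bigD1 i) //= eqxx mulr1n big1 ?addr0 // => j; rewrite eq_sym => /negPf ->.
  by rewrite mulr0n mul0r.
have dP i : P (\det N * mk i).
  have : P (\sum_l (\adj N) i l * \sum_j N l j * mk j).
    by apply: ideal_sum => // l _; apply: idealM.
  congr P; under eq_bigr do rewrite mulr_sumr; rewrite exchange_big /=.
  under eq_bigr do under eq_bigr do rewrite mulrA; under eq_bigr do rewrite -mulr_suml.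
  have adjE j : \sum_l (\adj N) i l * N l j = (\det N)%:M i j by rewrite -mul_adj_mx mxE.
  under eq_bigr do rewrite adjE mxE.
  rewrite (bigD1 i) //= eqxx mulr1n big1 ?addr0 // => j; rewrite eq_sym => /negPf ->.
  by rewrite mulr0n mul0r.
rewrite detE -/N.
have [I0|[i0]] : #|I| = 0%N \/ inhabited 'I_k.
  rewrite /k; case: #|I| => [|c]; [by left|by right; constructor; exact: ord0].
  have [b' [c [E _ _ _]]] := ex (\det N); rewrite E big1 ?add0r => [|i _].
    by apply: ideal_sum => // j _; apply: idealM.
  by have := card0_eq I0 i; rewrite inE.
have -> : \det N = mon 1 (- m (enum_val i0)) * (\det N * mk i0).
  by rewrite mulrCA /mk monoM ?SN // mulr1 addNr mono1 mulr1.
exact: idealM.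
Qed.

(** In other words, the residue norm modulo [P] restricts to the Gauss norm on K<T>. *)
Definition free_over T P := forall g f, supp_in T g -> P (g - f) -> nrm g <= nrm f.

(** Freeness is exactly the hypothesis of [berkovich_quot] for the nonzero elements of K<T>, with
    their Gauss norms as prescribed values. *)
Lemma free_spectrum T P : is_ideal P -> T 0 -> (forall x y, T x -> T y -> T (x + y)) ->
  free_over T P -> exists2 q, spectrum P q & forall g, supp_in T g -> q g = nrm g.
Proof.
move=> Pid T0 TD fr.
have [||||||||q [qu qn qP qT]] := @berkovich_quot R KU P [set g | g <> 0 /\ supp_in T g] nrm nrm.
- by [].
- split; first by apply/eqP; exact: oner_neq0.
  by rewrite -mono1; exact: supp_in_mono.
- move=> s t [s0 sT] [t0 tT]; split; last exact: supp_inM.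
  by move=> /restr_integral[].
- by move=> s [s0 _]; apply: nrm_gt0; apply/eqP.
- by move=> s t _ _; exact: nrmM.
- exact: nrm_submult.
- by [].
- by move=> s h [_ sT] Psh; exact: fr Psh.
exists q; first exact: spectrumP.
move=> g gT; have [->|/eqP g0] := eqVneq g 0; last exact: qT.
by rewrite nrm0; case: qu => /seminorm0.
Qed.

End Integrality.

(** Read as coefficients, the nonzero vectors are finitely many nonzero polynomials; some natural
    number is a root of none of them. *)
Lemma separating_powers (R : realType) (I : finType) (r : nat) (d : I -> 'I_r -> R) :
  exists N : nat, forall i, (exists j, d i j <> 0) -> \sum_j d i j * N%:R ^+ j <> 0.
Proof.
pose P i : {poly R} := \poly_(j < r) (if insub j is Some j' then d i j' else 0).
pose Q := \prod_(i | P i != 0) P i.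
have Q0 : Q != 0 by apply/prodf_neq0.
have [N QN] : exists N : nat, ~~ root Q N%:R.
  apply: contrapT => h.
  have := max_poly_roots Q0 (rs := [seq (i%:R : R) | i <- iota 0 (size Q)]).
  rewrite size_map size_iota ltnn => H; suff : false by []; apply: H.
    by apply/allP => _ /mapP[i _ ->]; apply: contrapT => hi; apply: h; exists i; apply/negP.
  by rewrite map_inj_uniq ?iota_uniq // => i j /eqP; rewrite eqr_nat => /eqP.
exists N => i [j dij].
have coefP (l : 'I_r) : (P i)`_l = d i l by rewrite coef_poly ltn_ord valK.
have Pi0 : P i != 0.
  by apply/eqP => /(congr1 (fun p : {poly R} => p`_j)); rewrite coefP poly.coef0.
move/negP: QN => QN E; apply: QN; rewrite /root /Q horner_prod; apply/prodf_eq0; exists i => //=.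
apply/eqP; rewrite -[RHS]E (horner_coef_wide _ (size_poly _ _)).
by apply: eq_bigr => l _; rewrite coefP.
Qed.

Section NoetherNormalization.
Context {R : realType} {K : fieldType} (v : valuation R K) {n : nat}.
Local Notation A := 'rV[int]_n.
Context (S : addrClosed A) (w : {additive A -> R}).
Local Notation KU := (restr v S w).
Local Notation nrm := (@gauss_norm R K v A S w).
Local Notation mon := (@mono R K v A S w).
Hypothesis SN : forall u, u \in S -> - u \in S.

Definition zspan j (e : 'I_j -> A) : set A := [set u | exists z : 'I_j -> int, u = \sum_i e i *~ z i].

Lemma zspan0 j (e : 'I_j -> A) : zspan e 0.
Proof. by exists (fun=> 0); rewrite big1 // => i _; rewrite mulr0z. Qed.

Lemma zspanD j (e : 'I_j -> A) x y : zspan e x -> zspan e y -> zspan e (x + y).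
Proof.
move=> [z ->] [z' ->]; exists (fun i => z i + z' i).
by rewrite -big_split /=; apply: eq_bigr => i _; rewrite mulrzDr.
Qed.

Lemma zspanN j (e : 'I_j -> A) x : zspan e x -> zspan e (- x).
Proof.
move=> [z ->]; exists (fun i => - z i).
by rewrite -sumrN; apply: eq_bigr => i _; rewrite mulrNz.
Qed.

Lemma zspan_gen j (e : 'I_j -> A) i : zspan e (e i).
Proof.
exists (fun l => (l == i)%:R); rewrite (bigD1 i) //= eqxx mulr1z big1 ?addr0 // => l /negPf ->.
by rewrite mulr0z.
Qed.

Lemma zspan_sub j (e : 'I_j -> A) x : (forall i, e i \in S) -> zspan e x -> x \in S.
Proof.
move=> eS [z ->]; apply: rpred_sum => i _; case: (z i) => k; first by rewrite -pmulrn rpredMn.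
by rewrite NegzE mulrNz -pmulrn SN // rpredMn.
Qed.

Definition zindep j (e : 'I_j -> A) :=
  forall z : 'I_j -> int, \sum_i e i *~ z i = 0 -> forall i, z i = 0.

(** The matrix of the [D a (e i)] has independent rows. In the application [D] consists of
    directions of the polyhedron, which stay independent as functionals on the span of [e]. *)
Definition transverse k (D : 'I_k -> {additive A -> R}) j (e : 'I_j -> A) : Prop :=
  forall c : 'I_k -> R, (forall i, \sum_a c a * D a (e i) = 0) -> forall a, c a = 0.

Variables (k : nat) (D : 'I_k -> {additive A -> R}) (P : set KU).
Hypothesis Pid : is_ideal P.

Definition noether_basis j (e : 'I_j -> A) : Prop :=
  [/\ forall i, e i \in S, zindep e, finite_over (zspan e) P & transverse D e].

Lemma transverse_le j (e : 'I_j -> A) : transverse D e -> (k <= j)%N.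
Proof.
move=> tr; pose M : 'M[R]_(k, j) := \matrix_(a, i) D a (e i).
suff : row_free M by move/eqP <-; exact: rank_leq_col.
apply/row_freeP; apply: contrapT => nf.
have : kermx M != 0 by rewrite kermx_eq0; apply/negP => /row_freeP.
move=> /rowV0Pn[x /sub_kermxP xM /rV0Pn[a xa]]; move/eqP: xa; apply.
apply: (tr (fun a => x 0 a)) => i.
have := congr1 (fun M : 'rV_j => M 0 i) xM; rewrite !mxE => E; rewrite -[RHS]E.
by apply: eq_bigr => b _; rewrite mxE.
Qed.

(** Replacing [e i] by [e i - N ^ i e0] gives a dominant exponent the [e0]-degree [phi], the value
    at [N] of its coordinate polynomial. For suitable [N] these degrees are distinct, so each
    coefficient in [chi^e0] is one monomial and Weierstrass division applies. *)
Lemma noether_step j (e : 'I_j.+1 -> A) : (k < j.+1)%N -> noether_basis e ->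
  ~ free_over (zspan e) P -> exists e' : 'I_j -> A, noether_basis e'.
Proof.
move=> kj [eS ez fin tr] nfree.
have [g [f [gT Pgf fg]]] : exists g f, [/\ supp_in (zspan e) g, P (g - f) & nrm f < nrm g].
  apply: contrapT => h; apply: nfree => g f gT Pgf; rewrite leNgt; apply/negP => fg.
  by apply: h; exists g, f.
have g0 : g != 0.
  by apply/eqP => g0; move: fg; rewrite g0 nrm0 ltNge nrm_ge0.
have gn0 := nrm_gt0 g0.
have [X0 hX0 _] := dominant_finite g0.
pose X := undup X0.
have hX u : (u \in X) = (tm g u == nrm g) by rewrite mem_undup hX0.
have Xu : uniq X := undup_uniq _.
have gX u : u \in X -> g u != 0.
  rewrite hX => /eqP tu; apply/eqP => gu; move: gn0; rewrite -tu /tm gu absv0 mul0r.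
  by rewrite ltxx.
(* Only the dominant terms stay on the left; the remaining ones are small and move to the right-hand
   side [F]. *)
pose G := mpart X g.
have GgN : nrm (g - G) < nrm g.
  have [u <-] := nrm_attained (g - G); rewrite /tm coefB coef_mpart //.
  case: ifP => [_|uX]; first by rewrite subrr absv0 mul0r.
  by rewrite subr0 lt_neqAle (le_nrm g u) andbT -/(tm g u) -hX uX.
pose F := f - (g - G).
have PGF : P (G - F).
  by rewrite (_ : G - F = g - f) // /F; ring.
have FG : nrm F < nrm g.
  by apply: le_lt_trans (nrmD _ _) _; rewrite nrmN gt_max fg.
have /choice[z hz] : forall u, exists z : 'I_j.+1 -> int, u \in X -> u = \sum_i e i *~ z i.
  move=> u; have [uX|_] := boolP (u \in X); last by exists (fun=> 0).
  by have [z ->] := gT _ (gX _ uX); exists z.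
pose M : 'M[R]_(k, j.+1) := \matrix_(a, i) D a (e i).
(* A combination of the [D a] that vanishes on the new basis has values proportional to [N ^ l] on
   [e]. Pairing these with a kernel vector [c], which exists since [k < j.+1], forces the
   combination to vanish on [e] too. *)
have [c c0 Mc] : exists2 c : 'cV[R]_j.+1, c != 0 & M *m c = 0.
  have : kermx M^T != 0.
    rewrite kermx_eq0 /row_free mxrank_tr neq_ltn (leq_ltn_trans _ kj) //.
    exact: rank_leq_row.
  move=> /rowV0Pn[x /sub_kermxP xM x0]; exists x^T; first by rewrite -trmx0 (inj_eq trmx_inj).
  by rewrite -[M]trmxK -trmx_mul xM trmx0.
have [l0 cl0] : exists l0, c l0 0 != 0.
  move: c0; apply: contraNP => h; apply/eqP/matrixP => a b; rewrite ord1 mxE.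
  by apply/eqP; apply: contrapT => /negP ca; apply: h; exists a.
pose IX := (seq_sub X * seq_sub X + unit)%type.
(* One [N] serves both purposes: [inl] separates the dominant exponents, [inr] keeps the pairing of
   [c] with the powers of [N] nonzero. *)
have [N hN] := @separating_powers R IX j.+1 (fun p l => match p with
   | inl (u, u') => (z (val u) l - z (val u') l)%:~R | inr tt => c l 0 end).
have cN : \sum_l c l 0 * N%:R ^+ l <> 0.
  by apply: (hN (inr tt)); exists l0; apply/eqP.
pose phi u : int := \sum_l z u l * N%:Z ^+ l.
have phi_inj u u' : u \in X -> u' \in X -> phi u = phi u' -> u = u'.
  move=> uX u'X E; apply: contrapT => uu'.
  have := hN (inl (SeqSub uX, SeqSub u'X)); apply.
    apply: contrapT => h; apply: uu'; rewrite (hz u) // (hz u') //; apply: eq_bigr => l _; congr (_ *~ _).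
    apply: contrapT => zz; apply: h; exists l => /eqP; rewrite intr_eq0 subr_eq0 => /eqP.
    exact: zz.
  rewrite /=; transitivity ((phi u - phi u')%:~R : R); last by rewrite E subrr.
  rewrite /phi -sumrB rmorph_sum; apply: eq_bigr => l _ /=.
  by rewrite -mulrBl rmorphM rmorphXn.
pose e0 := e ord0.
pose e' (i : 'I_j) := e (lift ord0 i) - e0 *~ (N%:Z ^+ i.+1).
have decomp (y : 'I_j.+1 -> int) : \sum_i e i *~ y i =
    \sum_i e' i *~ y (lift ord0 i) + e0 *~ (\sum_l y l * N%:Z ^+ l).
  rewrite big_ord_recl [in RHS]big_ord_recl /= expr0 mulr1 mulrzDr -/e0.
  rewrite addrCA; congr (_ + _).
  rewrite mulrz_sumr -big_split /=; apply: eq_bigr => i _.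
  by rewrite /bump /= add1n mulrzBl [y _ * _]mulrC mulrzA subrK.
have e'S i : e' i \in S.
  apply: rpredD; first exact: eS.
  by apply: SN; apply: (@zspan_sub 1 (fun=> e0)) => [_|]; [exact: eS|exists (fun=> N%:Z ^+ i.+1); rewrite big_ord1].
have e'z : zindep e'.
  move=> y Ey.
  pose y1 (l : 'I_j.+1) : int := if unlift ord0 l is Some i then y i else - \sum_i y i * N%:Z ^+ i.+1.
  have y1l i : y1 (lift ord0 i) = y i by rewrite /y1 liftK.
  have := ez y1; rewrite decomp (eq_bigr (fun i => e' i *~ y i)) ?Ey ?add0r => [|i _]; last by rewrite y1l.
  rewrite big_ord_recl expr0 mulr1 (eq_bigr (fun i : 'I_j => y i * N%:Z ^+ i.+1)) => [|i _]; last by rewrite y1l.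
  rewrite /y1 unlift_none addNr mulr0z => /(_ erefl) h i.
  by rewrite -y1l; exact: h.
have e'tr : transverse D e'.
  move=> x hx; apply: tr.
  pose y i := \sum_a x a * D a (e i).
  have yE i : y i = y ord0 * N%:R ^+ i.
    case: (unliftP ord0 i) => [i'|] ->; last by rewrite expr0 mulr1.
    apply/eqP; rewrite -subr_eq0 -[X in _ == X](hx i') /e'; apply/eqP.
    rewrite /y mulr_suml -sumrB; apply: eq_bigr => a _.
    by rewrite raddfB raddfMz /= -/e0 mulrBr -mulrzl rmorphXn /= /bump /= add1n mulrAC mulrA.
  suff y00 : y ord0 = 0 by move=> i; rewrite -/(y i) yE y00 mul0r.
  have : \sum_i y i * c i 0 = 0.
    rewrite /y; under eq_bigr do rewrite mulr_suml; rewrite exchange_big /=.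
    apply: big1 => a _; under eq_bigr do rewrite -mulrA; rewrite -mulr_sumr.
    have := congr1 (fun B : 'cV_k => B a 0) Mc; rewrite !mxE => E.
    by rewrite [X in _ * X](_ : _ = 0) ?mulr0 // -[RHS]E; apply: eq_bigr => i _; rewrite mxE.
  under eq_bigr do rewrite yE -mulrA [_ * c _ _]mulrC; rewrite -mulr_sumr => /eqP.
  by rewrite mulf_eq0 => /orP[/eqP //|/eqP/cN].
exists e'; split => //.
have Xne : X != [::].
  have [u tu] := nrm_attained g; have : u \in X by rewrite hX tu.
  by case: (X).
have [u1 u1X u1min] : exists2 u1, u1 \in X & forall u, u \in X -> phi u1 <= phi u.
  case: (X) Xne => // x s _; elim: s x => [|y s IH] x.
    by exists x; rewrite ?mem_head // => u; rewrite inE => /eqP ->.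
  have [u us hu] := IH y; have [le|lt] := leP (phi x) (phi u).
    by exists x; rewrite ?mem_head // => u'; rewrite inE => /orP[/eqP -> //|/hu]; exact: le_trans.
  exists u; first by rewrite inE us orbT.
  by move=> u'; rewrite inE => /orP[/eqP ->|/hu //]; exact: ltW.
have [u2 u2X u2max] : exists2 u2, u2 \in X & forall u, u \in X -> phi u <= phi u2.
  case: (X) Xne => // x s _; elim: s x => [|y s IH] x.
    by exists x; rewrite ?mem_head // => u; rewrite inE => /eqP ->.
  have [u us hu] := IH y; have [le|lt] := leP (phi u) (phi x).
    exists x; rewrite ?mem_head // => u'; rewrite inE => /orP[/eqP -> //|/hu h]; exact: le_trans h le.
  exists u; first by rewrite inE us orbT.
  by move=> u'; rewrite inE => /orP[/eqP ->|/hu //]; exact: ltW.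
pose t u := \sum_i e' i *~ z u (lift ord0 i).
have tX u : u \in X -> u = t u + e0 *~ phi u by move=> uX; rewrite {1}(hz u uX) decomp.
pose dg u := `|phi u - phi u1|%N.
have dgE u : u \in X -> (dg u)%:Z = phi u - phi u1.
  by move=> /u1min le; rewrite /dg gez0_abs // subr_ge0.
pose d := dg u2.
have dgd u : u \in X -> (dg u < d.+1)%N.
  by move=> uX; rewrite ltnS -lez_nat !dgE // lerB // u2max.
pose gc (l : 'I_d.+1) := \sum_(u <- X | dg u == l) mon (g u) (t u).
have tS u : t u \in S by apply: zspan_sub e'S _; exists (fun i => z u (lift ord0 i)).
have gc1 (l : 'I_d.+1) u : u \in X -> dg u = l -> gc l = mon (g u) (t u).
  move=> uX dul; rewrite /gc big_mkcond (bigD1_seq u) //= dul eqxx big_seq_cond big1 ?addr0 // => u' /andP[u'X /eqP uu'].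
  case: eqP => // du'.
  case: uu'; apply: phi_inj => //; apply: (@addIr _ (- phi u1)); rewrite -!dgE //.
  by rewrite du' dul.
have gc0 (l : 'I_d.+1) : (forall u, u \in X -> dg u <> l) -> gc l = 0.
  by move=> h; rewrite /gc big_seq_cond big1 // => u /andP[uX /eqP /h]; case.
have e0S z0 : e0 *~ z0 \in S.
  by apply: (@zspan_sub 1 (fun=> e0)) => [_|]; [exact: eS|exists (fun=> z0); rewrite big_ord1].
(* A shift by a unit, after which the lowest [e0]-degree is 0. *)
pose m1 := mon 1 (e0 *~ (- phi u1)).
have m1n : 0 < nrm m1 by exact: nrm_mon_gt0.
have uE u : u \in X -> mon (g u) (t u) * mon 1 (e0 *~ (dg u)) = m1 * mon (g u) u.
  move=> uX; rewrite /m1 !monoM // ?mulr1 ?mul1r; last by rewrite (tX u uX) rpredD.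
  congr (mon _ _); rewrite [in RHS](tX u uX) dgE // addrCA -mulrzDr; congr (_ + _ *~ _).
  exact: addrC.
have GE : m1 * G = \sum_(l < d.+1) gc l * mon 1 (e0 *~ (l : nat)).
  rewrite /G /mpart mulr_sumr.
  rewrite (eq_bigr (fun l : 'I_d.+1 => \sum_(u <- X | dg u == l) mon (g u) (t u) * mon 1 (e0 *~ (l : nat)))) => [|l _]; last by rewrite mulr_suml.
  rewrite (exchange_big_dep xpredT) //= big_seq [in RHS]big_seq; apply: eq_bigr => u uX.
  rewrite (big_pred1 (Ordinal (dgd u uX))) ?uE //.
have Gn : nrm (\sum_(l < d.+1) gc l * mon 1 (e0 *~ (l : nat))) = nrm m1 * nrm g.
  rewrite -GE nrmM; congr (_ * _).
  apply/eqP; rewrite eq_le; apply/andP; split.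
    have -> : G = g - (g - G) by rewrite opprB addrC subrK.
    by apply: le_trans (nrmD _ _) _; rewrite nrmN ge_max lexx ltW.
  by have := le_nrm G u1; rewrite /tm coef_mpart // u1X -/(tm g u1); have /eqP -> : tm g u1 == nrm g by rewrite -hX.
have un u : u \in X -> nrm (mon (g u) u) = nrm g.
  move=> uX; rewrite nrm_mono; last by rewrite (tX u uX) rpredD.
  by apply/eqP; rewrite -hX.
have dg1 : dg u1 = 0%N by rewrite /dg subrr.
have T't u : zspan e' (t u) by exists (fun i => z u (lift ord0 i)).
apply: (@finite_over_step R K v n S w SN (zspan e) (zspan e') e0 d gc (g u1) (g u2) (t u1) (t u2)
   _ _ _ _ _ _ _ _ _ _ _ _ _ _ _ P (m1 * F)) => //.
- exact: eS.
- by move=> y; exact: zspan_sub.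
- exact: zspan0.
- exact: zspanD.
- exact: zspanN.
- move=> y [y1 ->]; exists (\sum_i e' i *~ y1 (lift ord0 i)), (\sum_l y1 l * N%:Z ^+ l).
  by split => //; exists (fun i => y1 (lift ord0 i)).
- move=> l; apply: supp_in_sum => u _; exact: supp_in_mono.
- move=> l; rewrite Gn; have [[u [uX dul]]|h] := pselect (exists u, u \in X /\ dg u = l).
    by rewrite (gc1 _ u) // -dul uE // nrmM un.
  rewrite gc0 ?mul0r ?nrm0 ?mulr_ge0 ?nrm_ge0 // => u uX dul; apply: h; by exists u.
- exact: gc1.
- exact: gc1.
- by rewrite Gn mulr_gt0.
- rewrite Gn (gc1 _ u1) //=; have := uE u1 u1X; rewrite dg1 mulr0z mono1 mulr1 => ->.
  by rewrite nrmM un.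
- rewrite (gc1 _ u2) //= -/(dg u2) uE // Gn nrmM un //.
- by rewrite -GE -mulrBr; apply: idealM.
- by rewrite Gn nrmM ltr_pM2l.
Qed.

(** Each small relation lowers the rank by one, while transversality keeps it at least [k]. At rank
    [k] freeness is the hypothesis, so the descent ends at a free basis. *)
Lemma noether_normalization j (e : 'I_j -> A) : noether_basis e ->
  (forall e' : 'I_k -> A, (forall i, e' i \in S) -> transverse D e' -> free_over (zspan e') P) ->
  exists j' (e' : 'I_j' -> A), noether_basis e' /\ free_over (zspan e') P.
Proof.
move=> he free.
have free' j' (e' : 'I_j' -> A) : j' = k -> (forall i, e' i \in S) -> transverse D e' -> free_over (zspan e') P.
  by move=> jk; subst j'; exact: free.
elim: j e he => [|j IH] e he.
  have [eS _ _ tr] := he; have := transverse_le tr; rewrite leqn0 => /eqP k0.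
  by exists 0%N, e; split => //; exact: free'.
have [fr|nfr] := pselect (free_over (zspan e) P); first by exists j.+1, e.
have [eS _ _ tr] := he; have := transverse_le tr; rewrite leq_eqVlt => /orP[/eqP kj|kj].
  by case: nfr; exact: free'.
by have [e' he'] := noether_step kj he nfr; exact: IH he'.
Qed.

End NoetherNormalization.

(** * Deformation of Gauss points *)

Section LaurentEmbedding.
Context {R : realType} {K K' : fieldType} (v : valuation R K') {A : zmodType} (S S' : addrClosed A).
Context (w : {additive A -> R}) (iota : {rmorphism K -> K'}) (hS : forall u, u \in S -> u \in S').
Local Notation L := (laurent R K S).
Implicit Types f g : L.

Fact lemb_supp f u : u \notin S' -> iota (f u) = 0.
Proof. by move=> uS; rewrite coef_supp ?rmorph0 //; apply: contra uS => /hS. Qed.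
Fact lemb_null f : wnull v w (fun u => iota (f u)).
Proof.
move=> C; apply: sub_finite_set (laurent_finite f) => u /=.
by apply: contraPneq => ->; rewrite rmorph0 val0.
Qed.
(** One map for several inclusions: between Laurent rings of nested monoids, into restricted series
    of any weight, and into series over a larger field. Finite support makes it meaningful for every
    weight. *)
Definition lemb f : restr v S' w := Restr (@lemb_supp f) (@lemb_null f).

Lemma lemb_coef f u : lemb f u = iota (f u). Proof. by []. Qed.

Fact lemb_nmod : nmod_morphism lemb.
Proof.
split; first by apply: restr_eq => u; rewrite lemb_coef !coef0 rmorph0.
by move=> f g; apply: restr_eq => u; rewrite lemb_coef !coefD !lemb_coef rmorphD.
Qed.
HB.instance Definition _ := GRing.isNmodMorphism.Build L (restr v S' w) lemb lemb_nmod.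

Lemma lemb_mono c u : u \in S -> lemb (mono _ _ _ c u) = mono v S' w (iota c) u.
Proof.
move=> uS; apply: restr_eq => x; rewrite lemb_coef !coef_mono ?hS //.
by case: eqP; rewrite ?rmorph0.
Qed.

Lemma laurent_mpart f : exists2 E : seq A, uniq E & (forall u, u \in E -> u \in S) /\ f = mpart E f.
Proof. exact: approx_finite (laurent_finite f). Qed.

Fact lemb_monoid : monoid_morphism lemb.
Proof.
split.
  by rewrite -mono1 lemb_mono ?rpred0 // rmorph1 mono1.
move=> f g; have [E _ [ES ->]] := laurent_mpart f; have [E' _ [E'S ->]] := laurent_mpart g.
rewrite /mpart mulr_suml !raddf_sum mulr_suml big_seq [RHS]big_seq; apply: eq_bigr => u /ES uS.
rewrite !mulr_sumr raddf_sum /= big_seq [RHS]big_seq; apply: eq_bigr => u' /E'S u'S.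
rewrite monoM // lemb_mono ?rpredD // rmorphM -[LHS]monoM ?hS //.
by rewrite -!lemb_mono.
Qed.
HB.instance Definition _ := GRing.isMonoidMorphism.Build L (restr v S' w) lemb lemb_monoid.

Lemma lemb_inj : injective lemb.
Proof.
move=> f g h; apply: restr_eq => u; have := congr1 (fun h : restr v S' w => h u) h.
by rewrite !lemb_coef => /fmorph_inj.
Qed.

Lemma lemb_supp_in (T : set A) f : supp_in T f -> supp_in T (lemb f).
Proof. by move=> fT u; rewrite lemb_coef fmorph_eq0; exact: fT. Qed.

End LaurentEmbedding.

Section LaurentDense.
Context {R : realType} {K : fieldType} (v : valuation R K) {A : zmodType} (S : addrClosed A).
Context (w : {additive A -> R}).
Local Notation L := (laurent R K S).
Local Notation KU := (restr v S w).
Local Notation nrm := (@gauss_norm R K v A S w).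
Local Notation emb := (@lemb R K K v A S S w idfun (fun u h => h)).

Lemma lemb_dense (r : KU) (e : R) : 0 < e -> exists2 f : L, nrm (r - emb f) <= e &
  forall T : set A, supp_in T r -> supp_in T f.
Proof.
move=> e0; have [E _ [ES hE]] := approx r e0.
exists (\sum_(u <- E) mono _ _ _ (r u) u).
  rewrite raddf_sum (_ : \sum_(_ <- _) _ = mpart E r) //.
  by rewrite /mpart big_seq [RHS]big_seq; apply: eq_bigr => u /ES uS; exact: lemb_mono.
move=> T rT; apply: supp_in_sum => u _.
have [ru|ru] := eqVneq (r u) 0; first by rewrite ru mono0; exact: supp_in0.
by apply: supp_in_mono; exact: rT.
Qed.

Lemma laurent_sumP (f : L) (Q : L -> Prop) : Q 0 -> (forall g h, Q g -> Q h -> Q (g + h)) ->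
  (forall u, u \in S -> f u != 0 -> Q (mono _ _ _ (f u) u)) -> Q f.
Proof.
move=> Q0 QD Qm; have [E _ [ES fE]] := laurent_mpart f; rewrite fE /mpart big_seq.
elim/big_ind: _ => // u uE; have [->|fu] := eqVneq (f u) 0; last by apply: Qm => //; exact: ES.
by rewrite mono0.
Qed.

Lemma laurent_le_nrm (p : L -> R) : ums p ->
  (forall c u, u \in S -> p (mono _ _ _ c u) <= absv v c * expR (- w u)) -> forall f, p f <= nrm (emb f).
Proof.
move=> [pm pu] pmono f; apply: (@laurent_sumP f (fun g => p g <= nrm (emb f))).
- by rewrite (seminorm0 pm) nrm_ge0.
- by move=> g h hg hh; apply: le_trans (pu g h) _; rewrite ge_max hg.
- by move=> u uS _; apply: le_trans (pmono _ _ uS) _; exact: (le_nrm (emb f) u).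
Qed.

Lemma gen_ideal_is_ideal (B : comNzRingType) (G : set B) : is_ideal (gen_ideal G).
Proof.
split=> [I [I0 _ _] _ //|x y hx hy I Iid GI|x y hy I Iid GI].
  by apply: idealD => //; [exact: hx|exact: hy].
by apply: idealM => //; exact: hy.
Qed.

Lemma coef_imageP (I : set L) : coef_image id v w I = emb @` I.
Proof.
apply/seteqP; split => g /= [f If fg]; exists f => //; last by rewrite -fg.
by apply: restr_eq => u; rewrite fg.
Qed.

(** The series multiplying the generators can be replaced by Laurent polynomials close to them,
    which leaves an element of [I]. *)
Lemma gen_ideal_dense (I : set L) (x : KU) (e : R) : is_ideal I ->
  gen_ideal (coef_image id v w I) x -> 0 < e -> exists2 i, I i & nrm (x - emb i) <= e.
Proof.
move=> Iid ax; move: e; apply: (ax [set x | forall e, 0 < e -> exists2 i, I i & nrm (x - emb i) <= e]).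
- split=> /= [e e0|y z hy hz e e0|r y hy e e0].
  + by exists 0; [exact: ideal0|rewrite raddf0 subr0 nrm0 ltW].
  + have [i Ii hi] := hy e e0; have [j Ij hj] := hz e e0; exists (i + j); first exact: idealD.
    rewrite raddfD (_ : _ - _ = (y - emb i) + (z - emb j)); last by rewrite opprD addrACA.
    by apply: le_trans (nrmD _ _) _; rewrite ge_max hi.
  have r1 : 0 < nrm r + 1 by rewrite ltr_wpDl ?nrm_ge0.
  have [i Ii hi] := hy _ (divr_gt0 e0 r1).
  have i1 : 0 < nrm (emb i) + 1 by rewrite ltr_wpDl ?nrm_ge0.
  have [f hf _] := lemb_dense r (divr_gt0 e0 i1).
  exists (f * i); first exact: idealM.
  have -> : r * y - emb (f * i) = r * (y - emb i) + (r - emb f) * emb i.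
    by rewrite rmorphM mulrBr mulrBl addrA subrK.
  apply: le_trans (nrmD _ _) _; rewrite ge_max; apply/andP; split.
    apply: le_trans (nrmM_le _ _) _; apply: le_trans (ler_wpM2l (nrm_ge0 _) hi) _.
    by rewrite mulrCA ler_piMr ?(ltW e0) // ler_pdivrMr // mul1r lerDl.
  apply: le_trans (nrmM_le _ _) _; apply: le_trans (ler_wpM2r (nrm_ge0 _) hf) _.
  by rewrite mulrAC -mulrA ler_piMr ?(ltW e0) // ler_pdivrMr // mul1r lerDl.
- by rewrite coef_imageP => y /= [i Ii <-] e e0; exists i => //; rewrite subrr nrm0 ltW.
Qed.

End LaurentDense.

(** * Subgroups generated by a set of characters *)

Section Span.
Context {A : zmodType}.
Implicit Types G H : set A.

Definition zgen G : {pred A} := fun u => `[< forall U : set A, U 0 -> (forall x y, U x -> U y -> U (x - y)) ->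
  G `<=` U -> U u >].

Lemma zgen_sub G : G `<=` [set u | u \in zgen G].
Proof. by move=> u Gu; apply/asboolP => U _ _; apply. Qed.

Lemma zgen0 G : 0 \in zgen G. Proof. by apply/asboolP. Qed.

Lemma zgenB G x y : x \in zgen G -> y \in zgen G -> x - y \in zgen G.
Proof.
move=> /asboolP hx /asboolP hy; apply/asboolP => U U0 UB GU.
exact: UB (hx U U0 UB GU) (hy U U0 UB GU).
Qed.

Lemma zgenN G x : x \in zgen G -> - x \in zgen G.
Proof. by move=> hx; rewrite -sub0r; apply: zgenB => //; exact: zgen0. Qed.

Fact zgen_add G : GRing.addumagma_closed (zgen G).
Proof.
split; first exact: zgen0.
by move=> x y hx hy; rewrite -[y]opprK; apply: zgenB => //; exact: zgenN.
Qed.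
HB.instance Definition _ G := GRing.isAddClosed.Build A (zgen G) (zgen_add G).

Lemma zgen_min G (U : set A) : U 0 -> (forall x y, U x -> U y -> U (x - y)) -> G `<=` U ->
  forall u, u \in zgen G -> U u.
Proof. by move=> h0 hB hG u /asboolP; apply. Qed.

Lemma zgenS G H : G `<=` H -> forall u, u \in zgen G -> u \in zgen H.
Proof.
move=> GH; apply: (zgen_min (U := [set u | u \in zgen H])); [exact: zgen0|exact: zgenB|].
by apply: subset_trans GH _; exact: zgen_sub.
Qed.

Lemma zgenMz G x (z : int) : x \in zgen G -> x *~ z \in zgen G.
Proof.
move=> hx; case: z => k; first by rewrite -pmulrn rpredMn.
by rewrite NegzE mulrNz -pmulrn zgenN // rpredMn.
Qed.

Lemma zgen_adjoin G x u : u \in zgen (G `|` [set x]) -> exists t (z : int), t \in zgen G /\ u = t + x *~ z.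
Proof.
apply: (zgen_min (U := [set u | exists t (z : int), t \in zgen G /\ u = t + x *~ z])).
- by exists 0, 0; rewrite zgen0 mulr0z addr0.
- move=> _ _ [t [z [tG ->]]] [t' [z' [t'G ->]]]; exists (t - t'), (z - z').
  by rewrite zgenB // mulrzBr opprD addrACA.
- move=> y [Gy|->]; first by exists y, 0; rewrite mulr0z addr0; split => //; exact: zgen_sub.
  by exists 0, 1; rewrite zgen0 add0r mulr1z.
Qed.

(** Only finitely many generators are involved, so one member of the chain contains them all;
    [algebraic_maximal] needs this for Zorn's lemma. *)
Lemma zgen_union (F : set (set A)) G (s : seq A) : total_on F subset -> F !=set0 ->
  (forall u, u \in s -> u \in zgen (G `|` \bigcup_(X in F) X)) ->
  exists2 X, F X & forall u, u \in s -> u \in zgen (G `|` X).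
Proof.
move=> Ft [X0 FX0].
have one u : u \in zgen (G `|` \bigcup_(X in F) X) -> exists2 X, F X & u \in zgen (G `|` X).
  apply: (zgen_min (U := [set u | exists2 X, F X & u \in zgen (G `|` X)])).
  - by exists X0 => //; exact: zgen0.
  - move=> x y [X FX hx] [Y FY hy]; have [XY|YX] := Ft X Y FX FY.
      by exists Y => //; apply: zgenB => //; apply: zgenS hx; exact: setUS.
    by exists X => //; apply: zgenB => //; apply: zgenS hy; exact: setUS.
  - move=> y [Gy|[X FX Xy]]; first by exists X0 => //; apply: zgen_sub; left.
    by exists X => //; apply: zgen_sub; right.
elim: s => [|x s IH] h; first by exists X0.
have [|X FX hX] := IH; first by move=> u us; apply: h; rewrite inE us orbT.
have [|Y FY hY] := one x; first by apply: h; rewrite inE eqxx.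
have [XY|YX] := Ft X Y FX FY.
  by exists Y => // u; rewrite inE => /orP[/eqP ->//|/hX]; apply: zgenS; exact: setUS.
by exists X => // u; rewrite inE => /orP[/eqP ->|/hX //]; apply: zgenS hY; exact: setUS.
Qed.

End Span.

(** * Algebraic dependence of characters modulo a prime *)

Section Algebraic.
Context {R : realType} {K : fieldType} {A : zmodType} (S : addrClosed A).
Local Notation L := (laurent R K S).
Local Notation X u := (mono (trivial_valuation R K) S \0 (1 : K) u).
Hypothesis SN : forall u, u \in S -> - u \in S.
Variable J : set L.
Hypothesis PJ : is_prime J.

Definition incl G (hG : forall u, u \in zgen G -> u \in S) : {rmorphism laurent R K (zgen G) -> L} :=
  @lemb R K K (trivial_valuation R K) A (zgen G) S \0 idfun hG.

Lemma incl_lift G (hG : forall u, u \in zgen G -> u \in S) f : supp_in [set u | u \in zgen G] f ->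
  exists g, incl hG g = f.
Proof.
move=> fG; apply: (@laurent_sumP R K A S f (fun f => exists g, incl hG g = f)).
- by exists 0; rewrite rmorph0.
- by move=> _ _ [g <-] [h <-]; exists (g + h); rewrite rmorphD.
- move=> u uS fu; exists (mono _ _ _ (f u) u); exact: lemb_mono (fG _ fu).
Qed.

Definition algebraic_over (G : set A) (x : L) : Prop := exists f : {poly L},
  [/\ forall i, supp_in [set u | u \in zgen G] f`_i, J f.[x] & exists i, ~ J f`_i].

Lemma algebraic_overP G (hG : forall u, u \in zgen G -> u \in S) x :
  algebraic_over G x -> algebraic_mod J (incl hG) x.
Proof.
move=> [f [fG fx [i fi]]].
have /choice[c hc] : forall i, exists g, incl hG g = f`_i by move=> l; exact: incl_lift.
have E : map_poly (incl hG) (\poly_(l < size f) c l) = f.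
  apply/polyP => l; rewrite coef_map coef_poly.
  by case: ltnP => [_|h]; [exact: hc|rewrite [RHS]nth_default // [LHS]raddf0].
exists (\poly_(l < size f) c l); first by rewrite /vanishing /= E.
by exists i; rewrite -coef_map E.
Qed.

Lemma algebraic_image (B : comNzRingType) (phi : {rmorphism B -> L}) b : algebraic_mod J phi (phi b).
Proof.
exists ('X - b%:P); last first.
  by exists 1%N; rewrite poly.coefB coefX coefC subr0 rmorph1; case: PJ.
rewrite /vanishing /= rmorphB /= map_polyX map_polyC hornerXsubC subrr.
by case: PJ => -[].
Qed.

(** Steinitz exchange: a relation of [z] over [G] and [u] is reread as a relation of [chi^u] over
    [G] and [z]. It is not trivial because [z] is transcendental over [G]. *)
Lemma algebraic_exchange G (hG : forall u, u \in zgen G -> u \in S) z u : u \in S ->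
  ~ algebraic_over G z -> algebraic_over (G `|` [set u]) z -> algebraic_mod J (eval_at (incl hG) z) (X u).
Proof.
move=> uS tr [f [fG fz [i0 fi0]]].
have Jid : is_ideal J by case: PJ.
have /choice[r hr] : forall y, exists r : A * int, y \in zgen (G `|` [set u]) -> r.1 \in zgen G /\ y = r.1 + u *~ r.2.
  move=> y; have [/zgen_adjoin[t [l [tG ->]]]|//] := boolP (y \in zgen (G `|` [set u])); last by exists (0, 0).
  by exists (t, l).
(* Multiplication by the unit [chi^(N u)] clears the negative powers of [chi^u] in all coefficients
   at once. *)
have [N hN] : exists N : nat, forall i y, f`_i y != 0 -> 0 <= (r y).2 + N%:Z.
  suff [N hN] : exists N : nat, forall i y, (i < size f)%N -> f`_i y != 0 -> 0 <= (r y).2 + N%:Z.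
    exists N => i y; have [fi|fi] := ltnP i (size f); first exact: hN.
    by rewrite nth_default // coef0 eqxx.
  elim: (size f) => [|m [N hN]]; first by exists 0%N.
  have [E Eu [_ hE]] := laurent_mpart f`_m.
  have [N' hN'] : exists N' : nat, forall y, y \in E -> 0 <= (r y).2 + N'%:Z.
    elim: (E) => [|y s [N' hN']]; first by exists 0%N.
    exists (N' + `|(r y).2|)%N => y'; rewrite inE => /orP[/eqP ->|/hN' h]; first by lia.
    by apply: le_trans h _; rewrite lerD2l lez_nat leq_addr.
  exists (maxn N N') => i y; rewrite ltnS leq_eqVlt => /orP[/eqP ->|im] fy.
    have yE : y \in E by apply: contraNT fy => yE; rewrite hE coef_mpart // (negPf yE).
    by apply: le_trans (hN' y yE) _; rewrite lerD2l lez_nat leq_maxr.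
  by apply: le_trans (hN i y im fy) _; rewrite lerD2l lez_nat leq_maxl.
pose uN := X (u *+ N).
have SuN m : u *+ m \in S by rewrite rpredMn.
have /choice[C hC] : forall i, exists C : {poly laurent R K (zgen G)}, (map_poly (incl hG) C).[X u] = uN * f`_i.
  move=> i.
  have : forall y, f`_i y != 0 -> y \in zgen (G `|` [set u]) /\ 0 <= (r y).2 + N%:Z.
    by move=> y fy; split; [exact: fG fy|exact: hN fy].
  move: (f`_i) => a ha.
  apply: (@laurent_sumP R K A S a (fun a => exists C : {poly laurent R K (zgen G)}, (map_poly (incl hG) C).[X u] = uN * a)).
  - by exists 0; rewrite rmorph0 horner0 mulr0.
  - by move=> g h [C1 E1] [C2 E2]; exists (C1 + C2); rewrite rmorphD hornerD E1 E2 mulrDr.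
  - move=> y yS ay; have [yG N0] := ha y ay; have [tG yE] := hr y yG.
    exists ((mono _ _ _ (a y) (r y).1)%:P * 'X^(absz ((r y).2 + N%:Z))).
    rewrite rmorphM /= map_polyC map_polyXn hornerM hornerC hornerXn /= [incl hG _](lemb_mono _ _ _ hG) //.
    have XX m : X u ^+ m = X (u *+ m).
      elim: m => [|m IH]; first by rewrite expr0 mulr0n mono1.
      by rewrite exprS IH monoM // mulr1 mulrS.
    rewrite XX /uN !monoM ?(hG _ tG) // ?mulr1 ?mul1r.
    rewrite (_ : (r y).1 + u *+ _ = u *+ N + y) //.
    rewrite [in RHS]yE [in LHS]pmulrn gez0_abs // mulrzDr -pmulrn.
    by rewrite [u *+ N + _]addrC -addrA.
(* The two variables are swapped: the outer one stands for [chi^u], the inner one for [z]. *)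
pose F : {poly {poly laurent R K (zgen G)}} := \sum_(i < size f) map_poly polyC (C i) * ('X^i)%:P.
have coefF l : F`_l = \poly_(i < size f) (C i)`_l.
  rewrite /F poly.coef_sum poly_def; apply: eq_bigr => i _.
  by rewrite coefMC coef_map /= mul_polyC.
have Jun a : J (uN * a) -> J a.
  move=> h; have -> : a = X (- (u *+ N)) * (uN * a).
    by rewrite mulrA /uN monoM ?SN // mulr1 addNr mono1 mul1r.
  exact: idealM.
exists F.
  rewrite /vanishing /= (_ : _.[_] = uN * f.[z]); first exact: idealM.
  rewrite /F rmorph_sum horner_sum (horner_coef f z) mulr_sumr; apply: eq_bigr => i _.
  have e1 : map_poly (eval_at (incl hG) z) (map_poly polyC (C i)) = map_poly (incl hG) (C i).
    by apply/polyP => l; rewrite !coef_map; exact: eval_atC.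
  have e2 : eval_at (incl hG) z 'X^i = z ^+ i by rewrite /= map_polyXn /horner_eval hornerXn.
  transitivity ((map_poly (eval_at (incl hG) z) (map_poly polyC (C i)) *
      map_poly (eval_at (incl hG) z) ('X^i)%:P).[X u]); first by congr (_.[_]); exact: rmorphM.
  by rewrite e1 map_polyC hornerM hornerC hC mulrA; congr (_ * _); exact: e2.
have hi0 : (i0 < size f)%N.
  by rewrite ltnNge; apply/negP => hi; apply: fi0; rewrite nth_default //; exact: ideal0.
apply: contrapT => h; apply: fi0; apply: (Jun); rewrite -hC horner_coef.
apply: ideal_sum => // l _; apply: ideal_mulr => //; rewrite coef_map.
have Fl : J (eval_at (incl hG) z F`_l) by apply: contrapT => h'; apply: h; exists l.
apply: contrapT => h'; apply: tr; exists (map_poly (incl hG) F`_l); split.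
- move=> i y; rewrite coef_map => cu; apply: contrapT => /negP nu; move: cu.
  by rewrite [incl hG _ y]lemb_coef coef_supp // rmorph0 eqxx.
- exact: Fl.
- exists i0; by rewrite coef_map coefF coef_poly hi0.
Qed.

(** Completes [z] to a transcendence basis by characters: in a maximal family over which [z] stays
    transcendental, exchange makes every further character algebraic. *)
Lemma algebraic_maximal G z : (forall u, u \in zgen G -> u \in S) -> ~ algebraic_over G z ->
  exists H (hH : forall u, u \in zgen H -> u \in S), [/\ G `<=` H, ~ algebraic_over H z &
    forall u, u \in S -> algebraic_mod J (eval_at (incl hH) z) (X u)].
Proof.
move=> hG tr.
pose P (H : set A) := (forall u, u \in zgen (G `|` H) -> u \in S) /\ ~ algebraic_over (G `|` H) z.
have [|H [[hH trH] Hmax]] := @Zorn_bigcup A P.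
  move=> F FP Ft; have [[X0 FX0]|F0] := pselect (F !=set0); last first.
    rewrite /P (_ : G `|` _ = G) //; apply/seteqP; split=> [u [//|[Y FY]]|u]; last by left.
    by case: F0; exists Y.
  split=> [u hu|[f [fG fz fi]]].
    have [||Y FY hY] := @zgen_union _ F G [:: u] Ft.
    - by exists X0.
    - by move=> u'; rewrite inE => /eqP ->.
    by have [h _] := FP Y FY; apply: h; apply: hY; rewrite mem_head.
  have [s hs] : exists s : seq A, forall i y, f`_i y != 0 -> y \in s.
    suff [s hs] : exists s : seq A, forall i y, (i < size f)%N -> f`_i y != 0 -> y \in s.
      exists s => i y; have [fi'|fi'] := ltnP i (size f); first exact: hs.
      by rewrite nth_default // coef0 eqxx.
    elim: (size f) => [|m [s hs]]; first by exists [::].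
    have [E Eu [_ hE]] := laurent_mpart f`_m.
    exists (E ++ s) => i y; rewrite ltnS leq_eqVlt mem_cat => /orP[/eqP ->|im] fy; last by rewrite (hs i) ?orbT.
    by apply/orP; left; apply: contraNT fy => yE; rewrite hE coef_mpart // (negPf yE).
  have [||Y FY hY] := @zgen_union _ F G [seq y <- s | y \in zgen (G `|` \bigcup_(X in F) X)] Ft.
  - by exists X0.
  - by move=> u; rewrite mem_filter => /andP[].
  have [_] := FP Y FY; apply; exists f; split => // i y fy; apply: hY.
  by rewrite mem_filter (hs i) // andbT; exact: fG fy.
exists (G `|` H), hH; split => // u uS.
have hGu : forall y, y \in zgen ((G `|` H) `|` [set u]) -> y \in S.
  move=> y /zgen_adjoin[t [l [/hH tS ->]]]; rewrite rpredD //.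
  case: l => l; first by rewrite -pmulrn rpredMn.
  by rewrite NegzE mulrNz -pmulrn SN // rpredMn.
have [Hu|nHu] := pselect (H u).
  have uH : u \in zgen (G `|` H) by apply: zgen_sub; right.
  have -> : X u = eval_at (incl hH) z (mono _ _ _ 1 u)%:P.
    by rewrite eval_atC [RHS](lemb_mono _ _ _ hH) // rmorph1.
  exact: algebraic_image.
apply: algebraic_exchange => //; apply: contrapT => nalg.
have /Hmax : H `<` H `|` [set u].
  by split=> [y Hy|h]; [left|apply: nHu; apply: h; right].
by apply; rewrite /P setUA.
Qed.
End Algebraic.

Section SeminormKernels.
Context {R : realType}.

Lemma ums_comp (A B : comNzRingType) (phi : {rmorphism A -> B}) (p : B -> R) : ums p -> ums (p \o phi).
Proof.
move=> [[p0 p00 p1 pM pD] pu]; split; last by move=> x y; rewrite /= rmorphD; exact: pu.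
by split=> [x||| x y|x y] /=; rewrite ?rmorph0 ?rmorph1 ?rmorphM ?rmorphD //.
Qed.

Lemma ums_kernel_prime (A : comNzRingType) (p : A -> R) : ums p -> is_prime [set x | p x = 0].
Proof.
move=> [[p0 p00 p1 pM pD] pu]; split => /=.
- split=> //= [x y hx hy|x y hy]; last by rewrite pM hy mulr0.
  by apply/eqP; rewrite eq_le p0 andbT (le_trans (pD _ _)) // hx hy addr0.
- by rewrite p1 => /eqP; rewrite oner_eq0.
- by move=> x y; rewrite pM => /eqP; rewrite mulf_eq0 => /orP[] /eqP; auto.
Qed.

End SeminormKernels.

Lemma zspan_zgen n j (e : 'I_j -> 'rV[int]_n) u : zspan e u <-> u \in zgen (range e).
Proof.
split=> [[z ->]|].
  by apply: rpred_sum => i _; apply: zgenMz; apply: zgen_sub; exists i.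
apply: zgen_min => [|x y hx hy|_ [i _ <-]]; [exact: zspan0| |exact: zspan_gen].
by apply: zspanD => //; exact: zspanN.
Qed.

(** * Points of X_omega that are Gauss points on K[T] *)

Section FreeSpectralPoint.
Context {R : realType} {K : fieldType} (v : valuation R K) {n : nat}.
Local Notation A := 'rV[int]_n.
Context (S : addrClosed A) (w : {additive A -> R}).
Local Notation L := (laurent R K S).
Local Notation KU := (restr v S w).
Local Notation nrm := (@gauss_norm R K v A S w).
Local Notation emb := (@lemb R K K v A S S w idfun (fun u h => h)).
Local Notation X u := (mono (trivial_valuation R K) S \0 (1 : K) u).
Local Notation C c := (mono (trivial_valuation R K) S \0 (c : K) 0).
Hypothesis SN : forall u, u \in S -> - u \in S.
Variables (r : nat) (b : 'I_r -> A).
Hypotheses (bS : forall i, b i \in S) (Sb : forall u, u \in S -> zspan b u).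

Lemma monoX u m : u \in S -> X u ^+ m = X (u *+ m).
Proof.
move=> uS; elim: m => [|m IH]; first by rewrite expr0 mulr0n mono1.
by rewrite exprS IH monoM ?rpredMn // mulr1 mulrS.
Qed.

Lemma laurent_weight (p : L -> R) (W : {additive A -> R}) : mult_seminorm p ->
  (forall i, p (X (b i)) = expR (- W (b i))) -> forall u, u \in S -> p (X u) = expR (- W u).
Proof.
move=> pm hp u uS; suff [] : u \in S /\ p (X u) = expR (- W u) by [].
move/Sb/zspan_zgen: uS; apply: (zgen_min (U := [set u | u \in S /\ p (X u) = expR (- W u)])).
- by rewrite /= rpred0 mono1 (seminorm1 pm) raddf0 oppr0 expR0.
- move=> x y [xS hx] [yS hy]; split; first by rewrite rpredD // SN.
  have pN : p (X (- y)) = expR (W y).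
    have : p (X (- y) * X y) = 1 by rewrite monoM ?SN // mulr1 addNr mono1 (seminorm1 pm).
    rewrite (seminormM pm) hy expRN => /(canRL (mulfK _)) ->; last by rewrite invr_eq0 gt_eqF // expR_gt0.
    by rewrite mul1r invrK.
  have <- : X x * X (- y) = X (x - y) by rewrite monoM ?SN // mulr1.
  by rewrite (seminormM pm) hx pN -expRD raddfB opprB addrC.
- by move=> _ [i _ <-]; split.
Qed.

Lemma laurent_mono_value (p : L -> R) (W : {additive A -> R}) : mult_seminorm p ->
  (forall i, p (X (b i)) = expR (- W (b i))) -> (forall c, p (C c) = absv v c) ->
  forall c u, u \in S -> p (mono _ _ _ c u) = absv v c * expR (- W u).
Proof.
move=> pm hp hc c u uS; rewrite -(laurent_weight pm hp) // -hc -(seminormM pm) monoM ?rpred0 //.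
by rewrite mulr1 add0r.
Qed.

Lemma laurent_gen_by (B : comNzRingType) (phi : B -> L) (f : L) : (forall c, exists x, phi x = C c) ->
  gen_by phi ([seq X (b i) | i <- enum 'I_r] ++ [seq X (- b i) | i <- enum 'I_r]) f.
Proof.
move=> hphi P Pphi Pxs PD PM.
have P0 c : P (C c) by have [x <-] := hphi c.
have Pu u : u \in S -> P (X u) /\ P (X (- u)).
  move=> uS; suff [] : u \in S /\ (P (X u) /\ P (X (- u))) by [].
  move/Sb/zspan_zgen: uS; apply: (zgen_min (U := [set u | u \in S /\ (P (X u) /\ P (X (- u)))])).
  - by rewrite /= rpred0 oppr0.
  - move=> x y [xS [hx hx']] [yS [hy hy']]; split; first by rewrite rpredD // SN.
    rewrite opprB -[1]mulr1; split.
      by rewrite -monoM ?SN //; exact: PM.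
    by rewrite -monoM ?SN //; exact: PM.
  - move=> _ [i _ <-]; split => //.
    by split; apply: Pxs; rewrite mem_cat; apply/orP; [left|right]; apply/mapP; exists i; rewrite ?mem_enum.
apply: (@laurent_sumP R K A S f P) => [| |u uS _]; first by rewrite -(mono0 _ _ _ 0); exact: P0.
- exact: PD.
- have -> : mono _ _ _ (f u) u = C (f u) * X u :> L by rewrite monoM ?rpred0 // mulr1 add0r.
  by apply: PM; [exact: P0|have [] := Pu u uS].
Qed.

Variable I : set L.
Hypothesis Iid : is_ideal I.
Let a : set KU := gen_ideal (coef_image id v w I).
Variables (k : nat) (e : 'I_k -> A).
Hypotheses (eS : forall i, e i \in S) (fin : finite_over (zspan e) a).
Variable Q : KU -> R.
Hypotheses (Qa : spectrum a Q) (Qn : forall g, supp_in (zspan e) g -> Q g = nrm g).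
Let q (f : L) := Q (emb f).
Let J : set L := [set f | q f = 0].

Let hq : ums q. Proof. by have [Qu _ _] := spectrum_ums Qa; exact: (ums_comp _ Qu). Qed.
Let hqm : mult_seminorm q. Proof. by case: hq. Qed.
Let PJ : is_prime J. Proof. exact: (ums_kernel_prime hq). Qed.
Let Jid : is_ideal J. Proof. by case: PJ. Qed.
Let qI f : I f -> q f = 0.
Proof.
move=> If; have [_ _ h] := spectrum_ums Qa; apply: h => G Gid; apply.
by rewrite coef_imageP; exists f.
Qed.
Let qmono c u : u \in S -> q (mono _ _ _ c u) = absv v c * expR (- w u).
Proof. by move=> uS; rewrite /q lemb_mono // (spectrum_mono _ SN uS Qa). Qed.
Let qC c : q (C c) = absv v c. Proof. by rewrite qmono ?rpred0 // raddf0 oppr0 expR0 mulr1. Qed.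
Let qX u : u \in S -> q (X u) = expR (- w u). Proof. by move=> uS; rewrite qmono // absv1 mul1r. Qed.
Let XJ u : u \in S -> ~ J (X u).
Proof. by move=> uS; rewrite /J /= qX // => /eqP; rewrite gt_eqF // expR_gt0. Qed.

Lemma monic_decomp (B : nzRingType) (f : {poly B}) : f \is monic ->
  f = 'X^((size f).-1) + \poly_(i < (size f).-1) f`_i.
Proof.
move=> fm; have s0 : (0 < size f)%N by rewrite size_poly_gt0 monic_neq0.
apply/polyP => i; rewrite poly.coefD coefXn coef_poly.
case: (ltngtP i (size f).-1) => h; rewrite ?add0r ?addr0 //.
- by rewrite nth_default // -(prednK s0).
- by rewrite h -lead_coefE (monicP fm).
Qed.

(** The integral equation has coefficients in K<T> and holds modulo [a]; approximating both by
    Laurent polynomials brings it into K[S] and modulo [I], with an error as small as desired and,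
    crucially, in a fixed degree [D]. *)
Lemma approximate_relation u (eta : R) : u \in S -> exists D : nat,
  forall eta, 0 < eta -> exists (g : nat -> L) (i : L), [/\ forall l, supp_in (zspan e) (g l), I i &
    nrm (emb (X u ^+ D + \sum_(l < D) g l * X u ^+ l - i)) <= eta].
Proof.
move=> uS; have aid : is_ideal a by exact: gen_ideal_is_ideal.
have [f [fm fT fh]] := finite_over_integral (mono v S w 1 u) aid (zspan0 e) (@zspanD _ _ e) SN fin.
exists (size f).-1; set D := (size f).-1 => {}eta eta0.
pose h := emb (X u); have hE : h = mono v S w 1 u by rewrite /h lemb_mono // rmorph1.
pose M := \sum_(l < D) nrm (h ^+ l) + 1.
have M0 : 0 < M by rewrite ltr_wpDl // sumr_ge0 // => l _; exact: nrm_ge0.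
have /choice[g hg] : forall l, exists g, nrm (f`_l - emb g) <= eta / M /\ supp_in (zspan e) g.
  move=> l; have [g h1 h2] := lemb_dense f`_l (divr_gt0 eta0 M0); exists g; split => //.
  exact: h2 (fT l).
have [i Ii hi] := gen_ideal_dense Iid fh eta0.
exists g, i; split => //; first by move=> l; case: (hg l).
have -> : emb (X u ^+ D + \sum_(l < D) g l * X u ^+ l - i) =
    (f.[mono v S w 1 u] - emb i) - \sum_(l < D) (f`_l - emb (g l)) * h ^+ l.
  have e1 : emb (X u ^+ D + \sum_(l < D) g l * X u ^+ l - i) = h ^+ D + \sum_(l < D) emb (g l) * h ^+ l - emb i.
    rewrite raddfB raddfD /= rmorphXn raddf_sum; congr (_ + _ - _); apply: eq_bigr => l _.
    by transitivity (emb (g l) * emb (X u ^+ l)); [exact: rmorphM|rewrite rmorphXn].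
  have e2 : f.[mono v S w 1 u] = h ^+ D + \sum_(l < D) f`_l * h ^+ l.
    by rewrite {1}(monic_decomp fm) hornerD hornerXn -hE horner_poly.
  have e3 : \sum_(l < D) (f`_l - emb (g l)) * h ^+ l = \sum_(l < D) f`_l * h ^+ l - \sum_(l < D) emb (g l) * h ^+ l.
    by rewrite -sumrB; apply: eq_bigr => l _; exact: mulrBl.
  rewrite e1 e2 e3; move: (h ^+ D) (\sum_(l < D) f`_l * h ^+ l) (\sum_(l < D) _ * _) (emb i) => a1 a2 a3 a4.
  by ring.
apply: le_trans (nrmD _ _) _; rewrite ge_max hi nrmN; apply: nrm_sum_le => [|l _]; first exact: ltW.
apply: le_trans (nrmM_le _ _) _; have [h1 _] := hg l.
apply: le_trans (ler_wpM2r (nrm_ge0 _) h1) _.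
rewrite mulrAC -mulrA ler_piMr ?(ltW eta0) // ler_pdivrMr // mul1r.
rewrite /M (bigD1 l) //= -addrA lerDl addr_ge0 // sumr_ge0 // => l' _; exact: nrm_ge0.
Qed.

(** If [X u] were transcendental over K[T], it would be so over some larger [H] such that all
    characters are algebraic over [H] and [X u]. Then [q] could be deformed into the Gauss norm of
    small radius [t] around [X u] without changing its kernel or its values on constants and
    characters; so it would stay bounded by the norm and vanish on [I]. But the deformed norm of a
    monic polynomial of degree [D] in [X u] is at least [t ^+ D], against an approximate integral
    equation with error [t ^+ D / 2]. *)
Lemma free_algebraic u : u \in S -> algebraic_over J (range e) (X u).
Proof.
move=> uS; apply: contrapT => tr.
have eSu y : y \in zgen (range e) -> y \in S by move/zspan_zgen; exact: zspan_sub.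
have [H [hH [EH {}tr alg]]] := algebraic_maximal SN PJ eSu tr.
pose phi := eval_at (incl hH) (X u).
(* Taylor expansion around [X u]: the constant term is [phi c], and it decides the norm of radius
   [t] once [t] is small. The radius is the only parameter, whence germs over ['rV[R]_0]. *)
pose psi : {rmorphism {poly laurent R K (zgen H)} -> {poly L}} := comp_poly ('X + (X u)%:P) \o map_poly (incl hH).
pose Gam (t : R) (x : 'rV[R]_0) c := pnorm q t (psi c).
have psi0 c : (psi c)`_0 = phi c.
  by rewrite -horner_coef0 /psi /= horner_comp hornerD hornerX hornerC add0r.
have kerGam c t : 0 < t -> pnorm q t (psi c) = 0 <-> J (phi c).
  move=> t0; split=> [h|h].
    rewrite -psi0 /J /=; apply/eqP; rewrite eq_le (seminorm_ge0 hqm) andbT.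
    by have := le_pnorm t hq (psi c) 0; rewrite h /term expr0 mulr1.
  have cJ i : J (incl hH c`_i).
    apply: contrapT => ci; apply: tr; exists (map_poly (incl hH) c); split => //.
      move=> l y; rewrite coef_map => cu; apply: contrapT => /negP nu; move: cu.
      by rewrite [incl hH _ y]lemb_coef coef_supp // rmorph0 eqxx.
    by exists i; rewrite coef_map.
  apply/eqP; rewrite eq_le pnorm_ge0 // andbT; apply: pnorm_le => // i.
  suff : J ((psi c)`_i) by rewrite /J /= /term => ->; rewrite mul0r.
  rewrite /psi /= comp_polyE poly.coef_sum; apply: ideal_sum => // l _.
  by rewrite poly.coefZ; apply: ideal_mulr => //; rewrite coef_map; exact: cJ.
have x0i : forall l : 'rV[rat]_0, l != 0 -> rform l (0 : 'rV[R]_0) != 0.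
  by move=> l; rewrite [l]thinmx0 eqxx.
have phiC c : phi (mono _ _ _ c 0)%:P = C c.
  by rewrite /phi eval_atC [LHS](lemb_mono _ _ _ hH) // rpred0.
have psiC c : psi (mono _ _ _ c 0)%:P = (C c)%:P.
  by rewrite /psi /= map_polyC comp_polyC /= [Z in Z%:P](lemb_mono _ _ _ hH) // rpred0.
have [|||||||||Lb hL] := @germ_lift R 0 0 x0i L _ J phi q Gam r (fun i => X (b i))
    ([seq X (b i) | i <- enum 'I_r] ++ [seq X (- b i) | i <- enum 'I_r]).
- exact: PJ.
- exact: hq.
- by [].
- exists 1 => // t x /andP[t0 _] _; split; last by move=> c; exact: kerGam.
  exact: (ums_comp psi (pnorm_ums hq t0)).
- move=> c cJ; exists 0.
  have q0 : 0 < q (phi c) by rewrite lt_def (seminorm_ge0 hqm) andbT; apply/eqP.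
  pose M := \sum_(i < size (psi c)) q (psi c)`_i + 1.
  have M0 : 0 < M by rewrite ltr_wpDl // sumr_ge0 // => i _; exact: (seminorm_ge0 hqm).
  exists (Num.min 1 (q (phi c) / M)); first by rewrite lt_min ltr01 divr_gt0.
  move=> t x /andP[t0]; rewrite lt_min => /andP[t1 tM] _.
  rewrite /gev rform0 mulr0 addr0; congr (- ln _); rewrite /Gam.
  apply/eqP; rewrite eq_le; apply/andP; split; last first.
    by have := le_pnorm t hq (psi c) 0; rewrite /term expr0 mulr1 psi0.
  apply: pnorm_le => [|i]; first exact: ltW.
  rewrite /term; case: i => [|i]; first by rewrite expr0 mulr1 psi0.
  have [hi|hi] := ltnP i.+1 (size (psi c)); last first.
    by rewrite nth_default // (seminorm0 hqm) mul0r ltW.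
  apply: (@le_trans _ _ (M * t)); last by rewrite mulrC -ler_pdivlMr // ltW.
  apply: ler_pM; [exact: (seminorm_ge0 hqm)|by rewrite exprn_ge0 ?(ltW t0)| |].
    rewrite /M (bigD1 (Ordinal hi)) //= -addrA lerDl addr_ge0 // sumr_ge0 // => l _; exact: (seminorm_ge0 hqm).
  by rewrite exprS ler_piMr ?exprn_ile1 ?(ltW t0) // ltW.
- move=> m; have [-> _] : \prod_i X (b i) ^+ m i = X (\sum_i b i *+ m i) /\ \sum_i b i *+ m i \in S.
    elim/big_rec2: _ => [|i y1 y2 _ [-> y1S]]; last first.
      by rewrite monoX // monoM ?rpredMn // mulr1; split => //; rewrite rpredD ?rpredMn.
    by rewrite mono1; split => //; exact: rpred0.
  by apply: alg; apply: rpred_sum => i _; rewrite rpredMn.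
- by move=> i; exact: XJ.
- move=> y; rewrite mem_cat => /orP[] /mapP[i _ ->].
    by split; [exact: alg|exact: XJ].
  by split; [apply: alg; exact: SN|apply: XJ; exact: SN].
- by move=> f; apply: laurent_gen_by => c; exists (mono _ _ _ c 0)%:P.
have [t [x [[p [pu pJ pGam pb]] t0]]] : exists t x, (exists p : L -> R, [/\ ums p, (forall f, p f = 0 <-> J f),
    (forall c, p (phi c) = Gam t x c) & (forall i, - ln (p (X (b i))) = gev (- ln (q (X (b i))), Lb i) t x)]) /\ 0 < t.
  have tpos : near0 (0 : 'rV[R]_0) (fun t _ => 0 < t) by exists 1 => // t x /andP[].
  exact: near0_ex (near0_and hL tpos).
have [pm pult] := pu.
have ppos f : ~ J f -> 0 < p f.
  by move=> fJ; rewrite lt_def (seminorm_ge0 pm) andbT; apply/eqP => /pJ.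
have pXb i : p (X (b i)) = expR (- w (b i)).
  have := pb i; rewrite /gev (_ : rform _ _ = 0) ?mulr0 ?addr0; last by rewrite /rform big_ord0.
  move/oppr_inj/ln_inj; rewrite !posrE -qX //; apply; first by apply: ppos; exact: XJ.
  by rewrite qX ?expR_gt0.
have pC c : p (C c) = absv v c by rewrite -phiC pGam /Gam psiC pnormC // qC.
have ple f : p f <= nrm (emb f).
  by apply: laurent_le_nrm => // c y yS; rewrite (laurent_mono_value pm pXb pC).
have [D hD] := approximate_relation 1 uS.
have [g [i [gT Ii gi]]] := hD _ (divr_gt0 (exprn_gt0 D t0) (ltr0n _ 2)).
have /choice[c hc] : forall l, exists c, incl hH c = g l.
  move=> l; apply: incl_lift => y gy; apply: zgenS EH _ _; apply/zspan_zgen; exact: gT gy.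
pose G : {poly laurent R K (zgen H)} := 'X^D + \poly_(l < D) c l.
have mapG : map_poly (incl hH) G = 'X^D + \poly_(l < D) g l.
  rewrite rmorphD /= map_polyXn; congr (_ + _); apply/polyP => l; rewrite coef_map !coef_poly.
  by case: ltnP => _; [exact: hc|exact: raddf0].
have phiG : phi G = X u ^+ D + \sum_(l < D) g l * X u ^+ l.
  by rewrite /phi /= mapG /horner_eval hornerD hornerXn horner_poly.
have lower : t ^+ D <= p (phi G).
  rewrite pGam /Gam; have := le_pnorm t hq (psi G) D; rewrite /term (_ : (psi G)`_D = 1) ?(seminorm1 hqm) ?mul1r //.
  rewrite /psi /= mapG rmorphD /= comp_Xn_poly poly.coefD.
  have sz m : size (('X + (X u)%:P : {poly L}) ^+ m) = m.+1.
    by rewrite -[X u]opprK polyCN size_exp_XsubC.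
  have -> : (('X + (X u)%:P) ^+ D : {poly L})`_D = 1.
    have : ('X + (X u)%:P : {poly L}) ^+ D \is monic.
      by rewrite -[X u]opprK polyCN monic_exp // monicXsubC.
    by move/monicP; rewrite lead_coefE sz.
  rewrite comp_polyE poly.coef_sum big1 ?addr0 // => l _.
  rewrite poly.coefZ [Z in _ * Z]nth_default ?mulr0 // sz.
  exact: leq_trans (ltn_ord l) (size_poly _ _).
have upper : p (phi G) <= t ^+ D / 2.
  rewrite -(subrK i (phi G)); apply: le_trans (pult _ _) _; rewrite ge_max; apply/andP; split.
    by rewrite phiG; exact: le_trans (ple _) gi.
  have -> : p i = 0 by apply/pJ; exact: qI.
  by rewrite divr_ge0 // exprn_ge0 // ltW.
have := le_trans lower upper; rewrite leNgt => /negP; apply.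
by rewrite ltr_pdivrMr // ltr_pMr ?exprn_gt0 // ltr1n.
Qed.

Variables (y : 'I_k -> {additive A -> R}) (x0 : 'rV[R]_k).
Hypothesis y_dual : forall i j, y i (e j) = (i == j)%:R.
Hypothesis x0_indep : forall l : 'rV[rat]_k, l != 0 -> rform l x0 != 0.

Definition tilted (t : R) (x : 'rV[R]_k) (u : A) : R := w u + t * \sum_i x 0 i * y i u.
Fact tilted_nmod t x : nmod_morphism (tilted t x).
Proof.
split; first by rewrite /tilted raddf0 big1 ?mulr0 ?addr0 // => i _; rewrite raddf0 mulr0.
move=> u u'; rewrite /tilted raddfD addrACA -mulrDr -big_split; congr (_ + _ * _).
by apply: eq_bigr => i _; rewrite raddfD mulrDr.
Qed.
HB.instance Definition _ t x := GRing.isNmodMorphism.Build A R (tilted t x) (tilted_nmod t x).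

Lemma near0_seq (T : eqType) (s : seq T) (F : T -> R -> 'rV[R]_k -> Prop) :
  (forall z, z \in s -> near0 x0 (F z)) -> near0 x0 (fun t x => forall z, z \in s -> F z t x).
Proof.
elim: s => [|z s IH] h; first by exists 1.
have h1 := h z (mem_head _ _); have h2 := IH (fun z' zs => h z' (mem_behead (s := z :: s) zs)).
apply: near0_impl (near0_and h1 h2) _ => t x [f1 f2] z'.
by rewrite inE => /orP[/eqP ->|/f2].
Qed.

(** The family on K[T] consists of the Gauss norms of tilted weights. The norm of a Laurent
    polynomial is governed by finitely many terms, each an affine germ; as germs at [x0] are totally
    ordered, one term governs it for all nearby parameters, and [germ_lift] applies. *)
Lemma tropical_cell : exists Lb : 'I_r -> 'rV[rat]_k, near0 x0 (fun t x => exists p : L -> R,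
  [/\ ums p, forall f, I f -> p f = 0, forall c, p (C c) = absv v c,
   forall i, p (X (b i)) = expR (- (w (b i) + t * rform (Lb i) x)) &
   forall i, p (X (e i)) = expR (- (w (e i) + t * x 0 i))]).
Proof.
have hE u : u \in zgen (range e) -> u \in S by move/zspan_zgen; exact: zspan_sub.
pose phi : {rmorphism laurent R K (zgen (range e)) -> L} := incl hE.
pose te (t : R) (x : 'rV[R]_k) : {rmorphism laurent R K (zgen (range e)) -> _} :=
  @lemb R K K v A (zgen (range e)) (zgen (range e)) (tilted t x) idfun (fun u h => h).
pose Gam (t : R) (x : 'rV[R]_k) c := gauss_norm (te t x c).
have qphi c : q (phi c) = nrm (emb (phi c)).
  by apply: Qn; apply: lemb_supp_in => u cu; apply/zspan_zgen; apply: contrapT => /negP nu; move: cu;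
     rewrite lemb_coef coef_supp // rmorph0 eqxx.
have phi0 c : J (phi c) -> c = 0.
  rewrite /J /= qphi => /nrm_eq0 h; apply: (@lemb_inj _ _ _ (trivial_valuation R K) _ _ S \0 idfun hE).
  by apply: (@lemb_inj _ _ _ v _ S S w idfun (fun u h => h)); rewrite !raddf0.
have alg u : u \in S -> algebraic_mod J phi (X u).
  by move=> uS; apply: algebraic_overP; exact: free_algebraic.
have [|||||||||Lb hL] := @germ_lift R k x0 x0_indep L _ J phi q Gam r (fun i => X (b i))
    ([seq X (b i) | i <- enum 'I_r] ++ [seq X (- b i) | i <- enum 'I_r]).
- exact: PJ.
- exact: hq.
- by [].
- apply: near0T => t x; split; first exact: (ums_comp (te t x) (nrm_ums v _ _)).
  move=> c; split=> [/nrm_eq0 h|/phi0 ->]; last by rewrite /Gam rmorph0 nrm0.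
  suff -> : c = 0 by rewrite rmorph0; exact: ideal0.
  by apply: (@lemb_inj _ _ _ v _ _ _ (tilted t x) idfun (fun u h => h)); rewrite raddf0.
- move=> c cJ.
  have c0 : c <> 0 by move=> c0; apply: cJ; rewrite c0 rmorph0; exact: ideal0.
  have [E0 E0u [_ cE]] := laurent_mpart c.
  pose E := [seq u <- E0 | c u != 0].
  have hEc u : (u \in E) = (c u != 0).
    rewrite mem_filter; case: (boolP (c u != 0)) => //= cu.
    by apply: contraNT cu => uE; rewrite cE coef_mpart // (negPf uE).
  have /choice[z hz] : forall u, exists z : 'I_k -> int, u \in E -> u = \sum_i e i *~ z i.
    move=> u; have [|_] := boolP (u \in E); last by exists (fun=> 0).
    rewrite hEc => cu; have : zspan e u.
      by apply/zspan_zgen; apply: contrapT => /negP nu; rewrite coef_supp // eqxx in cu.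
    by move=> [z ->]; exists z.
  (* The germ of minus the logarithm of the term at [u]; its slope is the coordinate vector of [u]
     in the basis [e]. *)
  pose g u : germ := (- ln (absv v (c u)) + w u, \row_i (z u i)%:~R).
  have gE t x u : u \in E -> expR (- gev (g u) t x) = absv v (c u) * expR (- tilted t x u).
    move=> uE; rewrite /gev /= opprD opprD opprK -addrA -opprD expRD lnK ?posrE ?absv_gt0 -?hEc //.
    congr (_ * expR (- (_ + _ * _))); rewrite {2}(hz u uE).
    transitivity (\sum_i (z u i)%:~R * x 0 i).
      by apply: eq_bigr => i _; rewrite mxE ratr_int.
    apply: eq_bigr => i _; rewrite raddf_sum (bigD1 i) //= big1 ?addr0 => [|j ji].
      by rewrite raddfMz /= y_dual eqxx mulrC.
    by rewrite raddfMz /= y_dual eq_sym (negPf ji) mul0rz.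
  have En : E != [::].
    apply/negP => /eqP E0'; apply: c0; apply: restr_eq => u; apply/eqP; rewrite coef0 -[_ == 0]negbK -hEc E0'.
    by [].
  have [u0 u0E u0min] := @exists_min_seq _ (fun u u' => gle x0 (g u) (g u')) E
     (fun u u' => gle_total x0_indep (g u) (g u')) (fun u u' u'' => @gle_trans _ _ x0 (g u) (g u') (g u'')) En.
  exists (g u0).2.
  have min_nrm (S1 : addrClosed A) (W : {additive A -> R}) (h : restr v S1 W) (G : A -> R) : (forall u, h u = c u) ->
      (forall u, u \in E -> expR (- G u) = absv v (c u) * expR (- W u)) -> (forall u, u \in E -> G u0 <= G u) ->
      gauss_norm h = expR (- G u0).
    move=> hc hG Gm; apply/eqP; rewrite eq_le; apply/andP; split; last by rewrite hG // -hc; exact: (le_nrm h u0).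
    apply: nrm_le => u; rewrite /tm hc; have [uE|] := boolP (u \in E).
      by rewrite -hG // ler_expR lerN2 Gm.
    by rewrite hEc negbK => /eqP ->; rewrite absv0 mul0r expR_ge0.
  have q1 : q (phi c) = expR (- (g u0).1).
    rewrite qphi; apply: (min_nrm S w _ (fun u => (g u).1)) => // [u uE|u uE]; last exact: gle_fst (u0min u uE).
    by have := gE 0 0 u uE; rewrite /gev /tilted !mul0r !addr0.
  rewrite q1 expRK opprK -surjective_pairing.
  have : near0 x0 (fun t x => forall u, u \in E -> gev (g u0) t x <= gev (g u) t x).
    by apply: near0_seq => u uE; exact: gle_near (u0min u uE).
  move/near0_impl; apply => t x hm.
  by rewrite /Gam (min_nrm _ _ (te t x c) (fun u => gev (g u) t x)) ?expRK ?opprK // => u uE; exact: gE.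
- move=> m; have [-> mS] : \prod_i X (b i) ^+ m i = X (\sum_i b i *+ m i) /\ \sum_i b i *+ m i \in S.
    elim/big_rec2: _ => [|i y1 y2 _ [-> y1S]]; last first.
      by rewrite monoX // monoM ?rpredMn // mulr1; split => //; rewrite rpredD ?rpredMn.
    by rewrite mono1; split => //; exact: rpred0.
  exact: alg.
- by move=> i; exact: XJ.
- move=> z; rewrite mem_cat => /orP[] /mapP[i _ ->].
    by split; [exact: alg|exact: XJ].
  by split; [apply: alg; exact: SN|apply: XJ; exact: SN].
- move=> f; apply: laurent_gen_by => c; exists (mono _ _ _ c 0).
  by rewrite [LHS](lemb_mono _ _ _ hE) // rpred0.
exists Lb; apply: near0_impl hL _ => t x [p [pu pJ pGam pb]]; exists p.
have [pm _] := pu; have ppos f : ~ J f -> 0 < p f.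
  by move=> fJ; rewrite lt_def (seminorm_ge0 pm) andbT; apply/eqP => /pJ.
have GamM c u : u \in zgen (range e) -> Gam t x (mono _ _ _ c u) = absv v c * expR (- tilted t x u).
  by move=> uE; rewrite /Gam [te _ _ _](lemb_mono _ _ _ (fun u h => h)) // nrm_mono.
split => // [f If|c|i|i].
- by apply/pJ; exact: qI.
- have -> : C c = phi (mono _ _ _ c 0) by rewrite [RHS](lemb_mono _ _ _ hE) // rpred0.
  by rewrite pGam GamM ?rpred0 // raddf0 oppr0 expR0 mulr1.
- have := pb i; rewrite qX // expRK opprK /gev /= => h.
  by rewrite -h opprK lnK // posrE; apply: ppos; exact: XJ.
- have eE : e i \in zgen (range e) by apply: zgen_sub; exists i.
  have -> : X (e i) = phi (mono _ _ _ 1 (e i)) by rewrite [RHS](lemb_mono _ _ _ hE).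
  rewrite pGam GamM // absv1 mul1r; congr (expR (- (_ + _ * _))).
  rewrite (bigD1 i) //= y_dual eqxx mulr1 big1 ?addr0 // => j /negPf ji.
  by rewrite y_dual ji mulr0.
Qed.

End FreeSpectralPoint.

(** Baire category: the complements of points are open and dense in the reals. *)
Lemma avoid_sequence (R : realType) (c : nat -> R) : exists x, forall i, x <> c i.
Proof.
have h i : open (~` [set c i] : set R^o) /\ dense (~` [set c i] : set R^o).
  split; last exact: dense_set1C.
  by apply: closed_openC; apply/accessible_closed_set1/hausdorff_accessible; exact: Rhausdorff.
have := @Baire R R^o (fun i => ~` [set c i]) h setT.
move=> [||x [_ hx]]; [by exists 0|exact: openT|].
by exists x => i; apply: hx.
Qed.

(** Each new coordinate avoids the countably many rational combinations of the previous ones, which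
    [unpickle] enumerates. *)
Lemma rationally_independent (R : realType) k : exists x0 : 'rV[R]_k, forall l : 'rV[rat]_k, l != 0 -> rform l x0 != 0.
Proof.
elim: k => [|k [x hx]]; first by exists 0 => l; rewrite [l]thinmx0 eqxx.
pose c i : R := if (choice.unpickle i : option 'rV[rat]_k) is Some l then rform l x else 0.
have [y hy] := avoid_sequence c.
have hy' (l : 'rV[rat]_k) : y <> rform l x.
  by have := hy (choice.pickle l); rewrite /c choice.pickleK.
pose x' : 'rV[R]_k.+1 := \row_i if unlift ord_max i is Some j then x 0 j else y.
exists x' => l l0; pose l1 : 'rV[rat]_k := \row_i l 0 (lift ord_max i).
have -> : rform l x' = rform l1 x + ratr (l 0 ord_max) * y.
  rewrite /rform big_ord_recr /= mxE unlift_none; congr (_ + _).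
  apply: eq_bigr => i _; have -> : widen_ord (leqnSn k) i = lift ord_max i.
    by apply: val_inj; rewrite /= /bump leqNgt ltn_ord.
  by rewrite !mxE liftK.
have [lm|lm] := eqVneq (l 0 ord_max) 0.
  rewrite lm rmorph0 mul0r addr0; apply: hx; apply: contra l0 => /eqP l10.
  apply/eqP/matrixP => a i; rewrite ord1 mxE; case: (unliftP ord_max i) => [j|] -> //.
  by have := congr1 (fun M : 'rV_k => M 0 j) l10; rewrite !mxE.
apply/eqP => h; apply: (hy' (- (l 0 ord_max)^-1 *: l1)).
rewrite rformZ rmorphN fmorphV mulNr; apply: (@mulfI _ (ratr (l 0 ord_max))); first by rewrite fmorph_eq0.
by rewrite mulrN mulVKf ?fmorph_eq0 //; apply/eqP; rewrite -addr_eq0 addrC h.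
Qed.

(** * Tropicalization and dimension *)

Section Lattice.
Context {R : realType} {n : nat}.
Local Notation NR := 'rV[R]_n.
Local Notation M := 'rV[int]_n.
Implicit Types (s : set NR) (x : NR) (u : M).

Lemma pairingDl x y u : pairing (x + y) u = pairing x u + pairing y u.
Proof. by rewrite /pairing /dot -big_split; apply: eq_bigr => i _; rewrite !mxE mulrDr. Qed.
Lemma pairingZl a x u : pairing (a *: x) u = a * pairing x u.
Proof. by rewrite /pairing /dot mulr_sumr; apply: eq_bigr => i _; rewrite !mxE mulrCA. Qed.
Lemma pairing0l u : pairing (0 : NR) u = 0.
Proof. by rewrite -(scale0r 0) pairingZl mul0r. Qed.
Lemma pairingBl x y u : pairing (x - y) u = pairing x u - pairing y u.
Proof. by rewrite pairingDl -scaleN1r pairingZl mulN1r. Qed.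
Lemma pairing_suml (I : Type) (r : seq I) (P : pred I) (F : I -> NR) u :
  pairing (\sum_(i <- r | P i) F i) u = \sum_(i <- r | P i) pairing (F i) u.
Proof. by elim/big_rec2: _ => [|i y z _ <-]; rewrite ?pairing0l ?pairingDl. Qed.

Lemma span_pairing s x u : x \in linear_span s -> u \in perp s -> pairing x u = 0.
Proof.
move=> /asboolP hx /asboolP us; apply: (hx [set x | pairing x u = 0]) => /=.
- exact: pairing0l.
- by move=> a y z hy hz; rewrite pairingDl pairingZl hy hz mulr0 addr0.
- by move=> y; exact: us.
Qed.

Lemma weight_proj s x u : u \in perp s -> weight (quotient_proj s x) u = pairing x u.
Proof.
move=> us; apply/eqP; rewrite -subr_eq0 /weight -pairingBl.
by rewrite (span_pairing (repr_proj s x)).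
Qed.

Lemma perpN s u : u \in perp s -> - u \in perp s.
Proof.
by move=> /asboolP h; apply/asboolP => x sx; rewrite raddfN /= h // oppr0.
Qed.

Lemma cone_gens_span (k : nat) (g : 'I_k -> M) s : s = [set x | exists2 c : 'I_k -> R,
    forall i, 0 <= c i & x = \sum_i c i *: map_mx intr (g i)] ->
  forall c : 'I_k -> R, \sum_i c i *: map_mx intr (g i) \in linear_span s.
Proof.
move=> -> c; apply/asboolP => U U0 Ul sU.
have Ug i : U (map_mx intr (g i)).
  apply: sU; exists (fun j => (j == i)%:R) => [j|]; first exact: ler0n.
  by rewrite (bigD1 i) //= eqxx scale1r big1 ?addr0 // => j /negPf ->; rewrite scale0r.
by elim/big_ind: _ => // [x y Ux Uy|i _]; [rewrite -[x]scale1r; exact: Ul|rewrite -[_ *: _]addr0; exact: Ul].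
Qed.

(** Smith normal form of the matrix of generators, [G = L D Q]: the lattice [sigma^perp] has a basis
    among the columns of the inverse of [Q], and the corresponding rows of [Q] are dual to it. The
    other rows lie in the span of the cone, which is therefore the whole annihilator of
    [sigma^perp]. *)
Lemma perp_lattice s : rational_cone s -> exists (r : nat) (b : 'I_r -> M) (y : 'I_r -> NR),
  [/\ forall i, b i \in perp s, forall u, u \in perp s -> zspan b u,
      forall i j, pairing (y j) (b i) = (i == j)%:R &
      forall x, (forall i, pairing x (b i) = 0) -> x \in linear_span s].
Proof.
move=> [m [g sE]].
pose G : 'M[int]_(m, n) := \matrix_(i, j) g i 0 j.
have [L Lu [Q Qu [d _ GE]]] := int_Smith_normal_form G.
pose Dm : 'M[int]_(m, n) := \matrix_(i, j) (d`_i *+ (i == j :> nat)).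
(* The columns in which the diagonal form vanishes, because the divisor is 0 or the row does not
   exist. *)
pose Z : pred 'I_n := [pred j : 'I_n | (m <= j)%N || (d`_j == 0)].
have GD : invmx L *m G = Dm *m Q by rewrite GE -mulmxA mulKmx.
pose b (i : 'I_#|Z|) : M := (col (enum_val i) (invmx Q))^T.
pose y (i : 'I_#|Z|) : NR := map_mx intr (row (enum_val i) Q).
have pairE (x : NR) (u : M) : pairing x u = (x *m (map_mx intr u)^T) 0 0.
  by rewrite mxE; apply: eq_bigr => i _; rewrite !mxE mulrC.
have gs i : s (map_mx intr (g i)).
  rewrite sE; exists (fun j => (j == i)%:R) => [j|]; first exact: ler0n.
  by rewrite (bigD1 i) //= eqxx scale1r big1 ?addr0 // => j /negPf ->; rewrite scale0r.
have perpP u : u \in perp s <-> G *m u^T = 0.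
  have gu i : pairing (map_mx intr (g i) : NR) u = ((G *m u^T) i 0)%:~R.
    rewrite /pairing /dot mxE rmorph_sum; apply: eq_bigr => j _.
    by rewrite !mxE rmorphM mulrC.
  split=> [/asboolP h|h].
    apply/matrixP => i j; rewrite ord1 [RHS]mxE; apply/eqP; rewrite -(intr_eq0 R) -gu h //.
  apply/asboolP => x; rewrite sE => -[c _ ->]; rewrite pairing_suml big1 // => i _.
  by rewrite pairingZl gu h mxE mulr0.
have QZ j l : l \in Z -> (Q *m invmx Q) j l = (j == l)%:R by rewrite mulmxV // mxE.
have DmZ (c : 'cV[int]_n) : (forall j, j \notin Z -> c j 0 = 0) -> Dm *m c = 0.
  move=> hc; apply/matrixP => i j; rewrite ord1 mxE [RHS]mxE big1 // => l _; rewrite mxE.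
  have [lZ|/hc ->] := boolP (l \in Z); last by rewrite mulr0.
  case: eqP => [il|_]; last by rewrite mulr0n mul0r.
  by move: lZ; rewrite inE -il leqNgt ltn_ord /= => /eqP ->; rewrite mul0rn mul0r.
exists #|Z|, b, y; split.
- move=> i; apply/perpP; rewrite /b trmxK colE GE -!mulmxA [Q *m _]mulmxA mulmxV // mul1mx DmZ ?mulmx0 // => j jZ.
  rewrite !mxE; case: eqP => // ji; move: jZ; rewrite ji; have := enum_valP i; by move=> ->.
- move=> u /perpP Gu.
  have Du : Dm *m (Q *m u^T) = 0 by rewrite mulmxA -GD -mulmxA Gu mulmx0.
  exists (fun i => (Q *m u^T) (enum_val i) 0).
  apply: trmx_inj; rewrite -[LHS](mulKmx Qu); move: (Q *m u^T) Du => c Dc.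
  have c0 j : j \notin Z -> c j 0 = 0.
    rewrite inE negb_or -ltnNge => /andP[jm dj].
    have := congr1 (fun B : 'cV_m => B (Ordinal jm) 0) Dc; rewrite !mxE (bigD1 j) //= big1 => [|l lj].
      by rewrite mxE eqxx mulr1n addr0 => /eqP; rewrite mulf_eq0 (negPf dj) => /eqP.
    by rewrite mxE; case: eqP => [/= jl|_]; [case/eqP: lj; apply/val_inj|rewrite mulr0n mul0r].
  apply/matrixP => l a; rewrite ord1 [RHS]mxE summxE mxE (bigID (mem Z)) /= [X in _ + X]big1 ?addr0; last first.
    by move=> j /c0 ->; rewrite mulr0.
  rewrite big_enum_val; apply: eq_bigr => i _; rewrite [in RHS]/b -scaler_int mxE !mxE intz mulrC.
  by [].
- move=> i j; transitivity (((Q *m invmx Q) (enum_val j) (enum_val i))%:~R : R).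
    by rewrite [in RHS]mxE rmorph_sum; apply: eq_bigr => l _; rewrite !mxE rmorphM mulrC.
  by rewrite mulmxV // mxE (inj_eq enum_val_inj) eq_sym; case: eqP.
- move=> x hx.
  pose QR := map_mx intr Q : 'M[R]_n; pose QI := map_mx intr (invmx Q) : 'M[R]_n.
  have QIR : QI *m QR = 1%:M.
    apply/matrixP => i j; transitivity (((invmx Q *m Q) i j)%:~R : R); last by rewrite mulVmx // !mxE; case: eqP.
    by rewrite !mxE rmorph_sum; apply: eq_bigr => l _; rewrite !mxE rmorphM.
  have xE : x = \sum_j (x *m QI) 0 j *: row j QR by rewrite -mulmx_sum_row -mulmxA QIR mulmx1.
  have hz j : j \in Z -> (x *m QI) 0 j = 0.
    move=> jZ; have := hx (enum_rank_in jZ j); rewrite /b enum_rankK_in // => <-.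
    by rewrite mxE; apply: eq_bigr => l _; rewrite !mxE mulrC.
  rewrite xE; have span0 := linear_span0 s.
  rewrite (bigID (mem Z)) /= big1 ?add0r => [|j jZ]; last by rewrite hz // scale0r.
  apply: rpred_sum => j; rewrite inE negb_or -ltnNge => /andP[jm dj].
  have rowE : row j QR = ((d`_j)%:~R)^-1 *: \sum_i ((invmx L) (Ordinal jm) i)%:~R *: map_mx intr (g i).
    have dR : (d`_j)%:~R != 0 :> R by rewrite intr_eq0.
    apply: (canRL (scalerK dR)); apply/matrixP => a l; rewrite ord1 !mxE summxE.
    have := congr1 (fun B : 'M[int]_(m, n) => B (Ordinal jm) l) GD; rewrite !mxE => E.
    transitivity (((\sum_i (invmx L) (Ordinal jm) i * G i l)%:~R : R)).
      rewrite E (bigD1 j) //= big1 ?addr0 => [|j' j'j].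
        by rewrite mxE eqxx mulr1n rmorphM.
      by rewrite mxE; case: eqP => [/= jl|_]; [case/eqP: j'j; apply/val_inj|rewrite mulr0n mul0r].
    by rewrite rmorph_sum; apply: eq_bigr => i _; rewrite !mxE rmorphM.
  rewrite -[_ *: _]addr0; apply: linear_spanZD => //.
  by rewrite rowE -[_ *: _]addr0; apply: linear_spanZD => //; exact: cone_gens_span sE _.
Qed.

End Lattice.

Section TropicalDimension.
Context {R : realType} {K : fieldType} (v : valuation R K) {n : nat} (Delta : fan R n).
Variable X : closed_subscheme K Delta.
Local Notation NR := 'rV[R]_n.
Local Notation M := 'rV[int]_n.
Implicit Types (s : set NR) (u : M).

Lemma weightD s (x y : quotient s) u : u \in perp s -> weight (x + y) u = weight x u + weight y u.
Proof.
move=> us; rewrite -(quotient_projK x) -(quotient_projK y) -quotient_projD.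
by rewrite !weight_proj // pairingDl.
Qed.
Lemma weightZ s (a : R) (x : quotient s) u : u \in perp s -> weight (a *: x) u = a * weight x u.
Proof.
by move=> us; rewrite -[X in a *: X](quotient_projK x) (_ : a *: quotient_proj s (repr x) = quotient_proj s (a *: repr x)) ?quotient_projZ // -quotient_projZ weight_proj // pairingZl.
Qed.
Lemma weight0 s u : u \in perp s -> weight (0 : quotient s) u = 0.
Proof. by move=> us; rewrite -(scale0r (0 : quotient s)) weightZ // mul0r. Qed.
Lemma weight_sum s (I : Type) (r : seq I) (P : pred I) (F : I -> quotient s) u : u \in perp s ->
  weight (\sum_(i <- r | P i) F i) u = \sum_(i <- r | P i) weight (F i) u.
Proof. by move=> us; elim/big_rec2: _ => [|i y z _ <-]; rewrite ?weight0 ?weightD. Qed.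

Lemma weight_inj s r (b : 'I_r -> M) : (forall i, b i \in perp s) ->
  (forall x : NR, (forall i, pairing x (b i) = 0) -> x \in linear_span s) ->
  forall x y : quotient s, (forall i, weight x (b i) = weight y (b i)) -> x = y.
Proof.
move=> bs hb x y h; rewrite -(quotient_projK x) -(quotient_projK y); apply/eqP.
by rewrite quotient_projE; apply: hb => i; rewrite pairingBl; apply/eqP; rewrite subr_eq0; apply/eqP; exact: h.
Qed.

Lemma weight_inj_perp s : rational_cone s ->
  forall x y : quotient s, (forall u, u \in perp s -> weight x u = weight y u) -> x = y.
Proof.
move=> /(@perp_lattice R n)[r [b [y0 [bs _ _ hb]]]] x y h; apply: (weight_inj bs hb) => i; apply: h; exact: bs.
Qed.

Lemma trop_ptE (xi : toric_an v Delta) (x : quotient (torus_orbit xi)) :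
  (forall u, u \in perp (torus_orbit xi) -> @pt _ _ _ _ _ xi (mono _ _ _ 1 u) = expR (- weight x u)) -> trop_pt xi = x.
Proof.
move=> hx; have [cs _] := fan_cone (orbit_cone xi).
rewrite /trop_pt; case: xgetP => [y _ hy|]; last by move/(_ x).
apply: weight_inj_perp cs _ _ _ => u us; have := hy u us; rewrite hx // => /expR_inj/oppr_inj.
by [].
Qed.

Lemma trop_X_at_intro s (Ds : cones Delta s) (p : laurent R K (perp s) -> R) (x : quotient s) :
  mult_seminorm p -> (forall c, p (mono _ _ _ c 0) = absv v c) -> (forall f, orbit_ideal X s f -> p f = 0) ->
  (forall u, u \in perp s -> p (mono _ _ _ 1 u) = expR (- weight x u)) -> trop_X_at v X s x.
Proof.
move=> pm pc pI px; exists (ToricAn Ds pm pc); first exact: pI.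
by rewrite /trop /= (@trop_ptE (ToricAn Ds pm pc) x).
Qed.

Definition coordinate s u (us : u \in perp s) (x : quotient s) : R := weight x u.
Fact coordinate_linear s u (us : u \in perp s) : scalar (coordinate us).
Proof. by move=> a x y; rewrite /coordinate weightD // weightZ. Qed.
HB.instance Definition _ s u (us : u \in perp s) :=
  GRing.isLinear.Build R (quotient s) R *%R (coordinate us) (coordinate_linear us).

Variables (s : set NR) (Ds : cones Delta s) (omega : quotient s).
Local Notation S := (perp s).
Local Notation a := (@affinoid_ideal R K n Delta X K v id s omega).
Hypothesis Tomega : trop_X_at v X s omega.

Let SN : forall u : M, u \in S -> - u \in S. Proof. by move=> u; exact: perpN. Qed.

Lemma orbit_ideal_is_ideal : is_ideal (orbit_ideal X s).
Proof.
have [I0 ID IM] := ideal_ofP X Ds.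
have truncD (f g : laurent R K (dual s)) : trunc (perp s) (f + g) = trunc (perp s) f + trunc (perp s) g.
  by apply: restr_eq => u; rewrite coefD /= /trunc_coef coefD; case: ifP; rewrite ?addr0.
split.
- by exists 0 => //; apply: restr_eq => u; rewrite /= /trunc_coef !coef0; case: ifP.
- by move=> _ _ [f If <-] [g Ig <-]; exists (f + g); [exact: ID|rewrite truncD].
- move=> h _ [f If <-]; apply: (@laurent_sumP R K _ (perp s) h (fun h => orbit_ideal X s (h * trunc (perp s) f))).
  + by exists 0 => //; rewrite mul0r; apply: restr_eq => u; rewrite /= /trunc_coef !coef0; case: ifP.
  + move=> g1 g2 [f1 If1 E1] [f2 If2 E2]; exists (f1 + f2); first exact: ID.
    by rewrite truncD E1 E2 mulrDl.
  + move=> u us _; have ud : u \in dual s.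
      by move/asboolP: us => us; apply/asboolP => x sx; rewrite us.
    exists (mono _ _ _ (h u) u * f); first exact: IM.
    apply: restr_eq => x; rewrite [RHS]coef_monoM //= /trunc_coef coef_monoM //.
    have -> : (x - u \in perp s) = (x \in perp s).
      apply/idP/idP => hx; last by rewrite rpredD // perpN.
      by rewrite -(subrK u x) rpredD.
    by case: ifP => _; rewrite ?mulr0.
Qed.

Lemma aff_dim_ge (V : lmodType R) (P : set V) k (x : 'I_k.+1 -> V) : (forall i, P (x i)) ->
  affinely_independent x -> ((k%:R)%:E <= aff_dim P)%E.
Proof. by move=> Px ind; apply: ereal_sup_ubound; exists k => //; exists x. Qed.

Lemma set_dim_ge (V : lmodType R) (C P : set V) : polyhedron P -> P `<=` C -> (aff_dim P <= set_dim C)%E.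
Proof. by move=> h1 h2; apply: ereal_sup_ubound; exists P. Qed.

Lemma polyhedron_fin (V : lmodType R) (I : finType) (l : I -> {scalar V}) (c : I -> R) :
  polyhedron [set x | forall i, l i x <= c i].
Proof.
exists #|I|, (fun i => l (enum_val i)), (fun i => c (enum_val i)).
apply/seteqP; split=> x /= h i //.
by have := h (enum_rank i); rewrite enum_rankK.
Qed.

Definition combination (J : finType) (us : J -> M) (hus : forall j, us j \in S) (c : J -> R) (x : quotient s) : R :=
  \sum_j c j * weight x (us j).
Fact combination_linear J us hus c : scalar (@combination J us hus c).
Proof.
move=> t x y; rewrite /combination mulr_sumr -big_split; apply: eq_bigr => j _ /=.
by rewrite weightD // weightZ //; ring.
Qed.
HB.instance Definition _ J us hus c :=
  GRing.isLinear.Build R (quotient s) R *%R (@combination J us hus c) (@combination_linear J us hus c).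

(** Clearing denominators turns independence over the integers into independence over the rationals,
    and a right inverse of the coordinate matrix gives the dual vectors. *)
Lemma dual_vectors r (b : 'I_r -> M) (y : 'I_r -> NR) k (e : 'I_k -> M) :
  (forall i j, pairing (y j) (b i) = (i == j)%:R) -> (forall i, zspan b (e i)) -> zindep e ->
  exists y' : 'I_k -> NR, forall i j, pairing (y' i) (e j) = (i == j)%:R.
Proof.
move=> yb /choice[Z hZ] ez.
pose ZQ : 'M[rat]_(k, r) := \matrix_(i, j) (Z i j)%:~R.
have : row_free ZQ.
  apply: contrapT => nf; have : kermx ZQ != 0 by rewrite kermx_eq0; apply/negP.
  move=> /rowV0Pn[x /sub_kermxP xZ /rV0Pn[i0 xi0]]; move/eqP: xi0; apply.
  pose z i : int := numq (x 0 i) * \prod_(j | j != i) denq (x 0 j).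
  pose N : int := \prod_j denq (x 0 j).
  have N0 : N != 0 by apply/prodf_neq0 => j _; rewrite denq_neq0.
  have zE i : (z i)%:~R = N%:~R * x 0 i :> rat.
    rewrite /N (bigD1 i) //= !rmorphM /= mulrAC; congr (_ * _).
    by rewrite mulrC numqE.
  have z0 : z i0 = 0.
    apply: ez; have -> : \sum_i e i *~ z i = \sum_j b j *~ (\sum_i z i * Z i j).
      under [RHS]eq_bigr do rewrite mulrz_sumr.
      rewrite exchange_big; apply: eq_bigr => i _; rewrite [in LHS](hZ i) mulrz_suml.
      by apply: eq_bigr => j _; rewrite [z i * _]mulrC; exact/esym/mulrzA.
    apply: big1 => j _; suff -> : \sum_i z i * Z i j = 0 by rewrite mulr0z.
    apply/eqP; rewrite -(intr_eq0 rat) rmorph_sum; apply/eqP.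
    under eq_bigr do rewrite rmorphM /= zE -mulrA.
    rewrite -mulr_sumr; have := congr1 (fun M : 'rV_r => M 0 j) xZ; rewrite !mxE => E.
    by rewrite [X in _ * X](_ : _ = 0) ?mulr0 // -[RHS]E; apply: eq_bigr => i _; rewrite mxE.
  apply/eqP; have := zE i0; rewrite z0 => /esym/eqP; rewrite mulf_eq0 intr_eq0 (negPf N0).
  by [].
move=> /row_freeP[B ZB].
exists (fun i => \sum_l ratr (B l i) *: y l) => i j.
rewrite pairing_suml (eq_bigr (fun l => ratr (Z j l)%:~R * ratr (B l i))) => [|l _].
  under eq_bigr do rewrite -rmorphM /=; rewrite -rmorph_sum /=.
  transitivity (ratr ((ZQ *m B) j i) : R); last by rewrite ZB mxE eq_sym; case: eqP; rewrite ?rmorph1 ?rmorph0.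
  by congr ratr; rewrite mxE; apply: eq_bigr => l _; rewrite mxE.
rewrite pairingZl mulrC; congr (_ * _); rewrite (hZ j) raddf_sum (bigD1 l) //= big1 ?addr0 => [|l' l'l].
  by rewrite raddfMz /= yb eqxx ratr_int.
by rewrite raddfMz /= yb (negPf l'l) mul0rz.
Qed.

(** The deformed points tropicalize to [omega + t *: Lam x] with [Lam] linear, so a small cube
    around [x0] is carried into the local cone. Its image has dimension [k] because the weights of
    the [e i] recover [x]. *)
Lemma free_rank_le_dim k (e : 'I_k -> M) : (forall i, e i \in S) -> zindep e ->
  finite_over (zspan e) a -> free_over (zspan e) a ->
  ((k%:R)%:E <= local_trop_dim (trop_X_at v X s) omega)%E.
Proof.
move=> eS ez fin fre; have Iid := orbit_ideal_is_ideal.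
have [r [b [y0 [bS Sb yb hb]]]] := perp_lattice (proj1 (fan_cone Ds)).
have [y ye] := dual_vectors yb (fun i => Sb _ (eS i)) ez.
have [x0 hx0] := rationally_independent R k.
have [Q Qa Qn] := free_spectrum (gen_ideal_is_ideal _) (zspan0 e) (@zspanD _ _ e) fre.
have [Lb [eps eps0 hL]] := @tropical_cell R K v n S (weight omega) SN r b bS Sb (orbit_ideal X s) Iid k e eS fin Q Qa Qn
  (fun i => pairing (y i)) x0 ye hx0.
pose Lam (x : 'rV[R]_k) : quotient s := quotient_proj s (\sum_i rform (Lb i) x *: y0 i).
have Lamb x i : weight (Lam x) (b i) = rform (Lb i) x.
  rewrite weight_proj // pairing_suml (bigD1 i) //= big1 ?addr0 => [|j ji].
    by rewrite pairingZl yb eqxx mulr1.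
  by rewrite pairingZl yb eq_sym (negPf ji) mulr0.
have TL t (x : 'rV[R]_k) : 0 < t < eps -> (forall i, `|x 0 i - x0 0 i| < eps) ->
    trop_X_at v X s (omega + t *: Lam x) /\ forall i, weight (Lam x) (e i) = x 0 i.
  move=> ht hx; have [p [[pm pu] pI pC pb pe]] := hL t x ht hx.
  have pW u : u \in S -> p (mono _ _ _ 1 u) = expR (- weight (omega + t *: Lam x) u).
    apply: (@laurent_weight R K n S SN r b bS Sb p (weight (omega + t *: Lam x)) pm) => i.
    have E : weight (omega + t *: Lam x) (b i) = weight omega (b i) + t * rform (Lb i) x.
      by rewrite weightD // weightZ // Lamb.
    by rewrite pb -E.
  split; first exact: (trop_X_at_intro Ds pm pC pI pW).
  move=> i; have := pW _ (eS i); rewrite pe weightD // weightZ // => /expR_inj/oppr_inj/addrI/mulfI.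
  by move=> -> //; case/andP: ht => h _; rewrite gt_eqF.
pose del := eps / 2.
have del0 : 0 < del by rewrite divr_gt0.
have dele : del < eps by rewrite ltr_pdivrMr // ltr_pMr // ltr1n.
have Lame (x : 'rV[R]_k) : (forall i, `|x 0 i - x0 0 i| <= del) -> forall i, weight (Lam x) (e i) = x 0 i.
  move=> hx i; have [] // := TL del x; first by rewrite del0.
  by move=> j; exact: le_lt_trans (hx j) dele.
pose xof (eta : quotient s) : 'rV[R]_k := \row_i weight eta (e i).
(* The image of the cube, written by equations and inequalities in the weights, so that it is a
   polyhedron by inspection; [l] and [c] below split equations and absolute values into pairs of
   inequalities. *)
pose Cell : set (quotient s) := [set eta | (forall i, weight eta (b i) = rform (Lb i) (xof eta)) /\
  forall i, `|xof eta 0 i - x0 0 i| <= del].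
have CellL eta : Cell eta -> eta = Lam (xof eta).
  by move=> [h _]; apply: (weight_inj bS hb) => i; rewrite h Lamb.
have LCell (x : 'rV[R]_k) : (forall i, `|x 0 i - x0 0 i| <= del) -> Cell (Lam x).
  move=> hx; have xE : xof (Lam x) = x by apply/matrixP => i j; rewrite ord1 mxE Lame.
  by split=> i; rewrite ?xE // Lamb.
pose us (j : 'I_r + 'I_k) := match j with inl i => b i | inr i => e i end.
have usS j : us j \in S by case: j.
pose I := ((bool * 'I_r) + (bool * 'I_k))%type.
pose l (i : I) : {scalar quotient s} := combination usS (fun j => match i, j with
  | inl (sg, i), inl i' => (-1) ^+ sg * (i == i')%:R
  | inl (sg, i), inr a => - ((-1) ^+ sg * ratr (Lb i 0 a))
  | inr (sg, a), inl _ => 0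
  | inr (sg, a), inr a' => (-1) ^+ sg * (a == a')%:R end).
pose c (i : I) : R := match i with inl _ => 0 | inr (sg, a) => (-1) ^+ (sg : bool) * x0 0 a + del end.
have l1 sg i eta : l (inl (sg, i)) eta = (-1) ^+ sg * (weight eta (b i) - rform (Lb i) (xof eta)).
  rewrite /l /= /combination big_sumType /= (bigD1 i) //= eqxx big1 ?addr0 => [|j ji].
    rewrite mulr1 mulrBr; congr (_ + _); rewrite /rform mulr_sumr -sumrN; apply: eq_bigr => j _.
    by rewrite /xof mxE mulNr !mulrA.
  by rewrite eq_sym (negPf ji) mulr0 mul0r.
have l2 sg i eta : l (inr (sg, i)) eta = (-1) ^+ sg * xof eta 0 i.
  rewrite /l /= /combination big_sumType /= big1 ?add0r => [|j _]; last by rewrite mul0r.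
  rewrite (bigD1 i) //= eqxx big1 ?addr0 ?mulr1 ?mxE // => j ji.
  by rewrite eq_sym (negPf ji) mulr0 mul0r.
have CellP : Cell = [set eta | forall i, l i eta <= c i].
  apply/seteqP; split=> eta.
    move=> [h1 h2] [[sg i]|[sg i]]; first by rewrite l1 h1 subrr mulr0.
    rewrite l2 /= addrC -lerBlDr -mulrBr; apply: le_trans (h2 i); case: sg; rewrite ?expr1 ?expr0 ?mul1r ?mulN1r.
      by rewrite -normrN ler_norm.
    exact: ler_norm.
  move=> h; split=> i.
    have := h (inl (false, i)); have := h (inl (true, i)); rewrite !l1 /= expr0 expr1 mul1r mulN1r oppr_le0 => h1 h2.
    by apply/eqP; rewrite -subr_eq0 eq_le h2.
  have := h (inr (false, i)); have := h (inr (true, i)); rewrite !l2 /= expr0 expr1 !mul1r !mulN1r => h1 h2.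
  by rewrite ler_norml; apply/andP; split; lra.
apply: (@le_trans _ _ (aff_dim Cell)); last first.
  apply: set_dim_ge; first by rewrite CellP; exact: polyhedron_fin.
  move=> eta /[dup] hC /CellL etaE; exists del => // t /andP[t0 td].
  have [->|tn0] := eqVneq t 0; first by rewrite scale0r addr0.
  rewrite etaE; apply: (proj1 (TL _ _ _ _)); first by rewrite lt_def tn0 t0 (le_lt_trans td).
  by case: hC => _ h i; exact: le_lt_trans (h i) dele.
(* The vertices of a simplex in the cube: [x0] and its translates by [del] along the axes. *)
pose pts (i : 'I_k.+1) : 'rV[R]_k := \row_j (x0 0 j + if unlift ord0 i is Some i' then (i' == j)%:R * del else 0).
have ptsD i j : `|pts i 0 j - x0 0 j| <= del.
  rewrite mxE addrAC subrr add0r; case: unlift => [i'|]; last by rewrite normr0 ltW.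
  by case: eqP => _; rewrite ?mul1r ?mul0r ?normr0 ?gtr0_norm // ltW.
apply: (@aff_dim_ge _ _ _ (fun i => Lam (pts i))) => [i|cf c0 cL]; first by apply: LCell => j; exact: ptsD.
have clift j : cf (lift ord0 j) = 0.
  have := congr1 (fun eta => weight eta (e j)) cL; rewrite weight0 // weight_sum //.
  rewrite (eq_bigr (fun i => cf i * x0 0 j + cf i * (if unlift ord0 i is Some i' then (i' == j)%:R * del else 0))) => [|i _]; last first.
    by rewrite weightZ // Lame ?mxE ?mulrDr //; exact: ptsD.
  rewrite big_split /= -mulr_suml c0 mul0r add0r big_ord_recl unlift_none mulr0 add0r (bigD1 j) //= liftK eqxx mul1r.
  rewrite big1 ?addr0 => [/eqP|i ij]; last by rewrite liftK (negPf ij) mul0r mulr0.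
  by rewrite mulf_eq0 (gt_eqF del0) orbF => /eqP.
move=> i; case: (unliftP ord0 i) => [j|] -> //.
by move: c0; rewrite big_ord_recl big1 ?addr0.
Qed.

End TropicalDimension.

(** * Extension of scalars and Krull dimension *)

Section CoefficientExtension.
Context {R : realType} {K L : fieldType} (v : valuation R K) (vL : valuation R L) (iota : {rmorphism K -> L}).
Hypothesis viota : forall x, vL (iota x) = v x.
Context {n : nat}.
Local Notation A := 'rV[int]_n.
Context (S : addrClosed A) (w : {additive A -> R}).
Local Notation KU := (restr v S w).
Local Notation LU := (restr vL S w).
Implicit Types f g : KU.

Fact cemb_supp f u : u \notin S -> iota (f u) = 0.
Proof. by move=> uS; rewrite coef_supp ?rmorph0. Qed.
Fact cemb_null f : wnull vL w (fun u => iota (f u)).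
Proof. by move=> C; apply: sub_finite_set (coef_null f C) => u /=; rewrite viota. Qed.
Definition cemb f : LU := Restr (@cemb_supp f) (@cemb_null f).

Lemma cemb_coef f u : cemb f u = iota (f u). Proof. by []. Qed.

Lemma absv_iota x : absv vL (iota x) = absv v x.
Proof. by rewrite /absv viota. Qed.

Fact cemb_nmod : nmod_morphism cemb.
Proof.
split; first by apply: restr_eq => u; rewrite cemb_coef !coef0 rmorph0.
by move=> f g; apply: restr_eq => u; rewrite cemb_coef !coefD !cemb_coef rmorphD.
Qed.
HB.instance Definition _ := GRing.isNmodMorphism.Build KU LU cemb cemb_nmod.

Lemma cemb_mono c u : u \in S -> cemb (mono v S w c u) = mono vL S w (iota c) u.
Proof.
move=> uS; apply: restr_eq => x; rewrite cemb_coef !coef_mono //.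
by case: eqP; rewrite ?rmorph0.
Qed.

Lemma nrm_cemb f : gauss_norm (cemb f) = gauss_norm f.
Proof.
have tmE u : tm (cemb f) u = tm f u by rewrite /tm cemb_coef absv_iota.
apply/eqP; rewrite eq_le; apply/andP; split; apply: nrm_le => u.
  by rewrite tmE; exact: le_nrm.
by rewrite -tmE; exact: le_nrm.
Qed.

Lemma cemb_supp_in (T : set A) f : supp_in T f -> supp_in T (cemb f).
Proof. by move=> fT u; rewrite cemb_coef fmorph_eq0; exact: fT. Qed.

Lemma cemb_monoM c u g : u \in S -> cemb (mono v S w c u * g) = mono vL S w (iota c) u * cemb g.
Proof.
move=> uS; apply: restr_eq => x; rewrite cemb_coef coef_monoM // [RHS]coef_monoM // cemb_coef.
exact: rmorphM.
Qed.

(** Clear when the first factor is a finite sum of monomials; the general case follows by density,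
    since [cemb] preserves norms. *)
Fact cemb_monoid : monoid_morphism cemb.
Proof.
split; first by rewrite -mono1 cemb_mono ?rpred0 // rmorph1 mono1.
move=> f g; apply/eqP; rewrite -subr_eq0; apply/eqP/(@nrm_eq0 _ _ vL).
apply/eqP; rewrite eq_le nrm_ge0 andbT; apply/ler_addgt0Pr => e e0; rewrite add0r.
have g1 : 0 < gauss_norm g + 1 by rewrite ltr_wpDl ?nrm_ge0.
have [E _ [ES hE]] := approx f (divr_gt0 e0 g1); set r := f - mpart E f in hE.
have fE : f = mpart E f + r by rewrite /r addrC subrK.
have fin : cemb (mpart E f * g) = cemb (mpart E f) * cemb g.
  rewrite /mpart mulr_suml !raddf_sum mulr_suml big_seq [RHS]big_seq; apply: eq_bigr => u /ES uS.
  by rewrite [LHS]cemb_monoM //; congr (_ * _); exact/esym/cemb_mono.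
have e1 : cemb (f * g) = cemb (mpart E f) * cemb g + cemb (r * g).
  rewrite -fin -[RHS](raddfD cemb); congr cemb; rewrite {1}fE; exact: mulrDl.
have e2 : cemb f * cemb g = cemb (mpart E f) * cemb g + cemb r * cemb g.
  rewrite {1}fE (raddfD cemb); exact: mulrDl.
rewrite e1 e2 opprD addrACA subrr add0r.
have small : gauss_norm r * gauss_norm g <= e.
  apply: le_trans (ler_wpM2r (nrm_ge0 _) hE) _.
  by rewrite mulrAC -mulrA ler_piMr ?(ltW e0) // ler_pdivrMr // mul1r lerDl.
apply: le_trans (nrmD _ _) _; rewrite nrmN ge_max nrm_cemb; apply/andP; split.
  exact: le_trans (nrmM_le _ _) small.
by apply: le_trans (nrmM_le _ _) _; rewrite !nrm_cemb.
Qed.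
HB.instance Definition _ := GRing.isMonoidMorphism.Build KU LU cemb cemb_monoid.

Lemma coef_image_cemb (P : set KU) : coef_image iota vL w P = cemb @` P.
Proof.
apply/seteqP; split => g /= [f Pf fg]; exists f => //; last by rewrite -fg.
by apply: restr_eq => u; rewrite fg.
Qed.

(** A series over [L] is approximated by finitely many monomials, and each character is decomposed
    over [K]. The estimates survive because each term of a series is bounded by the norm of the
    series. *)
Lemma finite_over_extension (T : set A) (P : set KU) (Q : set LU) : is_ideal Q ->
  (forall x y, T x -> T y -> T (x + y)) -> T 0 ->
  (forall f, P f -> Q (cemb f)) -> finite_over T P -> finite_over T Q.
Proof.
move=> Qid TD T0 PQ [I [J [m [h [C [C0 mS hP ex]]]]]].
have h2 : 0 <= 1 / 2 :> R by rewrite divr_ge0.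
have h2' : 1 / 2 < 1 :> R by rewrite ltr_pdivrMr // mul1r ltr1n.
apply: (finite_over_approx h2 h2' C0 mS (fun j => PQ _ (hP j))) => f.
have [f0|f0] := eqVneq f 0.
  exists (fun=> 0), (fun=> 0), 0; rewrite f0; split => [||i|j|].
  - by rewrite !big1 ?addr0 // => i _; rewrite mul0r.
  - by move=> i; exact: supp_in0.
  - by rewrite mul0r nrm0.
  - by rewrite nrm0 mulr0.
  - by rewrite nrm0 mulr0.
have n0 := nrm_gt0 f0.
have [|E _ [ES hE]] := @approx _ _ vL A S w f (1 / 2 * gauss_norm f); first by rewrite mulr_gt0 // divr_gt0.
have /choice[b hb] : forall u, exists b : (I -> KU) * (J -> KU), mono v S w 1 u = \sum_i b.1 i * mono v S w 1 (m i) + \sum_j b.2 j * h j /\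
    [/\ forall i, supp_in T (b.1 i), forall i, gauss_norm (b.1 i * mono v S w 1 (m i)) <= gauss_norm (mono v S w 1 u) &
     forall j, gauss_norm (b.2 j) <= C * gauss_norm (mono v S w 1 u)].
  by move=> u; have [b [c [h1 hb1 hb3 hb4]]] := ex (mono v S w 1 u); exists (b, c).
exists (fun i => \sum_(u <- E) mono vL S w (f u) 0 * cemb ((b u).1 i)),
  (fun j => \sum_(u <- E) mono vL S w (f u) 0 * cemb ((b u).2 j)), (f - mpart E f).
have fu_le u : u \in S -> gauss_norm (mono vL S w (f u) 0) * gauss_norm (mono v S w 1 u) <= gauss_norm f.
  move=> uS; rewrite nrm_mono ?rpred0 // nrm_mono // raddf0 oppr0 expR0 mulr1 absv1 mul1r.
  exact: (le_nrm f u).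
split.
- rewrite -[LHS](subrK (mpart E f)) addrC; congr (_ + _).
  have term u : u \in E -> mono vL S w (f u) u =
      \sum_i mono vL S w (f u) 0 * cemb ((b u).1 i) * mono vL S w 1 (m i) +
      \sum_j mono vL S w (f u) 0 * cemb ((b u).2 j) * cemb (h j).
    move=> uE; have [hu _] := hb u.
    have -> : mono vL S w (f u) u = mono vL S w (f u) 0 * cemb (mono v S w 1 u).
      by rewrite cemb_mono ?ES // rmorph1 monoM ?rpred0 ?ES // mulr1 add0r.
    rewrite hu (raddfD cemb) !raddf_sum mulrDr !mulr_sumr; congr (_ + _); apply: eq_bigr => i _.
      rewrite -[in RHS]mulrA; congr (_ * _); apply: etrans (rmorphM cemb _ _) _; congr (_ * _).
      by apply: etrans (cemb_mono _ (mS i)) _; rewrite rmorph1.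
    by rewrite -[in RHS]mulrA; congr (_ * _); exact: (rmorphM cemb).
  rewrite /mpart big_seq (eq_bigr _ term) -big_seq big_split /=; congr (_ + _).
    by rewrite exchange_big; apply: eq_bigr => i _; rewrite mulr_suml.
  by rewrite exchange_big; apply: eq_bigr => i _; rewrite mulr_suml.
- move=> i; apply: supp_in_sum => u _; apply: supp_inM => //; first exact: supp_in_mono.
  by apply: cemb_supp_in; have [_ [hT _ _]] := hb u; exact: hT.
- move=> i; rewrite mulr_suml big_seq; apply: nrm_sum_le => [|u /ES uS]; first exact: nrm_ge0.
  rewrite -mulrA nrmM; have [_ [_ hn _]] := hb u.
  apply: le_trans (fu_le _ uS); apply: ler_wpM2l; first exact: nrm_ge0.
  have -> : cemb ((b u).1 i) * mono vL S w 1 (m i) = cemb ((b u).1 i * mono v S w 1 (m i)).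
    by apply: esym; apply: etrans (rmorphM cemb _ _) _; congr (_ * _); apply: etrans (cemb_mono _ (mS i)) _; rewrite rmorph1.
  by rewrite nrm_cemb.
- move=> j; rewrite big_seq; apply: nrm_sum_le => [|u /ES uS]; first by rewrite mulr_ge0 ?nrm_ge0.
  rewrite nrmM nrm_cemb; have [_ [_ _ hn]] := hb u.
  apply: le_trans (ler_wpM2l (nrm_ge0 _) (hn j)) _; rewrite mulrCA; apply: ler_wpM2l => //.
  exact: fu_le.
- exact: hE.
Qed.

End CoefficientExtension.

(** * Upper bound for the Krull dimension *)

Section KrullDimension.
Context {R : realType} {K : fieldType} (v : valuation R K) {n : nat}.
Local Notation A := 'rV[int]_n.
Context (S : addrClosed A) (w : {additive A -> R}).
Local Notation KU := (restr v S w).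
Hypothesis SN : forall u, u \in S -> - u \in S.

(* b is the lowest coefficient outside P of an integral equation of h over K<T>. *)
Lemma integral_multiple (T : set A) (P : set KU) (h : KU) : is_prime P -> T 0 ->
  (forall x y, T x -> T y -> T (x + y)) -> finite_over T P -> ~ P h ->
  exists b g, [/\ supp_in T b, ~ P b & P (b + h * g)].
Proof.
move=> PP T0 TD fin Ph; have [Pid P1 Pm] := PP.
have [f [fm fT fh]] := finite_over_integral h Pid T0 TD SN fin.
have ex : exists i, ~~ `[< P f`_i >].
  exists (size f).-1; apply/asboolP; rewrite -lead_coefE (monicP fm); exact: P1.
have [i hi imin] := ex_minnP ex.
have isz : (i <= size f)%N.
  have [//|h1] := leqP i (size f); move/asboolP: hi; rewrite nth_default ?(ltnW h1) //.
  by move=> []; exact: ideal0.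
exists f`_i, (\sum_(l < size f - i.+1) f`_(l + i.+1) * h ^+ l); split; [exact: fT|by move/asboolP: hi|].
have hX m : ~ P (h ^+ m).
  by elim: m => [//|m IH]; rewrite exprS => /Pm[].
suff : P (h ^+ i * (f`_i + h * (\sum_(l < size f - i.+1) f`_(l + i.+1) * h ^+ l))) by move/Pm => [/hX|].
have E : f.[h] = \sum_(l < i) f`_l * h ^+ l + h ^+ i * (f`_i + h * (\sum_(l < size f - i.+1) f`_(l + i.+1) * h ^+ l)).
  have [si|si] := ltnP i (size f); last first.
    rewrite (horner_coef_wide h si) (_ : (size f - i.+1)%N = 0%N); last by lia.
    by rewrite big_ord0 nth_default // mulr0 addr0 mulr0 addr0.
  rewrite horner_coef -(big_mkord xpredT (fun l => f`_l * h ^+ l)) (big_cat_nat (leq0n i) (ltnW si)) /=.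
  rewrite big_mkord; congr (_ + _); rewrite big_ltn // mulrDr; congr (_ + _); first exact: mulrC.
  rewrite -{1}[i.+1]add0n big_addn big_mkord mulrA mulr_sumr; apply: eq_bigr => l _.
  by rewrite -exprSr mulrCA -exprD addnC.
have : P (f.[h] - \sum_(l < i) f`_l * h ^+ l).
  apply: idealB => //; apply: ideal_sum => // l _; apply: ideal_mulr => //.
  by apply/asboolP; apply: contraT => nl; have := imin l nl; rewrite leqNgt ltn_ord.
by rewrite E addrAC subrr add0r.
Qed.

Lemma supp0_unit (P : set KU) (e : 'I_0 -> A) b : is_ideal P -> supp_in (zspan e) b -> b != 0 -> P b -> P 1.
Proof.
move=> Pid bT b0 Pb; have bE : b = mono v S w (b 0) 0.
  apply: restr_eq => u; rewrite coef_mono ?rpred0 //; case: eqP => [->//|u0]; apply/eqP.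
  apply: contrapT => /negP /bT[z]; by rewrite big_ord0.
have c0 : b 0 != 0 by apply: contra b0 => /eqP h; rewrite bE h mono0.
have -> : 1 = mono v S w (b 0)^-1 0 * b by rewrite {2}bE monoM ?rpred0 // mulVf // addr0 mono1.
exact: idealM.
Qed.

(** An element of [P_ 1] outside [P_ 0] has a multiple congruent modulo [P_ 0] to a nonzero element
    of K<T>, which then lies in [P_ 1]. So K<T> is not free modulo [P_ 1], and [noether_step]
    removes one variable. *)
Lemma chain_le_rank m j (e : 'I_j -> A) (P_ : nat -> set KU) :
  (forall i, (i <= m)%N -> is_prime (P_ i)) -> (forall i, (i < m)%N -> P_ i `<` P_ i.+1) ->
  (forall i, e i \in S) -> zindep e -> finite_over (zspan e) (P_ 0%N) -> (m <= j)%N.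
Proof.
elim: m j e P_ => [//|m IH] j e P_ PP sub eS ez fin.
have [[P0id P01 P0m] [P1id P11 _]] := (PP 0%N isT, PP 1%N isT).
have [h P1h P0h] : exists2 h, P_ 1%N h & ~ P_ 0%N h.
  have [_ ns] := sub 0%N isT; apply: contrapT => nh; apply: ns => h hh; apply: contrapT => h0.
  by apply: nh; exists h.
have [b [g [bT P0b Pbg]]] := integral_multiple (PP 0%N isT) (zspan0 e) (@zspanD _ _ e) fin P0h.
have P1b : P_ 1%N b.
  have -> : b = (b + h * g) - h * g by rewrite addrK.
  by apply: idealB => //; [exact: (proj1 (sub 0%N isT))|exact: ideal_mulr].
have b0 : b != 0 by apply/eqP => b0; apply: P0b; rewrite b0; exact: ideal0.
have fin1 : finite_over (zspan e) (P_ 1%N).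
  have [I [J [mm [hh [C [C0 mS hP ex]]]]]] := fin; exists I, J, mm, hh, C; split => // l.
  exact: (proj1 (sub 0%N isT)).
case: j e eS ez fin bT fin1 => [|j] e eS ez fin bT fin1.
  by case: P11; exact: supp0_unit bT b0 P1b.
(* The empty family of directions: transversality imposes nothing, and the rank may drop to 0. *)
pose D0 (i : 'I_0) : {additive A -> R} := match i with Ordinal m hm => False_rect _ (notF hm) end.
have nb : @noether_basis R K v n S w 0 D0 (P_ 1%N) _ e.
  by split => // c _ [].
have nf : ~ free_over (zspan e) (P_ 1%N).
  move=> /(_ b 0 bT); rewrite subr0 nrm0 => /(_ P1b); rewrite leNgt nrm_gt0 //.
have [e' [e'S e'z fin' _]] := noether_step SN P1id (ltn0Sn j) nb nf.
apply: (IH j e' (fun i => P_ i.+1)) => // i hi; [exact: PP|exact: sub].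
Qed.

Lemma krull_dim_le j (e : 'I_j -> A) (P : set KU) : (forall i, e i \in S) -> zindep e ->
  finite_over (zspan e) P -> (krull_dim P <= (j%:R)%:E :> \bar R)%E.
Proof.
move=> eS ez fin; apply: ge_ereal_sup => _ [k [P_ [PP sub]] <-]; rewrite lee_fin ler_nat.
apply: (chain_le_rank (P_ := P_)) eS ez _ => // [i hi|]; first by have [] := PP i hi.
have [I [J [mm [hh [C [C0 mS hP ex]]]]]] := fin; exists I, J, mm, hh, C; split => // l.
by have [_ h] := PP 0%N isT; exact: h.
Qed.

End KrullDimension.

(** * Prime ideals from Zorn's lemma *)

Section Primes.
Context {R : realType} {B : comNzRingType}.
Implicit Types (I P Q M : set B).

Lemma ideal_adjoin I x : is_ideal I -> is_ideal [set y | exists a z, I z /\ y = z + a * x].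
Proof.
move=> Iid; split.
- by exists 0, 0; rewrite mul0r addr0; split => //; exact: ideal0.
- move=> _ _ [a [z [Iz ->]]] [b [t [It ->]]]; exists (a + b), (z + t).
  by split; [exact: idealD|rewrite mulrDl addrACA].
- move=> r _ [a [z [Iz ->]]]; exists (r * a), (r * z).
  by split; [exact: idealM|rewrite mulrDr mulrA].
Qed.

Lemma prime_avoiding I M : is_ideal I -> M 1 -> (forall x y, M x -> M y -> M (x * y)) ->
  (forall x, I x -> ~ M x) -> exists P, [/\ is_prime P, I `<=` P & forall x, P x -> ~ M x].
Proof.
move=> Iid M1 MM IM.
pose good H := [/\ is_ideal H, I `<=` H & forall x, H x -> ~ M x].
have [|H [HP Hmax]] := @Zorn_bigcup B (fun H => H = set0 \/ good H).
  move=> F FP Ft; have [[X0 [FX0 gX0]]|nF] := pselect (exists X, F X /\ good X); last first.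
    left; apply/seteqP; split => // x [X FX Xx]; case: (FP X FX) => [X0|gX].
      by move: Xx; rewrite X0.
    by case: nF; exists X.
  right; have mem X x : F X -> X x -> good X.
    by move=> FX Xx; case: (FP X FX) => // X00; move: Xx; rewrite X00.
  split.
  - split.
    + by exists X0 => //; case: gX0 => -[].
    + move=> x y [X FX Xx] [Y FY Yy]; have [XY|YX] := Ft X Y FX FY.
        by exists Y => //; have [Yid _ _] := mem _ _ FY Yy; apply: idealD => //; exact: XY.
      by exists X => //; have [Xid _ _] := mem _ _ FX Xx; apply: idealD => //; exact: YX.
    + by move=> x y [X FX Xy]; exists X => //; have [Xid _ _] := mem _ _ FX Xy; exact: idealM.
  - by move=> x Ix; exists X0 => //; case: gX0 => _ h _; exact: h.
  - by move=> x [X FX Xx]; have [_ _ h] := mem _ _ FX Xx; exact: h.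
have gH : good H.
  case: HP => // H0; have /Hmax : H `<` I.
    by rewrite H0; split => // h; have := h 0 (ideal0 Iid).
  by case; right; split.
have [Hid IH HM] := gH.
have ext x : ~ H x -> exists a z, H z /\ M (z + a * x).
  move=> Hx; apply: contrapT => no.
  have /Hmax : H `<` [set y | exists a z, H z /\ y = z + a * x].
    split=> [y Hy|h]; first by exists 0, y; rewrite mul0r addr0.
    by apply: Hx; apply: h; exists 1, 0; rewrite mul1r add0r; split => //; exact: ideal0.
  case; right; split; first exact: ideal_adjoin.
    by move=> y /IH Hy; exists 0, y; rewrite mul0r addr0.
  by move=> _ [a [z [Hz ->]]] Mz; apply: no; exists a, z.
exists H; split => //; split => // [H1|x y Hxy]; first exact: HM M1.
apply: contrapT => /not_orP[/ext[a [z [Hz Mz]]] /ext[b [t [Ht Mt]]]].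
apply: (HM _ _ (MM _ _ Mz Mt)).
have -> : (z + a * x) * (t + b * y) = z * (t + b * y) + a * x * t + a * b * (x * y) by ring.
by apply: idealD => //; [apply: idealD => //; [exact: ideal_mulr|exact: idealM]|exact: idealM].
Qed.

(** Zorn's lemma is applied to complements of primes, so that intersections of decreasing chains of
    primes become unions. *)
Lemma minimal_prime_below I Q : is_prime Q -> I `<=` Q -> exists P, minimal_prime I P /\ P `<=` Q.
Proof.
move=> PQ IQ; pose good H := [/\ is_prime (~` H), I `<=` ~` H & ~` H `<=` Q].
have [|H [HP Hmax]] := @Zorn_bigcup B (fun H => H = set0 \/ good H).
  move=> F FP Ft; have [[X0 [FX0 gX0]]|nF] := pselect (exists X, F X /\ good X); last first.
    left; apply/seteqP; split => // x [X FX Xx]; case: (FP X FX) => [X0|gX].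
      by move: Xx; rewrite X0.
    by case: nF; exists X.
  right; have mem X x : F X -> X x -> good X.
    by move=> FX Xx; case: (FP X FX) => // X00; move: Xx; rewrite X00.
  have inter x : (~` \bigcup_(X in F) X) x <-> forall X, F X -> ~ X x.
    by split=> [h X FX Xx|h [X FX Xx]]; [apply: h; exists X|exact: h Xx].
  split.
  - split.
    + split.
      * apply/inter => X FX X0'; have [[[h0 _ _] _ _] _ _] := mem _ _ FX X0'; exact: h0.
      * move=> x y /inter hx /inter hy; apply/inter => X FX Xxy.
        have [[[_ hD _] _ _] _ _] := mem _ _ FX Xxy; exact: (hD x y (hx X FX) (hy X FX)).
      * move=> x y /inter hy; apply/inter => X FX Xxy.
        have [[[_ _ hM] _ _] _ _] := mem _ _ FX Xxy; exact: (hM x y (hy X FX)).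
    + move=> /inter h; have [[_ h1 _] _ _] := gX0; exact: h1 (h X0 FX0).
    + move=> x y /inter hxy; apply: contrapT => /not_orP[/contrapT[X FX Xx] /contrapT[Y FY Yy]].
      have comb Z : F Z -> Z x -> Z y -> False.
        move=> FZ Zx Zy; have [[_ _ hm] _ _] := mem _ _ FZ Zx.
        by have [//|//] := hm x y (hxy Z FZ).
      by have [XY|YX] := Ft X Y FX FY; [apply: (comb Y) => //; exact: XY|apply: (comb X) => //; exact: YX].
  - by move=> x Ix; apply/inter => X FX Xx; have [_ h _] := mem _ _ FX Xx; exact: h Ix Xx.
  - by move=> x /inter h; have [_ _ hQ] := gX0; apply: hQ; exact: h.
have [Qid Q1 Qm] := PQ.
have gH : good H.
  case: HP => // H0; have /Hmax : H `<` ~` Q by rewrite H0; split => // h; exact: h 1 Q1.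
  by case; right; rewrite /good setCK; split.
have [PH IH HQ] := gH; exists (~` H); split => //; split => // Q' PQ' IQ' Q'H.
apply: contrapT => ne; have /Hmax : H `<` ~` Q'.
  split=> [x Hx /Q'H //|h]; apply: ne; apply/seteqP; split => // x Hx.
  by apply: contrapT => Q'x; apply: Hx; exact: h.
by case; right; rewrite /good setCK; split => //; exact: subset_trans Q'H HQ.
Qed.

End Primes.

(** * Orthogonal approximation over an extension of the ground field *)

Section Orthogonal.
Context {R : realType} {K L : fieldType} (v : valuation R K) (vL : valuation R L) (iota : {rmorphism K -> L}).

(** Finitely many elements of [L] can be approximated in a finite-dimensional [K]-subspace with an
    orthogonal generating family. This allows statements over [L] to be checked coordinate by
    coordinate over [K]. *)
Definition orthogonally_dense : Prop := forall (s : seq L) (eps : R), 0 < eps ->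
  exists (r : nat) (b : 'I_r -> L),
    (forall (c : 'I_r -> K) i, absv v (c i) * absv vL (b i) <= absv vL (\sum_l iota (c l) * b l)) /\
    (forall x, x \in s -> exists c : 'I_r -> K, absv vL (x - \sum_l iota (c l) * b l) <= eps).

Hypothesis viota : forall x, vL (iota x) = v x.
Hypothesis odense : orthogonally_dense.
Context {n : nat}.
Local Notation A := 'rV[int]_n.
Context (S : addrClosed A) (w : {additive A -> R}).
Local Notation KU := (restr v S w).
Local Notation LU := (restr vL S w).
Local Notation cemb := (@cemb R K L v vL iota viota n S w).
Local Notation C x := (mono vL S w x 0).

Lemma common_approx (fs : seq LU) (e : R) : 0 < e -> exists2 E : seq A, uniq E &
  (forall u, u \in E -> u \in S) /\ forall f, f \in fs -> gauss_norm (f - mpart E f) <= e.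
Proof.
move=> e0; elim: fs => [|f fs [E Eu [ES hE]]]; first by exists [::].
have [E' E'u [E'S hE']] := approx f e0.
have mono_part (E1 E2 : seq A) (g : LU) : uniq E1 -> uniq E2 -> {subset E1 <= E2} ->
    gauss_norm (g - mpart E1 g) <= e -> gauss_norm (g - mpart E2 g) <= e.
  move=> u1 u2 sub h; apply: nrm_le => u; rewrite /tm coefB coef_mpart //.
  have [uE|uE] := boolP (u \in E2); first by rewrite subrr absv0 mul0r ltW.
  have : u \notin E1 by apply: contra uE => /sub.
  move=> uE1; apply: le_trans h; have := le_nrm (g - mpart E1 g) u.
  by rewrite /tm coefB coef_mpart // (negPf uE1).
exists (undup (E ++ E')); first exact: undup_uniq.
split=> [u|g]; first by rewrite mem_undup mem_cat => /orP[/ES|/E'S].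
have s1 : {subset E <= undup (E ++ E')} by move=> u uE; rewrite mem_undup mem_cat uE.
have s2 : {subset E' <= undup (E ++ E')} by move=> u uE; rewrite mem_undup mem_cat uE orbT.
rewrite inE => /orP[/eqP ->|/hE h]; [exact: (mono_part _ _ _ E'u (undup_uniq _) s2 hE')|].
exact: (mono_part _ _ _ Eu (undup_uniq _) s1 h).
Qed.

Lemma orthogonal_approx (fs : seq LU) (e : R) : 0 < e -> exists (r : nat) (b : 'I_r -> L),
  (forall (F : 'I_r -> KU) i, gauss_norm (C (b i)) * gauss_norm (F i) <= gauss_norm (\sum_l C (b l) * cemb (F l))) /\
  forall f, f \in fs -> exists F : 'I_r -> KU, gauss_norm (f - \sum_l C (b l) * cemb (F l)) <= e /\
    forall (T : set A), supp_in T f -> forall i, supp_in T (F i).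
Proof.
move=> e0; have [E Eu [ES hE]] := common_approx fs e0.
pose W := \sum_(u <- E) expR (- w u) + 1.
have W0 : 0 < W by rewrite ltr_wpDl // sumr_ge0 // => u _; exact: expR_ge0.
have [r [b [orth dens]]] := odense [seq f u | f : LU <- fs, u <- E] (divr_gt0 e0 W0).
exists r, b; split.
  move=> F i; have [u tu] := nrm_attained (F i).
  apply: le_trans (le_nrm _ u); rewrite -tu nrm_mono ?rpred0 // raddf0 oppr0 expR0 mulr1.
  rewrite /tm mulrA [X in X * _]mulrC; apply: ler_wpM2r; first exact: expR_ge0.
  rewrite coef_sum; apply: le_trans (orth (fun l => F l u) i) _.
  rewrite le_eqVlt; apply/orP; left; apply/eqP; congr absv; apply: eq_bigr => l _.
  by rewrite coef_monoM ?rpred0 // subr0 mulrC.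
move=> f ffs.
have /choice[c hc] : forall u, exists c : 'I_r -> K, u \in E -> absv vL (f u - \sum_l iota (c l) * b l) <= e / W.
  move=> u; have [uE|_] := boolP (u \in E); last by exists (fun=> 0).
  by have [|c h] := dens (f u); [apply/allpairsP; exists (f, u)|exists c].
pose F l : KU := \sum_(u <- E) (if f u == 0 then 0 else mono v S w (c u l) u).
exists F; split; last first.
  move=> T fT i; apply: supp_in_sum => u _; case: eqP => [_|/eqP fu]; first exact: supp_in0.
  by apply: supp_in_mono; exact: fT.
rewrite -(subrK (mpart E f) f) -addrA; apply: le_trans (nrmD _ _) _; rewrite ge_max hE //=.
have -> : \sum_l C (b l) * cemb (F l) = \sum_(u <- E) (if f u == 0 then 0 else mono vL S w (\sum_l iota (c u l) * b l) u).
  transitivity (\sum_l \sum_(u <- E) (if f u == 0 then 0 else mono vL S w (iota (c u l) * b l) u)).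
    apply: eq_bigr => l _; rewrite raddf_sum mulr_sumr big_seq [RHS]big_seq; apply: eq_bigr => u /ES uS.
    case: eqP => [_|_]; first by rewrite raddf0 mulr0.
    transitivity (C (b l) * mono vL S w (iota (c u l)) u); first by congr (_ * _); exact: cemb_mono.
    by rewrite monoM ?rpred0 // add0r mulrC.
  rewrite exchange_big; apply: eq_bigr => u _; case: eqP => _; first by rewrite big1.
  elim/big_rec2: _ => [|l y1 y2 _ ->]; first by rewrite mono0.
  exact/esym/monoD.
rewrite /mpart -sumrB big_seq; apply: nrm_sum_le => [|u uE]; first exact: ltW.
case: eqP => [->|fu]; first by rewrite mono0 subr0 nrm0 ltW.
have -> : mono vL S w (f u) u - mono vL S w (\sum_l iota (c u l) * b l) u = mono vL S w (f u - \sum_l iota (c u l) * b l) u.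
  by rewrite monoD monoN.
rewrite nrm_mono ?ES //; apply: le_trans (ler_wpM2r (expR_ge0 _) (hc u uE)) _.
rewrite mulrAC -mulrA ler_piMr ?(ltW e0) // ler_pdivrMr // mul1r.
rewrite /W (big_rem u) //= -addrA lerDl addr_ge0 // sumr_ge0 // => u' _; exact: expR_ge0.
Qed.

Lemma gen_ideal_sums (P : set KU) (y : LU) : gen_ideal (cemb @` P) y ->
  exists2 s : seq (LU * KU), (forall x, x \in s -> P x.2) & y = \sum_(x <- s) x.1 * cemb x.2.
Proof.
move=> h; apply: (h [set y | exists2 s : seq (LU * KU), (forall x, x \in s -> P x.2) & y = \sum_(x <- s) x.1 * cemb x.2]).
- split.
  + by exists [::] => //; rewrite big_nil.
  + move=> _ _ [s hs ->] [t ht ->]; exists (s ++ t); last by rewrite big_cat.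
    by move=> x; rewrite mem_cat => /orP[/hs|/ht].
  + move=> r _ [s hs ->]; exists [seq (r * x.1, x.2) | x <- s].
      by move=> _ /mapP[x /hs hx ->].
    by rewrite mulr_sumr big_map; apply: eq_bigr => x _; rewrite mulrA.
- move=> _ [f Pf <-]; exists [:: (1, f)]; first by move=> x; rewrite inE => /eqP ->.
  by rewrite big_seq1 mul1r.
Qed.

(** Expand [y] and the coefficients of its expression by elements of [P] in one approximate
    orthogonal family. Modulo [P], each coordinate [F y i] agrees with the coordinate [f_ i] of a
    small series. Since [p] is the Gauss norm on K<T> and kills [P], the coordinate of [y] is itself
    that small. *)
Lemma extension_disjoint (P : set KU) (T : set A) (p : KU -> R) (y : LU) :
  ums p -> (forall f, p f <= gauss_norm f) -> (forall f, P f -> p f = 0) -> is_ideal P ->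
  (forall f, supp_in T f -> p f = gauss_norm f) -> gen_ideal (cemb @` P) y -> supp_in T y -> y = 0.
Proof.
move=> [pm pu] pn pP Pid pT /gen_ideal_sums[s sP yE] yT.
apply/(@nrm_eq0 _ _ vL); apply/eqP; rewrite eq_le nrm_ge0 andbT; apply/ler_addgt0Pr => e e0; rewrite add0r.
pose M := \sum_(x <- s) gauss_norm x.2 + 1.
have M1 : 1 <= M by rewrite lerDr sumr_ge0 // => x _; exact: nrm_ge0.
have M0 : 0 < M by exact: lt_le_trans M1.
have eM : e / M <= e by rewrite ler_pdivrMr // ler_peMr // ltW.
have [r [b [orth dens]]] := orthogonal_approx (y :: [seq x.1 | x <- s]) (divr_gt0 e0 M0).
have /choice[F hF] : forall f, exists F : 'I_r -> KU, f \in y :: [seq x.1 | x <- s] ->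
    gauss_norm (f - \sum_l C (b l) * cemb (F l)) <= e / M /\ forall (T : set A), supp_in T f -> forall i, supp_in T (F i).
  move=> f; have [/dens[F h]|_] := boolP (f \in y :: [seq x.1 | x <- s]); [by exists F|by exists (fun=> 0)].
have [hy1 hy2] := hF y (mem_head _ _).
pose f_ i := F y i - \sum_(x <- s) F x.1 i * x.2.
have zE : \sum_l C (b l) * cemb (f_ l) = - (y - \sum_l C (b l) * cemb (F y l)) +
    \sum_(x <- s) (x.1 - \sum_l C (b l) * cemb (F x.1 l)) * cemb x.2.
  have e1 : \sum_l C (b l) * cemb (f_ l) = \sum_l C (b l) * cemb (F y l) - \sum_(x <- s) (\sum_l C (b l) * cemb (F x.1 l)) * cemb x.2.
    have -> : \sum_(x <- s) (\sum_l C (b l) * cemb (F x.1 l)) * cemb x.2 = \sum_l C (b l) * \sum_(x <- s) cemb (F x.1 l) * cemb x.2.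
      under eq_bigr do rewrite mulr_suml; rewrite exchange_big; apply: eq_bigr => l _.
      by rewrite mulr_sumr; apply: eq_bigr => x _; rewrite mulrA.
    rewrite -sumrB; apply: eq_bigr => l _; rewrite -mulrBr; congr (_ * _).
    rewrite /f_ (raddfB cemb) raddf_sum; congr (_ - _); apply: eq_bigr => x _; exact: (rmorphM cemb).
  have e2 : \sum_(x <- s) (x.1 - \sum_l C (b l) * cemb (F x.1 l)) * cemb x.2 = y - \sum_(x <- s) (\sum_l C (b l) * cemb (F x.1 l)) * cemb x.2.
    by rewrite yE -sumrB; apply: eq_bigr => x _; exact: mulrBl.
  rewrite e1 e2; move: (\sum_l C (b l) * cemb (F y l)) (\sum_(x <- s) _) => a1 a2.
  by ring.
have zn : gauss_norm (\sum_l C (b l) * cemb (f_ l)) <= e.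
  rewrite zE; apply: le_trans (nrmD _ _) _; rewrite nrmN ge_max (le_trans hy1 eM) /=.
  rewrite big_seq; apply: nrm_sum_le => [|x xs]; first exact: ltW.
  have [|h _] := hF x.1; first by rewrite inE map_f ?orbT.
  apply: le_trans (nrmM_le _ _) _; rewrite nrm_cemb; apply: le_trans (ler_wpM2r (nrm_ge0 _) h) _.
  rewrite mulrAC -mulrA ler_piMr ?(ltW e0) // ler_pdivrMr // mul1r.
  rewrite /M (big_rem x) //= -addrA lerDl addr_ge0 // sumr_ge0 // => z _; exact: nrm_ge0.
have Fn i : gauss_norm (F y i) <= gauss_norm (f_ i).
  rewrite -(pT _ (hy2 _ yT i)); apply: le_trans (pn _).
  have -> : F y i = f_ i + \sum_(x <- s) F x.1 i * x.2 by rewrite /f_ subrK.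
  apply: le_trans (pu _ _) _; rewrite ge_max lexx /= pP ?seminorm_ge0 //.
  rewrite big_seq; apply: ideal_sum => // x /sP Px; exact: idealM.
rewrite -(subrK (\sum_l C (b l) * cemb (F y l)) y); apply: le_trans (nrmD _ _) _.
rewrite ge_max (le_trans hy1 eM) /=; apply: nrm_sum_le => [|l _]; first exact: ltW.
apply: le_trans (nrmM_le _ _) _; rewrite nrm_cemb.
by apply: le_trans (ler_wpM2l (nrm_ge0 _) (Fn l)) _; exact: le_trans (orth f_ l) zn.
Qed.

End Orthogonal.

(** * Chains of primes of full length *)

Section Chains.
Context {R : realType} {K : fieldType} (v : valuation R K) {n : nat}.
Local Notation A := 'rV[int]_n.
Context (S : addrClosed A) (w : {additive A -> R}).
Local Notation KU := (restr v S w).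
Local Notation nrm := (@gauss_norm R K v A S w).
Local Notation mon := (@mono R K v A S w).
Hypothesis SN : forall u, u \in S -> - u \in S.
Hypothesis wG : forall u, u \in S -> value_group v (w u).

Definition meets_trivially (T : set A) (P : set KU) := forall b, supp_in T b -> P b -> b = 0.

Lemma tm_not_constant (f : KU) (x : nat -> A) : injective x -> (forall i, tm f (x i) = tm f (x 0%N)) -> f (x 0%N) = 0.
Proof.
move=> xi hx; apply/eqP; apply: contrapT => /negP f0.
have t0 : 0 < tm f (x 0%N) by rewrite /tm mulr_gt0 ?absv_gt0 ?expR_gt0.
have [E Eu [ES hE]] := approx f (divr_gt0 t0 (ltr0n _ 2)).
have xE i : x i \in E.
  apply: contraT => niE; have := le_trans (le_nrm (f - mpart E f) (x i)) hE.
  rewrite /tm coefB coef_mpart // (negPf niE) subr0 -/(tm f (x i)) hx leNgt => /negP; case.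
  by rewrite ltr_pdivrMr // ltr_pMr // ltr1n.
have := @uniq_leq_size _ [seq x i | i <- iota 0 (size E).+1] E.
rewrite map_inj_uniq ?iota_uniq // size_map size_iota ltnn => h; suff : false by [].
by apply: h => // _ /mapP[i _ ->].
Qed.

(** The relation [g = chi^e0 - c], with [c] a constant of the same absolute value, is added to [Q].
    The point is that the enlarged ideal meets K<T'> only in 0, where [T'] is spanned by the other
    [e i]; a prime avoiding the nonzero elements of K<T'> then does what is wanted. A constant [c]
    exists because the weights are values of the field. *)
Lemma add_relation j (e : 'I_j.+1 -> A) (Q : set KU) : is_prime Q -> (forall i, e i \in S) -> zindep e ->
  finite_over (zspan e) Q -> meets_trivially (zspan e) Q ->
  exists P, [/\ is_prime P, Q `<` P, finite_over (zspan (fun i => e (lift ord0 i))) P &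
    meets_trivially (zspan (fun i => e (lift ord0 i))) P].
Proof.
move=> PQ eS ez fin triv; have [Qid Q1 Qm] := PQ.
pose e0 := e ord0; pose e' i := e (lift ord0 i).
have e0S : e0 \in S by exact: eS.
have [c c0 vc] := wG e0S.
have absc : absv v c = expR (- w e0) by rewrite /absv vc.
have split_e u : zspan e u -> exists t (z : int), zspan e' t /\ u = t + e0 *~ z.
  move=> [z ->]; exists (\sum_i e' i *~ z (lift ord0 i)), (z ord0).
  by split; [exists (fun i => z (lift ord0 i))|rewrite big_ord_recl addrC].
have e'e u : zspan e' u -> zspan e u.
  move=> [z ->]; exists (fun i => if unlift ord0 i is Some i' then z i' else 0).
  rewrite big_ord_recl unlift_none mulr0z add0r; apply: eq_bigr => i _; by rewrite liftK.
have e0e (z : int) : zspan e (e0 *~ z).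
  exists (fun i => if i == ord0 then z else 0); rewrite (bigD1 ord0) //= big1 ?addr0 // => i /negPf ->.
  by rewrite mulr0z.
have indep0 u (z : int) : zspan e' u -> zspan e' (u + e0 *~ z) -> z = 0.
  move=> [y ->] [y' E]; have := ez (fun i => if unlift ord0 i is Some i' then y i' - y' i' else z).
  rewrite big_ord_recl unlift_none (eq_bigr (fun i => e' i *~ y i - e' i *~ y' i)) => [|i _]; last first.
    by rewrite liftK mulrzBr.
  rewrite sumrB -E addrC opprD addrA subrr add0r addNr => /(_ erefl ord0).
  by rewrite unlift_none.
have e'S u : zspan e' u -> u \in S by apply: zspan_sub => // i; exact: eS.
pose x := mon 1 e0.
pose I := [set y | exists a z, Q z /\ y = z + a * (x - mon c 0)].
have Iid : is_ideal I by exact: ideal_adjoin.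
have Itriv b : supp_in (zspan e') b -> I b -> b = 0.
  move=> bT [y [z [Qz bE]]].
  have [f [fm fT fy]] := finite_over_integral y Qid (zspan0 e) (@zspanD _ _ e) SN fin.
  pose g := x - mon c 0.
  have gT : supp_in (zspan e) g.
    apply: supp_inD; first by apply: supp_in_mono; rewrite -[e0]mulr1z.
    by apply: supp_inN; apply: supp_in_mono; exact: zspan0.
  set D := (size f).-1.
  have powT (h : KU) m : supp_in (zspan e) h -> supp_in (zspan e) (h ^+ m).
    move=> hT; elim: m => [|m IH]; first by rewrite expr0 -mono1; apply: supp_in_mono; exact: zspan0.
    by rewrite exprS; apply: supp_inM => //; exact: zspanD.
  have bTe : supp_in (zspan e) b by move=> u /bT; exact: e'e.
  pose s := \sum_(i < D) f`_i * g ^+ (D - i.+1) * b ^+ i.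
  have sT : supp_in (zspan e) s.
    apply: supp_in_sum => i _; apply: supp_inM; [exact: zspanD| |exact: powT].
    by apply: supp_inM; [exact: zspanD|exact: fT|exact: powT].
  have gyb : Q (g * y - b).
    by rewrite bE (_ : g * y - (z + y * g) = - z); [exact: idealN|by rewrite [y * g]mulrC opprD addrCA subrr addr0].
  have powQ (a1 a2 : KU) i : Q (a1 - a2) -> Q (a1 ^+ i - a2 ^+ i) by move=> h; rewrite subrXX; exact: ideal_mulr.
  (* The integral equation of [y] is multiplied by [g ^+ D], and [g * y] is replaced by [b], to
     which it is congruent modulo [Q]. The result lies in K<T>, where [Q] vanishes, so the
     congruence is an equality. *)
  have bD : b ^+ D + g * s = 0.
    apply: triv.
      by apply: supp_inD; [exact: powT|apply: supp_inM => //; exact: zspanD].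
    have E1 : g ^+ D * f.[y] = (g * y) ^+ D + \sum_(i < D) f`_i * g ^+ (D - i) * (g * y) ^+ i.
      have E0 : f.[y] = y ^+ D + \sum_(i < D) f`_i * y ^+ i.
        by rewrite {1}(monic_decomp fm) hornerD hornerXn horner_poly.
      rewrite E0 mulrDr mulr_sumr; congr (_ + _); first by rewrite exprMn.
      apply: eq_bigr => i _; have gD : g ^+ D = g ^+ (D - i) * g ^+ i by rewrite -exprD subnK // ltnW.
      by rewrite gD exprMn mulrACA [_ * f`_i]mulrC.
    pose s1 := \sum_(i < D) f`_i * g ^+ (D - i) * b ^+ i.
    pose s2 := \sum_(i < D) f`_i * g ^+ (D - i) * (g * y) ^+ i.
    have E2 : b ^+ D + g * s = g ^+ D * f.[y] - (((g * y) ^+ D - b ^+ D) +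
        \sum_(i < D) f`_i * g ^+ (D - i) * ((g * y) ^+ i - b ^+ i)).
      have e1 : g * s = s1.
        rewrite mulr_sumr; apply: eq_bigr => i _.
        by rewrite -[in RHS](subnSK (ltn_ord i)) exprS !mulrA [g * _]mulrC.
      have e2 : \sum_(i < D) f`_i * g ^+ (D - i) * ((g * y) ^+ i - b ^+ i) = s2 - s1.
        by rewrite -sumrB; apply: eq_bigr => i _; exact: mulrBr.
      have alg (a1 a2 a3 a4 : KU) : a1 + a3 = (a2 + a4) - ((a2 - a1) + (a4 - a3)).
        by rewrite opprD !opprB addrACA ![_ + (_ - _)]addrC !subrK.
      rewrite E1 e1 e2; exact: alg.
    rewrite E2; apply: idealB => //; first exact: idealM.
    apply: idealD => //; first exact: powQ.
    by apply: ideal_sum => // i _; apply: idealM => //; exact: powQ.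
  have bDT : supp_in (zspan e') (b ^+ D).
    elim: (D) => [|m IH]; first by rewrite expr0 -mono1; apply: supp_in_mono; exact: zspan0.
    by rewrite exprS; apply: supp_inM => //; exact: zspanD.
  suff bD0 : b ^+ D = 0.
    elim: (D) bD0 => [/eqP|m IH]; first by rewrite expr0 oner_eq0.
    by rewrite exprS => /restr_integral[].
  apply: restr_eq => u; rewrite coef0; apply/eqP; apply: contrapT => /negP bu.
  have uT := bDT _ bu.
  (* Along the line through [u] in direction [e0], [b ^+ D] has its only possible coefficient at
     [u]. So the terms of [s] have constant size on both half-lines, hence vanish, and the
     coefficient at [u] vanishes with them. *)
  have rel (z1 : int) : s (u + e0 *~ (z1 - 1)) - c * s (u + e0 *~ z1) = - (b ^+ D) (u + e0 *~ z1).
    have := congr1 (fun h : KU => h (u + e0 *~ z1)) bD; rewrite coefD coef0 /g mulrBl coefB.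
    rewrite [(x * s) _]coef_monoM // [(mon c 0 * s) _]coef_monoM ?rpred0 // mul1r subr0 => /addr0_eq ->.
    by rewrite mulrzBr mulr1z addrA.
  have relz (z1 : int) : z1 != 0 -> tm s (u + e0 *~ (z1 - 1)) = tm s (u + e0 *~ z1).
    move=> z10; have : (b ^+ D) (u + e0 *~ z1) = 0.
      apply/eqP; apply: contrapT => /negP /bDT h; move/eqP: z10; apply; exact: indep0 uT h.
    move=> h; have := rel z1; rewrite h oppr0 => /eqP; rewrite subr_eq0 => /eqP E.
    have uE : u + e0 *~ z1 = e0 + (u + e0 *~ (z1 - 1)).
      by rewrite mulrzBr mulr1z addrCA [e0 + _]addrC subrK.
    rewrite /tm E absvM absc [expR _ * absv _ _]mulrC -mulrA -expRD; congr (_ * expR _).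
    by rewrite [in RHS]uE [in RHS]raddfD opprD.
  have e00 : e0 != 0.
    apply/eqP => e00; have := ez (fun i => (i == ord0)%:R).
    rewrite big1 => [/(_ erefl ord0)|i _]; first by rewrite eqxx.
    by case: eqP => [->|_]; rewrite ?mulr0z // -/e0 e00 mul0rz.
  have inj1 : injective (fun i : nat => u + e0 *~ (i%:Z)).
    move=> i1 i2 /addrI /eqP; rewrite -subr_eq0 -mulrzBr => /eqP E.
    have := indep0 u (i1%:Z - i2%:Z) uT; rewrite E addr0 => /(_ uT) /eqP; rewrite subr_eq0 => /eqP [].
    by [].
  have inj2 : injective (fun i : nat => u + e0 *~ (- 1 - i%:Z)).
    move=> i1 i2 /addrI /eqP; rewrite -subr_eq0 -mulrzBr => /eqP E.
    have := indep0 u (- 1 - i1%:Z - (- 1 - i2%:Z)) uT; rewrite E addr0 => /(_ uT); lia.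
  have s0 : s u = 0.
    rewrite -[u]addr0 -(mulr0z e0); apply: (tm_not_constant inj1) => i; elim: i => [//|i IH].
    by rewrite -IH -(relz i.+1%:Z) //; congr (tm _ (_ + _ *~ _)); lia.
  have s1 : s (u + e0 *~ (-1)) = 0.
    have -> : (-1 : int) = - 1 - 0%N%:Z by [].
    apply: (tm_not_constant inj2) => i; elim: i => [//|i IH].
    by rewrite -IH -(relz (- 1 - i%:Z)) //; congr (tm _ (_ + _ *~ _)); lia.
  have := rel 0; rewrite sub0r s1 mulr0z addr0 s0 mulr0 subrr => /esym/eqP.
  by rewrite oppr_eq0 (negPf bu).
have [||||P [PP IP Pav]] := @prime_avoiding KU I [set b | b != 0 /\ supp_in (zspan e') b].
- exact: Iid.
- by split; [exact: oner_neq0|rewrite -mono1; apply: supp_in_mono; exact: zspan0].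
- move=> a b [a0 aT] [b0 bT]; split; last by apply: supp_inM => //; exact: zspanD.
  by apply/eqP => /restr_integral[/eqP|/eqP]; rewrite ?(negPf a0) ?(negPf b0).
- by move=> b Ib [/eqP b0 bT]; apply: b0; exact: Itriv.
have QP : Q `<=` P by move=> b Qb; apply: IP; exists 0, b; rewrite mul0r addr0.
have gP : P (x - mon c 0) by apply: IP; exists 1, 0; rewrite mul1r add0r; split => //; exact: ideal0.
have gT : supp_in (zspan e) (x - mon c 0).
  apply: supp_inD; first by apply: supp_in_mono; rewrite -[e0]mulr1z.
  by apply: supp_inN; apply: supp_in_mono; exact: zspan0.
have e00 : e0 <> 0.
  move=> e00; have := ez (fun i => (i == ord0)%:R).
  rewrite big1 => [/(_ erefl ord0)|i _]; first by rewrite eqxx.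
  by case: eqP => [->|_]; rewrite ?mulr0z // -/e0 e00 mul0rz.
have g0 : x - mon c 0 != 0.
  apply/eqP => /(congr1 (fun h : KU => h e0)); rewrite coefB coef0 !coef_mono ?rpred0 // eqxx.
  by case: eqP => [//|_]; rewrite subr0 => /eqP; rewrite oner_eq0.
exists P; split => //.
- by split => // h; move/eqP: g0; apply; apply: triv => //; exact: h.
(* Weierstrass division in degree 1: both coefficients of [g] are constants and carry its full
   norm. *)
- pose gc (l : 'I_2) := if l == ord0 then mon (- c) 0 else mon 1 0.
  have gE : \sum_(l < 2) gc l * mon 1 (e0 *~ (l : nat)) = x - mon c 0.
    rewrite !big_ord_recl big_ord0 addr0 /gc /= /bump /= addn0 mulr0z mulr1z mono1 mulr1 mul1r addrC.
    by rewrite monoN.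
  have cn : nrm (mon c 0) = expR (- w e0) by rewrite nrm_mono ?rpred0 // absc raddf0 oppr0 expR0 mulr1.
  have xn : nrm x = expR (- w e0) by rewrite nrm_mono // absv1 mul1r.
  have gn : nrm (x - mon c 0) = expR (- w e0).
    apply/eqP; rewrite eq_le; apply/andP; split.
      by apply: le_trans (nrmD _ _) _; rewrite nrmN cn xn maxxx.
    have := le_nrm (x - mon c 0) e0; rewrite /tm coefB !coef_mono ?rpred0 // eqxx.
    by case: eqP => [//|_]; rewrite subr0 absv1 mul1r.
  have finP : finite_over (zspan e) P.
    have [I1 [J [mm [hh [C [C0 mS hP ex]]]]]] := fin; exists I1, J, mm, hh, C; split => // l; exact: QP.
  have [Pid _ _] := PP.
  apply: (@finite_over_step R K v n S w SN (zspan e) (zspan e') e0 1 gc (- c) 1 0 0 _ _ _ _ _ _ _ _ _ _ _ _ _ _ _ P 0);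
    rewrite ?gE ?gn //.
  + exact: zspan0.
  + exact: zspanD.
  + exact: zspanN.
  + move=> l; rewrite /gc; case: eqP => _; apply: supp_in_mono; exact: zspan0.
  + move=> l; rewrite /gc; case: (unliftP ord0 l) => [l'|] -> /=.
      by rewrite ord1 /bump /= addn0 mulr1z mono1 mul1r -xn.
    by rewrite mulr0z mono1 mulr1 monoN nrmN cn.
  + exact: zspan0.
  + exact: zspan0.
  + exact: expR_gt0.
  + by rewrite /gc /= monoN nrmN cn.
  + by rewrite /gc /= mono1 mul1r mulr1z -xn.
  + by rewrite subr0.
  + by rewrite nrm0 expR_gt0.
- by move=> b bT Pb; apply/eqP; apply: contrapT => /negP b0; exact: (Pav b Pb).
Qed.

Lemma chain_exists j (e : 'I_j -> A) (Q : set KU) : is_prime Q -> (forall i, e i \in S) -> zindep e ->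
  finite_over (zspan e) Q -> meets_trivially (zspan e) Q ->
  exists P_ : nat -> set KU, [/\ P_ 0%N = Q, forall i, (i <= j)%N -> is_prime (P_ i) &
    forall i, (i < j)%N -> P_ i `<` P_ i.+1].
Proof.
elim: j e Q => [|j IH] e Q PQ eS ez fin triv.
  by exists (fun=> Q); split.
have [P [PP QP finP trivP]] := add_relation PQ eS ez fin triv.
have e'z : zindep (fun i => e (lift ord0 i)).
  move=> z Ez i; have := ez (fun i => if unlift ord0 i is Some i' then z i' else 0).
  rewrite big_ord_recl unlift_none mulr0z add0r (eq_bigr (fun i => e (lift ord0 i) *~ z i)) => [|l _]; last by rewrite liftK.
  by move=> /(_ Ez (lift ord0 i)); rewrite liftK.
have [P_ [P0 Pp Ps]] := IH _ _ PP (fun i => eS _) e'z finP trivP.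
exists (fun i => if i is i'.+1 then P_ i' else Q); split => // [[|i] hi|[|i] hi] //; first exact: Pp.
  by rewrite P0.
exact: Ps.
Qed.

Lemma krull_dim_ge j (e : 'I_j -> A) (P : set KU) : is_ideal P -> (forall i, e i \in S) -> zindep e ->
  finite_over (zspan e) P -> meets_trivially (zspan e) P -> ((j%:R)%:E <= krull_dim P :> \bar R)%E.
Proof.
move=> Pid eS ez fin triv.
have [||||Q [PQ PsQ Qav]] := @prime_avoiding KU P [set b | b != 0 /\ supp_in (zspan e) b].
- exact: Pid.
- by split; [exact: oner_neq0|rewrite -mono1; apply: supp_in_mono; exact: zspan0].
- move=> a b [a0 aT] [b0 bT]; split; last by apply: supp_inM => //; exact: zspanD.
  by apply/eqP => /restr_integral[/eqP|/eqP]; rewrite ?(negPf a0) ?(negPf b0).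
- by move=> b Ib [/eqP b0 bT]; apply: b0; exact: triv.
have finQ : finite_over (zspan e) Q.
  by have [I1 [J [mm [hh [C [C0 mS hP ex]]]]]] := fin; exists I1, J, mm, hh, C; split => // l; exact: PsQ.
have trivQ : meets_trivially (zspan e) Q.
  by move=> b bT Pb; apply/eqP; apply: contrapT => /negP b0; exact: (Qav b Pb).
have [P_ [P0 Pp Ps]] := chain_exists PQ eS ez finQ trivQ.
apply: ereal_sup_ubound; exists j => //; exists P_; split => // i hi; split; first exact: Pp.
elim: i hi => [|i IH] hi; first by rewrite P0.
by apply: subset_trans (IH (ltnW hi)) _; exact: (proj1 (Ps i hi)).
Qed.

End Chains.

Record absolute_value (R : realType) (F : fieldType) := AbsoluteValue {
  abs_fun :> F -> R;
  abs_ums : ums abs_fun;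
  abs_eq0 : forall x, abs_fun x = 0 -> x = 0 }.

(** * Existence of large valued extensions *)

Section AbsoluteValueTheory.
Context {R : realType} {F : fieldType} (N : absolute_value R F).

Let Nm : mult_seminorm N. Proof. by case: (abs_ums N). Qed.
Lemma abs_ge0 x : 0 <= N x. Proof. exact: seminorm_ge0. Qed.
Lemma abs0 : N 0 = 0. Proof. exact: seminorm0. Qed.
Lemma abs1 : N 1 = 1. Proof. exact: seminorm1. Qed.
Lemma absM x y : N (x * y) = N x * N y. Proof. exact: seminormM. Qed.
Lemma absN x : N (- x) = N x. Proof. exact: mult_seminormN. Qed.
Lemma absD x y : N (x + y) <= Num.max (N x) (N y). Proof. by case: (abs_ums N). Qed.
Lemma absB x y : N (x - y) <= Num.max (N x) (N y). Proof. by rewrite -(absN y); exact: absD. Qed.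
Lemma abs_gt0 x : x != 0 -> 0 < N x.
Proof. by move=> x0; rewrite lt_def abs_ge0 andbT; apply: contra x0 => /eqP/abs_eq0 ->. Qed.
Lemma absV x : N x^-1 = (N x)^-1.
Proof.
have [->|x0] := eqVneq x 0; first by rewrite invr0 abs0 invr0.
have Nx : N x != 0 by rewrite gt_eqF // abs_gt0.
by apply: (mulfI Nx); rewrite -absM !divff // abs1.
Qed.
Lemma absD_eq x y : N y < N x -> N (x + y) = N x.
Proof. by apply: ultra_eq => //; [exact: absN|exact: absD]. Qed.

Definition cauchy_seq (x : nat -> F) : Prop :=
  forall e, 0 < e -> exists M, forall i j, (M <= i)%N -> (M <= j)%N -> N (x i - x j) <= e.
Definition null_seq (x : nat -> F) : Prop :=
  forall e, 0 < e -> exists M, forall i, (M <= i)%N -> N (x i) <= e.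

(** In the ultrametric case absolute values along a non-null Cauchy sequence become constant; the
    completion can be built without limits of real numbers. *)
Lemma cauchy_dichotomy x : cauchy_seq x -> null_seq x \/ exists2 c, 0 < c & exists M, forall i, (M <= i)%N -> N (x i) = c.
Proof.
move=> hx; have [|nn] := pselect (null_seq x); [by left|right].
have [e0 e00 he0] : exists2 e0, 0 < e0 & forall M, exists2 i, (M <= i)%N & e0 < N (x i).
  apply: contrapT => h; apply: nn => e e0; apply: contrapT => h'; apply: h; exists e => // M.
  apply: contrapT => h''; apply: h'; exists M => i Mi; rewrite leNgt; apply/negP => ei.
  by apply: h''; exists i.
have [M hM] := hx e0 e00; have [i0 Mi0 hi0] := he0 M.
exists (N (x i0)); first exact: lt_trans hi0.
exists M => i Mi; rewrite -(subrK (x i0) (x i)) addrC; apply: absD_eq.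
exact: le_lt_trans (hM _ _ Mi Mi0) hi0.
Qed.

Lemma cauchy_bounded x : cauchy_seq x -> exists2 C, 0 < C & exists M, forall i, (M <= i)%N -> N (x i) <= C.
Proof.
move=> /cauchy_dichotomy[h|[c c0 [M hM]]].
  by have [M hM] := h 1 ltr01; exists 1 => //; exists M.
by exists c => //; exists M => i /hM ->.
Qed.

Definition cauchy_pred : {pred (nat -> F)} := fun x => `[< cauchy_seq x >].

Fact cauchy_subring : subring_closed cauchy_pred.
Proof.
split.
- by apply/asboolP => e e0; exists 0%N => i j _ _; rewrite subrr abs0 ltW.
- move=> x y /asboolP hx /asboolP hy; apply/asboolP => e e0.
  have [M hM] := hx e e0; have [M' hM'] := hy e e0; exists (maxn M M') => i j.
  rewrite !geq_max => /andP[Mi M'i] /andP[Mj M'j].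
  have -> : (x - y) i - (x - y) j = (x i - x j) - (y i - y j).
    by rewrite /= !opprD !opprK addrACA; congr (_ + _); rewrite addrC.
  by apply: le_trans (absB _ _) _; rewrite ge_max hM // hM'.
- move=> x y /asboolP hx /asboolP hy; apply/asboolP => e e0.
  have [C C0 [M1 hC]] := cauchy_bounded hx; have [C' C'0 [M2 hC']] := cauchy_bounded hy.
  have [M hM] := hx _ (divr_gt0 e0 C'0); have [M' hM'] := hy _ (divr_gt0 e0 C0).
  exists (maxn (maxn M1 M2) (maxn M M')) => i j; rewrite !geq_max => /andP[/andP[i1 i2] /andP[i3 i4]] /andP[/andP[j1 j2] /andP[j3 j4]].
  have -> : (x * y) i - (x * y) j = x i * (y i - y j) + (x i - x j) * y j.
    by rewrite mulrBr mulrBl addrA subrK.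
  apply: le_trans (absD _ _) _; rewrite ge_max !absM; apply/andP; split.
    apply: le_trans (ler_pM (abs_ge0 _) (abs_ge0 _) (hC _ i1) (hM' _ _ i4 j4)) _.
    by rewrite mulrC divfK // gt_eqF.
  apply: le_trans (ler_pM (abs_ge0 _) (abs_ge0 _) (hM _ _ i3 j3) (hC' _ j2)) _.
  by rewrite divfK // gt_eqF.
Qed.
HB.instance Definition _ := GRing.isSubringClosed.Build (nat -> F) cauchy_pred cauchy_subring.

Record cauchy := Cauchy { cauchy_val : nat -> F; cauchy_valP : cauchy_val \in cauchy_pred }.
HB.instance Definition _ := [isSub for cauchy_val].
HB.instance Definition _ := [Choice of cauchy by <:].
HB.instance Definition _ := [SubChoice_isSubComNzRing of cauchy by <:].

Lemma cauchyP (x : cauchy) : cauchy_seq (val x). Proof. exact/asboolP/(valP x). Qed.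

Definition null_pred : {pred cauchy} := fun x => `[< null_seq (val x) >].

Lemma null_seqB (x y : cauchy) : null_seq (val x) -> null_seq (val y) -> null_seq (val (x - y)).
Proof.
move=> hx hy e e0; have [M hM] := hx e e0; have [M' hM'] := hy e e0.
exists (maxn M M') => i; rewrite geq_max => /andP[Mi M'i].
by apply: le_trans (absB _ _) _; rewrite ge_max hM // hM'.
Qed.

Lemma null_seqM (a x : cauchy) : null_seq (val x) -> null_seq (val (a * x)).
Proof.
move=> hx e e0; have [C C0 [M hC]] := cauchy_bounded (cauchyP a).
have [M' hM'] := hx _ (divr_gt0 e0 C0); exists (maxn M M') => i; rewrite geq_max => /andP[Mi M'i].
rewrite absM; apply: le_trans (ler_pM (abs_ge0 _) (abs_ge0 _) (hC _ Mi) (hM' _ M'i)) _.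
by rewrite mulrC divfK // gt_eqF.
Qed.

Lemma null_seq0 : null_seq (val (0 : cauchy)).
Proof. by move=> e e0; exists 0%N => i _; rewrite abs0 ltW. Qed.

Fact null_idealr : idealr_closed null_pred.
Proof.
split.
- exact/asboolP/null_seq0.
- apply/asboolP => h; have [M /(_ M (leqnn M))] := h (1 / 2) (divr_gt0 ltr01 (ltr0n _ 2)).
  by rewrite abs1 ler_pdivlMr // mul1r leNgt ltr1n.
- move=> a x y /asboolP hx /asboolP hy; apply/asboolP.
  rewrite -[y]opprK; apply: null_seqB; first exact: null_seqM.
  by rewrite -sub0r; apply: null_seqB => //; exact: null_seq0.
Qed.
HB.instance Definition _ := isIdealr.Build cauchy null_pred null_idealr.

Definition completion := Quotient.quot null_pred.
HB.instance Definition _ := Choice.on completion.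
HB.instance Definition _ := GRing.ComNzRing.on completion.
HB.instance Definition _ := EqQuotient.on completion.

Definition cls (x : cauchy) : completion := (\pi_completion x)%qT.

Lemma cls_eq (x y : cauchy) : cls x = cls y <-> null_seq (val (x - y)).
Proof.
have := @Quotient.idealrBE cauchy null_pred x y; rewrite /cls => E.
by split=> [/eqP|h]; [rewrite -E => /asboolP|apply/eqP; rewrite -E; apply/asboolP].
Qed.

Lemma cls_repr (x : completion) : cls (repr x) = x. Proof. exact: reprK. Qed.
Lemma clsD x y : cls (x + y) = cls x + cls y. Proof. by rewrite /cls !piE. Qed.
Lemma clsN x : cls (- x) = - cls x. Proof. by rewrite /cls !piE. Qed.
Lemma clsM x y : cls (x * y) = cls x * cls y. Proof. by rewrite /cls !piE. Qed.
Lemma cls0 : cls 0 = 0. Proof. by rewrite /cls !piE. Qed.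
Lemma cls1 : cls 1 = 1. Proof. by rewrite /cls !piE. Qed.
Lemma cls_eq0 x : cls x = 0 <-> null_seq (val x).
Proof. by rewrite -cls0; split=> [/cls_eq|h]; [rewrite subr0|apply/cls_eq; rewrite subr0]. Qed.

Lemma completion_inverse (x : completion) : x != 0 -> exists y, y * x = 1.
Proof.
rewrite -(cls_repr x); move: (repr x) => s s0.
have [n0|[c c0 [M hM]]] := cauchy_dichotomy (cauchyP s).
  by case/eqP: s0; apply/cls_eq0.
pose t i := (val s i)^-1.
have tc : t \in cauchy_pred.
  apply/asboolP => e e0; have [M' hM'] := cauchyP s (mulr_gt0 e0 (mulr_gt0 c0 c0)).
  exists (maxn M M') => i j; rewrite !geq_max => /andP[Mi M'i] /andP[Mj M'j].
  have s_neq0 l : (M <= l)%N -> val s l != 0.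
    by move=> /hM h; apply/eqP => sl; move: c0; rewrite -h sl abs0 ltxx.
  have -> : t i - t j = - (val s i - val s j) / (val s i * val s j).
    by rewrite /t; field; rewrite !s_neq0.
  rewrite absM absN absV absM !hM // ler_pdivrMr ?mulr_gt0 //; exact: hM'.
exists (cls (Cauchy tc)); rewrite -clsM -cls1; apply/cls_eq => e e0; exists M => i Mi.
rewrite (_ : val _ i = t i * val s i - 1) // /t mulVf ?subrr ?abs0 ?ltW //.
by apply/eqP => si; move: c0; rewrite -(hM i Mi) si abs0 ltxx.
Qed.

Definition completion_inv (x : completion) : completion := xget 0 [set y | y * x = 1].
Fact completion_mulVf x : x != 0 -> completion_inv x * x = 1.
Proof. by move=> /completion_inverse[y hy]; rewrite /completion_inv; case: xgetP => [z _ //|/(_ y)]. Qed.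
Fact completion_inv0 : completion_inv 0 = 0.
Proof.
rewrite /completion_inv; case: xgetP => // z _ /=; rewrite mulr0 => /esym/eqP.
by rewrite oner_eq0.
Qed.
HB.instance Definition _ := GRing.ComNzRing_isField.Build completion completion_mulVf completion_inv0.

Definition eventually_abs (s : cauchy) (c : R) : Prop := 0 < c /\ exists M, forall i, (M <= i)%N -> N (val s i) = c.
(** The default value 0 is the right one for the class of null sequences, which have no positive
    eventual value. *)
Definition completion_abs (x : completion) : R := xget 0 [set c | eventually_abs (repr x) c].

Lemma eventually_abs_uniq s c c' : eventually_abs s c -> eventually_abs s c' -> c = c'.
Proof. by move=> [_ [M h]] [_ [M' h']]; rewrite -(h (maxn M M')) ?leq_maxl // h' ?leq_maxr. Qed.

Lemma eventually_abs_cls s s' c : cls s = cls s' -> eventually_abs s c -> eventually_abs s' c.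
Proof.
move=> /esym/cls_eq h [c0 [M hM]]; split => //.
have [M' hM'] := h (c / 2) (divr_gt0 c0 (ltr0n _ 2)); exists (maxn M M') => i; rewrite geq_max => /andP[Mi M'i].
rewrite -(hM i Mi) -[val s' i](subrK (val s i)) addrC; apply: absD_eq.
rewrite hM //; apply: le_lt_trans (hM' i M'i) _.
by rewrite ltr_pdivrMr // ltr_pMr // ltr1n.
Qed.

Lemma completion_absE s c : eventually_abs s c -> completion_abs (cls s) = c.
Proof.
move=> h; have h' : eventually_abs (repr (cls s)) c by apply: eventually_abs_cls h; rewrite cls_repr.
rewrite /completion_abs; case: xgetP => [c' _ hc|/(_ c) //]; exact: eventually_abs_uniq hc h'.
Qed.

Lemma completion_abs0 : completion_abs 0 = 0.
Proof.
rewrite /completion_abs; case: xgetP => // c _ [c0 [M hM]].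
have /cls_eq0 h : cls (repr (0 : completion)) = 0 by exact: cls_repr.
have [M' hM'] := h (c / 2) (divr_gt0 c0 (ltr0n _ 2)).
have := hM' (maxn M M') (leq_maxr _ _); rewrite hM ?leq_maxl // ler_pdivlMr // leNgt.
by rewrite ltr_pMr // ltr1n.
Qed.

Lemma completion_cases (x : completion) : x = 0 \/ exists s c, x = cls s /\ eventually_abs s c.
Proof.
have [h|[c c0 hM]] := cauchy_dichotomy (cauchyP (repr x)).
  by left; rewrite -(cls_repr x); apply/cls_eq0.
by right; exists (repr x), c; rewrite cls_repr.
Qed.

Fact completion_abs_ums : ums completion_abs.
Proof.
have ge0 x : 0 <= completion_abs x.
  have [->|[s [c [-> h]]]] := completion_cases x; first by rewrite completion_abs0.
  by rewrite (completion_absE h); case: h => /ltW.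
have ul : ultrametric completion_abs.
  move=> x y; have [->|[s [c [xE h]]]] := completion_cases x; first by rewrite add0r le_max lexx orbT.
  have [->|[t [c' [yE h']]]] := completion_cases y; first by rewrite addr0 le_max lexx.
  have [->|[u [d [zE hz]]]] := completion_cases (x + y); first by rewrite completion_abs0 le_max ge0.
  have hst : eventually_abs (s + t) d by apply: eventually_abs_cls hz; rewrite clsD -xE -yE zE.
  rewrite zE xE yE (completion_absE h) (completion_absE h') (completion_absE hz).
  case: h h' hst => _ [M1 h1] [_ [M2 h2]] [_ [M3 h3]]; pose i := maxn M1 (maxn M2 M3).
  have i1 : (M1 <= i)%N by rewrite leq_maxl.
  have i2 : (M2 <= i)%N by rewrite /i !leq_max leqnn orbT.
  have i3 : (M3 <= i)%N by rewrite /i !leq_max leqnn !orbT.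
  rewrite -(h1 i i1) -(h2 i i2) -(h3 i i3); exact: absD.
split => //; split => //.
- exact: completion_abs0.
- by rewrite -cls1; apply: completion_absE; split => //; exists 0%N => i _; exact: abs1.
- move=> x y; have [->|[s [c [-> h]]]] := completion_cases x; first by rewrite mul0r completion_abs0 mul0r.
  have [->|[t [c' [-> h']]]] := completion_cases y; first by rewrite mulr0 completion_abs0 mulr0.
  rewrite -clsM (completion_absE h) (completion_absE h'); apply: completion_absE.
  case: h h' => c0 [M1 h1] [c'0 [M2 h2]]; split; first exact: mulr_gt0.
  by exists (maxn M1 M2) => i; rewrite geq_max => /andP[i1 i2]; rewrite [LHS]absM h1 // h2.
- move=> x y; apply: le_trans (ul x y) _; rewrite ge_max lerDl lerDr.
  by rewrite !ge0.
Qed.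

Fact completion_abs_eq0 x : completion_abs x = 0 -> x = 0.
Proof.
have [//|[s [c [-> h]]]] := completion_cases x.
by rewrite (completion_absE h) => c0; case: h; rewrite c0 ltxx.
Qed.

Definition completion_absolute : absolute_value R completion := AbsoluteValue completion_abs_ums completion_abs_eq0.

Fact const_cauchy x : (fun=> x) \in cauchy_pred.
Proof. by apply/asboolP => e e0; exists 0%N => i j _ _; rewrite subrr abs0 ltW. Qed.
Definition into_completion (x : F) : completion := cls (Cauchy (const_cauchy x)).

Fact into_completion_nmod : nmod_morphism into_completion.
Proof.
split; first by rewrite -cls0; congr cls; apply: val_inj.
by move=> x y; rewrite -clsD; congr cls; apply: val_inj.
Qed.
HB.instance Definition _ := GRing.isNmodMorphism.Build F completion into_completion into_completion_nmod.
Fact into_completion_monoid : monoid_morphism into_completion.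
Proof.
split; first by rewrite -cls1; congr cls; apply: val_inj.
by move=> x y; rewrite -clsM; congr cls; apply: val_inj.
Qed.
HB.instance Definition _ := GRing.isMonoidMorphism.Build F completion into_completion into_completion_monoid.

Lemma into_completion_abs x : completion_abs (into_completion x) = N x.
Proof.
have [->|x0] := eqVneq x 0; first by rewrite raddf0 completion_abs0 abs0.
by apply: completion_absE; split; [exact: abs_gt0|exists 0%N].
Qed.

Lemma completion_abs_le (s : cauchy) (e : R) M : 0 <= e -> (forall i, (M <= i)%N -> N (val s i) <= e) -> completion_abs (cls s) <= e.
Proof.
move=> e0 h; have [->|[t [c [E hc]]]] := completion_cases (cls s); first by rewrite completion_abs0.
have hs := eventually_abs_cls (esym E) hc; rewrite (completion_absE hs).
by case: hs => _ [M' h']; rewrite -(h' (maxn M M')) ?leq_maxr // h // leq_maxl.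
Qed.

Lemma cauchy_approximates (s : cauchy) (e : R) : 0 < e -> exists M, forall i, (M <= i)%N ->
  completion_abs (cls s - into_completion (val s i)) <= e.
Proof.
move=> e0; have [M hM] := cauchyP s e0; exists M => i Mi.
rewrite -clsN -clsD; apply: (@completion_abs_le _ _ M); first exact: ltW.
by move=> j Mj; exact: hM.
Qed.

Lemma completion_dense (x : completion) (e : R) : 0 < e -> exists y, completion_abs (x - into_completion y) <= e.
Proof.
by rewrite -(cls_repr x) => /(cauchy_approximates (repr x))[M /(_ M (leqnn M))]; exists (val (repr x) M).
Qed.

Lemma completion_complete (l : nat -> completion) :
  (forall e, 0 < e -> exists M, forall i j, (M <= i)%N -> (M <= j)%N -> completion_abs (l i - l j) <= e) ->
  exists x, forall e, 0 < e -> exists M, forall i, (M <= i)%N -> completion_abs (l i - x) <= e.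
Proof.
move=> hl; have [_ ul] := completion_abs_ums; have cN := mult_seminormN (proj1 completion_abs_ums).
have ulB x y : completion_abs (x - y) <= Num.max (completion_abs x) (completion_abs y) by rewrite -(cN y); exact: ul.
have /choice[y hy] : forall k, exists y, completion_abs (l k - into_completion y) <= k.+1%:R^-1.
  by move=> k; apply: completion_dense; rewrite invr_gt0.
have small (e : R) : 0 < e -> exists M, forall i, (M <= i)%N -> completion_abs (l i - into_completion (y i)) <= e.
  move=> e0; exists (Num.truncn e^-1) => i hi; apply: le_trans (hy i) _.
  rewrite invf_ple ?posrE // (le_trans (ltW (Num.Theory.truncnS_gt _))) // ler_nat.
  by rewrite ltnS.
have yc : y \in cauchy_pred.
  apply/asboolP => e e0; have [M hM] := hl e e0; have [M' hM'] := small e e0.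
  exists (maxn M M') => i j; rewrite !geq_max => /andP[Mi M'i] /andP[Mj M'j].
  rewrite -into_completion_abs raddfB /=.
  have -> : into_completion (y i) - into_completion (y j) = (l i - l j) - (l i - into_completion (y i)) + (l j - into_completion (y j)) by ring.
  apply: le_trans (ul _ _) _; rewrite ge_max hM' // andbT.
  by apply: le_trans (ulB _ _) _; rewrite ge_max hM // hM'.
exists (cls (Cauchy yc)) => e e0; have [M hM] := small e e0; have [M' hM'] := cauchy_approximates (Cauchy yc) e0.
exists (maxn M M') => i; rewrite geq_max => /andP[Mi M'i].
have -> : l i - cls (Cauchy yc) = (l i - into_completion (y i)) - (cls (Cauchy yc) - into_completion (y i)) by ring.
by apply: le_trans (ulB _ _) _; rewrite ge_max hM // hM'.
Qed.

End AbsoluteValueTheory.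

Section ValuationOfAbsolute.
Context {R : realType} {L : fieldType} (N : absolute_value R L).
Hypothesis Ncomplete : forall l : nat -> L,
  (forall e, 0 < e -> exists M, forall i j, (M <= i)%N -> (M <= j)%N -> N (l i - l j) <= e) ->
  exists x, forall e, 0 < e -> exists M, forall i, (M <= i)%N -> N (l i - x) <= e.

Definition log_abs (x : L) : \bar R := if x == 0 then +oo%E else (- ln (N x))%:E.

Lemma log_abs_ge C x : (C%:E <= log_abs x)%E = (N x <= expR (- C)).
Proof.
rewrite /log_abs; case: eqVneq => [->|x0]; first by rewrite leey abs0 expR_ge0.
by rewrite lee_fin lerNr -[RHS]ler_ln ?posrE ?expR_gt0 ?abs_gt0 // expRK.
Qed.

Fact log_abs_neqNy x : (log_abs x != -oo)%E. Proof. by rewrite /log_abs; case: ifP. Qed.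
Fact log_abs_eqy x : (log_abs x == +oo%E) = (x == 0). Proof. by rewrite /log_abs; case: ifP. Qed.
Fact log_absM x y : log_abs (x * y) = (log_abs x + log_abs y)%E.
Proof.
rewrite /log_abs mulf_eq0; have [->|x0] := eqVneq x 0; first by case: ifP.
have [->|y0] := eqVneq y 0; first by [].
by rewrite /= absM lnM ?posrE ?abs_gt0 // opprD.
Qed.
Fact log_absD x y : (Order.min (log_abs x) (log_abs y) <= log_abs (x + y)%R)%E.
Proof.
have [xy0|xy0] := eqVneq (x + y) 0; first by rewrite xy0 {3}/log_abs eqxx leey.
have le1 (z t : L) : z != 0 -> t != 0 -> N t <= N z -> (log_abs z <= log_abs t)%E.
  move=> z0 t0 h; rewrite /log_abs (negPf z0) (negPf t0) lee_fin lerN2 ler_ln ?posrE ?abs_gt0 //.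
have := absD N x y; rewrite le_max ge_min => /orP[h|h].
  have x0 : x != 0.
    by apply: contra xy0 => /eqP x0; move: h; rewrite x0 abs0 => h; apply/eqP/(@abs_eq0 _ _ N)/eqP; rewrite eq_le h abs_ge0.
  by rewrite le1.
have y0 : y != 0.
  by apply: contra xy0 => /eqP y0; move: h; rewrite y0 abs0 => h; apply/eqP/(@abs_eq0 _ _ N)/eqP; rewrite eq_le h abs_ge0.
by rewrite (le1 y) ?orbT.
Qed.
Fact log_abs_complete (s : nat -> L) :
  (forall C : R, exists M : nat, forall i j : nat, (M <= i)%N -> (M <= j)%N -> (C%:E <= log_abs (s i - s j)%R)%E) ->
  exists l : L, forall C : R, exists M : nat, forall i : nat, (M <= i)%N -> (C%:E <= log_abs (s i - l)%R)%E.
Proof.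
move=> h; have [e e0|l hl] := @Ncomplete s.
  have [M hM] := h (- ln e); exists M => i j Mi Mj.
  by have := hM i j Mi Mj; rewrite log_abs_ge opprK lnK.
by exists l => C; have [M hM] := hl (expR (- C)) (expR_gt0 _); exists M => i Mi; rewrite log_abs_ge hM.
Qed.

Definition valuation_of_absolute : valuation R L :=
  Valuation log_abs_neqNy log_abs_eqy log_absM log_absD log_abs_complete.

Lemma absv_valuation_of_absolute x : absv valuation_of_absolute x = N x.
Proof.
rewrite /absv /= /log_abs; case: eqVneq => [->|x0]; first by rewrite abs0.
by rewrite /= opprK lnK // posrE abs_gt0.
Qed.

End ValuationOfAbsolute.

(** * Absolute values on fraction fields *)

Section FractionAbsolute.
Context {R : realType} {B : idomainType} (N : B -> R).
Hypotheses (hN : ums N) (N_eq0 : forall x, N x = 0 -> x = 0).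

Let Nm : mult_seminorm N. Proof. by case: hN. Qed.
Let N_gt0 x : x != 0 -> 0 < N x.
Proof. by move=> x0; rewrite lt_def (seminorm_ge0 Nm) andbT; apply: contra x0 => /eqP/N_eq0 ->. Qed.

Lemma fraction_form (x : {fraction B}) : exists n d : B, d != 0 /\ x = (FracField.tofrac n) / (FracField.tofrac d).
Proof.
exists (frac (repr x)).1, (frac (repr x)).2; have d0 := denom_ratioP (repr x); split => //.
have td0 : FracField.tofrac (frac (repr x)).2 != 0 by rewrite tofrac_eq0.
apply: (mulIf td0); rewrite divfK // -{1}[x]reprK.
move: (repr x) d0 td0 => r d0 _.
rewrite !piE; apply/eqmodP; rewrite /= FracField.equivfE /FracField.mulf !numden_Ratio ?mulf_neq0 ?oner_neq0 //.
by rewrite mulr1 mulrC mulr1.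
Qed.

Definition fraction_abs (x : {fraction B}) : R := xget 0 [set c | exists n d : B,
  [/\ d != 0, x = (FracField.tofrac n) / (FracField.tofrac d) & c = N n / N d]].

Lemma fraction_absE n d : d != 0 -> fraction_abs (FracField.tofrac n / FracField.tofrac d) = N n / N d.
Proof.
move=> d0; rewrite /fraction_abs; case: xgetP => [c _ [n' [d' [d'0 E ->]]]|/(_ (N n / N d))[]]; last by exists n, d.
move/eqP: E; rewrite eqr_div ?tofrac_eq0 // -!rmorphM tofrac_eq => /eqP E.
have E' : N n' * N d = N n * N d' by rewrite -!(seminormM Nm) E.
by apply/eqP; rewrite eqr_div ?E' // lt0r_neq0 ?N_gt0.
Qed.

Fact fraction_abs_ums : ums fraction_abs.
Proof.
have ge0 x : 0 <= fraction_abs x.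
  by have [n [d [d0 ->]]] := fraction_form x; rewrite fraction_absE // divr_ge0 // (seminorm_ge0 Nm).
have ul : ultrametric fraction_abs.
  move=> x y; have [n [d [d0 ->]]] := fraction_form x; have [n' [d' [d'0 ->]]] := fraction_form y.
  rewrite addf_div ?tofrac_eq0 // -!rmorphM -rmorphD !fraction_absE ?mulf_neq0 //.
  rewrite ler_pdivrMr ?N_gt0 ?mulf_neq0 // maxr_pMl ?(seminorm_ge0 Nm) // !(seminormM Nm).
  apply: le_trans (proj2 hN _ _) _; rewrite !(seminormM Nm) !mulrA divfK ?gt_eqF ?N_gt0 //.
  by rewrite [X in _ <= Num.max _ X](_ : _ = N n' * N d) // mulrAC divfK ?gt_eqF ?N_gt0.
split => //; split => //.
- by rewrite -(mul0r (FracField.tofrac 1)^-1) -(rmorph0 (@FracField.tofrac B)) fraction_absE ?oner_neq0 // (seminorm0 Nm) mul0r.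
- rewrite -[1](divr1 1) -(rmorph1 (@FracField.tofrac B)) fraction_absE ?oner_neq0 // (seminorm1 Nm).
  by rewrite divr1.
- move=> x y; have [n [d [d0 ->]]] := fraction_form x; have [n' [d' [d'0 ->]]] := fraction_form y.
  by rewrite mulf_div -!rmorphM !fraction_absE ?mulf_neq0 // !(seminormM Nm) mulf_div.
- move=> x y; apply: le_trans (ul x y) _; rewrite ge_max lerDl lerDr.
  by rewrite !ge0.
Qed.

Fact fraction_abs_eq0 x : fraction_abs x = 0 -> x = 0.
Proof.
have [n [d [d0 ->]]] := fraction_form x; rewrite fraction_absE // => /eqP.
by rewrite mulf_eq0 invr_eq0 (gt_eqF (N_gt0 d0)) orbF => /eqP/N_eq0 ->; rewrite rmorph0 mul0r.
Qed.

Definition fraction_absolute : absolute_value R {fraction B} := AbsoluteValue fraction_abs_ums fraction_abs_eq0.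

End FractionAbsolute.

Section ExtensionExists.
Context {R : realType} {K : fieldType} (v : valuation R K) {m : nat} (tau : 'I_m -> R).
Local Notation A := 'rV[int]_m.

Definition tau_weight (u : A) : R := \sum_i (u 0 i)%:~R * tau i.
Fact tau_weight_nmod : nmod_morphism tau_weight.
Proof.
split; first by rewrite /tau_weight big1 // => i _; rewrite mxE mul0r.
move=> x y; rewrite /tau_weight -big_split; apply: eq_bigr => i _ /=.
by rewrite mxE rmorphD mulrDl.
Qed.
HB.instance Definition _ := GRing.isNmodMorphism.Build A R tau_weight tau_weight_nmod.

Definition torus_ring := restr v (zgen (@setT A)) tau_weight.
HB.instance Definition _ := GRing.ComNzRing.on torus_ring.

Definition torus_unit : {pred torus_ring} := fun x => `[< exists y, y * x = 1 >].
Definition torus_inv (x : torus_ring) : torus_ring := if x \in torus_unit then xget 0 [set y | y * x = 1] else x.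
Fact torus_mulVx : {in torus_unit, left_inverse 1 torus_inv *%R}.
Proof.
move=> x xu; rewrite /torus_inv xu; move/asboolP: xu => -[y hy].
by case: xgetP => [z _ //|/(_ y)].
Qed.
Fact torus_unitP x y : y * x = 1 -> torus_unit x.
Proof. by move=> h; apply/asboolP; exists y. Qed.
Fact torus_inv_out : {in [predC torus_unit], torus_inv =1 id}.
Proof. by move=> x; rewrite inE /torus_inv => /negPf ->. Qed.
HB.instance Definition _ := GRing.ComNzRing_hasMulInverse.Build torus_ring torus_mulVx torus_unitP torus_inv_out.
Fact torus_integral : GRing.integral_domain_axiom torus_ring.
Proof. by move=> x y /restr_integral[->|->]; rewrite eqxx ?orbT. Qed.
HB.instance Definition _ := GRing.ComUnitRing_isIntegral.Build torus_ring torus_integral.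

Let Nt : torus_ring -> R := fun f => gauss_norm f.
Let Nt_ums : ums Nt. Proof. exact: nrm_ums. Qed.
Let Nt_eq0 (x : torus_ring) : Nt x = 0 -> x = 0. Proof. exact: nrm_eq0. Qed.
Let inT (u : A) : u \in zgen (@setT A). Proof. exact: zgen_sub. Qed.

(** [L] is the completed fraction field of a ring of restricted series, in which the variables are
    generic elements of valuations [tau i]. Monomials are orthogonal over [K] for the Gauss norm,
    and remain so after division by a common denominator. *)
Lemma extension_exists : exists (L : fieldType) (vL : valuation R L) (iota : {rmorphism K -> L}),
  [/\ forall x, vL (iota x) = v x, forall i, value_group vL (tau i) & orthogonally_dense v vL iota].
Proof.
pose FN := fraction_absolute Nt_ums Nt_eq0.
pose L : fieldType := completion FN; pose NL : absolute_value R L := completion_absolute FN.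
pose vL : valuation R L := @valuation_of_absolute R L NL (@completion_complete _ _ FN).
pose j0 : {rmorphism torus_ring -> L} := (@into_completion _ _ FN : {rmorphism _ -> _}) \o (@FracField.tofrac torus_ring : {rmorphism _ -> _}).
pose cst (c : K) : torus_ring := mono v _ tau_weight c 0.
have cstD : nmod_morphism cst.
  by split=> [|x y]; rewrite /cst ?mono0 // monoD.
have cstM : monoid_morphism cst.
  by split=> [|x y]; rewrite /cst ?mono1 // monoM ?inT // addr0.
pose cst' : {rmorphism K -> torus_ring} := HB.pack cst (GRing.isNmodMorphism.Build _ _ cst cstD) (GRing.isMonoidMorphism.Build _ _ cst cstM).
pose iota : {rmorphism K -> L} := j0 \o cst'.
have j0n (f : torus_ring) : absv vL (j0 f) = gauss_norm f.
  rewrite absv_valuation_of_absolute /NL /= into_completion_abs /FN /=.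
  have -> : FracField.tofrac f = FracField.tofrac f / FracField.tofrac 1 by rewrite rmorph1 divr1.
  by rewrite fraction_absE ?oner_neq0 // /Nt nrm1 divr1.
have iotan c : absv vL (iota c) = absv v c.
  by rewrite j0n nrm_mono ?inT // raddf0 oppr0 expR0 mulr1.
have fin_abs (F : fieldType) (vF : valuation R F) x : x != 0 -> vF x = (- ln (absv vF x))%:E.
  by move=> /(val_fin vF)[r vr]; rewrite /absv vr /= expRK opprK.
exists L, vL, iota; split.
- move=> x; have [->|x0] := eqVneq x 0; first by rewrite rmorph0 !val0.
  by rewrite !fin_abs ?fmorph_eq0 // iotan.
- move=> i; pose u : A := delta_mx 0 i.
  have wu : tau_weight u = tau i.
    rewrite /tau_weight (bigD1 i) //= mxE !eqxx mul1r big1 ?addr0 // => l li.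
    by rewrite mxE eqxx (negPf li) mul0r.
  have n1 : absv vL (j0 (mono v _ tau_weight 1 u)) = expR (- tau i).
    by rewrite j0n nrm_mono ?inT // absv1 mul1r; congr (expR (- _)); exact: wu.
  exists (j0 (mono v _ tau_weight 1 u)).
    by apply/eqP => h; move: n1; rewrite h absv0 => /esym/eqP; rewrite gt_eqF ?expR_gt0.
  rewrite fin_abs ?n1 ?expRK ?opprK //.
  by apply/eqP => h; move: n1; rewrite h absv0 => /esym/eqP; rewrite gt_eqF ?expR_gt0.
move=> s eps eps0.
(* after approximation and clearing denominators the elements of s are f / g *)
have [g g0 hg] : exists2 g : torus_ring, g != 0 & forall x, x \in s -> exists f : torus_ring, absv vL (x - j0 f / j0 g) <= eps.
  elim: s => [|x s [g g0 hg]]; first by exists 1; rewrite ?oner_neq0.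
  have [y hy] := @completion_dense _ _ FN x eps eps0.
  have [n [d [d0 yE]]] := fraction_form y.
  have j00 (a : torus_ring) : a != 0 -> j0 a != 0 by move=> a0; rewrite fmorph_eq0 tofrac_eq0.
  exists (g * d); first by rewrite mulf_neq0.
  move=> z; rewrite inE => /orP[/eqP ->|/hg[f hf]].
    exists (g * n); rewrite !rmorphM -mulf_div divff ?mul1r ?j00 //.
    rewrite absv_valuation_of_absolute; move: hy; rewrite yE rmorphM fmorphV.
    by [].
  by exists (f * d); rewrite !rmorphM -mulf_div divff ?mulr1 ?j00.
have j0g : j0 g != 0 by rewrite fmorph_eq0 tofrac_eq0.
have gn0 : 0 < gauss_norm (g : restr v _ _) by apply: nrm_gt0.
have /choice[f hf] : forall x, exists f : torus_ring, x \in s -> absv vL (x - j0 f / j0 g) <= eps.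
  by move=> x; have [/hg[f h]|_] := boolP (x \in s); [exists f|exists 0].
have [E Eu hE] : exists2 E : seq A, uniq E & forall x, x \in s -> gauss_norm (f x - mpart E (f x)) <= eps * gauss_norm (g : restr v _ _).
  have pos : 0 < eps * gauss_norm (g : restr v _ _) by rewrite mulr_gt0.
  elim: (s) => [|x t [E Eu hE]]; first by exists [::].
  have [E' E'u [_ hE']] := approx (f x) pos.
  have mono_part (E1 E2 : seq A) (h : restr v (zgen (@setT A)) tau_weight) : uniq E1 -> uniq E2 -> {subset E1 <= E2} ->
      gauss_norm (h - mpart E1 h) <= eps * gauss_norm (g : restr v _ _) -> gauss_norm (h - mpart E2 h) <= eps * gauss_norm (g : restr v _ _).
    move=> u1 u2 sub h1; apply: nrm_le => u; rewrite /tm coefB coef_mpart //.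
    have [uE|uE] := boolP (u \in E2); first by rewrite subrr absv0 mul0r ltW.
    have : u \notin E1 by apply: contra uE => /sub.
    move=> uE1; apply: le_trans h1; have := le_nrm (h - mpart E1 h) u.
    by rewrite /tm coefB coef_mpart // (negPf uE1).
  exists (undup (E ++ E')); first exact: undup_uniq.
  have s1 : {subset E <= undup (E ++ E')} by move=> u uE; rewrite mem_undup mem_cat uE.
  have s2 : {subset E' <= undup (E ++ E')} by move=> u uE; rewrite mem_undup mem_cat uE orbT.
  move=> z; rewrite inE => /orP[/eqP ->|/hE h].
    exact: (mono_part _ _ _ E'u (undup_uniq _) s2 hE').
  exact: (mono_part _ _ _ Eu (undup_uniq _) s1 h).
pose r := size E; pose ex (i : 'I_r) : A := nth 0 E i.
pose b (i : 'I_r) : L := j0 (mono v _ tau_weight 1 (ex i)) / j0 g.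
have comb (c : 'I_r -> K) : \sum_l iota (c l) * b l = j0 (\sum_l mono v _ tau_weight (c l) (ex l)) / j0 g.
  rewrite rmorph_sum mulr_suml; apply: eq_bigr => l _; rewrite /b mulrA; congr (_ / _).
  transitivity (j0 (cst (c l) * mono v _ tau_weight 1 (ex l))); first by rewrite rmorphM.
  by congr (j0 _); rewrite /cst [LHS]monoM ?inT // mulr1 add0r.
have absdiv (a : torus_ring) : absv vL (j0 a / j0 g) = gauss_norm a / gauss_norm (g : restr v _ _).
  by rewrite absvM absvV !j0n.
exists r, b; split=> [c i|x xs].
  rewrite comb absdiv /b absdiv mulrA; apply: ler_wpM2r; first by rewrite invr_ge0 nrm_ge0.
  rewrite nrm_mono ?inT // absv1 mul1r.
  have := le_nrm (\sum_l mono v (zgen (@setT A)) tau_weight (c l) (ex l)) (ex i); rewrite /tm coef_sum.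
  rewrite (bigD1 i) //= coef_mono ?inT // eqxx big1 ?addr0 // => l li.
  rewrite coef_mono ?inT //; case: eqP => // /eqP; rewrite nth_uniq ?ltn_ord // => /eqP h.
  by case/eqP: li; apply: val_inj.
exists (fun l => f x (ex l)); rewrite comb.
have -> : \sum_l mono v (zgen (@setT A)) tau_weight (f x (ex l)) (ex l) = mpart E (f x).
  by rewrite /mpart (big_nth 0) big_mkord.
have -> : x - j0 (mpart E (f x)) / j0 g = (x - j0 (f x) / j0 g) + j0 (f x - mpart E (f x)) / j0 g.
  by rewrite rmorphB mulrBl addrA subrK.
apply: le_trans (absvD _ _ _) _; rewrite ge_max hf //= absdiv ler_pdivrMr //.
exact: hE.
Qed.

End ExtensionExists.

(** * Points over a Gauss point *)

Section LocalDimension.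
Context {R : realType} {K : fieldType} (v : valuation R K) {n : nat}.
Local Notation A := 'rV[int]_n.
Context (S : addrClosed A) (w : {additive A -> R}).
Local Notation KU := (restr v S w).
Hypothesis SN : forall u, u \in S -> - u \in S.
Variables (r : nat) (b : 'I_r -> A).
Hypotheses (bS : forall i, b i \in S) (Sb : forall u, u \in S -> zspan b u).

Lemma value_group_zspan (L : fieldType) (vL : valuation R L) u : (forall i, value_group vL (w (b i))) ->
  zspan b u -> value_group vL (w u).
Proof.
move=> hb /zspan_zgen; apply: (zgen_min (U := [set u | value_group vL (w u)])).
- by exists 1; rewrite ?oner_neq0 // Defs.val1 raddf0.
- move=> x y [c c0 vc] [d d0 vd]; exists (c / d); first by rewrite mulf_neq0 ?invr_eq0.
  have : vL (c / d * d) = (w x)%:E by rewrite divfK.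
  have [z vz] := val_fin vL (mulf_neq0 c0 (invr_neq0 d0)).
  rewrite Defs.valM vd vz -EFinD raddfB => -[<-]; congr (_%:E); by rewrite addrK.
- by move=> _ [i _ <-]; exact: hb.
Qed.

(** The upper bound holds over every admissible extension of [K]. For the lower bound, a component
    lies below the kernel of [p], which meets K<T> only in 0; orthogonal approximation carries this
    over to a suitable [L], where chains of length [k] exist. *)
Lemma local_dim_torus (a : set KU) k (e : 'I_k -> A) p : (forall i, e i \in S) -> zindep e ->
  finite_over (zspan e) a -> spectrum a p -> (forall g, supp_in (zspan e) g -> p g = gauss_norm g) ->
  local_dim a p (k%:R)%:E.
Proof.
move=> eS ez fin pa pT; have [pu pn p0] := spectrum_ums pa.
have ext (P : set KU) (L : fieldType) (vL : valuation R L) (iota : {rmorphism K -> L}) (viota : forall x, vL (iota x) = v x) :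
    a `<=` P -> finite_over (zspan e) (gen_ideal (coef_image iota vL w P)).
  move=> aP; refine (finite_over_extension (viota := viota) (gen_ideal_is_ideal _) (@zspanD _ _ e) (zspan0 e) _ fin).
  by move=> f af J Jid; apply; rewrite (coef_image_cemb viota); exists f => //; exact: aP.
split; last first.
  move=> P e' [_ aP _] _ [L [vL [iota [viota _ _ <-]]]].
  exact: krull_dim_le eS ez (ext P L vL iota viota aP).
have [P [minP Pp]] := minimal_prime_below (ums_kernel_prime pu) p0.
exists P; split => //; first exact: spectrumP.
(* The weights of the basis make the algebra strictly affinoid over [L]; the additional value 1
   makes the valuation nontrivial. *)
pose tau (i : 'I_r.+1) := if unlift ord0 i is Some i' then w (b i') else 1.
have [L [vL [iota [viota vtau od]]]] := extension_exists v tau.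
have [_ aP _] := minP.
exists L, vL, iota; split => //.
- have [x x0 vx] := vtau ord0; exists x => //; rewrite vx /tau unlift_none.
  by rewrite eqe oner_eq0.
- move=> u /Sb; apply: value_group_zspan => i.
  by have := vtau (lift ord0 i); rewrite /tau liftK.
apply/eqP; rewrite eq_le (krull_dim_le SN eS ez (ext P L vL iota viota aP)) /=.
apply: krull_dim_ge => //.
- move=> u /Sb; apply: value_group_zspan => i.
  by have := vtau (lift ord0 i); rewrite /tau liftK.
- exact: gen_ideal_is_ideal.
- exact: ext.
move=> y yT; rewrite (coef_image_cemb viota) => Py.
have Pid : is_ideal P by case: minP => -[].
exact: (extension_disjoint (viota := viota) od pu pn Pp Pid pT Py yT).
Qed.

End LocalDimension.

(** * Extending a seminorm from Laurent polynomials to series *)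

Section ExtendSeminorm.
Context {R : realType} {K : fieldType} (v : valuation R K) {n : nat}.
Local Notation A := 'rV[int]_n.
Context (S : addrClosed A) (w : {additive A -> R}).
Local Notation L := (laurent R K S).
Local Notation KU := (restr v S w).
Local Notation nrm := (@gauss_norm R K v A S w).
Local Notation emb := (@lemb R K K v A S S w idfun (fun u h => h)).
Variables (I : set L) (xi : L -> R).
Hypotheses (Iid : is_ideal I) (xiu : ums xi) (xin : forall f, xi f <= nrm (emb f)) (xiI : forall f, I f -> xi f = 0).

Let xim : mult_seminorm xi. Proof. by case: xiu. Qed.
Let xi0 f : 0 <= xi f. Proof. exact: seminorm_ge0. Qed.

(** Extension by continuity written without limits: a Laurent polynomial closer to [f] than the
    value of [f] already has that value, by [extended_eq]. *)
Definition extended_seminorm (f : KU) : R := inf [set Num.max (xi g) (nrm (f - emb g)) | g in setT].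
Local Notation p := extended_seminorm.

Lemma extended_near f g e : nrm (f - emb g) <= e -> p f <= Num.max (xi g) e /\ xi g <= Num.max (p f) e.
Proof.
move=> h; have lb0 : has_lbound [set Num.max (xi g) (nrm (f - emb g)) | g in setT].
  by exists 0 => _ [g' _ <-]; rewrite le_max xi0.
split.
  apply: (@le_trans _ _ (Num.max (xi g) (nrm (f - emb g)))).
    by apply: ge_inf => //; exists g.
  by rewrite ge_max le_max lexx /= le_max h orbT.
rewrite le_max; have [le|lt] := leP (xi g) e; first by rewrite orbT.
apply/orP; left; apply: lb_le_inf; first by exists (Num.max (xi 0) (nrm (f - emb 0))), 0.
move=> _ [g' _ <-].
have h1 : xi g <= Num.max (xi g') (xi (g - g')) by have [_ u] := xiu; rewrite -{1}(subrK g' g) addrC; exact: u.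
have h2 : xi (g - g') <= Num.max (nrm (f - emb g')) e.
  apply: le_trans (xin _) _; rewrite raddfB /= (_ : emb g - emb g' = (f - emb g') - (f - emb g)); last first.
    by rewrite opprB [RHS]addrC addrA subrK.
  by apply: le_trans (nrmD _ _) _; rewrite nrmN ge_max le_max lexx /= le_max h orbT.
have := le_trans h1 (_ : _ <= Num.max (xi g') (Num.max (nrm (f - emb g')) e)).
rewrite ge_max le_max lexx /= le_max h2 orbT => /(_ isT).
by rewrite maxA le_max => /orP[//|]; rewrite leNgt lt.
Qed.

Lemma extended_ge0 f : 0 <= p f.
Proof.
apply: lb_le_inf; first by exists (Num.max (xi 0) (nrm (f - emb 0))), 0.
by move=> _ [g' _ <-]; rewrite le_max xi0.
Qed.

Lemma extended_emb g : p (emb g) = xi g.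
Proof.
have [|h1 h2] := @extended_near (emb g) g 0; first by rewrite subrr nrm0.
move: h1 h2; rewrite !(elimT max_idPl _) ?extended_ge0 ?xi0 // => h1 h2.
by apply/eqP; rewrite eq_le h1.
Qed.

Lemma extended_eq f g e : nrm (f - emb g) <= e -> e < p f -> xi g = p f.
Proof.
move=> /extended_near[h1 h2] lt; apply/eqP; rewrite eq_le; apply/andP; split.
  by move: h2; rewrite le_max => /orP[//|h]; exact: le_trans h (ltW lt).
by move: h1; rewrite le_max => /orP[//|]; rewrite leNgt lt.
Qed.

Lemma extended_le_nrm f : p f <= nrm f.
Proof.
have [|h _] := @extended_near f 0 (nrm f); first by rewrite raddf0 subr0.
by apply: le_trans h _; rewrite (seminorm0 xim) ge_max nrm_ge0 /=.
Qed.

Lemma extended_ultra : ultrametric p.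
Proof.
move=> f f'; apply/ler_addgt0Pr => e e0.
have [g hg _] := lemb_dense f e0; have [g' hg' _] := lemb_dense f' e0.
have [|h _] := @extended_near (f + f') (g + g') e.
  by rewrite raddfD opprD addrACA; apply: le_trans (nrmD _ _) _; rewrite ge_max hg.
apply: le_trans h _; have [_ u] := xiu.
have m0 : 0 <= Num.max (p f) (p f') by rewrite le_max extended_ge0.
have [_ h1] := extended_near hg; have [_ h2] := extended_near hg'.
have le1 x : x <= Num.max (p f) e -> x <= Num.max (p f) (p f') + e.
  by rewrite le_max => /orP[h'|h']; apply: le_trans h' _; rewrite ?lerDr // (le_trans _ (_ : Num.max (p f) (p f') <= _)) ?le_max ?lexx // lerDl ltW.
have le2 x : x <= Num.max (p f') e -> x <= Num.max (p f) (p f') + e.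
  by rewrite le_max => /orP[h'|h']; apply: le_trans h' _; rewrite ?lerDr // (le_trans _ (_ : Num.max (p f) (p f') <= _)) ?le_max ?lexx ?orbT // lerDl ltW.
rewrite ge_max lerDr m0 andbT; apply: le_trans (u _ _) _; rewrite ge_max.
by rewrite le1 //= le2.
Qed.

Lemma extended_mul f f' : p (f * f') = p f * p f'.
Proof.
pose C := nrm f + nrm f' + 1.
have C0 : 0 < C by rewrite ltr_wpDl // addr_ge0 ?nrm_ge0.
have close e g g' : 0 < e -> e <= 1 -> nrm (f - emb g) <= e -> nrm (f' - emb g') <= e -> nrm (f * f' - emb (g * g')) <= C * e.
  move=> e0 e1 h h'; have -> : f * f' - emb (g * g') = f * (f' - emb g') + (f - emb g) * emb g'.
    by rewrite rmorphM mulrBr mulrBl addrA subrK.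
  have g'n : nrm (emb g') <= nrm f' + 1.
    rewrite (_ : emb g' = f' - (f' - emb g')); last by rewrite opprB addrC subrK.
    apply: le_trans (nrmD _ _) _; rewrite nrmN ge_max lerDl ler01 /=.
    by apply: le_trans h' _; apply: le_trans e1 _; rewrite lerDr nrm_ge0.
  apply: le_trans (nrmD _ _) _; rewrite ge_max; apply/andP; split.
    apply: le_trans (nrmM_le _ _) _; apply: ler_pM => //; rewrite ?nrm_ge0 //.
    by rewrite /C -addrA lerDl addr_ge0 ?nrm_ge0.
  apply: le_trans (nrmM_le _ _) _; rewrite mulrC; apply: ler_pM => //; rewrite ?nrm_ge0 //.
  by apply: le_trans g'n _; rewrite /C -addrA lerDr nrm_ge0.
have zero (h h' : KU) : p h = 0 -> (forall e g g', 0 < e -> e <= 1 -> nrm (h - emb g) <= e -> nrm (h' - emb g') <= e ->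
    nrm (f * f' - emb (g * g')) <= C * e) -> p (f * f') = 0.
  move=> ph cl; apply/eqP; rewrite eq_le extended_ge0 andbT; apply/ler_addgt0Pr => d d0; rewrite add0r.
  pose C' := C + p h' + 1.
  have C'0 : 0 < C' by rewrite ltr_wpDl // addr_ge0 ?extended_ge0 // ltW.
  pose e := Num.min 1 (d / C').
  have e0 : 0 < e by rewrite lt_min ltr01 divr_gt0.
  have e1 : e <= 1 by rewrite ge_min lexx.
  have ed : C' * e <= d by rewrite mulrC -ler_pdivlMr // ge_min lexx orbT.
  have [g hg _] := lemb_dense h e0; have [g' hg' _] := lemb_dense h' e0.
  have [h1 _] := extended_near (cl e g g' e0 e1 hg hg').
  apply: le_trans h1 _; rewrite ge_max; apply/andP; split; last first.
    by apply: le_trans ed; apply: ler_wpM2r; rewrite ?(ltW e0) // /C' -addrA lerDl addr_ge0 // extended_ge0.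
  have [_ g1] := extended_near hg; have [_ g2] := extended_near hg'.
  rewrite (seminormM xim); apply: le_trans ed; rewrite [C' * e]mulrC; apply: ler_pM => //.
    by move: g1; rewrite ph (elimT max_idPr _) // ltW.
  apply: le_trans g2 _; rewrite ge_max; apply/andP; split.
    by rewrite /C' -addrA addrCA lerDl addr_ge0 // ltW.
  by apply: le_trans e1 _; rewrite /C' lerDr addr_ge0 ?extended_ge0 // ltW.
have [f0|f0] := eqVneq (p f) 0.
  by rewrite f0 mul0r; apply: zero f0 _ => e g g'; exact: close.
have [f'0|f'0] := eqVneq (p f') 0.
  rewrite f'0 mulr0; apply: (zero f' f f'0) => e g g' e0 e1 h h'; rewrite [g * g']mulrC; exact: close.
have pf : 0 < p f by rewrite lt_def f0 extended_ge0.
have pf' : 0 < p f' by rewrite lt_def f'0 extended_ge0.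
pose e := Num.min 1 (Num.min (p f) (Num.min (p f') (p f * p f' / C))) / 2.
have m0 : 0 < Num.min 1 (Num.min (p f) (Num.min (p f') (p f * p f' / C))).
  by rewrite !lt_min ltr01 pf pf' divr_gt0 // mulr_gt0.
have e0 : 0 < e by rewrite divr_gt0.
have : e < Num.min 1 (Num.min (p f) (Num.min (p f') (p f * p f' / C))).
  by rewrite ltr_pdivrMr // ltr_pMr // ltr1n.
rewrite !lt_min => /and4P[e1 ef ef' eff].
have [g hg _] := lemb_dense f e0; have [g' hg' _] := lemb_dense f' e0.
have Ce : C * e < p f * p f' by rewrite mulrC -ltr_pdivlMr.
have [h1 h2] := extended_near (close e g g' e0 (ltW e1) hg hg').
move: h1 h2; rewrite (seminormM xim) (extended_eq hg ef) (extended_eq hg' ef').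
rewrite !le_max => /orP[h1|h1] /orP[h2|h2]; [by apply/eqP; rewrite eq_le h1| | |].
- by move: (le_lt_trans h2 Ce); rewrite ltxx.
- by move: (le_lt_trans (le_trans h2 h1) Ce); rewrite ltxx.
- by move: (le_lt_trans h2 Ce); rewrite ltxx.
Qed.

Lemma extended_spectrum : spectrum (gen_ideal (coef_image id v w I)) p.
Proof.
apply: spectrumP; last first.
- move=> f af; apply/eqP; rewrite eq_le extended_ge0 andbT; apply/ler_addgt0Pr => e e0; rewrite add0r.
  have [i Ii hi] := gen_ideal_dense Iid af e0.
  by have [h _] := extended_near hi; move: h; rewrite xiI // (elimT max_idPr _) // ltW.
- exact: extended_le_nrm.
split; last exact: extended_ultra.
split; [exact: extended_ge0| | |exact: extended_mul|].
- by rewrite -(raddf0 emb) extended_emb (seminorm0 xim).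
- by rewrite -(rmorph1 emb) extended_emb (seminorm1 xim).
- move=> x y; apply: le_trans (extended_ultra x y) _; rewrite ge_max lerDl lerDr.
  by rewrite !extended_ge0.
Qed.

Lemma extended_gauss (T : set A) : (forall g, supp_in T g -> xi g = nrm (emb g)) ->
  forall f, supp_in T f -> p f = nrm f.
Proof.
move=> xiT f fT; apply/eqP; rewrite eq_le extended_le_nrm /= leNgt; apply/negP => lt.
have d0 : 0 < nrm f by apply: le_lt_trans lt; exact: extended_ge0.
have e0 : 0 < (p f + nrm f) / 2 by rewrite divr_gt0 // ltr_wpDl ?extended_ge0.
have e1 : (p f + nrm f) / 2 < nrm f by rewrite ltr_pdivrMr // mulr_natr mulr2n ltrD2r.
have e2 : p f < (p f + nrm f) / 2 by rewrite ltr_pdivlMr // mulr_natr mulr2n ltrD2l.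
have [g hg gT] := lemb_dense f e0.
have [_ h2] := extended_near hg; move: h2; rewrite xiT; last exact: gT.
have -> : nrm (emb g) = nrm f.
  have [_ nu] := nrm_ums v S w; rewrite (_ : emb g = f - (f - emb g)); last by rewrite opprB addrC subrK.
  apply: ultra_eq => //; first exact: nrmN.
  by rewrite nrmN; exact: le_lt_trans hg e1.
by rewrite le_max => /orP[|]; rewrite leNgt ?lt // e1.
Qed.

End ExtendSeminorm.

Section RealContinuity.
Context {R : realType} {W : topologicalType}.
Implicit Types g h : W -> R.

Lemma continuous_sub g h : continuous g -> continuous h -> continuous (fun q => g q - h q).
Proof. by move=> cg ch q; exact: (@continuousB R R W g h q (cg q) (ch q)). Qed.

Lemma continuous_mul g h : continuous g -> continuous h -> continuous (fun q => g q * h q).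
Proof. by move=> cg ch q; exact: (@continuousM R W g h q (cg q) (ch q)). Qed.

Lemma continuous_add g h : continuous g -> continuous h -> continuous (fun q => g q + h q).
Proof. by move=> cg ch q; exact: (@continuousD R R W g h q (cg q) (ch q)). Qed.

Lemma closed_eqP g h : continuous g -> continuous h -> closed [set q | g q = h q].
Proof.
move=> cg ch; have -> : [set q | g q = h q] = (fun q => g q - h q) @^-1` [set x | x = 0].
  by apply/seteqP; split => q /=; [move=> ->; rewrite subrr|move=> /eqP; rewrite subr_eq0 => /eqP].
by apply: preimage_closed; [move=> q _; exact: continuous_sub|exact: closed_eq].
Qed.

Lemma closed_leP g h : continuous g -> continuous h -> closed [set q | g q <= h q].
Proof.
move=> cg ch; have -> : [set q | g q <= h q] = (fun q => h q - g q) @^-1` [set x | 0 <= x].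
  by apply/seteqP; split => q /=; rewrite subr_ge0.
by apply: preimage_closed; [move=> q _; exact: continuous_sub|exact: closed_ge].
Qed.

End RealContinuity.

(** * The fibre over a Gauss point and the Shilov boundary *)

Section Shilov.
Context {R : realType} {K : fieldType} (v : valuation R K) {n : nat}.
Local Notation A := 'rV[int]_n.
Context (S : addrClosed A) (w : {additive A -> R}).
Local Notation KU := (restr v S w).
Local Notation nrm := (@gauss_norm R K v A S w).
Hypothesis SN : forall u, u \in S -> - u \in S.
Variables (a : set KU) (T : set A).
Hypotheses (aid : is_ideal a) (T0 : T 0) (TD : forall x y, T x -> T y -> T (x + y)).
Hypothesis fin : finite_over T a.

Lemma kernel_vector m (M : 'I_m.+1 -> 'I_m -> KU) : (forall i j, supp_in T (M i j)) ->
  exists2 l : 'I_m.+1 -> KU, (forall i, supp_in T (l i)) &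
    (exists i, l i != 0) /\ forall j, \sum_i l i * M i j = 0.
Proof.
elim: m M => [|m IH] M MT.
  exists (fun=> 1).
    by move=> _; rewrite -(mono1 v S w); exact: supp_in_mono.
  by split => [|[]//]; exists ord0; exact: oner_neq0.
have [[i0 Mi0]|none] := pselect (exists i, M i ord0 != 0); last first.
  have M0 i : M i ord0 = 0 by apply/eqP/negPn/negP => h; apply: none; exists i.
  have [l lT [[i1 li1] lM]] := IH (fun i j => M (lift ord0 i) (lift ord0 j)) (fun i j => MT _ _).
  exists (fun i => if unlift ord0 i is Some i' then l i' else 0).
    by move=> i; case: unliftP => [i' _|_]; [exact: lT|exact: supp_in0].
  split; first by exists (lift ord0 i1); rewrite liftK.
  move=> j; rewrite big_ord_recl unlift_none mul0r add0r.
  case: (unliftP ord0 j) => [j' ->|->]; last by rewrite big1 // => i _; rewrite M0 mulr0.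
  by rewrite -[RHS](lM j'); apply: eq_bigr => i _; rewrite liftK.
pose M' i j := M i0 ord0 * M (lift i0 i) (lift ord0 j) - M (lift i0 i) ord0 * M i0 (lift ord0 j).
have M'T i j : supp_in T (M' i j).
  by apply: supp_inD; [|apply: supp_inN]; apply: supp_inM => //; exact: MT.
have [l lT [[i1 li1] lM]] := IH M' M'T.
pose s := \sum_i l i * M (lift i0 i) ord0.
exists (fun i => if unlift i0 i is Some i' then l i' * M i0 ord0 else - s).
  move=> i; case: unliftP => [i' _|_]; first exact: supp_inM.
  by apply: supp_inN; apply: supp_in_sum => i' _; apply: supp_inM.
split.
  exists (lift i0 i1); rewrite liftK; apply/eqP => h.
  by have [/eqP|/eqP] := restr_integral h; apply/negP.
move=> j; rewrite (bigD1_ord i0) //= unlift_none.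
under eq_bigr => i _ do rewrite liftK.
case: (unliftP ord0 j) => [j' ->|->].
  have h : \sum_i l i * M' i j' = \sum_i l i * (M i0 ord0 * M (lift i0 i) (lift ord0 j')) -
      \sum_i l i * (M (lift i0 i) ord0 * M i0 (lift ord0 j')).
    by rewrite -sumrB; apply: eq_bigr => i _; exact: mulrBr.
  move: h; rewrite lM => /esym/eqP; rewrite subr_eq0 => /eqP h.
  rewrite mulNr /s mulr_suml; apply/eqP; rewrite addrC subr_eq0; apply/eqP.
  rewrite (eq_bigr (fun i => l i * (M i0 ord0 * M (lift i0 i) (lift ord0 j')))); last first.
    by move=> i _; rewrite [RHS]mulrA.
  by rewrite h; apply: eq_bigr => i _; rewrite [LHS]mulrA.
rewrite mulNr /s mulr_suml addrC; apply/eqP; rewrite subr_eq0; apply/eqP.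
by apply: eq_bigr => i _; rewrite mulrAC.
Qed.

Definition gauss_fiber (q : KU -> R) : Prop := spectrum a q /\ forall g, supp_in T g -> q g = nrm g.
Local Notation F := gauss_fiber.

Let Fu q : F q -> ums q. Proof. by case=> /spectrum_ums[]. Qed.
Let Fa q f : F q -> a f -> q f = 0. Proof. by case=> /spectrum_ums[_ _ +] _ => /(_ f). Qed.
Let Fn q f : F q -> q f <= nrm f. Proof. by case=> /spectrum_ums[_ + _] _; apply. Qed.
Let FM q f g : F q -> q (f * g) = q f * q g. Proof. by case/Fu => -[]. Qed.
Let FX q f i : F q -> q (f ^+ i) = q f ^+ i. Proof. by case/Fu => /mult_seminormX. Qed.
Let F0 q f : F q -> 0 <= q f. Proof. by case/Fu => -[]. Qed.
Let FN q f : F q -> q (- f) = q f. Proof. by case/Fu => /mult_seminormN. Qed.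
Let FD q f g : F q -> q g < q f -> q (f + g) = q f.
Proof. by move=> Fq; apply: ultra_eq; [move=> h; exact: FN|case: (Fu Fq)]. Qed.
Let FU q f g : F q -> q (f + g) <= Num.max (q f) (q g). Proof. by case/Fu => _; apply. Qed.

(** An integral equation of [h], factored at its lowest nonzero coefficient [b]. *)
Lemma integral_factor h : exists b g m, [/\ supp_in T b, b != 0 & a (h ^+ m * (b + h * g))].
Proof.
have [f [fm fT af]] := finite_over_integral h aid T0 TD SN fin.
have ex : exists i, f`_i != 0.
  by exists (size f).-1; rewrite -lead_coefE (eqP fm) oner_neq0.
pose m := ex_minn ex; exists f`_m, (drop_poly m.+1 f).[h], m; split; first exact: fT.
  by rewrite /m; case: ex_minnP.
have fE : f = ((f`_m)%:P + 'X * drop_poly m.+1 f) * 'X^m.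
  apply/polyP => i; rewrite coefMXn; case: ltnP => im.
    by rewrite /m in im *; case: ex_minnP im => k _ km ik; apply/eqP/negPn/negP => /km; rewrite leqNgt ik.
  rewrite poly.coefD coefC coefXM coef_drop_poly subn_eq0.
  have [->|mi] := eqVneq i m; first by rewrite leqnn addr0.
  have lt : (m < i)%N by rewrite ltn_neqAle eq_sym mi.
  rewrite leqNgt lt /= add0r; congr (_`_ _); lia.
by move: af; rewrite {1}fE hornerM hornerXn hornerD hornerC hornerM hornerX mulrC.
Qed.

(** Up to the factor [b] of K<T>, the same [g] inverts [h] at all points of the fibre where [h] does
    not vanish. The value of [b] is the same at all of them, which makes the values of [h] and [g]
    comparable between points. *)
Lemma fiber_inverse h : exists b g, [/\ supp_in T b, b != 0 &
  forall q, F q -> q h != 0 -> q (b + h * g) = 0 /\ q h * q g = nrm b].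
Proof.
have [b [g [m [bT b0 ab]]]] := integral_factor h; exists b, g; split => // q Fq qh.
have z : q (b + h * g) = 0.
  by have := Fa Fq ab; rewrite FM // FX // => /eqP; rewrite mulf_eq0 expf_eq0 (negPf qh) andbF /= => /eqP.
split => //; rewrite -FM //.
rewrite -(proj2 Fq b bT); apply/eqP; rewrite eq_le; apply/andP; split.
  rewrite (_ : h * g = (b + h * g) + - b); last by rewrite addrAC subrr add0r.
  by apply: le_trans (FU _ _ Fq) _; rewrite z FN // ge_max lexx F0.
rewrite {1}(_ : b = (b + h * g) + - (h * g)); last by rewrite addrK.
by apply: le_trans (FU _ _ Fq) _; rewrite z FN // ge_max lexx F0.
Qed.

(** The inequality holds for [h] and for its inverse [g] up to [b], while both products of values
    equal [nrm b]. *)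
Lemma fiber_antichain p q : F p -> F q -> (forall h, p h <= q h) -> p = q.
Proof.
move=> Fp Fq pq; apply/funext => h; have [b [g [bT b0 hb]]] := fiber_inverse h.
have nb := nrm_gt0 b0.
have [ph|ph] := eqVneq (p h) 0.
  have [->//|qh] := eqVneq (q h) 0.
  have [z _] := hb q Fq qh; have := pq (b + h * g); rewrite z.
  have := FD (f := b) (g := h * g) Fp.
  by rewrite FM // ph mul0r (proj2 Fp b bT) => /(_ nb) ->; rewrite leNgt nb.
have p0 : 0 < p h by rewrite lt_def ph F0.
have q0 : 0 < q h by exact: lt_le_trans (pq h).
have [_ hp] := hb p Fp ph; have [_ hq] := hb q Fq (lt0r_neq0 q0).
apply/eqP; rewrite eq_le pq /=; have := pq g.
have -> : p g = nrm b / p h by rewrite -hp mulrC mulKf.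
have -> : q g = nrm b / q h by rewrite -hq mulrC mulKf // lt0r_neq0.
by rewrite ler_pM2l // lef_pV2.
Qed.

Lemma fiber_separated p q : F p -> F q -> p <> q -> exists h, q h < p h.
Proof.
move=> Fp Fq pq; apply: contrapT => no; apply: pq; apply: fiber_antichain => // h.
by rewrite leNgt; apply/negP => lt; apply: no; exists h.
Qed.

(** In the integral equation of [h] two terms of maximal size must tie, which expresses a power of
    the value of [h] by values of K<T>. *)
Lemma value_torsion p h : F p -> p h != 0 -> exists r s c,
  [/\ (0 < r)%N, supp_in T s /\ supp_in T c, nrm s != 0, nrm c != 0 & p h ^+ r * nrm s = nrm c].
Proof.
move=> Fp ph; have [f [fm fT af]] := finite_over_integral h aid T0 TD SN fin.
have p0 : 0 < p h by rewrite lt_def ph F0.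
pose t i := p (f`_i * h ^+ i).
have tE i : t i = nrm f`_i * p h ^+ i by rewrite /t FM // FX // (proj2 Fp).
have sf : (0 < size f)%N by rewrite size_poly_gt0 monic_neq0.
have sl : ((size f).-1 < size f)%N by rewrite prednK.
pose l := Ordinal sl.
have [i _ im] := @arg_maxP _ _ _ l xpredT (fun i => t i) isT.
have ti : 0 < t i.
  apply: lt_le_trans (im l isT); rewrite tE -lead_coefE (eqP fm) nrm1 mul1r exprn_gt0 //.
have [[j ji tij]|none] := pselect (exists2 j : 'I_(size f), j != i & t j = t i); last first.
  have := Fa Fp af; rewrite horner_coef (bigD1 i) //= ultra_eq => [h0|||].
  - by move: ti; rewrite /t h0 ltxx.
  - by move=> x; exact: FN.
  - by case: (Fu Fp).
  apply: ultra_sum_lt => [||j ji]; [exact: Fu|exact: ti|].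
  rewrite lt_neqAle; apply/andP; split; last exact: im j isT.
  by apply/eqP => h0; apply: none; exists j.
wlog ij : i j {im} ti ji tij / (i < j)%N.
  move=> wl; have [ij|ij|/val_inj e] := ltngtP i j; first exact: wl ti ji tij ij.
    by apply: (wl j i) => //; rewrite ?tij // eq_sym.
  by rewrite e eqxx in ji.
exists (j - i)%N, f`_j, f`_i.
have ni : nrm f`_i != 0 by apply: contraTneq ti => z; rewrite tE z mul0r ltxx.
have nj : nrm f`_j != 0 by apply: contraTneq ti => z; rewrite -tij tE z mul0r ltxx.
split; rewrite ?subn_gt0 //.
have ne : p h ^+ i != 0 by rewrite expf_neq0.
apply: (mulIf ne); rewrite mulrAC -exprD subnK 1?ltnW // mulrC.
by rewrite -!tE.
Qed.

(** Weak approximation, by induction on the list. If [h] separates [p] from the new point [q], and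
    [f] separates it from the others without favouring [q], then [f ^+ N * h] works for large [N].
    If the [f0] at hand is larger at [q], a power of it is normalized to have at [p] the value of an
    element [c] of K<T>, and is then corrected by inverting [c + f]. *)
Lemma finite_separation p (s : seq (KU -> R)) : F p -> (forall q, q \in s -> F q /\ q <> p) ->
  exists2 h, 0 < p h & forall q, q \in s -> q h < p h.
Proof.
move=> Fp; elim: s => [|q s IH] hs; first by exists 1 => //; case: (Fu Fp) => -[_ _ ->]; rewrite ltr01.
have [f0 pf0 f0s] := IH (fun q' q's => hs q' (mem_behead (s := q :: s) q's)).
have [Fq qp] := hs q (mem_head _ _).
have Fs q' : q' \in s -> F q' by move=> q's; have [] := hs q' (mem_behead (s := q :: s) q's).
have [h qh] := fiber_separated Fp Fq (fun e => qp (esym e)).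
have ph : 0 < p h by apply: le_lt_trans qh; exact: F0.
suff key f : (forall q', q' \in s -> q' f < p f) -> q f <= p f -> 0 < p f ->
    exists2 h, 0 < p h & forall q', q' \in q :: s -> q' h < p h.
  have [le|lt] := leP (q f0) (p f0); first exact: (key f0).
  have [r [t [c [r0 [tT cT] nt nc e]]]] := value_torsion Fp (lt0r_neq0 pf0).
  pose f := f0 ^+ r * t.
  have fE q' : F q' -> q' f = q' f0 ^+ r * nrm t by move=> Fq'; rewrite (FM _ _ Fq') (FX _ _ Fq') (proj2 Fq' t tT).
  have pf : p f = nrm c by rewrite fE.
  have t0 : 0 < nrm t by rewrite lt_def nt nrm_ge0.
  have c0 : 0 < nrm c by rewrite lt_def nc nrm_ge0.
  have qf q' : q' \in s -> q' f < nrm c.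
    move=> q's; rewrite -pf !fE //; last exact: Fs.
    by rewrite ltr_pM2r // ltrXn2r -?lt0n ?f0s // F0 //; exact: Fs.
  have qf' : nrm c < q f.
    by rewrite -pf !fE // ltr_pM2r // ltrXn2r -?lt0n // F0.
  (* Dividing f^k by d, which has the value of c^k on s and of f^k at q, brings q to the value 1. *)
  have [k [d [k0 pd qd sd]]] : exists k d, [/\ (0 < k)%N, p d != 0 /\ p d <= nrm c ^+ k, q d = q f ^+ k &
     forall q', q' \in s -> q' d = nrm c ^+ k].
    have Fc q' : F q' -> q' c = nrm c by move=> Fq'; rewrite (proj2 Fq').
    (* Should [c + f] vanish at [p], the denominator [c ^+ 2 + f * (c + f)] with [k = 2] has the
       required values. *)
    have [z|nz] := eqVneq (p (c + f)) 0; last first.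
      exists 1%N, (c + f); rewrite !expr1; split => //.
      - by split => //; apply: le_trans (FU _ _ Fp) _; rewrite pf Fc // maxxx.
      - by rewrite addrC FD ?Fc.
      by move=> q' q's; rewrite FD ?Fc ?qf //; exact: Fs.
    exists 2%N, (c ^+ 2 + f * (c + f)); split => //.
    - have -> : p (c ^+ 2 + f * (c + f)) = nrm c ^+ 2.
        have lt2 : p (f * (c + f)) < p (c ^+ 2) by rewrite (FM _ _ Fp) z mulr0 (FX _ _ Fp) (Fc _ Fp) exprn_gt0.
        by rewrite (FD Fp lt2) (FX _ _ Fp) (Fc _ Fp).
      by rewrite expf_neq0.
    - have e1 : q (c + f) = q f by rewrite addrC FD ?Fc.
      rewrite addrC FD // FM // e1 ?FX ?Fc -?expr2 //.
      by rewrite ltrXn2r ?nrm_ge0 // ltW.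
    move=> q' q's; have Fq' := Fs _ q's; have q'f := qf q' q's.
    have lt2 : q' (f * (c + f)) < q' (c ^+ 2).
      rewrite (FM _ _ Fq') (FX _ _ Fq') expr2 (Fc _ Fq') FD ?Fc // ltr_pM2r //.
    by rewrite (FD Fq' lt2) (FX _ _ Fq') (Fc _ Fq').
  have [b [g [bT b0 hb]]] := fiber_inverse d; have nb := nrm_gt0 b0.
  apply: (key (f ^+ k * g)).
  - move=> q' q's; have Fq' := Fs _ q's.
    have qd0 : q' d != 0 by rewrite sd // expf_neq0.
    have [_ hq'] := hb q' Fq' qd0; have [_ hp] := hb p Fp (proj1 pd).
    rewrite !FM // !FX // pf.
    have -> : q' g = nrm b / nrm c ^+ k by rewrite -hq' sd // mulrC mulKf // expf_neq0.
    apply: (@lt_le_trans _ _ (nrm b)).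
      rewrite mulrCA gtr_pMr // ltr_pdivrMr ?exprn_gt0 // mul1r.
      by rewrite ltrXn2r -?lt0n ?qf ?F0.
    rewrite -hp; apply: ler_wpM2r; [exact: F0|exact: (proj2 pd)].
  - have [|_ hq] := hb q Fq; first by rewrite qd expf_neq0 // lt0r_neq0 // (lt_trans c0).
    have [_ hp] := hb p Fp (proj1 pd).
    rewrite !FM // !FX // -qd hq -hp pf; apply: ler_wpM2r; [exact: F0|exact: (proj2 pd)].
  have [_ hp] := hb p Fp (proj1 pd).
  rewrite lt_def F0 // andbT FM // FX // pf mulf_neq0 ?expf_neq0 //.
  by apply: contra_neq (lt0r_neq0 nb) => z; rewrite -hp z mulr0.
move=> fs qf pf.
have [N hN] : exists N, forall q', q' \in s -> (q' f / p f) ^+ N * q' h < p h.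
  elim: (s) (fun q' q's => conj (Fs q' q's) (fs q' q's)) => [|q1 s' IH'] hs'; first by exists 0%N.
  have [N hN] := IH' (fun q' q's => hs' q' (mem_behead (s := q1 :: s') q's)).
  have [Fq1 lt1] := hs' q1 (mem_head _ _).
  have [N1 hN1] : exists N1, (q1 f / p f) ^+ N1 * (q1 h + 1) < p h.
    have q1h : 0 < q1 h + 1 by rewrite ltr_wpDl // F0.
    have [|||N1 hN1] := @geometric_lt R (q1 f / p f) (p h / (q1 h + 1)).
    - by rewrite divr_ge0 // ?F0 // ltW.
    - by rewrite ltr_pdivrMr // mul1r.
    by rewrite divr_gt0.
    by exists N1; rewrite -ltr_pdivlMr.
  exists (N + N1)%N.
  have mono q' m m' : F q' -> q' f < p f -> (m <= m')%N -> (q' f / p f) ^+ m' * q' h <= (q' f / p f) ^+ m * q' h.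
    move=> Fq' lt' mm'; apply: ler_wpM2r; first exact: F0.
    rewrite -(subnK mm') exprD ler_piMl ?exprn_ge0 ?divr_ge0 ?F0 // ?(ltW pf) //.
    by rewrite exprn_ile1 ?divr_ge0 ?F0 // ?(ltW pf) // ler_pdivrMr // mul1r ltW.
  move=> q'; rewrite inE => /predU1P[->|q's'].
    apply: le_lt_trans (mono q1 _ _ Fq1 lt1 (leq_addl N N1)) _; apply: le_lt_trans hN1.
    by apply: ler_wpM2l; rewrite ?lerDl // exprn_ge0 // divr_ge0 ?F0 // ltW.
  have [Fq' lt'] := hs' q' (mem_behead (s := q1 :: s') q's').
  exact: le_lt_trans (mono q' _ _ Fq' lt' (leq_addr N1 N)) (hN q' q's').
have fin' q' : F q' -> (q' f / p f) ^+ N * q' h < p h -> q' (f ^+ N * h) < p (f ^+ N * h).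
  move=> Fq'; rewrite !FM // !FX // exprMn exprVn mulrAC.
  by rewrite ltr_pdivrMr ?exprn_gt0 // [p h * _]mulrC.
exists (f ^+ N * h); first by rewrite FM // FX // mulr_gt0 ?exprn_gt0.
move=> q'; rewrite inE => /predU1P[->|q's]; last first.
  by apply: fin'; [exact: Fs|exact: hN].
apply: fin' => //; apply: le_lt_trans qh; apply: ler_piMl; first exact: F0.
by rewrite exprn_ile1 ?divr_ge0 ?F0 // ?(ltW pf) // ler_pdivrMr // mul1r.
Qed.

(* Too many points give a K<T>-linear relation between functions separating them, and some
   point sees only one of its terms. *)
Lemma fiber_bounded : exists D : nat, forall s : seq (KU -> R), uniq s -> (forall q, q \in s -> F q) -> (size s <= D)%N.
Proof.
have [I [J [m [hh [C [C0 mS hP ex]]]]]] := fin.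
exists #|I| => s us Fs; rewrite leqNgt; apply/negP => lt.
pose D := #|I|; pose q (i : 'I_D.+1) := nth (fun=> 0) s i.
have is_ (i : 'I_D.+1) : (i < size s)%N by apply: leq_trans lt.
have Fq i : F (q i) by apply: Fs; apply: mem_nth.
have qinj i j : i != j -> q i <> q j.
  by move=> ij /eqP; rewrite /q nth_uniq // => /eqP/val_inj/eqP; apply/negP.
have /choice[y hy] : forall i, exists y, 0 < q i y /\ forall j, j != i -> q j y < q i y.
  move=> i.
  have [|h h0 hh'] := @finite_separation (q i) [seq q j | j <- enum 'I_D.+1 & j != i] (Fq i).
    move=> q' /mapP[j]; rewrite mem_filter => /andP[ji _] ->; split; first exact: Fq.
    exact: qinj.
  by exists h; split => // j ji; apply: hh'; apply/mapP; exists j => //; rewrite mem_filter ji mem_enum.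
have /choice[B hB] : forall i, exists b : I -> KU, (forall x, supp_in T (b x)) /\ a (y i - \sum_x b x * mono v S w 1 (m x)).
  move=> i; have [b [c [e bT _ _]]] := ex (y i); exists b; split => //.
  rewrite e addrAC subrr add0r; apply: ideal_sum => // j _; exact: idealM.
have [l lT [[i1 li1] lM]] := @kernel_vector D (fun i j => B i (enum_val j)) (fun i j => (proj1 (hB i)) _).
have az : a (\sum_i l i * y i).
  have -> : \sum_i l i * y i = \sum_i l i * (y i - \sum_x B i x * mono v S w 1 (m x)).
    under [RHS]eq_bigr => i _ do rewrite mulrBr.
    rewrite sumrB [X in _ - X](_ : _ = 0) ?subr0 //.
    under eq_bigr => i _ do rewrite mulr_sumr.
    rewrite exchange_big big1 //= => x _.
    under eq_bigr => i _ do rewrite mulrA.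
    by rewrite -mulr_suml -[x]enum_rankK lM mul0r.
  apply: ideal_sum => // i _; apply: idealM => //; exact: (proj2 (hB i)).
pose t i := q i (l i * y i).
have [j _ jm] := @arg_maxP _ _ _ i1 xpredT t isT.
have lt0 i i' : i' != i -> l i != 0 -> q i' (l i * y i) < t i.
  move=> ii' li; rewrite /t (FM _ _ (Fq i)) (FM _ _ (Fq i')) (proj2 (Fq i) _ (lT i)) (proj2 (Fq i') _ (lT i)).
  by rewrite ltr_pM2l ?nrm_gt0 //; exact: (proj2 (hy i)).
have t1 : 0 < t i1.
  by rewrite /t FM // (proj2 (Fq _)) // mulr_gt0 ?nrm_gt0 //; case: (hy i1).
have tj : 0 < t j by exact: lt_le_trans (jm i1 isT).
have := Fa (Fq j) az; rewrite (bigD1 j) //= FD // => [z|]; first by move: tj; rewrite /t z ltxx.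
apply: ultra_sum_lt => [||i ij]; [exact: Fu|exact: tj|].
have [l0|l0] := eqVneq (l i) 0; last first.
  by apply: lt_le_trans (jm i isT); apply: lt0; rewrite // eq_sym.
by rewrite l0 mul0r; have [[_ -> _ _ _] _] := Fu (Fq j).
Qed.


Lemma eval_continuous (f : KU) : continuous (fun q : {ptws KU -> R} => q f).
Proof. exact: (@proj_continuous KU (fun=> R) f). Qed.

Lemma spectrum_compact (b : set KU) : compact (spectrum b : set {ptws KU -> R}).
Proof.
have ev := eval_continuous.
have -> : spectrum b = [set q : {ptws KU -> R} | forall f, 0 <= q f <= nrm f] `&`
    (\bigcap_(x in [set: KU * KU]) [set q : {ptws KU -> R} | q (x.1 * x.2) = q x.1 * q x.2] `&`
    (\bigcap_(x in [set: KU * KU]) [set q : {ptws KU -> R} | q (x.1 + x.2) <= q x.1 + q x.2] `&`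
    ([set q : {ptws KU -> R} | q 1 = 1] `&` \bigcap_(f in b) [set q : {ptws KU -> R} | q f = 0]))).
  apply/seteqP; split => q /=.
    move=> /[dup] /spectrum_ums[[[q0 qz q1 qM qD] qu] qn qb] sq; split => [f|]; first by rewrite q0 qn.
    by split => [[x y] _|]; [exact: qM|split => [[x y] _|]; [exact: qD|split]].
  move=> [qn [qM [qD [q1 qb]]]]; split; [|split; [exists 1 => f; rewrite mul1r; by case/andP: (qn f)|exact: qb]].
  split.
  - by move=> f; case/andP: (qn f).
  - by apply/eqP; rewrite eq_le; move: (qn 0); rewrite nrm0 andbC.
  - exact: q1.
  - by move=> x y; exact: (qM (x, y) I).
  - by move=> x y; exact: (qD (x, y) I).
apply: compact_closedI.
  have <- : [set q : {ptws KU -> R} | forall f, `[0, nrm f]%classic (q f)] = [set q : {ptws KU -> R} | forall f, 0 <= q f <= nrm f].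
    by apply/seteqP; split => q h f; have := h f; rewrite /= in_itv.
  by apply: (@tychonoff KU (fun=> R) (fun f => `[0, nrm f]%classic)) => f; exact: segment_compact.
apply: closedI.
  apply: closed_bigI => x _; apply: closed_eqP; first exact: ev.
  by apply: continuous_mul; exact: ev.
apply: closedI.
  apply: closed_bigI => x _; apply: closed_leP; first exact: ev.
  by apply: continuous_add; exact: ev.
apply: closedI; first by apply: closed_eqP; [exact: ev|exact: cst_continuous].
by apply: closed_bigI => f _; apply: closed_eqP; [exact: ev|exact: cst_continuous].
Qed.

(** [h] separates [p] from the rest of the finite fibre. If no [h * g] with [g] in K<T> peaked at
    [p], the closed sets [V g] would meet [B]; they are directed, since [V (g * g')] is contained in
    both, so by compactness some [q] of [B] lies in all of them. This [q] lies in the fibre and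
    satisfies [p h <= q h], hence equals [p]. *)
Lemma fiber_peak p (B : set (KU -> R)) (C : set {ptws KU -> R}) : F p -> closed C ->
  B = spectrum a `&` C -> ~ B p -> exists f, forall q, B q -> q f < p f.
Proof.
move=> Fp cC BE nBp.
have Bc : compact (B : set {ptws KU -> R}).
  by rewrite BE; apply: compact_closedI => //; exact: spectrum_compact.
have [h ph sep] : exists2 h, 0 < p h & forall q, F q -> q <> p -> q h < p h.
  have [D hD] := fiber_bounded.
  pose Q m := `[< exists s : seq (KU -> R), [/\ uniq s, size s = m & forall q, q \in s -> F q] >].
  have Q0 : exists m, Q m by exists 0%N; apply/asboolP; exists [::].
  have QD m : Q m -> (m <= D)%N by move=> /asboolP[s [us <- Fs]]; exact: hD.
  have [m /asboolP[s [us sm Fs]] mm] := ex_maxnP Q0 QD.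
  have all_ q : F q -> q \in s.
    move=> Fq; apply/negPn/negP => qs; have := mm m.+1; rewrite ltnn => h; apply/notF/h/asboolP.
    exists (q :: s); split => [/=||q']; [by rewrite qs|by rewrite /= sm|].
    by rewrite inE => /predU1P[->//|]; exact: Fs.
  have [|h ph hs] := @finite_separation p [seq q <- s | q != p] Fp.
    by move=> q; rewrite mem_filter => /andP[/eqP qp /Fs].
  by exists h => // q Fq qp; apply: hs; rewrite mem_filter all_ // andbT; exact/eqP.
have p1 g : supp_in T g -> p g = nrm g by case: Fp => _; apply.
apply: contrapT => none.
pose V g := [set q : {ptws KU -> R} | p h * nrm g <= q (h * g)].
pose D := [set g : KU | supp_in T g /\ g != 0].
have Vne g : D g -> exists2 q, B q & V g q.
  move=> [gT g0]; apply: contrapT => no; apply: none; exists (h * g) => q Bq.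
  by rewrite (FM _ _ Fp) (p1 _ gT) ltNge; apply/negP => le; apply: no; exists q.
have Vdir g g' q : D g -> D g' -> B q -> V (g * g') q -> V g q /\ V g' q.
  move=> [_ g0] [_ g'0]; rewrite BE => -[/spectrum_ums[[[q0 _ _ qM _] _] qn _] _].
  have n0 := nrm_gt0 g0; have n'0 := nrm_gt0 g'0; rewrite /V /= nrmM => le.
  split; [rewrite -(ler_pM2r n'0)|rewrite -(ler_pM2r n0)].
    rewrite -mulrA; apply: le_trans le _; rewrite mulrA qM.
    by apply: ler_wpM2l.
  rewrite -mulrA [nrm g' * _]mulrC; apply: le_trans le _; rewrite [g * g']mulrC mulrA qM.
  by apply: ler_wpM2l.
have D1 : D 1.
  by split; [rewrite -(mono1 v S w); exact: supp_in_mono|exact: oner_neq0].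
have DM g g' : D g -> D g' -> D (g * g').
  move=> [gT g0] [g'T g'0]; split; first exact: supp_inM.
  by apply/eqP => /restr_integral[] /eqP; apply/negP.
pose G := filter_from D (fun g => B `&` V g).
have GF : ProperFilter G.
  apply: filter_from_proper; last by move=> g /Vne[q Bq Vq]; exists q.
  apply: filter_from_filter; first by exists 1.
  move=> g g' Dg Dg'; exists (g * g'); first exact: DM.
  by move=> q [Bq /(Vdir _ _ _ Dg Dg' Bq)[Vq Vq']].
have GB : G B by exists 1 => // q [].
have [q [Bq]] := Bc G GF GB; rewrite clusterE => cl.
have qV g : D g -> V g q.
  move=> Dg; have cV : closed (V g).
    by apply: closed_leP; [exact: cst_continuous|exact: eval_continuous].
  rewrite (closure_id (V g)).1 //; apply: cl; exists g => // x [_ //].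
have sq : spectrum a q by move: Bq; rewrite BE => -[].
have [[[q0 _ q1 qM _] qu] qn _] := spectrum_ums sq.
have le : p h <= q h by have := qV 1 D1; rewrite /V /= nrm1 !mulr1.
have Fq : F q.
  split => // g gT; have [->|g0] := eqVneq g 0; first by rewrite nrm0; case: (spectrum_ums sq) => -[[_ -> _ _ _] _].
  apply/eqP; rewrite eq_le qn /= leNgt; apply/negP => lt.
  have ng := nrm_gt0 g0.
  have h0 : 0 < nrm h by apply: lt_le_trans (qn h); exact: lt_le_trans ph le.
  (* A loss of norm of [g] at [q] grows exponentially with the powers of [g], while [h] contributes
     only a constant factor. *)
  have [|||N hN] := @geometric_lt R (q g / nrm g) (p h / nrm h).
  - by rewrite divr_ge0 ?q0 // ltW.
  - by rewrite ltr_pdivrMr // mul1r.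
  - by rewrite divr_gt0.
  have DX : D (g ^+ N) by elim: (N) => [|N' IH]; [rewrite expr0|rewrite exprS; apply: DM].
  have nX : nrm (g ^+ N) = nrm g ^+ N by apply: mult_seminormX; case: (nrm_ums v S w).
  have := qV _ DX; rewrite /V /= qM nX (mult_seminormX (p := q)); last by case: (spectrum_ums sq) => -[].
  apply/negP; rewrite -ltNge.
  move: hN; rewrite expr_div_n ltr_pdivrMr ?exprn_gt0 // => hN.
  apply: (@le_lt_trans _ _ (nrm h * q g ^+ N)).
    by apply: ler_wpM2r; rewrite ?exprn_ge0.
  by rewrite mulrC -ltr_pdivlMr // mulrAC.
have [qp|qp] := pselect (q = p); first by rewrite qp in Bq.
by move: (sep q Fq qp); rewrite ltNge le.
Qed.

Lemma fiber_shilov p : F p -> shilov_boundary a p.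
Proof.
move=> Fp B [Bs [C cC BE] Bmax]; apply: contrapT => nBp.
have [f hf] := fiber_peak Fp cC BE nBp.
have [q Bq qm] := Bmax f; have := qm p (proj1 Fp).
by rewrite leNgt hf.
Qed.

End Shilov.

(** * Relevant polyhedra *)

Section Reduction.
Context {R : realType} {K : fieldType} (v : valuation R K) {n : nat}.
Local Notation A := 'rV[int]_n.
Context (S : addrClosed A) (w : {additive A -> R}).
Local Notation KU := (restr v S w).
Local Notation nrm := (@gauss_norm R K v A S w).
Local Notation mon := (mono v S w).
Local Notation ball := (unit_ball v S w).
Hypothesis SN : forall u, u \in S -> - u \in S.
Hypothesis wG : forall u, u \in S -> value_group v (w u).
Hypothesis vn : nontrivially_valued v.
Implicit Types b : ball.
Variables (a : set KU) (Z : set ball).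
Hypotheses (aid : is_ideal a) (Zp : is_prime Z) (Za : init_ideal a `<=` Z).

Lemma unit_ballE (f : KU) : (f \in @unit_ball_pred R K v A S w) = (nrm f <= 1).
Proof.
have e1 : 1 = expR (- 0) :> R by rewrite oppr0 expR0.
apply/asboolP/idP => h; first by apply: nrm_le => u; rewrite e1 tm_le_expR.
by move=> u; rewrite -tm_le_expR -e1; apply: le_trans (le_nrm f u) h.
Qed.

Lemma unit_ball_exists (f : KU) : nrm f <= 1 -> exists b, val b = f.
Proof. by rewrite -unit_ballE => h; exists (UnitBall h). Qed.

Lemma nrm_ball b : nrm (val b) <= 1.
Proof. by rewrite -unit_ballE; exact: ball_valP. Qed.

Lemma pseudouniformizer : exists c, [/\ c != 0, 0 < absv v c < 1 & (0%:E < v c)%E].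
Proof.
have [x x0 vx] := vn.
have [c c0 vc] : exists2 c, c != 0 & (0%:E < v c)%E.
  have [r vr] := val_fin v x0.
  move: vx; rewrite vr eqe => r0; have [r1|r1] : (r < 0) \/ (0 < r) by move: r0; rewrite neq_lt => /orP.
    exists x^-1; first by rewrite invr_eq0.
    have [s vs] := val_fin v (invr_neq0 x0).
    have := Defs.valM v x x^-1; rewrite mulfV // Defs.val1 vr vs -EFinD => -[/eqP].
    by rewrite lte_fin eq_sym addr_eq0 => /eqP e; rewrite -oppr_lt0 -e.
  by exists x => //; rewrite vr lte_fin.
exists c; split => //; rewrite /absv; have [s vs] := val_fin v c0; move: vc; rewrite vs /= lte_fin => s0.
by rewrite expR_gt0 /= expR_lt1 oppr_lt0.
Qed.

(** A power of [b] is divisible in the unit ball by a constant of positive valuation, which lies in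
    the ideal of the initial degeneration; nontriviality of the valuation provides the constant. *)
Lemma prime_small b : nrm (val b) < 1 -> Z b.
Proof.
move=> lt; have [c [c0 /andP[ac0 ac1] vc]] := pseudouniformizer.
have [|||N hN] := @geometric_lt R (nrm (val b)) (absv v c) => //; first exact: nrm_ge0.
have nX : nrm (val b ^+ N) = nrm (val b) ^+ N by apply: mult_seminormX; case: (nrm_ums v S w).
have nc : nrm (mon c 0) = absv v c by rewrite nrm_mono ?rpred0 // raddf0 oppr0 expR0 mulr1.
have [bc bcE] : exists bc : ball, val bc = mon c 0 by apply: unit_ball_exists; rewrite nc ltW.
have [d dE] : exists d : ball, val d = mon c^-1 0 * val b ^+ N.
  apply: unit_ball_exists; rewrite nrmM nrm_mono ?rpred0 // raddf0 oppr0 expR0 mulr1 nX.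
  by rewrite absvV mulrC ler_pdivrMr // mul1r ltW.
have ZbN : Z (b ^+ N).
  have -> : b ^+ N = d * bc.
    apply: val_inj; rewrite rmorphM rmorphXn /= [ball_val d]dE [ball_val bc]bcE mulrC mulrA.
    by rewrite monoM ?rpred0 // mulfV // addr0 mono1 mul1r.
  apply: (idealM (prime_ideal Zp)); apply: Za => J Jid; apply; right; exists c => //.
elim: N ZbN {hN nX d dE} => [|N IH]; first by rewrite expr0 => /(prime_proper Zp).
by rewrite exprS => /(primeM Zp)[].
Qed.

(** Were a nonzero constant congruent modulo [a] to a series of smaller norm, 1 would lie in the
    prime [Z]. So the constants are free modulo [a], and [free_spectrum] applies to the trivial
    subgroup. *)
Lemma spectrum_nonempty : exists q, spectrum a q.
Proof.
have [||q sq _] := @free_spectrum R K v n S w [set 0] a aid erefl.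
- by move=> x y -> ->; rewrite addr0.
- move=> g f gT agf; rewrite leNgt; apply/negP => lt.
  pose c := g 0; have gE : g = mon c 0.
    apply: restr_eq => u; rewrite coef_mono ?rpred0 //; case: eqP => [->//|u0].
    by apply: contrapT => /eqP /gT.
  have n0 : 0 < nrm g by apply: le_lt_trans lt; exact: nrm_ge0.
  have c0 : c != 0 by apply: contraTneq n0 => z; rewrite gE z mono0 nrm0 ltxx.
  have ng : nrm g = absv v c by rewrite gE nrm_mono ?rpred0 // raddf0 oppr0 expR0 mulr1.
  pose f' := mon c^-1 0 * f.
  have nf' : nrm f' < 1.
    rewrite nrmM nrm_mono ?rpred0 // raddf0 oppr0 expR0 mulr1 absvV mulrC ltr_pdivrMr -?ng //.
    by rewrite mul1r.
  have [b bE] := unit_ball_exists (ltW nf').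
  have Zb : Z b by apply: prime_small; rewrite bE.
  apply: (prime_proper Zp); rewrite -(subrK b 1); apply: (idealD (prime_ideal Zp)) => //.
  apply: Za => J Jid; apply; left => /=.
  rewrite [ball_val b]bE.
  have -> : 1 - f' = mon c^-1 0 * (g - f).
    by rewrite gE mulrBr monoM ?rpred0 // mulVf // addr0 mono1.
  exact: idealM.
by exists q.
Qed.

(** The spectrum is itself a closed boundary, because it is compact and not empty. *)
Lemma shilov_spectrum p : shilov_boundary a p -> spectrum a p.
Proof.
apply; split => //; first by exists setT; [exact: closedT|rewrite setIT].
move=> f; have [q sq] := spectrum_nonempty.
have [||p' p's hp'] := @derive.compact_EVT_max {ptws KU -> R} R (fun q => q f) (spectrum a) _ (spectrum_compact (b := a)).
- by exists q.
- by apply: continuous_subspaceT => x; exact: eval_continuous.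
by exists p'; [exact: set_mem|move=> q' sq'; apply: hp'; exact: mem_set].
Qed.

(** Scaled to norm 1, [g] reduces into [Z], so the seminorm [q] behind [eta] vanishes on it. Modulo
    terms of norm below 1 only the dominant terms remain; they have the values [expR (- eta u)], and
    an ultrametric sum can vanish only if two terms tie. *)
Lemma trop_special_tie (eta : A -> R) (g : KU) (E : seq A) (p : KU -> R) : trop_special Z eta ->
  Z = iota_red p -> mult_seminorm p -> (forall c, p (mon c 0) = absv v c) -> p g < nrm g ->
  (forall u, (u \in E) = (tm g u == nrm g)) ->
  exists u1 u2, [/\ u1 \in E, u2 \in E, u1 != u2 & eta u1 = eta u2].
Proof.
move=> [q [qm qZ q1 qmon]] ZE pm pc lt EP.
have n0 : 0 < nrm g by apply: le_lt_trans lt; exact: seminorm_ge0.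
have tmS u : u \in E -> u \in S.
  by rewrite EP => /eqP h; apply: contrapT => /negP uS; move: n0; rewrite -h /tm coef_supp // absv0 mul0r ltxx.
have [u0 u0E] : exists u0, u0 \in E by have [u hu] := nrm_attained g; exists u; rewrite EP hu.
have gu u : u \in E -> exists2 r, v (g u) = r%:E & nrm g = expR (- (r + w u)).
  rewrite EP => /eqP h; have g0 : g u != 0 by apply: contraTneq n0 => z; rewrite -h /tm z absv0 mul0r ltxx.
  have [r vr] := val_fin v g0; exists r => //; rewrite -h /tm /absv vr /= -expRD opprD //.
have [c [c0 nc]] : exists c, c != 0 /\ absv v c * nrm g = 1.
  have [r vr ng] := gu u0 u0E; have [d d0 vd] := wG (tmS u0 u0E).
  have g0 : g u0 != 0 by rewrite -(val_eqy v) vr.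
  exists (g u0 * d)^-1; split; first by rewrite invr_eq0 mulf_neq0.
  by rewrite absvV /absv Defs.valM vr vd -EFinD /= ng mulVf // gt_eqF // expR_gt0.
have nM f : nrm (mon c 0 * f) = absv v c * nrm f.
  by rewrite nrmM nrm_mono ?rpred0 // raddf0 oppr0 expR0 mulr1.
have [b bE] : exists b : ball, val b = mon c 0 * g by apply: unit_ball_exists; rewrite nM nc.
have Zb : Z b.
  rewrite ZE /iota_red /= [ball_val b]bE (seminormM pm) pc -nc.
  by rewrite ltr_pM2l // lt_def absv_ge0 andbT; apply: contra_eqN nc => /eqP ->; rewrite mul0r eq_sym oner_neq0.
(* A natural number is either a unit of the valuation ring, where [q] is 1, or has positive
   valuation and lies in [Z], where [q] is 0. *)
have qu : ultrametric q.
  apply: ultrametric_of_nat => // m.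
  have vm : val (m%:R : ball) = mon m%:R 0.
    rewrite rmorph_nat; elim: m => [|m IH]; first by rewrite mono0.
    by rewrite mulrSr IH [in RHS]mulrSr monoD mono1.
  have [e|ne] := eqVneq (v m%:R) 0%E; first by rewrite (q1 _ _ e vm).
  rewrite qZ ?ler01 //; apply: Za => J Jid; apply; right; exists m%:R => //.
  have : (0%:E <= v m%:R)%E.
    have := nrm_ball (m%:R : ball); rewrite vm nrm_mono ?rpred0 // raddf0 oppr0 expR0 mulr1.
    by rewrite -absv_le oppr0 expR0.
  by rewrite le_eqVlt eq_sym (negPf ne).
pose E' := undup E.
have E'P u : (u \in E') = (tm g u == nrm g) by rewrite mem_undup.
have /choice[t tP] : forall u, exists t : ball, u \in E' -> val t = mon (c * g u) u.
  move=> u; have [uE|uE] := boolP (u \in E'); last by exists 0.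
  have uS : u \in S by apply: tmS; rewrite -mem_undup.
  have [|t tE] := @unit_ball_exists (mon (c * g u) u); last by exists t.
  rewrite nrm_mono // absvM -mulrA -[_ * expR _]/(tm g u).
  by move: uE; rewrite E'P => /eqP ->; rewrite nc.
have qt u : u \in E' -> q (t u) = expR (- eta u).
  move=> uE; have uE0 : u \in E by rewrite -mem_undup.
  have uS : u \in S by exact: tmS.
  apply: (qmon _ (c * g u) u uS _ (tP u uE)).
  have [r vr ng] := gu u uE0; have [s vs] := val_fin v c0.
  rewrite Defs.valM vr vs -!EFinD; congr (_%:E).
  move: nc; rewrite ng /absv vs /= -expRD -[RHS]expR0 => /expR_inj /eqP.
  by rewrite -opprD oppr_eq0 addrA => /eqP.
have rest : nrm (val b - \sum_(u <- E') val (t u)) < 1.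
  have [u <-] := nrm_attained (val b - \sum_(u <- E') val (t u)); rewrite /tm.
  have -> : (val b - \sum_(u <- E') val (t u)) u = if u \in E' then 0 else c * g u.
    have -> : \sum_(u <- E') val (t u) = mon c 0 * mpart E' g.
      rewrite /mpart mulr_sumr big_seq [RHS]big_seq; apply: eq_bigr => x xE.
      by rewrite tP // monoM ?rpred0 ?add0r // tmS // -mem_undup.
    rewrite [val b]bE coefB coefZ coefZ coef_mpart ?undup_uniq //.
    by case: ifP => _; rewrite ?subrr // mulr0 subr0.
  case: ifPn => [_|uE]; first by rewrite absv0 mul0r ltr01.
  rewrite absvM -mulrA -[_ * expR _]/(tm g u) -nc ltr_pM2l.
    by rewrite lt_neqAle le_nrm andbT -E'P.
  by rewrite lt_def absv_ge0 andbT; apply: contra_eqN nc => /eqP ->; rewrite mul0r eq_sym oner_neq0.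
have qs0 : q (\sum_(u <- E') t u) = 0.
  have Zr : Z (b - \sum_(u <- E') t u).
    by apply: prime_small; rewrite rmorphB rmorph_sum.
  apply: qZ; rewrite -[\sum_(u <- E') t u](subKr b).
  by apply: idealB => //; exact: prime_ideal.
apply: contrapT => none.
have inj u1 u2 : u1 \in E' -> u2 \in E' -> u1 != u2 -> q (t u1) != q (t u2).
  move=> h1 h2 ne; rewrite !qt //; apply/eqP => /expR_inj /oppr_inj e; apply: none.
  by exists u1, u2; split => //; rewrite -mem_undup.
have u0E' : u0 \in E' by rewrite mem_undup.
have [um umE hm] : exists2 um, um \in E' & forall u, u \in E' -> q (t u) <= q (t um).
  have [i _ im] := @arg_maxP _ _ _ (SeqSub u0E') xpredT (fun i : seq_sub E' => q (t (val i))) isT.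
  by exists (val i); [exact: valP|move=> u uE; exact: (im (SeqSub uE) isT)].
move: qs0; rewrite (bigD1_seq um) ?undup_uniq //= ultra_eq //.
- by rewrite qt // => z; have := expR_gt0 (- eta um); rewrite z ltxx.
- exact: mult_seminormN.
rewrite big_seq_cond; apply: ultra_sum_lt => // [|u /andP[uE ne]]; first by rewrite qt // expR_gt0.
by rewrite lt_neqAle inj // hm.
Qed.

End Reduction.

Section GenericPoint.
Context {R : realType} {V : lmodType R}.

Lemma polyhedron_barycenter (P : set V) r (z : 'I_r.+1 -> V) (c : 'I_r.+1 -> R) : polyhedron P ->
  (forall i, P (z i)) -> (forall i, 0 <= c i) -> \sum_i c i = 1 -> P (\sum_i c i *: z i).
Proof.
move=> [m [l [d ->]]] Pz c0 c1 i /=; rewrite linear_sum /=.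
rewrite -[d i]mul1r -c1 mulr_suml; apply: ler_sum => j _; rewrite linearZ /=.
by apply: ler_wpM2l => //; exact: Pz.
Qed.

(** A barycentre of the [z j] with weights proportional to [N ^ j]: by [separating_powers] some [N]
    violates all the affine conditions, each of which fails at some [z j]. *)
Lemma generic_point (P : set V) r (z : 'I_r.+1 -> V) (I : finType) (phi : I -> V -> R) (d : I -> R) :
  polyhedron P -> (forall i, P (z i)) ->
  (forall i m (x : 'I_m -> V) (c : 'I_m -> R), phi i (\sum_j c j *: x j) = \sum_j c j * phi i (x j)) ->
  (forall i, exists j, phi i (z j) <> d i) -> exists2 x, P x & forall i, phi i x <> d i.
Proof.
move=> Pp Pz lin ne.
have [N hN] := separating_powers (fun i j => phi i (z j) - d i).
pose s := \sum_(j < r.+1) N%:R ^+ j : R.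
have s0 : 0 < s.
  rewrite /s big_ord_recl expr0 ltr_wpDr ?ltr01 // sumr_ge0 // => j _; exact: exprn_ge0.
pose c (j : 'I_r.+1) := N%:R ^+ j / s : R.
have c0 j : 0 <= c j by rewrite divr_ge0 ?exprn_ge0 // ltW.
have c1 : \sum_j c j = 1 by rewrite -mulr_suml mulfV // gt_eqF.
exists (\sum_j c j *: z j); first exact: polyhedron_barycenter.
move=> i; rewrite lin => e; have [|] := hN i.
  by have [j hj] := ne i; exists j => /eqP; rewrite subr_eq0 => /eqP.
have : \sum_j c j * (phi i (z j) - d i) = 0.
  under eq_bigr => j _ do rewrite mulrBr.
  by rewrite sumrB e -mulr_suml c1 mul1r subrr.
have -> : \sum_j c j * (phi i (z j) - d i) = (\sum_j (phi i (z j) - d i) * N%:R ^+ j) / s.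
  by rewrite mulr_suml; apply: eq_bigr => j _; rewrite /c mulrC mulrA.
by move/eqP; rewrite mulf_eq0 invr_eq0 (gt_eqF s0) orbF => /eqP.
Qed.

End GenericPoint.

(** * Points of toric varieties and integral functionals on faces *)

Section ToricPoints.
Context {R : realType} {K : fieldType} (v : valuation R K) {n : nat} (Delta : fan R n).
Local Notation NR := 'rV[R]_n.
Local Notation M := 'rV[int]_n.
Local Notation "'ev' xi" := (@pt R K v n Delta xi) (at level 10).
Implicit Types (s : set NR) (u : M) (xi : toric_an v Delta).

Lemma an_mono xi c u : u \in perp (torus_orbit xi) -> ev xi (mono _ _ _ c u) = absv v c * ev xi (mono _ _ _ 1 u).
Proof.
move=> us; rewrite -(pt_abs xi) -(seminormM (pt_seminorm xi)) monoM ?rpred0 //.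
by rewrite mulr1 add0r.
Qed.

Lemma an_mono_gt0 xi u : u \in perp (torus_orbit xi) -> 0 < ev xi (mono _ _ _ 1 u).
Proof.
move=> us; have pm := pt_seminorm xi; rewrite lt_def (seminorm_ge0 pm) andbT; apply/eqP => z.
have := seminorm1 pm; rewrite -mono1 -(subrr u) -[1]mulr1 -monoM ?perpN // (seminormM pm) z mul0r.
by move/esym/eqP; rewrite oner_eq0.
Qed.

(** On constants the point is the ultrametric absolute value of [K], hence at most 1 on natural
    numbers, and this upgrades the triangle inequality. *)
Lemma an_ums xi : ums (ev xi).
Proof.
split; first exact: pt_seminorm; apply: ultrametric_of_nat => [|m]; first exact: pt_seminorm.
have -> : m%:R = mono _ _ _ m%:R 0 :> laurent R K (perp (torus_orbit xi)).
  by elim: m => [|m IH]; [rewrite mono0|rewrite mulrSr IH [in RHS]mulrSr monoD mono1].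
rewrite pt_abs; have := nrm_nat v (perp (torus_orbit xi)) (weight (trop_pt xi)) m.
have -> : m%:R = mono _ _ _ m%:R 0 :> restr v (perp (torus_orbit xi)) (weight (trop_pt xi)).
  by elim: m => [|m IH]; [rewrite mono0|rewrite mulrSr IH [in RHS]mulrSr monoD mono1].
by rewrite nrm_mono ?rpred0 // raddf0 oppr0 expR0 mulr1.
Qed.

(** The condition defining [trop_pt] can be satisfied: logarithms on a lattice basis are combined
    with the dual vectors. *)
Lemma trop_pt_weight xi u : u \in perp (torus_orbit xi) -> ev xi (mono _ _ _ 1 u) = expR (- weight (trop_pt xi) u).
Proof.
pose s := torus_orbit xi; have [cs _] := fan_cone (orbit_cone xi).
have [r [b [y [bs Sb yb _]]]] := perp_lattice cs.
pose x : quotient s := quotient_proj s (\sum_j (- ln (ev xi (mono _ _ _ 1 (b j)))) *: y j).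
have hx : forall u, u \in perp s -> ev xi (mono _ _ _ 1 u) = expR (- weight x u).
  apply: (laurent_weight (W := weight x) (@perpN _ _ s) bs Sb (pt_seminorm xi)) => i.
  have e : weight x (b i) = - ln (ev xi (mono _ _ _ 1 (b i))).
    rewrite weight_proj; last exact: bs.
    rewrite pairing_suml (bigD1 i) //= big1 => [|j ji]; last first.
      by rewrite pairingZl yb eq_sym (negPf ji) mulr0.
    by rewrite addr0 pairingZl yb eqxx mulr1.
  apply: etrans (congr1 (fun t => expR (- t)) (esym e)).
  by rewrite opprK lnK // posrE; apply: an_mono_gt0; exact: bs.
by rewrite (trop_ptE hx); exact: hx.
Qed.

Lemma an_le_nrm xi f : ev xi f <= gauss_norm (@lemb R K K v M (perp (torus_orbit xi)) (perp (torus_orbit xi))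
  (weight (trop_pt xi)) idfun (fun u h => h) f).
Proof.
apply: laurent_le_nrm f => [|c u us]; first exact: an_ums.
by rewrite an_mono // trop_pt_weight.
Qed.

Lemma value_group_perp (K' : fieldType) (v' : valuation R K') s (x : quotient s) u : rational_point v' x ->
  u \in perp s -> value_group v' (weight x u).
Proof.
move=> [y yv ->] us; rewrite weight_proj //.
apply: (@value_group_zspan R n (pairing y) n (fun i => delta_mx 0 i)) => [i|].
  have e : pairing y (delta_mx 0 i) = y 0 i.
    rewrite /pairing /dot (bigD1 i) //= big1 => [|j ji]; first by rewrite !mxE !eqxx mul1r addr0.
    by rewrite !mxE eqxx (negPf ji) mul0r.
  by have := yv i; rewrite -e.
exists (fun i => u 0 i); rewrite {1}(row_sum_delta u); apply: eq_bigr => i _.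
by rewrite -scaler_int intz.
Qed.

Lemma relevant_tie (X : closed_subscheme K Delta) xi (P : set (quotient (torus_orbit xi))) f :
  relevant X xi P ->
  ev xi f < gauss_norm (@lemb R K K v M (perp (torus_orbit xi)) (perp (torus_orbit xi))
    (weight (trop_pt xi)) idfun (fun u h => h) f) ->
  exists2 E : seq M, forall u, u \in E -> f u != 0 &
    forall x, P x -> exists u1 u2, [/\ u1 \in E, u2 \in E, u1 != u2 &
      weight x u1 - weight x u2 = weight (trop_pt xi) u1 - weight (trop_pt xi) u2].
Proof.
move=> [K' [v' [iota [viota vn rat [p [shp res [_ [Z minZ [ZE hP]]]]]]]]].
pose s := torus_orbit xi; pose w := weight (trop_pt xi).
pose emb' := @lemb R K K' v' M (perp s) (perp s) w iota (fun u h => h).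
have SN : forall u, u \in perp s -> - u \in perp s by move=> u; exact: perpN.
have aid : is_ideal (@affinoid_ideal R K n Delta X K' v' iota _ (trop_pt xi)) := gen_ideal_is_ideal _.
have wG u : u \in perp s -> value_group v' (w u) by move=> us; exact: value_group_perp.
have [Zp Za _] := minZ.
have sp := shilov_spectrum vn aid Zp Za shp.
have nE f' : gauss_norm (emb' f') = gauss_norm (@lemb R K K v M (perp s) (perp s) w idfun (fun u h => h) f').
  by congr (sup _); apply/seteqP; split => _ [u _ <-]; exists u; rewrite //= /absv viota.
have pE : p (emb' f) = ev xi f by apply: res.
rewrite -nE -pE => lt.
have f0 : emb' f != 0.
  by apply: contraTneq lt => ->; rewrite nrm0 -leNgt (seminorm_ge0 (proj1 sp)).
have [E EP _] := dominant_finite f0.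
have n0 := nrm_gt0 f0.
have Ef u : u \in E -> f u != 0.
  by rewrite EP => /eqP h; apply: contraTneq n0 => z; rewrite -h /tm lemb_coef z rmorph0 absv0 mul0r ltxx.
exists E => // x Px; have [y hy ->] := hP x Px.
have pc c : p (mono _ _ _ c 0) = absv v' c.
  by rewrite (spectrum_mono _ SN _ sp) ?rpred0 // raddf0 oppr0 expR0 mulr1.
have [u1 [u2 [h1 h2 ne e]]] := trop_special_tie wG vn Zp Za hy ZE (proj1 sp) pc lt EP.
have uS u : u \in E -> u \in perp s.
  by move=> /Ef fu; apply: contraNT fu => /coef_supp ->.
exists u1, u2; split => //; rewrite !weightD ?uS // e; ring.
Qed.

(** The definition of a face provides a real functional; an integral one is needed to have a
    character. The real one is a combination of a lattice basis of [t^perp], and rounding the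
    coefficients of a large multiple keeps it positive on the generators off the face. *)
Lemma face_functional s t : rational_cone s -> rational_cone t -> face t s ->
  exists u, [/\ u \in dual s, u \in perp t & forall x, s x -> pairing x u = 0 -> t x].
Proof.
move=> [k [g sE]] ct [y y0 tE].
have [r [b [_ [bt _ _ hb]]]] := perp_lattice ct.
pose B : 'M[R]_(r, n) := \matrix_(i, j) (b i 0 j)%:~R.
have dotD x1 x2 : dot y (x1 + x2) = dot y x1 + dot y x2.
  by rewrite /dot -big_split; apply: eq_bigr => i _; rewrite mxE mulrDr.
have dotZ c x : dot y (c *: x) = c * dot y x.
  by rewrite /dot mulr_sumr; apply: eq_bigr => i _; rewrite mxE mulrCA.
have yt x : x \in linear_span t -> dot y x = 0.
  move=> /asboolP hx; apply: (hx [set x | dot y x = 0]).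
  - by rewrite /= /dot big1 // => i _; rewrite mxE mulr0.
  - by move=> c x1 x2 /= h1 h2; rewrite dotD dotZ h1 h2 mulr0 addr0.
  - by move=> x1; rewrite tE => -[].
have : (y <= B)%MS.
  rewrite submxE; apply/eqP/rowP => j; rewrite mxE [RHS]mxE.
  pose x : NR := (col j (cokermx B))^T.
  have -> : \sum_j0 y 0 j0 * cokermx B j0 j = dot y x by apply: eq_bigr => i _; rewrite !mxE.
  apply: yt; apply: hb => i.
  have := mulmx_coker B => /(congr1 (fun N : 'M_(r, n) => N i j)); rewrite !mxE => e.
  by rewrite -[RHS]e /pairing /dot; apply: eq_bigr => l _; rewrite !mxE.
move=> /submxP[c yE].
have yg x : dot y x = \sum_i c 0 i * pairing x (b i).
  rewrite yE /dot; under eq_bigr do rewrite mxE mulr_suml.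
  rewrite exchange_big; apply: eq_bigr => i _ /=; rewrite /pairing /dot mulr_sumr.
  by apply: eq_bigr => l _; rewrite !mxE mulrA.
pose gr l : NR := map_mx intr (g l).
have sg l : s (gr l).
  rewrite sE; exists (fun l' => (l' == l)%:R) => [i|]; first exact: ler0n.
  by rewrite (bigD1 l) //= eqxx scale1r big1 ?addr0 // => i /negPf ->; rewrite scale0r.
pose m l := \sum_i `|pairing (gr l) (b i)|.
have [N hN] : exists N : nat, forall l, 0 < dot y (gr l) -> m l < N%:R * dot y (gr l).
  have hl l : exists N : nat, 0 < dot y (gr l) -> m l < N%:R * dot y (gr l).
    have [h|h] := pselect (0 < dot y (gr l)); last by exists 0%N.
    have [N hN] := exists_ge_nat (m l / dot y (gr l) + 1); exists N => _.
    by rewrite -ltr_pdivrMr //; apply: lt_le_trans hN; rewrite ltrDl ltr01.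
  have [F hF] := choice hl; exists (\max_l F l)%N => l h.
  by apply: lt_le_trans (hF l h) _; rewrite ler_pM2r // ler_nat leq_bigmax.
(* Rounding changes the pairing with [gr l] by at most [m l], which for generators off the face is
   less than [N%:R * dot y (gr l)]. *)
pose z i := Num.floor (N%:R * c 0 i).
pose u := \sum_i b i *~ z i.
have pu x : pairing x u = \sum_i (z i)%:~R * pairing x (b i).
  by rewrite /u raddf_sum; apply: eq_bigr => i _; rewrite raddfMz -mulrzr mulrC.
have ut : u \in perp t by apply: rpred_sum => i _; case: (z i) => k'; rewrite ?NegzE ?mulrNz ?perpN // -?pmulrn rpredMn // bt.
have upos l : 0 < dot y (gr l) -> 0 < pairing (gr l) u.
  move=> h; rewrite pu; have := hN l h.
  rewrite yg mulr_sumr -subr_gt0 => h1; apply: lt_le_trans h1 _.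
  rewrite lerBlDr -lerBlDl -sumrB; apply: le_trans (ler_norm _) _; apply: le_trans (ler_norm_sum _ _ _) _.
  apply: ler_sum => i _; rewrite mulrA -mulrBl normrM; apply: ler_piMl => //.
  have [h1 h2] : (z i)%:~R <= N%:R * c 0 i /\ N%:R * c 0 i < (z i + 1)%:~R.
    by have /andP[] := Num.Theory.floor_itv (N%:R * c 0 i).
  by rewrite ger0_norm ?subr_ge0 // ltW // ltrBlDr addrC -[1]/(1%:~R) -rmorphD.
have uzero l : dot y (gr l) = 0 -> pairing (gr l) u = 0.
  move=> h; move/asboolP: ut; apply; rewrite tE; split => //; exact: sg.
have ug l : 0 <= pairing (gr l) u.
  have := y0 _ (sg l); rewrite le_eqVlt => /orP[/eqP/esym/uzero ->//|/upos/ltW//].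
exists u; split => //.
  apply/asboolP => x; rewrite sE => -[d d0 ->]; rewrite pairing_suml sumr_ge0 // => l _.
  by rewrite pairingZl mulr_ge0 // ug.
move=> x sx; rewrite tE /=; move=> xu; split => //; move: (sx); rewrite sE => -[d d0 xE].
move: xu; rewrite xE pairing_suml => /eqP; rewrite psumr_eq0 => [/allP h|l _]; last first.
  by rewrite pairingZl mulr_ge0 // ug.
have yD (F : 'I_k -> NR) : dot y (\sum_l F l) = \sum_l dot y (F l).
  by rewrite /dot exchange_big; apply: eq_bigr => i _; rewrite summxE mulr_sumr.
rewrite yD big1 // => l _; have := h l (mem_index_enum l); rewrite /= pairingZl mulf_eq0.
rewrite dotZ.
move=> /orP[/eqP -> |/eqP h0]; first by rewrite mul0r.
have := y0 _ (sg l); rewrite le_eqVlt => /orP[/eqP <-|/upos]; first by rewrite mulr0.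
by rewrite h0 ltxx.
Qed.

End ToricPoints.

(** * Convergence in the toric variety *)

Section Specialization.
Context {R : realType} {K : fieldType} (v : valuation R K) {n : nat} (Delta : fan R n).
Local Notation NR := 'rV[R]_n.
Local Notation M := 'rV[int]_n.
Local Notation "'ev' xi" := (@pt R K v n Delta xi) (at level 10).
Implicit Types (s t : set NR) (u : M) (xi : toric_an v Delta).

Lemma fan_face_sub s t : cones Delta s -> cones Delta t -> (face t s <-> t `<=` s).
Proof.
move=> Ds Dt; split=> [[y _ ->] x []//|ts].
by have := fan_cap Ds Dt; rewrite (setIidr ts).
Qed.

Lemma trunc_mono (S S' : addrClosed M) c u : u \in S -> u \in S' ->
  trunc S' (mono _ _ _ c u : laurent R K S) = mono _ _ _ c u.
Proof.
move=> uS uS'; apply: restr_eq => x; rewrite /= /trunc_coef /= !coef_mono //.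
by case: ifPn => // xS; case: eqP => // e; rewrite e uS' in xS.
Qed.

Lemma perp_sub s t u : t `<=` s -> u \in perp s -> u \in perp t.
Proof. by move=> ts /asboolP h; apply/asboolP => x /ts; exact: h. Qed.

(** On each generator of [s] either [u] is positive, and a multiple of it compensates [m], or the
    generator lies in [t], where [m] vanishes. *)
Lemma shift_dual s t u m : rational_cone s -> (forall x, s x -> pairing x u = 0 -> t x) -> u \in dual s ->
  m \in perp t -> exists k, m + u *+ k \in dual s.
Proof.
move=> [k [g sE]] su /asboolP ud /asboolP mt.
have sg l : s (map_mx intr (g l)).
  rewrite sE; exists (fun l' => (l' == l)%:R) => [i|]; first exact: ler0n.
  by rewrite (bigD1 l) //= eqxx scale1r big1 ?addr0 // => i /negPf ->; rewrite scale0r.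
pose gr l : NR := map_mx intr (g l).
have hl l : exists N : nat, - pairing (gr l) m <= N%:R * pairing (gr l) u.
  have := ud _ (sg l); rewrite le_eqVlt => /orP[/eqP/esym h|h].
    by exists 0%N; rewrite mul0r (mt _ (su _ (sg l) h)) oppr0.
  have [N hN] := exists_ge_nat (- pairing (gr l) m / pairing (gr l) u); exists N.
  by rewrite -ler_pdivrMr.
have [F hF] := choice hl; exists (\max_l F l)%N; apply/asboolP => x; rewrite sE => -[d d0 ->].
rewrite pairing_suml sumr_ge0 // => l _; rewrite pairingZl mulr_ge0 // pairingD.
rewrite -lerBlDl sub0r raddfMn; apply: le_trans (hF l) _; rewrite -[leRHS]mulr_natl; apply: ler_wpM2r; first exact: (ud _ (sg l)).
by rewrite ler_nat leq_bigmax.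
Qed.

Lemma shift_laurent s t u (f : laurent R K (perp t)) : rational_cone s ->
  (forall x, s x -> pairing x u = 0 -> t x) -> u \in dual s ->
  exists k0 : nat, forall k, (k0 <= k)%N -> forall m, f m != 0 -> m + u *+ k \in dual s.
Proof.
move=> cs su ud; have ft m : f m != 0 -> m \in perp t by move=> fm; apply: contraNT fm => /coef_supp ->.
have /choice[F hF] : forall m, exists k, f m != 0 -> m + u *+ k \in dual s.
  move=> m; have [fm|fm] := boolP (f m != 0); last by exists 0%N.
  by have [k hk] := shift_dual cs su ud (ft m fm); exists k.
have [E _ [ES fE]] := laurent_mpart f.
exists (\max_(m <- E) F m)%N => k hk m fm.
have mE : m \in E.
  apply: contraNT fm => mE; apply/eqP; rewrite fE coef_sum big1_seq // => x /andP[_ xE].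
  rewrite coef_mono ?ES //; case: eqP => // e; by rewrite e xE in mE.
have hk' : (F m <= k)%N by apply: leq_trans hk; exact: leq_bigmax_seq.
by rewrite -(subnK hk') addnC mulrnDr addrA rpredD ?hF // rpredMn.
Qed.

Definition below s (f g : laurent R K (perp s)) : set (toric_an v Delta) :=
  [set xi | torus_orbit xi `<=` s /\
    ev xi (trunc (perp (torus_orbit xi)) f) < ev xi (trunc (perp (torus_orbit xi)) g)].

(** Characters orthogonal to [s] are invertible functions on all orbits of faces of [s], so [f] and
    [g] can be compared near the orbit of [s]. Openness has to be tested in the chart of every cone
    of the fan, where these characters need not be regular. *)
Lemma below_open s (f g : laurent R K (perp s)) : cones Delta s -> open (below f g).
Proof.
move=> Ds; suff: toric_open (below f g) by [].
move=> s' Ds'; have [cs' _] := fan_cone Ds'.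
have Dt : cones Delta (s' `&` s) by apply: (fan_face Ds'); exact: (fan_cap Ds' Ds).
have [ct _] := fan_cone Dt.
have [u [ud ut us]] := face_functional cs' ct (fan_cap Ds' Ds).
have ts : s' `&` s `<=` s by move=> x [].
have us' x : s' x -> pairing x u = 0 -> s x by move=> h1 h2; have [] := us x h1 h2.
(* In the chart of s', the orbits in the chart of s are those where chi^u does not vanish, and
   chi^(k u) clears the denominators of f and g. *)
have [kf hf] := shift_laurent f cs' us' ud; have [kg hg] := shift_laurent g cs' us' ud.
pose k := maxn kf kg.
have shift (h : laurent R K (perp s)) : (forall m, h m != 0 -> m + u *+ k \in dual s') ->
    exists H : laurent R K (dual s'), forall xi, torus_orbit xi `<=` s' `&` s ->
      chart xi H = ev xi (trunc (perp (torus_orbit xi)) h) * ev xi (mono _ _ _ 1 u) ^+ k.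
  move=> hh.
  have fs : forall m, m \notin dual s' -> h (m - u *+ k) = 0.
    move=> m; apply: contraNeq => /hh; by rewrite subrK.
  have fn : wnull (trivial_valuation R K) (\0 : M -> R) (fun m => h (m - u *+ k)).
    move=> C; apply: sub_finite_set (finite_image (fun m => m + u *+ k) (laurent_finite h)) => m /= hm.
    exists (m - u *+ k); rewrite ?subrK //=; apply: contraTneq hm => ->.
    by rewrite /trivial_val eqxx.
  exists (Restr fs fn) => xi xis; have xis' : torus_orbit xi `<=` s' by move=> x /xis[].
  have up : u \in perp (torus_orbit xi) by apply: perp_sub ut.
  have pm := pt_seminorm xi; rewrite -(mult_seminormX pm) -(seminormM pm) /chart; congr (ev xi _).
  have -> : mono _ _ _ 1 u ^+ k = mono _ _ _ 1 (u *+ k) :> laurent R K (perp (torus_orbit xi)).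
    by elim: (k) => [|k' IH]; [rewrite expr0 mulr0n mono1|rewrite exprS IH monoM ?rpredMn // mulr1 mulrS].
  apply: restr_eq => m; rewrite mulrC [RHS]coef_monoM; last exact: rpredMn.
  rewrite mul1r /= /trunc_coef /=.
  have -> : (m - u *+ k \in perp (torus_orbit xi)) = (m \in perp (torus_orbit xi)).
    apply/idP/idP => hm; last by rewrite rpredD ?perpN // rpredMn.
    by rewrite -(subrK (u *+ k) m) rpredD // rpredMn.
  by [].
have [F hF] := shift f (hf k (leq_maxl _ _)); have [G hG] := shift g (hg k (leq_maxr _ _)).
pose U : laurent R K (dual s') := mono _ _ _ 1 u.
exists [set q : {ptws laurent R K (dual s') -> R} | 0 < q U /\ q F < q G].
  apply: openI.
    have := @open_comp _ _ (fun q : {ptws laurent R K (dual s') -> R} => q U) [set x | 0 < x].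
    apply; [by move=> q _; exact: (@proj_continuous (laurent R K (dual s')) (fun=> R) U)|exact: open_gt].
  have op : open (~` [set q : {ptws laurent R K (dual s') -> R} | q G <= q F]).
    apply: closed_openC; apply: closed_leP.
      exact: (@proj_continuous (laurent R K (dual s')) (fun=> R) G).
    exact: (@proj_continuous (laurent R K (dual s')) (fun=> R) F).
  have e : [set q : {ptws laurent R K (dual s') -> R} | q F < q G] =
      ~` [set q : {ptws laurent R K (dual s') -> R} | q G <= q F].
    by apply/seteqP; split => q /=; rewrite ltNge => /negP.
  by rewrite -e in op.
move=> xi fxi; have xs' : torus_orbit xi `<=` s' by apply/(fan_face_sub Ds' (orbit_cone xi)).
have key : torus_orbit xi `<=` s -> 0 < chart xi U /\
    (chart xi F < chart xi G <-> ev xi (trunc (perp (torus_orbit xi)) f) < ev xi (trunc (perp (torus_orbit xi)) g)).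
  move=> xs; have xt : torus_orbit xi `<=` s' `&` s by move=> x h; split; [exact: xs'|exact: xs].
  have up : u \in perp (torus_orbit xi) by apply: perp_sub ut.
  have u0 := an_mono_gt0 up; rewrite hF // hG // ltr_pM2r ?exprn_gt0 //; split => //.
  by rewrite /chart trunc_mono.
split=> [[xs lt]|[U0 lt]]; first by have [h1 h2] := key xs; split => //; exact/h2.
have xs : torus_orbit xi `<=` s.
  move: U0; rewrite /chart; have [up|up] := boolP (u \in perp (torus_orbit xi)).
    by move=> _ x tx; apply: us'; [exact: xs'|move/asboolP: up; apply].
  have -> : trunc (perp (torus_orbit xi)) U = 0.
    apply: restr_eq => m; rewrite /= /trunc_coef /= coef_mono //; case: ifPn => // mp.
    by case: eqP => // e; rewrite e (negPf up) in mp.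
  by rewrite (seminorm0 (pt_seminorm xi)) ltxx.
by split => //; apply/(proj2 (key xs)).
Qed.

Lemma specialization (xi_ : nat -> toric_an v Delta) xi (f g : laurent R K (perp (torus_orbit xi))) :
  xi_ @ \oo --> xi ->
  (forall i, ev (xi_ i) (trunc (perp (torus_orbit (xi_ i))) g) <= ev (xi_ i) (trunc (perp (torus_orbit (xi_ i))) f)) ->
  ev xi g <= ev xi f.
Proof.
move=> cv le; rewrite leNgt; apply/negP => lt.
have tr (h : laurent R K (perp (torus_orbit xi))) : trunc (perp (torus_orbit xi)) h = h.
  by apply: restr_eq => m; rewrite /= /trunc_coef; case: ifPn => // /coef_supp ->.
have nW : nbhs xi (below f g).
  by apply: open_nbhs_nbhs; split; [apply: below_open; exact: orbit_cone|split => //; rewrite !tr].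
have [N _ hN] := cv _ nW.
by have [_] := hN N (leqnn N); rewrite ltNge le.
Qed.

End Specialization.

Section RelevantPolyhedra.
Context {R : realType} {K : fieldType} (v : valuation R K) {n : nat} (Delta : fan R n).
Local Notation NR := 'rV[R]_n.
Local Notation M := 'rV[int]_n.
Local Notation "'ev' xi" := (@pt R K v n Delta xi) (at level 10).
Implicit Types (s : set NR) (u : M) (xi : toric_an v Delta).

Lemma trop_inj xi (x : quotient (torus_orbit xi)) : trop xi = existT _ (torus_orbit xi) x -> x = trop_pt xi.
Proof.
move=> e; have [cs _] := fan_cone (orbit_cone xi).
apply: weight_inj_perp cs _ _ _ => u _.
by have /= -> := congr1 (fun z : {s : set NR & quotient s} => weight (projT2 z) u) e.
Qed.

Lemma transverse_square k (D : 'I_k -> {additive M -> R}) (e : 'I_k -> M) u : transverse D e ->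
  zspan e u -> (forall a, D a u = 0) -> u = 0.
Proof.
move=> tr [z ->] Du.
pose N : 'M[R]_k := \matrix_(a, i) D a (e i).
have Nu : N \in unitmx.
  rewrite -row_free_unit -kermx_eq0; apply/negPn/negP => /rowV0Pn[c /sub_kermxP cN /rV0Pn[i ci]].
  move/eqP: ci; apply; apply: (tr (fun a => c 0 a)) => j.
  have := congr1 (fun r : 'rV_k => r 0 j) cN; rewrite !mxE => h; rewrite -[RHS]h.
  by apply: eq_bigr => a _; rewrite mxE.
pose x : 'cV[R]_k := \col_i (z i)%:~R.
have Nx : N *m x = 0.
  apply/colP => a; rewrite !mxE -[RHS](Du a) raddf_sum; apply: eq_bigr => i _.
  by rewrite !mxE raddfMz mulrzr.
have x0 : x = 0 by rewrite -[x](mulKmx Nu) Nx mulmx0.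
rewrite big1 // => i _; have := congr1 (fun c : 'cV_k => c i 0) x0; rewrite !mxE => /eqP.
by rewrite intr_eq0 => /eqP ->; rewrite mulr0z.
Qed.

Lemma affine_transverse s r (b : 'I_r -> M) k (z : 'I_k.+1 -> NR) : (forall i, b i \in perp s) ->
  (forall x, (forall i, pairing x (b i) = 0) -> x \in linear_span s) ->
  affinely_independent (fun i => quotient_proj s (z i)) ->
  transverse (fun a : 'I_k => pairing (z (lift ord0 a) - z ord0)) b.
Proof.
move=> bs hb ind c hc.
pose c' (i : 'I_k.+1) := if unlift ord0 i is Some a then c a else - \sum_a c a.
have c'0 : \sum_i c' i = 0.
  rewrite big_ord_recl /c' unlift_none; under [X in _ + X]eq_bigr => a _ do rewrite liftK.
  by rewrite addNr.
have c'x : \sum_i c' i *: quotient_proj s (z i) = 0.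
  apply: (weight_inj bs hb) => i; rewrite weight0 // weight_sum // -[RHS](hc i).
  rewrite big_ord_recl /c' unlift_none weightZ // weight_proj // mulNr mulr_suml.
  under [X in _ + X]eq_bigr => a _ do rewrite liftK weightZ // weight_proj //.
  by rewrite addrC -sumrB; apply: eq_bigr => a _; rewrite -mulrBr; congr (_ * _); exact/esym/pairingBl.
by move=> a; have := ind c' c'0 c'x (lift ord0 a); rewrite /c' liftK.
Qed.

Lemma aff_dim_attained s (P : set NR) : rational_cone s -> P !=set0 ->
  exists k (z : 'I_k.+1 -> NR), [/\ forall i, P (z i),
    affinely_independent (fun i => quotient_proj s (z i)) &
    aff_dim (quotient_proj s @` P) = (k%:R)%:E].
Proof.
move=> /(@perp_lattice R n)[r [b [_ [bs _ _ hb]]]] [z0 Pz0].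
pose Q k := `[< exists2 z : 'I_k.+1 -> NR, forall i, P (z i) & affinely_independent (fun i => quotient_proj s (z i)) >].
have Q0 : exists k, Q k.
  exists 0%N; apply/asboolP; exists (fun=> z0) => // c; rewrite big_ord1 => c0 _ i.
  by rewrite (ord1 i).
have Qr k : Q k -> (k <= r)%N.
  by move=> /asboolP[z Pz ind]; apply: transverse_le (affine_transverse bs hb ind).
have [k /asboolP[z Pz ind] kmax] := ex_maxnP Q0 Qr.
exists k, z; split => //; apply/eqP; rewrite eq_le; apply/andP; split; last first.
  by apply: aff_dim_ge ind => i; exists (z i).
apply: ge_ereal_sup => _ [m [x Px indx] <-]; rewrite lee_fin ler_nat; apply: kmax; apply/asboolP.
have /choice[z' hz'] : forall i, exists y, P y /\ quotient_proj s y = x i.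
  by move=> i; have [y Py yx] := Px i; exists y.
exists z' => [i|]; first by case: (hz' i).
by move=> c c0 cx; apply: indx => //; rewrite -[RHS]cx; apply: eq_bigr => i _; rewrite (proj2 (hz' i)).
Qed.

Lemma relevant_dominates (X : closed_subscheme K Delta) s xi (P : set NR) k (z : 'I_k.+1 -> NR) (e : 'I_k -> M)
    (f : laurent R K (perp s)) u :
  torus_orbit xi = [set 0] -> polyhedron P -> (forall i, P (z i)) ->
  transverse (fun a : 'I_k => pairing (z (lift ord0 a) - z ord0)) e -> supp_in (zspan e) f ->
  relevant X xi (quotient_proj (torus_orbit xi) @` P) -> u \in perp s ->
  ev xi (trunc (perp (torus_orbit xi)) (mono _ _ _ (f u) u : laurent R K (perp s))) <=
  ev xi (trunc (perp (torus_orbit xi)) f).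
Proof.
move=> xi0 Pp Pz tr fT rel us; rewrite leNgt; apply/negP => lt.
have all_ m : m \in perp (torus_orbit xi).
  by rewrite xi0; apply/asboolP => _ ->; exact: pairing0l.
have lt' := lt_le_trans lt _.
have [|E Ef tie] := relevant_tie rel (f := trunc (perp (torus_orbit xi)) f).
  apply: lt'; rewrite trunc_mono // an_mono // trop_pt_weight //.
  set g := lemb _ _ _ _ _; have := le_nrm g u; rewrite /tm lemb_coef /= /trunc_coef all_.
  exact.
have ET m : m \in E -> zspan e m.
  by move=> /Ef; rewrite /= /trunc_coef all_; exact: fT.
pose I := {q : seq_sub E * seq_sub E | val q.1 != val q.2}.
pose phi (i : I) (x : NR) := pairing x (val (val i).1 - val (val i).2).
pose d (i : I) := weight (trop_pt xi) (val (val i).1) - weight (trop_pt xi) (val (val i).2).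
(* A tie that held at all the [z j] would put the difference of two distinct exponents in the kernel
   of all directions; by transversality in equal rank it would be 0. *)
have [|i|x Px hx] := generic_point (phi := phi) (d := d) Pp Pz.
- move=> i m x c; rewrite /phi pairing_suml; apply: eq_bigr => j _; exact: pairingZl.
- apply: contrapT => /forallNP h; have h' j : phi i (z j) = d i by apply: contrapT; exact: h.
  have := valP i; rewrite /= => /negP; apply; rewrite -subr_eq0; apply/eqP.
  apply: (transverse_square tr); first by apply: zspanD; [|apply: zspanN]; apply: ET; exact: valP.
  by move=> a; apply: etrans (pairingBl _ _ _) _; have := h' (lift ord0 a); rewrite -(h' ord0) /phi => ->; rewrite subrr.
have [u1 [u2 [u1E u2E ne]]] := tie (quotient_proj _ x) (ex_intro2 _ _ x Px erefl).
rewrite !weight_proj // => e12; apply: (hx (exist _ (SeqSub u1E, SeqSub u2E) ne)).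
by rewrite /phi /d /= raddfB.
Qed.

End RelevantPolyhedra.

Theorem theorem6p1 (R : realType) (K : fieldType) (v : valuation R K) (n : nat)
    (Delta : fan R n) (X : closed_subscheme K Delta) (d : nat)
    (xi_ : nat -> toric_an v Delta) (xi : toric_an v Delta)
    (sigma : set 'rV[R]_n) (omega_ : nat -> 'rV[R]_n) (omega : quotient sigma)
    (P : set 'rV[R]_n) :
  equidimensional R (orbit_ideal X [set 0]) d ->
  (forall i, trop_skeleton X (xi_ i)) ->
  (forall i, orbit_an X [set 0] (xi_ i)) ->
  xi_ @ \oo --> xi ->
  cones Delta sigma ->
  orbit_an X sigma xi ->
  (forall i, trop (xi_ i) = existT _ [set 0] (quotient_proj [set 0] (omega_ i))) ->
  trop xi = existT _ sigma omega ->
  polyhedron P ->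
  quotient_proj [set 0] @` P `<=` trop_X_at v X [set 0] ->
  aff_dim P = (d%:R)%:E ->
  (forall i, P (omega_ i)) ->
  (forall i, relevant X (xi_ i) (quotient_proj (torus_orbit (xi_ i)) @` P)) ->
  d_maximal (trop_X_at v X sigma) (quotient_proj sigma @` P) omega ->
  trop_skeleton X xi /\ fiber_dim X xi (local_trop_dim (trop_X_at v X sigma) omega).
Proof.
move=> _ _ xi0 cv Ds [xan xs] _ tro Pp _ _ Pom rel [_ PT Pomega dimP].
subst sigma; move/trop_inj: tro => om; subst omega.
have [cs _] := fan_cone Ds.
have [k [z [Pz ind dk]]] := aff_dim_attained cs (ex_intro _ _ (Pom 0%N)).
have [r [b [y [bs Sb yb hb]]]] := perp_lattice cs.
pose D (a : 'I_k) : {additive 'rV[int]_n -> R} := pairing (z (lift ord0 a) - z ord0).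
have SN : forall u, u \in perp (torus_orbit xi) -> - u \in perp (torus_orbit xi) by move=> u; exact: perpN.
have Iid := orbit_ideal_is_ideal X Ds.
pose w := weight (trop_pt xi).
pose a := @affinoid_ideal R K n Delta X K v id (torus_orbit xi) (trop_pt xi).
have aid : is_ideal a := gen_ideal_is_ideal _.
(* The point [xi] as a point of X_omega, extended from Laurent polynomials to K<U_omega>. *)
pose p : restr v (perp (torus_orbit xi)) w -> R := extended_seminorm (w := w) (@pt _ _ _ _ _ xi).
have sp : spectrum a p := extended_spectrum Iid (an_ums xi) (@an_le_nrm _ _ _ _ _ xi) xan.
have gauss (e : 'I_k -> 'rV[int]_n) : transverse D e -> forall g, supp_in (zspan e) g -> p g = gauss_norm g.
  move=> tr; apply: (extended_gauss (an_ums xi) (@an_le_nrm _ _ _ _ _ xi)) => f fT.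
  apply/eqP; rewrite eq_le an_le_nrm /=.
  set g := lemb _ _ _ _ f; have [u <-] := nrm_attained g; rewrite /tm lemb_coef /=.
  have [us|us] := boolP (u \in perp (torus_orbit xi)); last first.
    by rewrite coef_supp // absv0 mul0r (seminorm_ge0 (pt_seminorm xi)).
  rewrite -trop_pt_weight // -an_mono //; apply: (specialization cv) => i.
  have [_ i0] := xi0 i; exact: (relevant_dominates i0 Pp Pz tr fT (rel i) us).
have free (e : 'I_k -> 'rV[int]_n) : (forall i, e i \in perp (torus_orbit xi)) -> transverse D e ->
    free_over (zspan e) a.
  move=> _ tr g f gT agf; have [pu pn p0] := spectrum_ums sp.
  rewrite -(gauss e tr g gT) -(subrK f g); apply: le_trans (proj2 pu _ _) _.
  by rewrite p0 // ge_max nrm_ge0 pn.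
have nb : noether_basis D a b.
  split => //.
  - move=> c hc j; have := congr1 (pairing (y j)) hc; rewrite raddf0 raddf_sum (bigD1 j) //= big1 => [|i ij].
      by rewrite addr0 raddfMz /= yb eqxx => /eqP; rewrite intr_eq0 => /eqP.
    by rewrite raddfMz /= yb (negPf ij) mul0rz.
  - have -> : zspan b = [set u | u \in perp (torus_orbit xi)].
      by apply/seteqP; split => u; [exact: zspan_sub|exact: Sb].
    exact: finite_over_self.
  - exact: affine_transverse bs hb ind.
have [k' [e [[eS ez fin tr] fr]]] := noether_normalization SN aid nb free.
have kk : (k <= k')%N := transverse_le tr.
(* By maximality of the projected polyhedron, [k] is also the dimension of the local cone, which
   bounds the rank of a free basis. *)
have kk' : (k' <= k)%N.
  have := free_rank_le_dim Ds (PT _ Pomega) eS ez fin fr.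
  by rewrite -dimP dk lee_fin ler_nat.
have {kk kk'} ek : k' = k by apply/eqP; rewrite eqn_leq kk' kk.
subst k'.
have res : restricts_to id p (@pt _ _ _ _ _ xi).
  move=> f g fg; have -> : g = @lemb R K K v _ (perp (torus_orbit xi)) (perp (torus_orbit xi)) w idfun (fun u h => h) f.
    by apply: restr_eq => u; rewrite fg.
  exact: (extended_emb (an_ums xi) (@an_le_nrm _ _ _ _ _ xi)).
split.
  split; first exact: xan.
  exists p => //; apply: (fiber_shilov SN aid (zspan0 e) (@zspanD _ _ e) fin).
  by split => //; exact: gauss.
exists p; split => //; rewrite -dimP dk.
exact: (local_dim_torus SN Sb eS ez fin sp (gauss e tr)).
Qed.
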